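(* Let $\eta\ge 0$, $\eta\neq 1$. Let $\ell\in C([0,+\infty))$ be positive with $|\ell'(t)|<1$ for all $t\ge 0$, and put $L=\ell(0)$. Let $\varphi\in C^1([-L,+\infty))$ be real-valued with $\varphi'>0$ on $[-L,+\infty)$ and $\varphi(t+\ell(t))-\varphi(t-\ell(t))=2$ for all $t\ge 0$. Let $u^0\in V_0(0,L)$ and $u^1\in L^2(0,L)$, and let $T>0$. Then the problem $$\begin{cases} u_{tt}-u_{xx}=0, & 0<x<\ell(t),\ t>0,\\ (1+\eta\ell'(t))\,u_x(\ell(t),t)+(\eta+\ell'(t))\,u_t(\ell(t),t)=0, & t>0,\\ u(0,t)=0, & t>0,\\ u(x,0)=u^0(x),\quad u_t(x,0)=u^1(x), & 0<x<L,\end{cases}$$ has a unique solution satisfying $$u\in C([0,T];V_0(0,\ell(t)))\cap C^1([0,T];L^2(0,\ell(t))),$$ given by the series $$u(x,t)=\sum_{n\in\mathbb Z}c_n\left(e^{\omega_n\varphi(t+x)}-e^{\omega_n\varphi(t-x)}\right),\qquad 0<x<\ell(t),\ t\ge 0,$$ where the coefficients $c_n\in\mathbb C$ are computed as $$c_n=\frac{1}{4\omega_n}\int_{-L}^{L}\left(\tilde u^0_x+\tilde u^1\right)e^{-\omega_n\varphi(x)}\,dx,\qquad n\in\mathbb Z.$$ Moreover, $$\sum_{n\in\mathbb Z}|\omega_nc_n|^2=\frac18\int_{-L}^{L}\left(\tilde u^0_x+\tilde u^1\right)^2e^{\ln|\gamma_\eta|\,\varphi(x)}\frac{dx}{\varphi'(x)}<+\infty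 .$$
   Context: The unknown $u(x,t)$ is the (real) displacement of a string of length $\ell(t)$. $V_0(0,\ell(t)):=\{w\in H^1(0,\ell(t)) : w(0)=0\}$ for $t\ge 0$ (in particular $V_0(0,L)$ at $t=0$). $\gamma_\eta:=\frac{1+\eta}{1-\eta}$. For $n\in\mathbb Z$, $\omega_n:=-\frac12\ln|\gamma_\eta|+\frac{2n+1}{2}i\pi$ if $0\le\eta<1$, and $\omega_n:=-\frac12\ln|\gamma_\eta|+n i\pi$ if $\eta>1$. $\tilde u^0_x$ denotes the even extension to $(-L,L)$ of the derivative $u^0_x$ of $u^0$ (equivalently the derivative of the odd extension of $u^0$), and $\tilde u^1$ is the odd extension of $u^1$ to $(-L,L)$. *)

(* Defs.v *)
From HB Require Import structures.
From mathcomp Require Import all_boot all_order all_algebra.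
From mathcomp Require Import complex finmap.
From mathcomp Require Import all_classical all_reals all_analysis.
From mathcomp Require Import summability.

Set Implicit Arguments.
Unset Strict Implicit.
Unset Printing Implicit Defensive.

Import Order.TTheory GRing.Theory Num.Theory.
Import numFieldNormedType.Exports.

Local Open Scope classical_set_scope.
Local Open Scope complex_scope.
Local Open Scope ring_scope.

Section one_variable.
Context {R : realType}.
Implicit Types (D : set R) (f w g psi : R -> R) (a : R).

(* Derivatives are taken relatively to [D]: one-sided at an endpoint of an
   interval. *)
Definition derivative_on D f (df : R -> R) :=
  forall x, D x ->
    (f y - f x) / (y - x) @[y --> within D x^'] --> df x.

Definition C1_on D f (df : R -> R) := derivative_on D f df /\ {within D, continuous df}.

Definition L2 D f : Prop := (f \_ D) \in Lfun lebesgue_measure 2%:E.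

Definition L2norm D f : \bar R := 'N[lebesgue_measure]_2%:E[EFin \o (f \_ D)]%E.

(* [psi] is in C^1_c(D), for [D] open in R. *)
Definition test1 D psi :=
  [/\ forall x, derivable psi x 1, continuous (derive1 psi) &
      exists K : set R,
        [/\ compact K, K `<=` D & forall x, ~ K x -> psi x = 0]].

Definition weak_derivative a w g :=
  forall psi, test1 `]0, a[ psi ->
    \int[lebesgue_measure]_(x in `]0, a[) (w x * derive1 psi x) =
    - \int[lebesgue_measure]_(x in `]0, a[) (g x * psi x).

(* [w] is in H^1(0,a), with weak derivative [g].  As usual in dimension one, an
   element of H^1(0,a) is identified with its representative that is continuous
   on [0,a]; this is what gives a meaning to pointwise values. *)
Definition H1 a w g :=
  [/\ {within `[0, a], continuous w}, L2 `]0, a[ w, L2 `]0, a[ g &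
      weak_derivative a w g].

Definition V0 a w g := H1 a w g /\ w 0 = 0.

Definition even_ext f : R -> R := fun x => f `|x|.

Definition odd_ext f : R -> R := fun x => Num.sg x * f `|x|.

End one_variable.

(* Functions of (x,t) are curried with the space variable first, and are
   only meaningful for 0 < x < l t (0 <= x <= l t for the displacement). *)
Section moving_domain.
Context {R : realType}.
Variables (l dl : R -> R) (T : R).
Implicit Types (u ux ut w psi : R -> R -> R) (p q : R -> R).

(* [w] is in C([0,T]; L^2(0,l(t))): its extension by zero outside (0,l(t)) is
   continuous from [0,T] to L^2(R). *)
Definition C0_L2 w :=
  (forall t, 0 <= t <= T -> L2 `]0, l t[ (w^~ t)) /\
  (forall t, 0 <= t <= T ->
     L2norm setT (((w^~ s) \_ `]0, l s[) \- ((w^~ t) \_ `]0, l t[))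
       @[s --> within `[0, T] (nbhs t)] --> 0%E).

(* [u] is in C([0,T]; V_0(0,l(t))) and [ux t] is the derivative of [u t]. *)
Definition C0_V0 u ux :=
  [/\ forall t, 0 <= t <= T -> V0 (l t) (u^~ t) (ux^~ t), C0_L2 u & C0_L2 ux].

(* [u] is in C^1([0,T]; L^2(0,l(t))) with time derivative [ut]: the difference
   quotients converge in L^2 over the common part of the two domains. *)
Definition C1_L2 u ut :=
  [/\ C0_L2 u, C0_L2 ut &
      forall t, 0 <= t <= T ->
        L2norm `]0, Num.min (l t) (l s)[
            (fun x => (u x s - u x t) / (s - t) - ut x t)
          @[s --> within `[0, T] t^'] --> 0%E].

Definition domain : set (R * R) := [set z | 0 < z.2 < T /\ 0 < z.1 < l z.2].

Definition dx psi x t : R := derive1 (psi^~ t) x.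
Definition dt psi x t : R := derive1 (psi x) t.

(* [psi] is in C^1_c(domain). *)
Definition test2 psi :=
  [/\ forall x t, derivable (psi^~ t) x 1 /\ derivable (psi x) t 1,
      continuous (fun z : R * R => dx psi z.1 z.2),
      continuous (fun z : R * R => dt psi z.1 z.2) &
      exists K : set (R * R),
        [/\ compact K, K `<=` domain & forall x t, ~ K (x, t) -> psi x t = 0]].

(* u_tt - u_xx = 0 in the sense of distributions on [domain], where u_tt and
   u_xx are the distributional derivatives of [ut] in t and of [ux] in x. *)
Definition wave_equation ux ut :=
  forall psi, test2 psi ->
    \int[lebesgue_measure]_(t in `]0, T[)
      (\int[lebesgue_measure]_(x in `]0, l t[)
         (ux x t * dx psi x t - ut x t * dt psi x t)) = 0.

(* [p t] is the trace w(l(t),t) on the moving boundary of a function [w] that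
   is only defined almost everywhere: the mean value of |w(x,t) - p(t)|^2 over
   the boundary layer l(t) - e < x < l(t) tends to 0 with e, in L^1(0,T). *)
Definition moving_trace w p :=
  L2 `]0, T[ p /\
  ((e^-1)%:E * \int[lebesgue_measure]_(t in `]0%R, T[)
                 \int[lebesgue_measure]_(x in `](l t - e)%R, l t[)
                   ((w x t - p t) ^+ 2)%:E)%E
    @[e --> 0^'+] --> 0%E.

Definition moving_boundary_condition (eta : R) ux ut :=
  exists p q, [/\ moving_trace ux p, moving_trace ut q &
    {ae lebesgue_measure, forall t, 0 < t < T ->
       (1 + eta * dl t) * p t + (eta + dl t) * q t = 0}].

Record wave_solution_with (eta : R) (u0 u1 : R -> R) u ux ut : Prop := {
  sol_C0 : C0_V0 u ux;
  sol_C1 : C1_L2 u ut;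
  sol_wave : wave_equation ux ut;
  sol_moving_end : moving_boundary_condition eta ux ut;
  sol_fixed_end : forall t, 0 < t <= T -> u 0 t = 0;
  sol_init : forall x, 0 < x < l 0 -> u x 0 = u0 x;
  sol_init_t :
    {ae lebesgue_measure, forall x, 0 < x < l 0 -> ut x 0 = u1 x} }.

Definition wave_solution (eta : R) (u0 u1 : R -> R) u :=
  exists ux ut, wave_solution_with eta u0 u1 u ux ut.

End moving_domain.

Section coefficients.
Context {R : realType}.
Implicit Types (D : set R) (eta : R) (n : int).

Definition cexp (z : R[i]) : R[i] :=
  (expR (complex.Re z) * cos (complex.Im z)) +i*
  (expR (complex.Re z) * sin (complex.Im z)).

Definition cintegral D (f : R -> R[i]) : R[i] :=
  (\int[lebesgue_measure]_(x in D) complex.Re (f x)) +i*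
  (\int[lebesgue_measure]_(x in D) complex.Im (f x)).

(* Unconditional convergence: limit along the finite sets of indices, ordered by
   inclusion. *)
Definition sums_to (a : int -> R[i]) (s : R[i]) :=
  partial_sum a A @[A --> totally] --> (s : R[i]^o).

Definition gamma eta : R := (1 + eta) / (1 - eta).

Definition omega eta n : R[i] :=
  (- (2^-1 * ln `|gamma eta|)) +i*
  (if eta < 1 then (2 * n + 1)%:~R / 2 * pi else n%:~R * pi).

Definition coef eta (phi : R -> R) (L : R) (u0x u1 : R -> R) n : R[i] :=
  (4 * omega eta n)^-1 *
  cintegral `]- L, L[ (fun x =>
    (even_ext u0x x + odd_ext u1 x)%:C * cexp (- omega eta n * (phi x)%:C)).

End coefficients.

(* Main.v *)
(* A solution has the d'Alembert form u(x,t) = F(t + x) - F(t - x).  Writing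
   F = G o phi, the boundary condition on the moving end becomes the twisted
   periodicity G'(s + 2) = kappa G'(s) with kappa = -1/gamma, and the initial data
   give G' on one period.  Hence e^(a s) G'(s), with a = ln|gamma| / 2, is periodic
   or antiperiodic, and the theorem is its Fourier expansion: Parseval gives the
   identity for the c_n, and integration gives uniform convergence of the series.
   Uniqueness: the Riemann invariants u_x +- u_t of the difference of two solutions
   are constant along characteristics; they vanish at time 0, so that the boundary
   conditions make them vanish one reflection after the other.  Since l' may tend
   to 1, the characteristic maps t +- l(t) need not be onto; l is therefore first
   extended from [0,T], and phi from [-L, T + l(T)], to all of R. *)

Require Import Defs.
From HB Require Import structures.
From mathcomp Require Import all_boot all_order all_algebra.
From mathcomp Require Import complex finmap.
From mathcomp Require Import all_classical all_reals all_analysis.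
From mathcomp Require Import summability.
From mathcomp Require Import measurable_realfun classical_sets.
From mathcomp Require Import ring lra.
Set Implicit Arguments.
Unset Strict Implicit.
Unset Printing Implicit Defensive.
Import Order.TTheory GRing.Theory Num.Theory.
Import numFieldNormedType.Exports.
Local Open Scope classical_set_scope.
Local Open Scope ring_scope.

(** * Integration and square-integrable functions *)

(** All regularity is in mean square, so statements about derivatives are made about primitives: an
    invariant is transported when the difference of two primitives is constant, and such constancy
    comes from testing against a difference of two narrow bumps ([dhat_pairing]). The weak wave
    equation only accepts test functions supported inside the domain. The waves
    [al (t + x) - al (t - x)] vanish at the fixed end, so they can be cut off near [x = 0] with an
    error that tends to 0; from the moving end the characteristics have to be kept away. The traces
    there are limits of layer averages, so a reflection is carried out on averages of width [e].
    Each reflection gains a fixed length [m], a lower bound of [l] on [0,T], hence finitely many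
    suffice. In the Fourier part, e^(2 omega_n) has the same value kappa for every n, and kappa
    differs from 1: this is what bounds a function by its derivative and makes the series converge
    uniformly. The periodic and antiperiodic systems are treated together; completeness comes from
    powers of cos (pi r / 2), whose parity selects the system. *)

Section intg.
Context {R : realType}.
Local Notation mu := (@lebesgue_measure R).
Implicit Types (D E : set R) (f g : R -> R) (a b c : R).

Definition intg D f := mu.-integrable D (fun x => (f x)%:E).

Lemma intg_measurable D f : intg D f -> measurable_fun D f.
Proof. by move/integrableP => [/measurable_EFinP]. Qed.

Lemma intgS D E f : measurable D -> measurable E -> D `<=` E -> intg E f -> intg D f.
Proof. by move=> mD mE DE; exact: integrableS. Qed.

Lemma intgD D f g : measurable D -> intg D f -> intg D g ->
  intg D (fun x => f x + g x).
Proof.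
move=> mD fi gi.
rewrite /intg (_ : (fun _ => _) = (fun x => (f x)%:E + (g x)%:E)%E)//.
exact: integrableD.
Qed.

Lemma intgZ D c f : measurable D -> intg D f -> intg D (fun x => c * f x).
Proof.
move=> mD fi; rewrite /intg (_ : (fun _ => _) = (fun x => c%:E * (f x)%:E)%E)//.
exact: integrableZl.
Qed.

Lemma intgN D f : measurable D -> intg D f -> intg D (fun x => - f x).
Proof.
move=> mD fi; rewrite (_ : (fun _ => _) = (fun x => -1 * f x)); first exact: intgZ.
by apply/funext => x; rewrite mulN1r.
Qed.

Lemma intgB D f g : measurable D -> intg D f -> intg D g ->
  intg D (fun x => f x - g x).
Proof. by move=> mD fi gi; exact: (intgD mD fi (intgN mD gi)). Qed.

Lemma intg_le D f g : measurable D -> measurable_fun D f ->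
  (forall x, D x -> `|f x| <= g x) -> intg D g -> intg D f.
Proof.
move=> mD mf fg; apply: le_integrable => //; first exact/measurable_EFinP.
by move=> x Dx /=; rewrite lee_fin (le_trans (fg _ Dx))// ler_norm.
Qed.

Lemma eq_intg D f g : measurable D -> (forall x, D x -> f x = g x) ->
  intg D f -> intg D g.
Proof. by move=> mD fg; apply: eq_integrable => // x /set_mem Dx; rewrite fg. Qed.

Lemma intg_cst D c : measurable D -> (mu D < +oo)%E -> intg D (fun _ => c).
Proof.
move=> mD Dfin; apply/integrableP; split; first exact/measurable_EFinP.
rewrite (_ : (fun _ => _) = cst `|c|%:E)// integral_cst//.
by rewrite lte_mul_pinfty// lee_fin.
Qed.

Lemma intg_bounded D f (M : R) : measurable D -> (mu D < +oo)%E ->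
  measurable_fun D f -> (forall x, D x -> `|f x| <= M) -> intg D f.
Proof. by move=> mD Dfin mf fM; apply: intg_le fM _ => //; exact: intg_cst. Qed.

Lemma intgM_bounded D f g (M : R) : measurable D -> measurable_fun D g ->
  (forall x, D x -> `|g x| <= M) -> intg D f -> intg D (fun x => f x * g x).
Proof.
move=> mD mg gM fi; have mf := intg_measurable fi.
apply: (@intg_le _ _ (fun x => M * `|f x|)) => //; first exact: measurable_funM.
  by move=> x Dx; rewrite normrM mulrC ler_wpM2r ?gM.
by apply: intgZ => //; exact: (integrable_abse fi).
Qed.

Lemma intg_norm D f : measurable D -> intg D f -> intg D (fun x => `|f x|).
Proof. by move=> mD fi; exact: (integrable_abse fi). Qed.

Lemma mu_itv_fin (i : interval R) (a b : R) :
  [set` i] `<=` `[a, b] -> (mu [set` i] < +oo)%E.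
Proof.
move=> iab; apply: (@le_lt_trans _ _ (mu `[a, b])); first by apply: le_measure; rewrite ?inE.
by rewrite lebesgue_measure_itv/=; case: ifP => _; rewrite ?ltry// -EFinB ltry.
Qed.

Lemma intg_cont a b f : {within `[a, b], continuous f} -> intg `[a, b] f.
Proof. by move=> cf; exact: (continuous_compact_integrable (@segment_compact _ a b) cf). Qed.

Lemma RintD D f g : measurable D -> intg D f -> intg D g ->
  \int[mu]_(x in D) (f x + g x) = \int[mu]_(x in D) f x + \int[mu]_(x in D) g x.
Proof. by move=> *; exact: RintegralD. Qed.

Lemma RintB D f g : measurable D -> intg D f -> intg D g ->
  \int[mu]_(x in D) (f x - g x) = \int[mu]_(x in D) f x - \int[mu]_(x in D) g x.
Proof. by move=> *; exact: RintegralB. Qed.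

Lemma RintZ D c f : measurable D -> intg D f ->
  \int[mu]_(x in D) (c * f x) = c * \int[mu]_(x in D) f x.
Proof. by move=> *; exact: RintegralZl. Qed.

Lemma RintN D f : measurable D -> intg D f ->
  \int[mu]_(x in D) (- f x) = - \int[mu]_(x in D) f x.
Proof.
move=> mD fi; rewrite -[RHS]mulN1r -RintZ//.
by apply: eq_Rintegral => x _; rewrite mulN1r.
Qed.

Lemma Rint_le D f g : measurable D -> intg D f -> intg D g ->
  (forall x, D x -> f x <= g x) ->
  \int[mu]_(x in D) f x <= \int[mu]_(x in D) g x.
Proof. by move=> *; exact: le_Rintegral. Qed.

Lemma Rint_norm D f : measurable D -> intg D f ->
  `|\int[mu]_(x in D) f x| <= \int[mu]_(x in D) `|f x|.
Proof. by move=> *; exact: le_normr_Rintegral. Qed.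

Lemma Rint_eq D f g : (forall x, D x -> f x = g x) ->
  \int[mu]_(x in D) f x = \int[mu]_(x in D) g x.
Proof. by move=> fg; apply: eq_Rintegral => x /set_mem; exact: fg. Qed.

Lemma Rint_EFin D f : measurable D -> intg D f ->
  (\int[mu]_(x in D) f x)%:E = (\int[mu]_(x in D) (f x)%:E)%E.
Proof. by move=> mD fi; rewrite /Rintegral fineK//; exact: integrable_fin_num. Qed.

Lemma Rint_sub_le D E f : measurable D -> measurable E -> D `<=` E ->
  intg E f -> (forall x, E x -> 0 <= f x) ->
  \int[mu]_(x in D) f x <= \int[mu]_(x in E) f x.
Proof.
move=> mD mE DE fi f0; rewrite -lee_fin !Rint_EFin//; last exact: intgS fi.
by apply: ge0_subset_integral => //; exact: measurable_int fi.
Qed.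

Lemma intg_restrict D f : measurable D -> intg D f -> intg setT (f \_ D).
Proof.
move=> mD fi; rewrite /intg (_ : (fun _ => _) = (EFin \o f) \_ D); last first.
  by apply/funext => x; rewrite /= !patchE; case: ifP.
by apply/integrable_restrict => //; rewrite setTI.
Qed.

Lemma Rint_restrict D f : \int[mu]_(x in D) f x = \int[mu]_x (f \_ D) x.
Proof. exact: Rintegral_mkcond. Qed.

End intg.

Section sqint.
Context {R : realType}.
Local Notation mu := (@lebesgue_measure R).
Implicit Types (D : set R) (f g : R -> R).

Definition sqint D f :=
  measurable_fun D f /\ mu.-integrable D (fun x => ((f x) ^+ 2)%:E).

Lemma sqintP D f : measurable D ->
  sqint D f <-> measurable_fun D f /\
                (\int[mu]_(x in D) ((f x) ^+ 2)%:E < +oo)%E.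
Proof.
move=> mD; split=> -[mf h]; split => //.
- have /integrableP[_] := h.
  by under eq_integral => x _ do rewrite gee0_abs ?lee_fin ?sqr_ge0//.
- apply/integrableP; split.
    by apply/measurable_EFinP; exact: measurable_funX.
  under eq_integral => x _ do rewrite gee0_abs ?lee_fin ?sqr_ge0//.
  exact: h.
Qed.

Lemma L2norm_powE D f :
  L2norm D f = ((\int[mu]_(x in D) ((f x) ^+ 2)%:E) `^ 2^-1)%E.
Proof.
rewrite /L2norm unlock; congr (_ `^ _)%E.
rewrite [RHS]integral_mkcond; apply: eq_integral => x _.
rewrite -[LHS]/((`|(f \_ D) x| `^ 2)%:E) powR_mulrn// real_normK ?num_real//.
by rewrite !patchE; case: ifP => //; rewrite expr0n.
Qed.

Lemma L2P D f : measurable D -> L2 D f <-> sqint D f.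
Proof.
move=> mD; rewrite sqintP//.
have nE : ((L2norm D f < +oo) <->
          (\int[mu]_(x in D) ((f x) ^+ 2)%:E < +oo))%E.
  rewrite L2norm_powE; split; first by apply: lty_poweRy; rewrite invr_neq0.
  exact: poweR_lty.
have -> : L2 D f <-> measurable_fun setT (f \_ D) /\ (L2norm D f < +oo)%E.
  have -> : L2 D f <-> (f \_ D \in mfun) && (f \_ D \in finLfun mu 2%:E) by [].
  split=> [/andP[mf nf]|[mf nf]]; last by apply/andP; split; apply/mem_set.
  by split; [exact: (set_mem mf)|exact: (set_mem nf)].
by rewrite nE; split=> -[mf fi]; split => //; apply/(measurable_restrictT _ mD).
Qed.

Lemma cvge0P {T : Type} (F : set_system T) {FF : Filter F} (X : T -> \bar R) :
  (forall s, 0 <= X s)%E ->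
  (X s @[s --> F] --> 0%E) <->
  (forall e : R, 0 < e -> \forall s \near F, (X s <= e%:E)%E).
Proof.
move=> X0; split=> [/fine_cvgP[Xf /cvgr0Pnorm_le Xc] e e0|h].
  near=> s; have Xs : X s \is a fin_num by near: s.
  rewrite -(fineK Xs) lee_fin (le_trans (ler_norm _))//.
  by near: s; exact: Xc.
apply/fine_cvgP; split.
  near=> s; rewrite ge0_fin_numE//; apply: (@le_lt_trans _ _ 1%:E); last exact: ltry.
  by near: s; exact: h.
apply/cvgr0Pnorm_le => e e0; near=> s => /=.
have Xe : (X s <= e%:E)%E by near: s; exact: h.
have Xs : X s \is a fin_num by rewrite ge0_fin_numE// (le_lt_trans Xe)// ltry.
by rewrite ger0_norm ?fine_ge0// -lee_fin fineK.
Unshelve. all: by end_near. Qed.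

Lemma L2norm_cvg0P {T : Type} (F : set_system T) {FF : Filter F}
    (D : T -> set R) (X : T -> R -> R) :
  (L2norm (D s) (X s) @[s --> F] --> 0%E) <->
  (forall e : R, 0 < e ->
    \forall s \near F, (\int[mu]_(x in D s) ((X s x) ^+ 2)%:E <= e%:E)%E).
Proof.
have X0 s : (0 <= \int[mu]_(x in D s) ((X s x) ^+ 2)%:E)%E.
  by apply: integral_ge0 => x _; rewrite lee_fin sqr_ge0.
rewrite cvge0P; last by move=> s; exact: Lnorm_ge0.
split=> h e e0.
- have := h (Num.sqrt e); rewrite sqrtr_gt0 => /(_ e0); apply: filterS => s.
  rewrite L2norm_powE => hs.
  have : ((\int[mu]_(x in D s) ((X s x) ^+ 2)%:E) `^ 2^-1 `^ 2 <=
           (Num.sqrt e)%:E `^ 2)%E.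
    by apply: gt0_ler_poweR => //; rewrite in_itv/= ?lee_fin ?sqrtr_ge0 ?poweR_ge0 ?leey.
  rewrite -poweRrM mulVf ?pnatr_eq0// poweRe1// poweR_EFin powR_mulrn ?sqrtr_ge0//.
  by rewrite sqr_sqrtr// ltW.
- have := h (e ^+ 2); rewrite exprn_gt0// => /(_ isT); apply: filterS => s hs.
  rewrite L2norm_powE.
  have : ((\int[mu]_(x in D s) ((X s x) ^+ 2)%:E) `^ 2^-1 <=
           (e ^+ 2)%:E `^ 2^-1)%E.
    apply: gt0_ler_poweR => //; rewrite ?invr_ge0 ?in_itv/= ?lee_fin ?sqr_ge0 ?leey ?andbT//.
  by rewrite poweR_EFin -powR_mulrn ?(ltW e0)// -powRrM mulfV ?pnatr_eq0// powRr1// ltW.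
Qed.

End sqint.

Section sqint_theory.
Context {R : realType}.
Local Notation mu := (@lebesgue_measure R).
Implicit Types (D E : set R) (f g : R -> R) (a b c : R).

Lemma sqintS D E f : measurable D -> measurable E -> D `<=` E ->
  sqint E f -> sqint D f.
Proof.
move=> mD mE DE [mf fi]; split; first exact: measurable_funS mf.
exact: integrableS fi.
Qed.

Lemma sqint_mul D f g : measurable D -> sqint D f -> sqint D g ->
  intg D (fun x => f x * g x).
Proof.
move=> mD [mf fi] [mg gi].
have : mu.-integrable D (fun x => (f x ^+ 2 + g x ^+ 2)%:E).
  rewrite (_ : (fun _ => _) = (fun x => (f x ^+ 2)%:E + (g x ^+ 2)%:E)%E)//.
  exact: integrableD.
apply: le_integrable => //.
  by apply/measurable_EFinP; exact: measurable_funM.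
move=> x Dx /=; rewrite lee_fin (ger0_norm (x := _ + _)) ?addr_ge0 ?sqr_ge0//.
by rewrite ler_norml; apply/andP; split; nra.
Qed.

Lemma sqint_cst D c : measurable D -> (mu D < +oo)%E -> sqint D (cst c).
Proof.
move=> mD Dfin; apply/sqintP => //; split => //.
rewrite (_ : (fun _ => _) = cst (c ^+ 2)%:E)// integral_cst//.
by rewrite lte_mul_pinfty// lee_fin sqr_ge0.
Qed.

Lemma sqint_integrable D f : measurable D -> (mu D < +oo)%E -> sqint D f ->
  intg D f.
Proof.
move=> mD Dfin fi; have := sqint_mul mD fi (sqint_cst 1 mD Dfin).
by apply: eq_integrable => // x _; rewrite /= mulr1.
Qed.

Lemma sqintM_bounded D f g (M : R) : measurable D -> measurable_fun D g ->
  (forall x, D x -> `|g x| <= M) -> sqint D f -> sqint D (fun x => f x * g x).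
Proof.
move=> mD mg gM [mf fi]; split; first exact: measurable_funM.
have : mu.-integrable D (fun x => ((M ^+ 2)%:E * (f x ^+ 2)%:E)%E).
  exact: integrableZl.
apply: le_integrable => //.
  by apply/measurable_EFinP; apply: measurable_funX; exact: measurable_funM.
move=> x Dx /=; rewrite lee_fin exprMn mulrC normrM [leRHS]normrM ler_wpM2r// !normrX.
by rewrite lerXn2r ?nnegrE// (le_trans (gM _ Dx))// ler_norm.
Qed.

Lemma sqint_bounded D g (M : R) : measurable D -> (mu D < +oo)%E ->
  measurable_fun D g -> (forall x, D x -> `|g x| <= M) -> sqint D g.
Proof.
move=> mD Dfin mg gM; have := sqintM_bounded mD mg gM (sqint_cst 1 mD Dfin).
by rewrite (_ : (fun x => _) = g)//; apply/funext => x /=; rewrite mul1r.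
Qed.

Lemma sqintZ D c f : measurable D -> sqint D f -> sqint D (fun x => c * f x).
Proof.
move=> mD fi.
have := @sqintM_bounded D f (cst c) `|c| mD (measurable_cst _) (fun _ _ => lexx _) fi.
by rewrite (_ : (fun x => _) = (fun x => c * f x))//; apply/funext => x /=; rewrite mulrC.
Qed.

Lemma sqintD D f g : measurable D -> sqint D f -> sqint D g ->
  sqint D (fun x => f x + g x).
Proof.
move=> mD fi gi; have fg := sqint_mul mD fi gi.
case: fi gi => mf fi [mg gi]; split; first exact: measurable_funD.
rewrite (_ : (fun _ => _) = (fun x => ((f x ^+ 2)%:E + 2%:E * (f x * g x)%:E)
    + (g x ^+ 2)%:E)%E); last first.
  by apply/funext => x; rewrite -EFinM -!EFinD; congr EFin; ring.
by do 2!apply: integrableD => //; exact: integrableZl.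
Qed.

Lemma sqintB D f g : measurable D -> sqint D f -> sqint D g ->
  sqint D (fun x => f x - g x).
Proof.
move=> mD fi gi; have := sqintD mD fi (sqintZ (-1) mD gi).
by rewrite (_ : (fun x => _) = (fun x => f x - g x))//; apply/funext => x /=; rewrite mulN1r.
Qed.

Lemma Rintegral_sqr_ge0 D f : 0 <= \int[mu]_(x in D) ((f x) ^+ 2).
Proof. by apply: Rintegral_ge0 => x _; exact: sqr_ge0. Qed.

Lemma cauchy_schwarz D f g : measurable D -> sqint D f -> sqint D g ->
  (\int[mu]_(x in D) (f x * g x)) ^+ 2 <=
  (\int[mu]_(x in D) (f x ^+ 2)) * (\int[mu]_(x in D) (g x ^+ 2)).
Proof.
move=> mD fi gi.
set A := \int[mu]_(x in D) (f x ^+ 2); set B := \int[mu]_(x in D) (g x ^+ 2).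
set C := \int[mu]_(x in D) (f x * g x).
have H s t : 0 <= s ^+ 2 * A + 2 * s * t * C + t ^+ 2 * B.
  have := Rintegral_sqr_ge0 D (fun x => s * f x + t * g x).
  have -> : \int[mu]_(x in D) (s * f x + t * g x) ^+ 2 =
     \int[mu]_(x in D) ((s ^+ 2 * f x ^+ 2 + (2 * s * t) * (f x * g x)) + t ^+ 2 * g x ^+ 2).
    by apply: eq_Rintegral => x _; ring.
  have [_ f2] := fi; have [_ g2] := gi; have fg := sqint_mul mD fi gi.
  have if2 := intgZ (s ^+ 2) mD f2; have ig2 := intgZ (t ^+ 2) mD g2.
  have ifg := intgZ (2 * s * t) mD fg.
  rewrite RintD//; last exact: intgD.
  by rewrite RintD// !RintZ.
have A0 : 0 <= A by exact: Rintegral_sqr_ge0.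
have B0 : 0 <= B by exact: Rintegral_sqr_ge0.
have [A00|A00] := eqVneq A 0; last first.
  have := H (- C) A; have : 0 < A by rewrite lt_neqAle eq_sym A00.
  by move=> *; nra.
have [->|C0] := eqVneq C 0; first by rewrite expr0n/= mulr_ge0.
exfalso; have := H (- (B + 1) / (2 * C)) 1; rewrite A00 mulr0 add0r mulr1 expr1n mul1r.
have -> : 2 * (- (B + 1) / (2 * C)) * C = - (B + 1) by field.
by lra.
Qed.

End sqint_theory.

(** * Change of variables *)

Section transfer.
Context {R : realType}.
Local Notation mu := (@lebesgue_measure R).
Variables (D E : set R) (p w : R -> R).
Hypotheses (mD : measurable D) (mE : measurable E).
Hypothesis mpw : forall h : R -> R, measurable_fun D h -> measurable_fun E (fun x => h (p x) * w x).
Hypothesis w0 : forall x, 0 <= w x.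
Hypothesis ge0_transfer : forall h : R -> R, measurable_fun D h ->
  (forall x, D x -> 0 <= h x) ->
  (\int[mu]_(x in D) (h x)%:E = \int[mu]_(x in E) (h (p x) * w x)%:E)%E.

Lemma intg_transfer g : intg D g -> intg E (fun x => g (p x) * w x).
Proof.
move=> gi; have mg := intg_measurable gi.
apply/integrableP; split; first by apply/measurable_EFinP; exact: mpw.
have := (integrableP _ _ _ gi).2; apply: le_lt_trans.
rewrite (ge0_transfer (h := fun x => `|g x|))//; last exact: measurableT_comp.
rewrite le_eqVlt; apply/orP; left; apply/eqP/eq_integral => x _.
by rewrite /= normrM (ger0_norm (w0 x)).
Qed.

(** Splitting into positive and negative parts reduces the signed case to [ge0_transfer]. The map
    [p] and the weight [w] are kept abstract because this serves twice: for increasing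
    diffeomorphisms, weighted by their derivative, and for the reflection [-%R], with weight 1. *)
Lemma Rint_transfer g : intg D g ->
  \int[mu]_(x in D) g x = \int[mu]_(x in E) (g (p x) * w x).
Proof.
move=> gi; have mg := intg_measurable gi.
pose gp x := Num.max (g x) 0; pose gm x := Num.max (- g x) 0.
have gE x : g x = gp x - gm x.
  by rewrite /gp /gm; case: (leP (g x) 0) => h; case: (leP (- g x) 0) => k; lra.
have gle (h : R -> R) : h = gp \/ h = gm -> forall x, `|h x| <= `|g x|.
  move=> hh x; rewrite ger0_norm; last by case: hh => ->; rewrite le_max lexx orbT.
  by case: hh => ->; rewrite ge_max normr_ge0 andbT ?ler_norm// -normrN ler_norm.
have ih (h : R -> R) : h = gp \/ h = gm -> intg D h.
  move=> hh; apply: (intg_le (g := fun x => `|g x|)) => //.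
  - case: hh => ->; apply: measurable_maxr => //.
    exact: measurableT_comp.
  - by move=> x _; exact: gle.
  - exact: intg_norm.
have key (h : R -> R) : h = gp \/ h = gm ->
   \int[mu]_(x in D) h x = \int[mu]_(x in E) (h (p x) * w x).
  move=> hh; rewrite /Rintegral ge0_transfer//.
  - exact: intg_measurable (ih _ hh).
  - by move=> x _; case: hh => ->; rewrite le_max lexx orbT.
under eq_Rintegral do rewrite gE.
under [RHS]eq_Rintegral do rewrite gE mulrBl.
have ip := ih gp (or_introl erefl); have im := ih gm (or_intror erefl).
rewrite !RintB//; try exact: intg_transfer.
by rewrite (key gp) ?(key gm)//; [right|left].
Qed.

End transfer.

Section diffeo.
Context {R : realType}.
Local Notation mu := (@lebesgue_measure R).

(** Surjectivity is a field of its own because a positive derivative does not imply it. It is what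
    allows [t + l t = y] and [t - l t = y] to be solved for arbitrary [y] in the reflection
    argument. *)
Record diffeo (s ds : R -> R) : Prop := Diffeo {
  diffeo_derive : forall x : R, is_derive x 1 s (ds x);
  diffeo_cont : continuous ds;
  diffeo_gt0 : forall x, 0 < ds x;
  diffeo_surj : forall y, exists x, s x = y }.

Section one.
Variables (s ds : R -> R) (S : diffeo s ds).

Lemma diffeo_continuous : continuous s.
Proof.
move=> x; have [sd _] := diffeo_derive S x.
by apply: differentiable_continuous; apply/derivable1_diffP.
Qed.

Lemma diffeo_derive1 x : derive1 s x = ds x.
Proof. by rewrite derive1E; have [_ <-] := diffeo_derive S x. Qed.

Lemma diffeo_lt : {mono s : x y / x < y}.
Proof.
have ss x y : x < y -> s x < s y.
  move=> xy.
  have [c cxy] : exists2 c, c \in `]x, y[ & s y - s x = ds c * (y - x).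
    apply: MVT => // [z _|]; first exact: diffeo_derive S z.
    by apply: continuous_subspaceT => z; exact: diffeo_continuous.
  by move=> e; rewrite -subr_gt0 e mulr_gt0 ?subr_gt0// (diffeo_gt0 S).
move=> x y; have [/ss->//|/ltW|->] := ltgtP x y; last by rewrite ltxx.
rewrite le_eqVlt => /predU1P[->|/ss yx]; first by rewrite ltxx.
by apply/negbTE; rewrite -leNgt ltW.
Qed.

Lemma diffeo_le : {mono s : x y / x <= y}.
Proof. by move=> x y; rewrite !leNgt diffeo_lt. Qed.

Lemma diffeo_inj : injective s.
Proof. by move=> x y e; apply/eqP; rewrite eq_le -(diffeo_le x) -(diffeo_le y) e lexx. Qed.

Lemma diffeo_measurable : measurable_fun setT s.
Proof. by apply: continuous_measurable_fun; exact: diffeo_continuous. Qed.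

Lemma diffeo_dmeasurable : measurable_fun setT ds.
Proof. by apply: continuous_measurable_fun; exact: diffeo_cont S. Qed.

Lemma integral_diffeo_itv a b : a <= b ->
  (\int[mu]_(x in `[a, b]) (ds x)%:E = (s b - s a)%:E)%E.
Proof.
rewrite le_eqVlt => /predU1P[->|ab].
  by rewrite set_itv1 integral_set1 subrr.
rewrite (@continuous_FTC2 _ ds s)//.
- by apply: continuous_subspaceT; exact: diffeo_cont S.
- split => //.
  + by move=> x _; have [] := diffeo_derive S x.
  + by apply: cvg_at_right_filter; exact: diffeo_continuous.
  + by apply: cvg_at_left_filter; exact: diffeo_continuous.
- by move=> x _; exact: diffeo_derive1.
Qed.

Let nu (A : set (measurableTypeR R)) : \bar R := (\int[mu]_(x in s @^-1` A) (ds x)%:E)%E.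

Let ms (A : set R) : measurable A -> measurable (s @^-1` A).
Proof. by move=> mA; rewrite -[X in measurable X]setTI; exact: diffeo_measurable. Qed.

Let mds A : measurable_fun A (fun x => (ds x)%:E).
Proof. by apply/measurable_EFinP; apply: measurable_funTS; exact: diffeo_dmeasurable. Qed.

Let ds0 x : (0 <= (ds x)%:E)%E. Proof. by rewrite lee_fin ltW// (diffeo_gt0 S). Qed.

Let nu0 : nu set0 = 0%E. Proof. by rewrite /nu preimage_set0 integral_set0. Qed.

Let nu_ge0 A : (0 <= nu A)%E. Proof. by apply: integral_ge0 => x _; exact: ds0. Qed.

Let nu_sigma : semi_sigma_additive nu.
Proof.
move=> F mF tF mUF; rewrite /nu preimage_bigcup ge0_integral_bigcup//=.
- by apply: is_cvg_ereal_nneg_natsum_cond => n _ _; exact: integral_ge0.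
- by move=> k; apply: ms; exact: mF.
- exact: mds.
- apply/trivIsetP => i j _ _ ij; rewrite -preimage_setI.
  by move/trivIsetP : tF => ->//; rewrite preimage_set0.
Qed.

HB.instance Definition _ := isMeasure.Build _ (measurableTypeR R) _ nu nu0 nu_ge0 nu_sigma.

(** [nu] is the image under [s] of the measure with density [ds]. By the fundamental theorem of
    calculus it gives half-open intervals their length, and Lebesgue measure is the only measure
    that does. *)
Lemma diffeo_measure A : measurable A ->
  mu A = (\int[mu]_(x in s @^-1` A) (ds x)%:E)%E.
Proof.
move=> mA; have := @lebesgue_measure_unique R nu; apply => //= X [[a b]] _ <-.
rewrite /nu /=; have [x xa] := diffeo_surj S a; have [y yb] := diffeo_surj S b.
rewrite (_ : _ @^-1` _ = `]x, y]%classic); last first.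
  by apply/seteqP; split => z /=; rewrite !in_itv/= -xa -yb diffeo_lt diffeo_le.
rewrite lebesgue_measure_itv/= lte_fin -xa -yb diffeo_lt.
case: ifPn => [xy|]; last by rewrite -leNgt => yx; rewrite set_itv_ge ?bnd_simp -?leNgt// integral_set0.
by rewrite integral_itv_obnd_cbnd// integral_diffeo_itv ?EFinB// ltW.
Qed.

Import HBNNSimple.

Let ge0_change_nnsfun (h : {nnsfun (measurableTypeR R) >-> R}) :
  (\int[mu]_x (h x)%:E = \int[mu]_x ((h (s x))%:E * (ds x)%:E))%E.
Proof.
have mhk k : measurable (h @^-1` [set k]) by [].
transitivity (\sum_(k \in range h)
    \int[mu]_x (k * \1_(h @^-1` [set k]) x)%:E)%E.
  under eq_integral do rewrite fimfunE -fsumEFin//.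
  rewrite ge0_integral_fsum//.
  - by move=> r; exact/measurable_EFinP/measurable_funM.
  - by move=> r x _; rewrite nnfun_muleindic_ge0.
transitivity (\sum_(k \in range h)
    \int[mu]_x ((k * \1_(h @^-1` [set k]) (s x))%:E * (ds x)%:E))%E; last first.
  rewrite -ge0_integral_fsum//.
  - apply: eq_integral => x _; rewrite -ge0_mule_fsuml; last first.
      by move=> r; rewrite nnfun_muleindic_ge0.
    by rewrite fsumEFin// -fimfunE.
  - move=> r; apply: emeasurable_funM => //; last exact: mds.
    apply/measurable_EFinP; apply: measurable_funM => //.
    rewrite (_ : (fun _ => _) = \1_(s @^-1` (h @^-1` [set r])))//.
    by apply: measurable_indic; exact: (ms (mhk r)).
  - by move=> r x _; rewrite mule_ge0// nnfun_muleindic_ge0.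
apply: eq_fsbigr => k _.
have [k0|k0] := ltP k 0.
  rewrite !integral0_eq// => x _.
    by rewrite (_ : h @^-1` [set k] = set0) ?indic0 ?mulr0 ?mul0e// preimage_nnfun0.
  by rewrite (_ : h @^-1` [set k] = set0) ?indic0 ?mulr0// preimage_nnfun0.
under eq_integral do rewrite EFinM.
rewrite ge0_integralZl//; last exact/measurable_EFinP.
rewrite [X in (_ * X)%E](_ : _ = mu (h @^-1` [set k])); last first.
  by rewrite integral_indic// setIT.
rewrite diffeo_measure//.
rewrite [X in (_ * X)%E]integral_mkcond -ge0_integralZl//; last 2 first.
- by apply/(measurable_restrictT _ (ms (mhk k))); exact: mds.
- by move=> x _; rewrite patchE; case: ifP.
apply: eq_integral => x _; rewrite patchE EFinM -muleA; congr (_ * _)%E.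
rewrite indicE (_ : (s x \in _) = (x \in s @^-1` (h @^-1` [set k])))//.
by case: (_ \in _); rewrite /= ?mul1e ?mul0e.
Qed.

Lemma ge0_change_of_variables (g : R -> \bar R) : measurable_fun setT g ->
  (forall x, 0 <= g x)%E ->
  (\int[mu]_x g x = \int[mu]_x (g (s x) * (ds x)%:E))%E.
Proof.
move=> mg g0.
have mg' : measurable_fun [set: measurableTypeR R] g by [].
pose h := nnsfun_approx measurableT mg'.
have mh n : measurable_fun setT (h n) by [].
have hx x : (h n x)%:E @[n --> \oo] --> g x by apply: cvg_nnsfun_approx.
have hnd x : nondecreasing_seq (fun n => (h n x)%:E).
  by move=> m n mn; rewrite lee_fin; exact/lefP/nd_nnsfun_approx.
have -> : (\int[mu]_x g x = limn (fun n => \int[mu]_x (h n x)%:E))%E.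
  rewrite -monotone_convergence//.
  - by apply: eq_integral => x _; apply/esym/cvg_lim.
  - by move=> n; apply/measurable_EFinP; exact: mh.
  - by move=> n x _; rewrite lee_fin.
have -> : (\int[mu]_x (g (s x) * (ds x)%:E) =
           limn (fun n => \int[mu]_x ((h n (s x))%:E * (ds x)%:E)))%E.
  rewrite -monotone_convergence//.
  - apply: eq_integral => x _; apply/esym/cvg_lim => //.
    by apply: cvgeZr => //.
  - move=> n; apply: emeasurable_funM; last exact: mds.
    by apply/measurable_EFinP; apply: (measurableT_comp (mh n)); exact: diffeo_measurable.
  - by move=> n x _; rewrite mule_ge0// lee_fin.
  - by move=> x _ m n mn; rewrite lee_wpmul2r//; exact: hnd.
by congr (limn _); apply/funext => n; exact: ge0_change_nnsfun.
Qed.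

Lemma ge0_change_of_variables_itv (g : R -> R) a b : a <= b ->
  measurable_fun `[s a, s b] g -> (forall x, s a <= x <= s b -> 0 <= g x) ->
  (\int[mu]_(x in `[s a, s b]) (g x)%:E = \int[mu]_(x in `[a, b]) (g (s x) * ds x)%:E)%E.
Proof.
move=> ab mg g0; rewrite integral_mkcond ge0_change_of_variables.
- rewrite [RHS]integral_mkcond; apply: eq_integral => x _.
  rewrite !patchE !mem_setE !in_itv/= !diffeo_le; case: ifP => _; first by rewrite EFinM.
  by rewrite mul0e.
- apply/(measurable_restrictT _ (measurable_itv `[s a, s b])).
  by apply/measurable_EFinP; exact: mg.
- move=> x; rewrite patchE; case: ifPn => //; rewrite inE/= in_itv/= => xab.
  by rewrite lee_fin g0.
Qed.

Lemma measurable_fun_change_itv (g : R -> R) a b :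
  measurable_fun `[s a, s b] g -> measurable_fun `[a, b] (fun x => g (s x)).
Proof.
move=> mg; apply: (@measurable_comp _ _ _ _ _ _ `[s a, s b]) => //.
  by move=> _ [x xab <-] /=; move: xab; rewrite /= !in_itv/= !diffeo_le.
by apply: measurable_funTS; exact: diffeo_measurable.
Qed.

Let mtr a b (h : R -> R) : measurable_fun `[s a, s b] h ->
  measurable_fun `[a, b] (fun x => h (s x) * ds x).
Proof.
move=> mh; apply: measurable_funM; first exact: measurable_fun_change_itv.
by apply: measurable_funTS; exact: diffeo_dmeasurable.
Qed.

Lemma intg_change_itv (g : R -> R) a b : a <= b ->
  intg `[s a, s b] g -> intg `[a, b] (fun x => g (s x) * ds x).
Proof.
move=> ab; apply: intg_transfer => // [h|h mh h0].
- exact: mtr.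
- by apply: ge0_change_of_variables_itv.
Qed.

Lemma change_of_variables (g : R -> R) a b : a <= b ->
  intg `[s a, s b] g ->
  \int[mu]_(x in `[s a, s b]) g x = \int[mu]_(x in `[a, b]) (g (s x) * ds x).
Proof.
move=> ab; apply: Rint_transfer => // [h|h mh h0].
- exact: mtr.
- by apply: ge0_change_of_variables_itv.
Qed.

End one.
End diffeo.

Section affine_changes.
Context {R : realType}.
Local Notation mu := (@lebesgue_measure R).
Implicit Types (f g : R -> R) (a b c k e : R).

Lemma diffeo_affine k c : 0 < k -> diffeo (fun x => k * x + c) (fun=> k).
Proof.
move=> k0; split => [x|x|x|y] //.
- rewrite (_ : (fun _ => _) = ((k *: (@id R)) + cst c)%R)//.
  by apply: is_derive_eq; rewrite /GRing.scale/= mulr1 addr0.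
- exact: cvg_cst.
- by exists ((y - c) / k); field; rewrite gt_eqF.
Qed.

Lemma intg_shift g a b c : a <= b -> intg `[a + c, b + c] g ->
  intg `[a, b] (fun x => g (x + c)).
Proof.
move=> ab gi; have := intg_change_itv (diffeo_affine c ltr01) ab.
move=> /(_ g); rewrite !mul1r => /(_ gi).
by apply: eq_intg => // x _; rewrite mulr1 mul1r.
Qed.

Lemma Rint_shift g a b c : a <= b -> intg `[a + c, b + c] g ->
  \int[mu]_(x in `[a + c, b + c]) g x = \int[mu]_(x in `[a, b]) g (x + c).
Proof.
move=> ab gi; have := change_of_variables (diffeo_affine c ltr01) ab.
move=> /(_ g); rewrite !mul1r => /(_ gi) ->.
by apply: Rint_eq => x _; rewrite mulr1 mul1r.
Qed.

Let opp_itv a b : `[a, b]%classic = (-%R : R -> measurableTypeR R) @^-1` `[- b, - a].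
Proof. by rewrite opp_preimage_itvbndbnd/= !opprK. Qed.

Let ge0_reflect a b g : measurable_fun `[- b, - a] g ->
  (forall x, `[- b, - a]%classic x -> 0 <= g x) ->
  (\int[mu]_(x in `[(- b)%R, (- a)%R]) (g x)%:E = \int[mu]_(x in `[a, b]) (g (- x) * 1)%:E)%E.
Proof.
move=> mg g0; rewrite opp_itv.
under [RHS]eq_integral do rewrite mulr1.
have mN : measurable_fun [set: measurableTypeR R] (-%R : _ -> measurableTypeR R) by [].
rewrite -(@ge0_integral_pushforward _ _ _ _ _ _ mN _ _ (EFin \o g))//=.
- by apply: eq_measure_integral => //= A mA AS; rewrite lebesgue_measureN.
- by apply/measurable_EFinP; exact: mg.
- by move=> x /set_mem xab; rewrite lee_fin; exact: g0.
Qed.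

Let mreflect a b (h : R -> R) : measurable_fun `[- b, - a] h ->
  measurable_fun `[a, b] (fun x => h (- x) * 1).
Proof.
move=> mh; apply: measurable_funM => //.
apply: (@measurable_comp _ _ _ _ _ _ `[- b, - a]) => //.
by move=> _ [x xab <-] /=; move: xab; rewrite /= !in_itv/= !lerN2 andbC.
Qed.

Lemma intg_reflect g a b : intg `[- b, - a] g -> intg `[a, b] (fun x => g (- x)).
Proof.
move=> gi; have : intg `[a, b] (fun x => g (- x) * 1).
  apply: (intg_transfer (D := `[- b, - a]%classic)) => //; first exact: mreflect.
  by move=> h mh h0; exact: ge0_reflect.
by apply: eq_intg => // x _; rewrite mulr1.
Qed.

Lemma Rint_reflect g a b : intg `[- b, - a] g ->
  \int[mu]_(x in `[- b, - a]) g x = \int[mu]_(x in `[a, b]) g (- x).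
Proof.
move=> gi; rewrite (Rint_transfer (E := `[a, b]%classic) (p := -%R) (w := fun=> 1))//.
- by apply: Rint_eq => x _; rewrite mulr1.
- exact: mreflect.
- by move=> h mh h0; exact: ge0_reflect.
Qed.

(** Uniform continuity from compactness in its near-covering form: [d] tending to 0 is the
    parameter, and each point [x] contributes a ball of radius [r / 2] on which every [d < r / 2]
    works. *)
Lemma heine a b g e : {within `[a, b], continuous g} -> 0 < e ->
  exists2 d, 0 < d & forall x y, a <= x <= b -> a <= y <= b -> `|x - y| < d ->
    `|g x - g y| < e.
Proof.
move=> /subspace_continuousP cg e0.
have /compact_near_coveringP := @segment_compact R a b.
move=> /(_ _ 0^'+ (fun d x => forall y, a <= x <= b -> a <= y <= b -> `|x - y| < d ->
    `|g x - g y| < e)) => H.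
have : \forall d \near 0^'+, `[a, b] `<=` (fun x => forall y, a <= x <= b -> a <= y <= b ->
   `|x - y| < d -> `|g x - g y| < e).
  apply: H => x /= xab.
  have /cvgrPdist_lt /(_ (e / 2)) := cg x xab.
  rewrite divr_gt0// => /(_ isT); rewrite near_withinE => /nbhs_ballP[r /= r0 xr].
  have r20 : 0 < r / 2 by rewrite divr_gt0.
  exists (ball x (r / 2), [set d | d < r / 2]) => /=.
    split; first exact: nbhsx_ballx.
    by apply: nbhs_right_lt.
  move=> [x' d]/= [xx' dr] y x'ab yab x'y.
  have rd (z : R) : a <= z <= b -> `|x - z| < r -> `|g x - g z| < e / 2.
    by move=> zab xz; apply: xr => //=; rewrite in_itv.
  have h1 : `|g x - g x'| < e / 2.
    by apply: rd => //; apply: lt_trans xx' _; lra.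
  have h2 : `|g x - g y| < e / 2.
    apply: rd => //; rewrite (_ : x - y = (x - x') + (x' - y)); last by ring.
    rewrite (le_lt_trans (ler_normD _ _))//; move: xx'; rewrite /ball/= => xx'; lra.
  rewrite (_ : g x' - g y = (g x - g y) - (g x - g x')); last by ring.
  by rewrite (le_lt_trans (ler_normB _ _))//; lra.
move=> h.
have [d [d0 dP]] : exists d, 0 < d /\ `[a, b] `<=` (fun x => forall y, a <= x <= b ->
   a <= y <= b -> `|x - y| < d -> `|g x - g y| < e).
  near (0 : R)^'+ => d; exists d; split; first by [].
  by near: d.
by exists d => // x y xab yab; apply: (dP x) => //=; rewrite in_itv.
Unshelve. all: by end_near. Qed.

Lemma intg_itv_mono a b c d f : c <= a -> b <= d -> intg `[c, d] f -> intg `[a, b] f.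
Proof.
move=> ca bd; apply: intgS => // x /=; rewrite !in_itv/= => /andP[ax xb].
by rewrite (le_trans ca ax) (le_trans xb bd).
Qed.

Lemma mu_itv_cc_fin a b : (mu `[a, b] < +oo)%E.
Proof. exact: (mu_itv_fin (a := a) (b := b)). Qed.

End affine_changes.

(** * Density of continuous functions and continuity of translations in L^2 *)

Section density.
Context {R : realType}.
Local Notation mu := (@lebesgue_measure R).
Implicit Types (f g : R -> R) (a b c k e : R).

Lemma Rint_cst a b c : a <= b -> \int[mu]_(x in `[a, b]) c = c * (b - a).
Proof.
move=> ab; rewrite Rintegral_cst//; congr (_ * _).
have E : mu `[a, b] = (b - a)%:E; last exact: (congr1 fine E).
rewrite lebesgue_measure_itv/= lte_fin; case: ltP => // ba.
by rewrite (@le_anti _ _ a b) ?subrr// ab.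
Qed.

Definition clip (M x : R) : R := Num.max (- M) (Num.min M x).

Lemma clipP (M x : R) : 0 <= M ->
  [\/ x <= - M /\ clip M x = - M, - M <= x <= M /\ clip M x = x | M <= x /\ clip M x = M].
Proof.
move=> M0; rewrite /clip; case: (leP M x) => Mx.
  by apply: Or33; split => //; case: (leP (- M) M) => //; lra.
case: (leP (- M) x) => xM; first by apply: Or32; split => //; rewrite ltW.
by apply: Or31; split => //; exact: ltW.
Qed.

Lemma clip_bound (M x : R) : 0 <= M -> `|clip M x| <= M.
Proof.
move=> M0; rewrite ler_norml.
by case: (clipP x M0) => -[xM ->]; apply/andP; split; lra.
Qed.

Lemma clip_id (M x : R) : `|x| <= M -> clip M x = x.
Proof.
move=> xM; have M0 : 0 <= M by exact: le_trans xM.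
by move: xM; rewrite ler_norml => /andP[? ?]; case: (clipP x M0) => -[h ->]; lra.
Qed.

Lemma clip_lip (M x y : R) : 0 <= M -> `|clip M x - clip M y| <= `|x - y|.
Proof.
move=> M0; have h1 := ler_norm (x - y); have h2 := ler_norm (y - x); rewrite distrC in h2.
rewrite ler_norml.
by case: (clipP x M0) => -[xM ->]; case: (clipP y M0) => -[yM ->]; apply/andP; split; lra.
Qed.

Lemma clip_sub (M x : R) : 0 <= M -> `|x - clip M x| <= `|x|.
Proof.
move=> M0; have h1 := ler_norm x; have h2 := ler_norm (- x); rewrite normrN in h2.
by rewrite ler_norml; case: (clipP x M0) => -[xM ->]; apply/andP; split; lra.
Qed.

Lemma measurable_clip D M f : measurable D -> measurable_fun D f ->
  measurable_fun D (fun x => clip M (f x)).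
Proof.
by move=> mD mf; apply: measurable_maxr => //; exact: measurable_minr.
Qed.

Lemma continuous_clip M f : continuous f -> continuous (fun x => clip M (f x)).
Proof.
move=> cf x; apply: (@continuous_max _ _ (cst (- M)) (fun x => Num.min M (f x))); first exact: cvg_cst.
by apply: (@continuous_min _ _ (cst M) f); [exact: cvg_cst|exact: cf].
Qed.

Lemma sqint_intg_sqr D f : sqint D f -> intg D (fun x => (f x) ^+ 2).
Proof. by case. Qed.

(** Truncation first makes [f] bounded, at a small cost in L^2 by dominated convergence. The
    truncated function is approximated in L^1 by a continuous one, which is clipped as well: between
    functions bounded by [M], L^1-closeness gives L^2-closeness. *)
Lemma L2_dense a b f e : sqint `[a, b] f -> 0 < e ->
  exists2 g : R -> R, continuous g & \int[mu]_(x in `[a, b]) ((f x - g x) ^+ 2) <= e.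
Proof.
move=> fi e0; have [mf f2] := fi; have mD := measurable_itv `[a, b].
have Dfin : (mu `[a, b] < +oo)%E := mu_itv_cc_fin a b.
pose fn (n : nat) x := clip n%:R (f x).
have mfn n : measurable_fun `[a, b] (fn n) by exact: measurable_clip.
have sfn n : sqint `[a, b] (fn n).
  by apply: (@sqint_bounded _ _ _ n%:R) => // x _; exact: clip_bound.
have [N hN] : exists n, \int[mu]_(x in `[a, b]) ((f x - fn n x) ^+ 2) <= e / 4.
  have : (\int[mu]_(x in `[a, b]) (((f x - fn n x) ^+ 2)%:E) @[n --> \oo] -->
          \int[mu]_(x in `[a, b]) (cst 0%E) x)%E.
    apply: (@dominated_cvg _ _ _ mu _ mD _ _ (fun x => ((f x) ^+ 2)%:E)) => //.
    - move=> n; apply/measurable_EFinP; apply: measurable_funX.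
      exact: (measurable_funB mf (mfn n)).
    - move=> x _; have [n0 hn0] : exists n0 : nat, `|f x| <= n0%:R.
        by exists (Num.bound `|f x|); apply: ltW; apply: archi_boundP.
      apply: cvg_near_cst; exists n0 => // n /= n0n.
      rewrite /fn clip_id ?subrr ?expr0n// (le_trans hn0)// ler_nat//.
    - move=> n x _ /=; rewrite lee_fin normrX -(real_normK (num_real (f x))).
      by rewrite lerXn2r ?nnegrE// clip_sub.
  rewrite integral0 => /cvge0P -/(_ _) h.
  have /h : 0 < e / 4 by lra.
  case.
    by move=> n; apply: integral_ge0 => x _; rewrite lee_fin sqr_ge0.
  move=> n0 _ hn; exists n0; rewrite -lee_fin Rint_EFin//; last exact: sqint_intg_sqr (sqintB mD fi (sfn n0)).
  exact: (hn n0 (leqnn _)).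
(* The added 1 keeps [M] positive even when [N] is 0, as the division by [8 * M] requires. *)
pose M : R := N%:R + 1; have M0 : 0 < M by rewrite ltr_wpDl.
have iN : mu.-integrable `[a, b] (EFin \o fn N) := sqint_integrable mD Dfin (sfn N).
have [g [cg ig gcvg]] := approximation_continuous_integrable mD Dfin iN.
have [n hn] : exists n, (\int[mu]_(x in `[a, b]) `|(fn N x - g n x)%:E| <= (e / (8 * M))%:E)%E.
  move/cvge0P : gcvg => h.
  have /h : 0 < e / (8 * M) by rewrite divr_gt0// mulr_gt0.
  by case=> [n|n0 _ hn]; [exact: integral_ge0|exists n0; exact: hn n0 (leqnn _)].
exists (fun x => clip M (g n x)); first by apply: continuous_clip; exact: cg.
have mg : measurable_fun `[a, b] (g n) by apply: measurable_funTS; apply: continuous_measurable_fun; exact: cg.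
have sG : sqint `[a, b] (fun x => clip M (g n x)).
  apply: (@sqint_bounded _ _ _ M) => //; first exact: measurable_clip.
  by move=> x _; apply: clip_bound; exact: ltW.
have ifg : intg `[a, b] (fun x => `|fn N x - g n x|).
  by apply: intg_norm => //; apply: intgB => //; exact: ig.
(* One factor of the square is bounded by [2 * M]; in the other the clip is removed, since clipping
   is 1-Lipschitz and fixes [fn N x]. *)
have fNG x : (fn N x - clip M (g n x)) ^+ 2 <= 2 * M * `|fn N x - g n x|.
  have b1 : `|fn N x| <= M by apply: le_trans (clip_bound _ _) _ => //; rewrite /M lerDl.
  have b2 : `|clip M (g n x)| <= M by apply: clip_bound; exact: ltW.
  rewrite -real_normK ?num_real// expr2 ler_pM//.
    by rewrite (le_trans (ler_normB _ _))//; lra.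
  by rewrite -{1}(clip_id b1); apply: clip_lip; exact: ltW.
have s1 := sqint_intg_sqr (sqintB mD fi (sfn N)).
apply: (@le_trans _ _ (\int[mu]_(x in `[a, b]) (2 * (f x - fn N x) ^+ 2 + (4 * M) * `|fn N x - g n x|))).
  apply: Rint_le => //; first exact: sqint_intg_sqr (sqintB mD fi sG).
    by apply: intgD => //; exact: intgZ.
  move=> x _; have := fNG x; have := sqr_ge0 (f x - 2 * fn N x + clip M (g n x)).
  by move: (f x) (fn N x) (clip M (g n x)) `|_| => F A B C; nra.
rewrite RintD//; [|exact: intgZ..].
rewrite !RintZ//.
have : \int[mu]_(x in `[a, b]) `|fn N x - g n x| <= e / (8 * M).
  by rewrite -lee_fin Rint_EFin.
move=> h2; have : 4 * M * \int[mu]_(x in `[a, b]) `|fn N x - g n x| <= 4 * M * (e / (8 * M)).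
  by rewrite ler_wpM2l// mulr_ge0// ltW.
have -> : 4 * M * (e / (8 * M)) = e / 2 by field; rewrite gt_eqF.
by move: hN; lra.
Qed.

(** Functions on the whole line, so that translation, reflection and composition need no bookkeeping
    of domains. Functions given on an interval enter through their extension by zero. *)
Definition L2loc f := measurable_fun setT f /\ forall a b, intg `[a, b] (fun x => (f x) ^+ 2).

Lemma L2loc_sqint f a b : L2loc f -> sqint `[a, b] f.
Proof. by move=> [mf fi]; split; [exact: measurable_funTS|exact: fi]. Qed.

Lemma L2loc_intg f a b : L2loc f -> intg `[a, b] f.
Proof.
by move=> fl; apply: sqint_integrable => //; [exact: mu_itv_cc_fin|exact: L2loc_sqint].
Qed.

Lemma L2loc_shift f c : L2loc f -> L2loc (fun x => f (x + c)).
Proof.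
move=> [mf fi]; split=> [|a b].
  by apply: (measurableT_comp mf); exact: measurable_funD.
have [ab|ab] := leP a b; last by rewrite set_itv_ge ?bnd_simp -?ltNge//; exact: integrable_set0.
exact: (intg_shift ab (fi (a + c) (b + c))).
Qed.

Lemma L2loc_reflect f : L2loc f -> L2loc (fun x => f (- x)).
Proof.
move=> [mf fi]; split=> [|a b]; first exact: (measurableT_comp mf).
exact: (intg_reflect (fi (- b) (- a))).
Qed.

Lemma L2loc_cont f : continuous f -> L2loc f.
Proof.
move=> cf; split=> [|a b]; first exact: continuous_measurable_fun.
apply: intg_cont; apply: continuous_subspaceT => x.
by apply: (@continuousM _ _ f f); exact: cf.
Qed.

Lemma L2locB f g : L2loc f -> L2loc g -> L2loc (fun x => f x - g x).
Proof.
move=> fl gl; split=> [|a b]; first by apply: measurable_funB; [exact: fl.1|exact: gl.1].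
by apply: sqint_intg_sqr; apply: sqintB => //; exact: L2loc_sqint.
Qed.

Lemma L2locZ c f : L2loc f -> L2loc (fun x => c * f x).
Proof.
move=> fl; split=> [|a b]; first by apply: measurable_funM => //; exact: fl.1.
by apply: sqint_intg_sqr; apply: sqintZ => //; exact: L2loc_sqint.
Qed.

Lemma L2locD f g : L2loc f -> L2loc g -> L2loc (fun x => f x + g x).
Proof.
move=> fl gl; split=> [|a b]; first by apply: measurable_funD; [exact: fl.1|exact: gl.1].
by apply: sqint_intg_sqr; apply: sqintD => //; exact: L2loc_sqint.
Qed.

(** A continuous approximation [g] is uniformly continuous, and [f (x + h) - f x] differs from
    [g (x + h) - g x] by two approximation errors. *)
Lemma L2_translate f a b e : L2loc f -> 0 < e ->
  exists2 d, 0 < d & forall h, `|h| < d ->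
    \int[mu]_(x in `[a, b]) ((f (x + h) - f x) ^+ 2) <= e.
Proof.
move=> fl e0; have mD := measurable_itv `[a, b].
have [ab|ab] := leP a b; last first.
  exists 1 => // h _; rewrite set_itv_ge ?bnd_simp -?ltNge// Rintegral_set0; exact: ltW.
(* Three errors of size [e / 9], each multiplied by the 3 of the square of a sum of three terms. The
   approximation lives on an interval larger by 1 on each side, so that it also covers the
   translates with [|h| < 1]. *)
have e9 : 0 < e / 9 by rewrite divr_gt0.
have [g cg fg] := L2_dense (L2loc_sqint (a - 1) (b + 1) fl) e9.
have gl := L2loc_cont cg.
have w0 : 0 < e / (9 * (b - a + 1)) by rewrite divr_gt0// mulr_gt0//; lra.
have [d d0 gd] := @heine R (a - 1) (b + 1) g (Num.sqrt (e / (9 * (b - a + 1))))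
  (continuous_subspaceT cg) ltac:(by rewrite sqrtr_gt0).
exists (Num.min d 1); first by rewrite lt_min d0 ltr01.
move=> h; rewrite lt_min => /andP[hd h1].
have h11 : -1 < h < 1 by rewrite -ltr_norml.
have fgl := L2locB fl gl.
have i1 : intg `[a, b] (fun x => (f (x + h) - g (x + h)) ^+ 2) := (L2loc_shift h fgl).2 a b.
have i2 : intg `[a, b] (fun x => (g (x + h) - g x) ^+ 2) := (L2locB (L2loc_shift h gl) gl).2 a b.
have i3 : intg `[a, b] (fun x => (f x - g x) ^+ 2) := fgl.2 a b.
apply: (@le_trans _ _ (\int[mu]_(x in `[a, b]) (3 * ((f (x + h) - g (x + h)) ^+ 2
    + (g (x + h) - g x) ^+ 2 + (f x - g x) ^+ 2)))).
  apply: Rint_le => //.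
  - exact: (L2locB (L2loc_shift h fl) fl).2.
  - by apply: intgZ => //; do 2!apply: intgD => //.
  - move=> x _; move: (f (x + h)) (g (x + h)) (f x) (g x) => A B C D.
    have h1' := sqr_ge0 ((A - B) - (B - D)); have h2' := sqr_ge0 ((A - B) + (C - D)).
    by have h3' := sqr_ge0 ((B - D) + (C - D)); nra.
rewrite RintZ//; last by do 2!apply: intgD => //.
rewrite RintD//; last by apply: intgD.
rewrite RintD//.
have b3 : \int[mu]_(x in `[a, b]) (f x - g x) ^+ 2 <= e / 9.
  apply: le_trans fg; apply: Rint_sub_le => //.
  - by move=> x /=; rewrite !in_itv/= => /andP[? ?]; apply/andP; split; lra.
  - exact: fgl.2.
  - by move=> x _; exact: sqr_ge0.
have b1 : \int[mu]_(x in `[a, b]) (f (x + h) - g (x + h)) ^+ 2 <= e / 9.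
  rewrite -(@Rint_shift R (fun x => (f x - g x) ^+ 2))//; last exact: fgl.2.
  apply: le_trans fg; apply: Rint_sub_le => //.
  - by move=> x /=; rewrite !in_itv/= => /andP[? ?]; apply/andP; split; lra.
  - exact: fgl.2.
  - by move=> x _; exact: sqr_ge0.
have b2 : \int[mu]_(x in `[a, b]) (g (x + h) - g x) ^+ 2 <= e / 9.
  apply: (@le_trans _ _ (\int[mu]_(x in `[a, b]) (e / (9 * (b - a + 1))))).
    apply: Rint_le => //; first exact: (intg_cst _ mD (mu_itv_cc_fin a b)).
    move=> x /=; rewrite in_itv/= => /andP[ax xb].
    rewrite -[leRHS]sqr_sqrtr; last exact: ltW.
    rewrite -real_normK ?num_real// lerXn2r ?nnegrE ?sqrtr_ge0//.
    by apply: ltW; apply: gd; [lra|lra|rewrite addrAC subrr add0r].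
  rewrite Rint_cst//.
  rewrite -mulrA ler_wpM2l ?(ltW e0)// invfM -mulrA ler_piMr// ler_pdivrMl; lra.
by lra.
Qed.

End density.

(** * Filters in epsilon-delta form *)

Section eps_delta.
Context {R : realType}.

Lemma near_ballP (x : R) (P : R -> Prop) :
  (\forall y \near x, P y) <-> exists2 d : R, 0 < d & forall y, `|x - y| < d -> P y.
Proof. by split=> [/nbhs_ballP[d /= d0 h]|[d d0 h]]; [exists d|apply/nbhs_ballP; exists d]. Qed.

Lemma cvgR_epsP (f : R -> R) x l : f y @[y --> x] --> l <->
  forall e : R, 0 < e -> exists2 d : R, 0 < d & forall y, `|x - y| < d -> `|l - f y| < e.
Proof.
by split=> [/cvgrPdist_lt h e /h/near_ballP|h]; last by apply/cvgrPdist_lt => e /h/near_ballP.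
Qed.

Lemma near_withinP (D : set R) (x : R) (P : R -> Prop) :
  (\forall y \near within D (nbhs x), P y) <->
  exists2 d : R, 0 < d & forall y, `|x - y| < d -> D y -> P y.
Proof. exact: (near_ballP x (fun y => D y -> P y)). Qed.

Lemma near_dnbhsP (D : set R) (x : R) (P : R -> Prop) :
  (\forall y \near within D x^', P y) <->
  exists2 d : R, 0 < d & forall y, `|x - y| < d -> y != x -> D y -> P y.
Proof. exact: (near_ballP x (fun y => y != x -> D y -> P y)). Qed.

Lemma near_right0P (P : R -> Prop) :
  (\forall y \near 0^'+, P y) <->
  exists2 d : R, 0 < d & forall y, 0 < y < d -> P y.
Proof.
have E : (\forall y \near 0^'+, P y) <-> (\forall y \near (0 : R), 0 < y -> P y) by [].
rewrite E near_ballP; split=> -[d d0 h]; exists d => // y.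
  by move=> /andP[y0 yd]; apply: h => //; rewrite sub0r normrN gtr0_norm.
by rewrite sub0r normrN => yd y0; apply: h; rewrite y0 (le_lt_trans (ler_norm y)).
Qed.

Lemma near_prodP (z : R * R) (P : R * R -> Prop) :
  (\forall y \near z, P y) <-> exists2 d : R, 0 < d &
    forall x y, `|z.1 - x| < d -> `|z.2 - y| < d -> P (x, y).
Proof.
split=> [/nbhs_ballP[d /= d0 h]|[d d0 h]]; first by exists d => // x y hx hy; exact: h.
by apply/nbhs_ballP; exists d => // -[x y] [hx hy]; exact: h.
Qed.

Lemma cvgprod_epsP (f : R * R -> R) z l : f y @[y --> z] --> l <->
  forall e : R, 0 < e -> exists2 d : R, 0 < d &
    forall x y, `|z.1 - x| < d -> `|z.2 - y| < d -> `|l - f (x, y)| < e.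
Proof.
split=> [/cvgrPdist_lt h e e0|h].
  exact: (near_prodP z (fun w => `|l - f w| < e)).1 (h _ e0).
apply/cvgrPdist_lt => e e0.
exact: (near_prodP z (fun w => `|l - f w| < e)).2 (h _ e0).
Qed.

End eps_delta.

(** * Primitives and their difference quotients in mean square *)

Section primitive.
Context {R : realType}.
Local Notation mu := (@lebesgue_measure R).
Implicit Types (f g : R -> R) (a b c k e h : R).

Lemma Rint_split f a b c : a <= c -> c <= b -> intg `[a, b] f ->
  \int[mu]_(x in `[a, b]) f x = \int[mu]_(x in `[a, c]) f x + \int[mu]_(x in `[c, b]) f x.
Proof.
move=> ac cb fi; rewrite -(@Rintegral_itv_obnd_cbnd _ c); last first.
  by apply: (intgS _ _ _ fi) => // x /=; rewrite !in_itv/= => /andP[/ltW/(le_trans ac)-> ->].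
by rewrite -(Rintegral_itvB (a := BLeft a))//; [ring|rewrite bnd_simp..].
Qed.

Lemma Rint_itv1 f a : \int[mu]_(x in `[a, a]) f x = 0.
Proof. by rewrite set_itv1 Rintegral_set1. Qed.

Definition prim f x : R :=
  if 0 <= x then \int[mu]_(y in `[0, x]) f y else - \int[mu]_(y in `[x, 0]) f y.

Definition locintg f := forall a b, intg `[a, b] f.

Lemma prim0 f : prim f 0 = 0.
Proof. by rewrite /prim lexx Rint_itv1. Qed.

Lemma primB f a b : locintg f -> a <= b ->
  prim f b - prim f a = \int[mu]_(y in `[a, b]) f y.
Proof.
move=> fi ab; rewrite /prim; case: (leP 0 a) => a0; case: (leP 0 b) => b0.
- by rewrite (@Rint_split f 0 b a)//; ring.
- by lra.
- by rewrite (@Rint_split f a b 0)//; [ring|exact: ltW].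
- by rewrite (@Rint_split f a 0 b)//; [ring|exact: ltW].
Qed.

Lemma L2loc_locintg f : L2loc f -> locintg f.
Proof. by move=> fl a b; exact: L2loc_intg. Qed.

Lemma Rint_sqr_le D f : measurable D -> (mu D < +oo)%E -> sqint D f ->
  (\int[mu]_(x in D) f x) ^+ 2 <= fine (mu D) * \int[mu]_(x in D) (f x ^+ 2).
Proof.
move=> mD Dfin fi; have := cauchy_schwarz mD (sqint_cst 1 mD Dfin) fi.
rewrite (Rint_eq (g := f)); last by move=> x _; rewrite /= mul1r.
move/le_trans; apply; rewrite le_eqVlt; apply/orP; left; apply/eqP; congr (_ * _).
rewrite (Rint_eq (g := fun=> 1)); last by move=> x _ /=; rewrite expr1n.
by rewrite Rintegral_cst// mul1r.
Qed.

Lemma Rint_sqr_le_itv f a b : a <= b -> sqint `[a, b] f ->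
  (\int[mu]_(x in `[a, b]) f x) ^+ 2 <= (b - a) * \int[mu]_(x in `[a, b]) (f x ^+ 2).
Proof.
move=> ab fi; have := Rint_sqr_le (measurable_itv `[a, b]) (mu_itv_cc_fin a b) fi.
by have := Rint_cst 1 ab; rewrite Rintegral_cst// !mul1r => ->.
Qed.

(** Cauchy-Schwarz on the segment between [x] and [y]. Besides the continuity of primitives it
    yields their constancy wherever the energy of [f] vanishes. *)
Lemma prim_hoelder f a b x y : L2loc f -> a <= x <= b -> a <= y <= b ->
  (prim f x - prim f y) ^+ 2 <= `|x - y| * \int[mu]_(z in `[a, b]) (f z ^+ 2).
Proof.
move=> fl; wlog yx : x y / y <= x => [H xab yab|/andP[ax xb] /andP[ay yb]].
  have [/H|/ltW/H] := leP y x; first exact.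
  by rewrite distrC -sqrrN opprB; apply.
rewrite (primB (L2loc_locintg fl) yx) ger0_norm ?subr_ge0//.
apply: le_trans (Rint_sqr_le_itv yx (L2loc_sqint y x fl)) _.
rewrite ler_wpM2l ?subr_ge0//; apply: Rint_sub_le => //.
- by move=> z /=; rewrite !in_itv/= => /andP[? ?]; apply/andP; split; lra.
- exact: fl.2.
- by move=> z _; exact: sqr_ge0.
Qed.

Lemma prim_continuous f : L2loc f -> continuous (prim f).
Proof.
move=> fl x; apply/cvgR_epsP => e e0.
pose K := \int[mu]_(z in `[x - 1, x + 1]) (f z ^+ 2).
have K0 : 0 <= K by exact: Rintegral_sqr_ge0.
exists (Num.min 1 (e ^+ 2 / (K + 1))).
  by rewrite lt_min ltr01 divr_gt0 ?exprn_gt0//; lra.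
move=> y; rewrite lt_min => /andP[xy1 xy2].
rewrite -(ltr_pXn2r (n := 2))// ?nnegrE ?(ltW e0)// real_normK ?num_real//.
apply: le_lt_trans (@prim_hoelder f (x - 1) (x + 1) x y fl _ _) _.
- by lra.
- by move: xy1; rewrite ltr_norml; lra.
- move: xy2; rewrite ltr_pdivlMr; last by lra.
  by rewrite -/K; have := normr_ge0 (x - y); nra.
Qed.

Lemma measurable_prim f : L2loc f -> measurable_fun setT (prim f).
Proof. by move=> fl; apply: continuous_measurable_fun; exact: prim_continuous. Qed.

Lemma tonelli_restrict (k : R * R -> R) (A B : set R) : measurable A -> measurable B ->
  measurable_fun setT k -> (forall z, 0 <= k z) ->
  (\int[mu]_(x in A) \int[mu]_(y in B) (k (x, y))%:E =
   \int[mu]_(y in B) \int[mu]_(x in A) (k (x, y))%:E)%E.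
Proof.
move=> mA mB mk k0.
pose K (z : measurableTypeR R * measurableTypeR R) : \bar R :=
  (k z * (\1_A z.1 * \1_B z.2))%:E.
have mK : measurable_fun setT K.
  apply/measurable_EFinP; apply: measurable_funM; first exact: mk.
  apply: measurable_funM.
    have m1 : measurable_fun setT (\1_A : measurableTypeR R -> R) by exact: measurable_indic.
    exact: (measurableT_comp m1 measurable_fst).
  have m1 : measurable_fun setT (\1_B : measurableTypeR R -> R) by exact: measurable_indic.
  exact: (measurableT_comp m1 measurable_snd).
have K0 z : (0 <= K z)%E by rewrite lee_fin !mulr_ge0.
have := @fubini_tonelli _ _ _ _ R mu mu K mK K0.
rewrite /fubini_F/=.
have -> : (\int[mu]_x \int[mu]_y K (x, y) = \int[mu]_(x in A) \int[mu]_(y in B) (k (x, y))%:E)%E.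
  rewrite [RHS]integral_mkcond; apply: eq_integral => x _; rewrite patchE /K/= indicE.
  case: (x \in A) => /=; last by apply: integral0_eq => y _; rewrite mul0r mulr0.
  rewrite [RHS]integral_mkcond; apply: eq_integral => y _; rewrite patchE indicE mul1r.
  by case: (y \in B) => /=; rewrite ?mulr1 ?mulr0.
move=> ->; rewrite [RHS]integral_mkcond; apply: eq_integral => y _; rewrite patchE /K/= indicE.
case: (y \in B) => /=; last by apply: integral0_eq => x _; rewrite !mulr0.
rewrite [RHS]integral_mkcond; apply: eq_integral => x _; rewrite patchE indicE mulr1.
by case: (x \in A) => /=; rewrite ?mulr1 ?mulr0.
Qed.

(* The integral of a nonnegative function is a lower integral, so monotonicity
   does not need measurability. *)
Lemma ge0_le_lower_integral (D : set R) (f1 f2 : R -> \bar R) :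
  (forall x, D x -> 0 <= f1 x)%E -> (forall x, D x -> f1 x <= f2 x)%E ->
  (\int[mu]_(x in D) f1 x <= \int[mu]_(x in D) f2 x)%E.
Proof.
move=> f10 f12; rewrite !ge0_integralE//; last first.
  by move=> x Dx; exact: le_trans (f10 _ Dx) (f12 _ Dx).
apply: le_ereal_sup => _ /= [g gf <-]; exists g => // x.
apply: le_trans (gf x) _; rewrite !patchE; case: ifPn => // /set_mem; exact: f12.
Qed.

(** After Tonelli the inner integral is over [A], for a fixed displacement [c = h * p th] with
    [|c| <= |h|], and [0,1] has measure 1. In this way continuity of translations turns into an
    estimate on averages. *)
Lemma average_le (f s p : R -> R) (A : set R) h e : measurable A -> measurable_fun setT f ->
  measurable_fun setT s -> measurable_fun setT p -> 0 <= e ->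
  (forall th, `[0, 1]%classic th -> 0 <= p th <= 1) ->
  (forall c, `|c| <= `|h| -> (\int[mu]_(x in A) ((f (s x + c) - f (s x)) ^+ 2)%:E <= e%:E)%E) ->
  (\int[mu]_(x in A) \int[mu]_(th in `[0%R, 1%R]) ((f (s x + h * p th) - f (s x)) ^+ 2)%:E <= e%:E)%E.
Proof.
move=> mA mf ms mp e0 p01 H.
rewrite (@tonelli_restrict (fun z => (f (s z.1 + h * p z.2) - f (s z.1)) ^+ 2))//; last 2 first.
- apply: measurable_funX; apply: measurable_funB.
    apply: (measurableT_comp mf); apply: measurable_funD.
      exact: (measurableT_comp ms measurable_fst).
    by apply: measurable_funM => //; exact: (measurableT_comp mp measurable_snd).
  exact: (measurableT_comp mf (measurableT_comp ms measurable_fst)).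
- by move=> z; exact: sqr_ge0.
apply: (@le_trans _ _ (\int[mu]_(th in `[0%R, 1%R]) (cst e%:E th))%E); last first.
  rewrite integral_cst//= (_ : lebesgue_measure _ = 1%E) ?mule1//.
  by rewrite lebesgue_measure_itv/= lte_fin ltr01 -EFinB subr0.
apply: ge0_le_lower_integral => th th01.
  by apply: integral_ge0 => x _; rewrite lee_fin sqr_ge0.
by rewrite /=; apply: H; have /= := p01 _ th01 => /andP[p0 p1]; rewrite normrM ler_piMr// ger0_norm.
Qed.

(** The change of variables has to be increasing, hence [p th = th] for positive [h] and
    [p th = 1 - th] for negative [h]. *)
Lemma primB_average f : L2loc f -> forall h, h != 0 -> exists p : R -> R,
  [/\ measurable_fun setT p, forall th, `[0, 1]%classic th -> 0 <= p th <= 1 &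
   forall x, intg `[0, 1] (fun th => f (x + h * p th)) /\
     (prim f (x + h) - prim f x) / h = \int[mu]_(th in `[0, 1]) f (x + h * p th)].
Proof.
move=> fl h h0; have fi := L2loc_locintg fl.
have [hp|hn|/esym/eqP] := ltgtP 0 h; last by rewrite (negbTE h0).
- exists id; split => // x.
  have xxh : x <= x + h by rewrite lerDl ltW.
  have D := diffeo_affine x hp.
  have := @intg_change_itv R _ _ D f 0 1 ler01.
  have := @change_of_variables R _ _ D f 0 1 ler01.
  rewrite mulr0 mulr1 add0r [h + x]addrC => /(_ (fi _ _)) cv /(_ (fi _ _)) ci.
  have ci' : intg `[0, 1] (fun th => f (x + h * th)).
    have := intgZ h^-1 (measurable_itv _) ci.
    by apply: eq_intg => // th _; rewrite [x + _]addrC; field.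
  split => //; rewrite (primB fi xxh) cv mulrC -RintZ//.
  by apply: Rint_eq => th _; rewrite [x + _]addrC; field.
- have hp : 0 < - h by rewrite oppr_gt0.
  exists (fun th => 1 - th); split => // [|x|x].
  + exact: measurable_funB.
  + by rewrite /= in_itv/= => ?; apply/andP; split; lra.
  have xxh : x + h <= x by rewrite gerDl ltW.
  have D := diffeo_affine (x + h) hp.
  have := @intg_change_itv R _ _ D f 0 1 ler01.
  have := @change_of_variables R _ _ D f 0 1 ler01.
  rewrite mulr0 mulr1 add0r (_ : - h + (x + h) = x); last by ring.
  move=> /(_ (fi _ _)) cv /(_ (fi _ _)) ci.
  have E th : - h * th + (x + h) = x + h * (1 - th) by ring.
  have ci' : intg `[0, 1] (fun th => f (x + h * (1 - th))).
    have := intgZ (- h^-1) (measurable_itv _) ci.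
    by apply: eq_intg => // th _; rewrite E; field.
  split => //; rewrite -opprB (primB fi xxh) cv mulNr mulrC -mulNr -RintZ//.
  by apply: Rint_eq => th _; rewrite E; field.
Qed.

(** The quotient is a mean of [f] over [0,1], and the square of a mean is at most the mean of the
    square; [average_le] does the rest. *)
Lemma average_quotient_le f (s : R -> R) (A : set R) h e : measurable A -> L2loc f ->
  measurable_fun setT s -> 0 <= e -> h != 0 ->
  (forall c, `|c| <= `|h| -> (\int[mu]_(x in A) ((f (s x + c) - f (s x)) ^+ 2)%:E <= e%:E)%E) ->
  (\int[mu]_(x in A) (((prim f (s x + h) - prim f (s x)) / h - f (s x)) ^+ 2)%:E <= e%:E)%E.
Proof.
move=> mA fl ms e0 h0 H; have [p [mp p01 hp]] := primB_average fl h0.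
apply: le_trans (average_le (p := p) mA fl.1 ms mp e0 p01 H).
apply: ge0_le_lower_integral => x _; first by rewrite lee_fin sqr_ge0.
have [ci ->] := hp (s x).
have i01 := intg_cst (f (s x)) (measurable_itv `[0, 1]) (mu_itv_cc_fin 0 1).
have cfi := intgB (measurable_itv `[0, 1]) ci i01.
have -> : \int[mu]_(th in `[0, 1]) f (s x + h * p th) - f (s x) =
    \int[mu]_(th in `[0, 1]) (f (s x + h * p th) - f (s x)).
  by rewrite RintB// (Rint_cst (f (s x)) ler01); ring.
(* If the translates are not square integrable in [th] for this [x], the right-hand side is infinite
   and there is nothing to prove. *)
have [si|si] := pselect (sqint `[0, 1] (fun th => f (s x + h * p th) - f (s x))).
  rewrite -Rint_EFin//; last exact: sqint_intg_sqr.
  by rewrite lee_fin; apply: le_trans (Rint_sqr_le_itv ler01 si) _; rewrite subr0 mul1r.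
have : ~ (\int[mu]_(th in `[0%R, 1%R]) ((f (s x + h * p th) - f (s x)) ^+ 2)%:E < +oo)%E.
  by move=> hh; apply: si; apply/sqintP => //; split => //; exact: intg_measurable cfi.
by move/negP; rewrite -leNgt leye_eq => /eqP ->; rewrite leey.
Qed.

End primitive.

(** * Classical integration by parts and C^1 bumps *)

Section derivatives.
Context {R : realType}.
Local Notation mu := (@lebesgue_measure R).
Implicit Types (f g : R -> R) (a b c k e h : R).

Lemma is_derive_epsP f (x l : R) : is_derive x 1 f l <->
  forall e, 0 < e -> exists2 d : R, 0 < d & forall h, h != 0 -> `|h| < d ->
    `|(f (x + h) - f x) / h - l| < e.
Proof.
have E : h^-1 *: (f (h *: 1 + x) - f x) @[h --> 0^'] --> l <->
  forall e, 0 < e -> exists2 d : R, 0 < d & forall h, h != 0 -> `|h| < d ->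
    `|(f (x + h) - f x) / h - l| < e.
  have scE h : h^-1 *: (f (h *: 1 + x) - f x) = (f (x + h) - f x) / h :> R.
    by rewrite /GRing.scale/= mulr1 mulrC (addrC h).
  split=> [/cvgrPdist_lt H e e0|H].
    have /near_ballP[d d0 hd] := H _ e0.
    exists d => // h h0 hh; have := hd h; rewrite sub0r normrN => /(_ hh h0).
    by rewrite scE distrC.
  apply/cvgrPdist_lt => e e0; have [d d0 hd] := H _ e0.
  apply/near_ballP; exists d => // h; rewrite sub0r normrN => hh h0.
  by rewrite scE distrC; exact: hd.
rewrite -E; split=> [[df <-]|H].
  by rewrite -[X in _ --> X]/(lim _); exact: df.
by split; [apply/cvg_ex; exists l|exact: cvg_lim].
Qed.

Lemma prim_is_derive g (x : R) : continuous g -> is_derive x 1 (prim g) (g x).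
Proof.
move=> cg; have gl := L2loc_cont cg; apply/is_derive_epsP => e e0.
have e20 : 0 < e / 2 by rewrite divr_gt0.
have /cvgR_epsP/(_ _ e20)[d d0 gd] := cg x.
exists d => // h h0 hd; have [p [mp p01 /(_ x)[pi ->]]] := primB_average gl h0.
have m01 := measurable_itv (`[0, 1] : interval R).
have i1 := intg_cst (g x) m01 (mu_itv_cc_fin 0 1).
have -> : \int[mu]_(th in `[0, 1]) g (x + h * p th) - g x =
    \int[mu]_(th in `[0, 1]) (g (x + h * p th) - g x).
  by rewrite RintB// (Rint_cst (g x) ler01); ring.
apply: le_lt_trans (Rint_norm m01 (intgB m01 pi i1)) _.
apply: (@le_lt_trans _ _ (\int[mu]_(t in `[0, 1]) (e / 2))); last by rewrite Rint_cst//; lra.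
apply: Rint_le => //; first by apply: intg_norm => //; exact: intgB.
  exact: intg_cst _ m01 (mu_itv_cc_fin 0 1).
move=> th th01; have /= /andP[p0 p1] := p01 _ th01; apply: ltW; rewrite distrC; apply: gd.
rewrite opprD addrA subrr add0r normrN; apply: le_lt_trans hd.
by rewrite normrM ler_piMr// ger0_norm.
Qed.

Lemma is_derive_continuous f (l x : R) : is_derive x (1 : R) f l -> {for x, continuous f}.
Proof. by case=> df _; apply: differentiable_continuous; apply/derivable1_diffP. Qed.

Lemma is_derive_derivable f (l x : R) : is_derive x (1 : R) f l -> derivable f x 1.
Proof. by case. Qed.

Lemma is_derive_derive1 f (l x : R) : is_derive x (1 : R) f l -> derive1 f x = l.
Proof. by move=> H; rewrite derive1E; case: H. Qed.

Lemma Rint_by_parts f df g dg a b : a <= b ->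
  (forall x : R, is_derive x 1 f (df x)) -> (forall x : R, is_derive x 1 g (dg x)) ->
  continuous df -> continuous dg ->
  \int[mu]_(x in `[a, b]) (f x * dg x) = f b * g b - f a * g a -
  \int[mu]_(x in `[a, b]) (df x * g x).
Proof.
rewrite le_eqVlt => /predU1P[<-*|ab Df Dg cf cg]; first by rewrite !Rint_itv1 subrr subrr.
have LR (h dh : R -> R) : (forall x : R, is_derive x 1 h (dh x)) -> derivable_oo_LRcontinuous h a b.
  move=> H; split => [x _||]; first exact: is_derive_derivable (H x).
    by apply: cvg_at_right_filter; exact: (is_derive_continuous (H a)).
  by apply: cvg_at_left_filter; exact: (is_derive_continuous (H b)).
apply: Rintegration_by_parts => //.
- exact: continuous_subspaceT.
- exact: LR Df.
- by move=> x _; exact: is_derive_derive1 (Df x).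
- exact: continuous_subspaceT.
- exact: LR Dg.
- by move=> x _; exact: is_derive_derive1 (Dg x).
Qed.

Lemma Rint_derive f df a b : a <= b ->
  (forall x : R, is_derive x 1 f (df x)) -> continuous df ->
  \int[mu]_(x in `[a, b]) df x = f b - f a.
Proof.
move=> ab Df cf.
have D1 (x : R) : is_derive x (1 : R) (cst 1 : R -> R) (cst 0 x) by exact: is_derive_cst.
have c0 : continuous (cst 0 : R -> R) by move=> x; exact: cvg_cst.
have := Rint_by_parts ab D1 Df c0 cf.
rewrite (Rint_eq (g := df)); last by move=> x _; rewrite /= mul1r.
rewrite (Rint_eq (f := fun x => cst 0 x * f x) (g := fun=> 0)); last by move=> x _; rewrite /= mul0r.
by rewrite Rint_cst// mul0r subr0 !mul1r.
Qed.

Definition pos2 (x : R) : R := (Num.max 0 x) ^+ 2.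

Lemma pos2_derive (x : R) : is_derive x 1 pos2 (2 * Num.max 0 x).
Proof.
apply/is_derive_epsP => e e0; exists e => // h h0 hd.
rewrite (_ : _ - _ = (pos2 (x + h) - pos2 x - 2 * Num.max 0 x * h) / h); last by field.
rewrite normrM normfV ltr_pdivrMr ?normr_gt0//; apply: (@le_lt_trans _ _ (`|h| ^+ 2)).
  rewrite real_normK ?num_real// /pos2 ler_norml.
  by case: (leP 0 x) => x0; case: (leP 0 (x + h)) => xh0; apply/andP; split; nra.
by rewrite expr2 ltr_pM2r ?normr_gt0.
Qed.

(** The test functions of the problem are only C^1, so the squared positive part of a polynomial is
    smooth enough, with an explicit derivative. *)
Definition bump e x : R := pos2 (e ^+ 2 - x ^+ 2).
Definition dbump e x : R := 2 * Num.max 0 (e ^+ 2 - x ^+ 2) * (- (2 * x)).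

Lemma bump_derive e (x : R) : is_derive x 1 (bump e) (dbump e x).
Proof.
rewrite (_ : bump e = pos2 \o (fun x => e ^+ 2 - x ^+ 2))//.
have D : is_derive x 1 (fun x : R => e ^+ 2 - x ^+ 2) (- (2 * x)).
  rewrite (_ : (fun _ => _) = (cst (e ^+ 2) - (@id R) ^+ 2)%R)//; apply: is_derive_eq.
  by rewrite /GRing.scale/= sub0r expr1 mulr1 -mulr_natl mulrC.
exact: (@is_derive1_comp R pos2 (fun x : R => e ^+ 2 - x ^+ 2) x _ _ (pos2_derive _) D).
Qed.

Lemma dbump_continuous e : continuous (dbump e).
Proof.
move=> x; apply: cvgM; last by apply: cvgN; apply: cvgM; [exact: cvg_cst|exact: cvg_id].
apply: cvgM; first exact: cvg_cst.
apply: (@continuous_max _ _ (cst 0) (fun x : R => e ^+ 2 - x ^+ 2)); first exact: cvg_cst.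
by apply: cvgB; [exact: cvg_cst|exact: exprn_continuous].
Qed.

Lemma bump_continuous e : continuous (bump e).
Proof. by move=> x; exact: is_derive_continuous (bump_derive e x). Qed.

Lemma bump_ge0 e x : 0 <= bump e x.
Proof. exact: sqr_ge0. Qed.

Lemma bump_out e x : 0 < e -> e <= `|x| -> bump e x = 0.
Proof.
move=> e0 ex; rewrite /bump /pos2 max_l ?expr0n// subr_le0 -(real_normK (num_real x)).
by rewrite lerXn2r ?nnegrE// ltW.
Qed.

Lemma bump_gt0 e x : `|x| < e -> 0 < bump e x.
Proof.
move=> xe; have e0 : 0 < e := le_lt_trans (normr_ge0 _) xe.
rewrite /bump /pos2 exprn_gt0// lt_max subr_gt0 -(real_normK (num_real x)).
by rewrite ltr_pXn2r ?nnegrE ?(ltW e0)// xe orbT.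
Qed.

Definition mass e : R := \int[mu]_(x in `[- e, e]) bump e x.

Lemma cont_intg f a b : continuous f -> intg `[a, b] f.
Proof. by move=> cf; apply: intg_cont; exact: continuous_subspaceT. Qed.

Lemma mass_gt0 e : 0 < e -> 0 < mass e.
Proof.
move=> e0; pose m := e / 2; have m0 : 0 < m by rewrite divr_gt0.
apply: (@lt_le_trans _ _ (\int[mu]_(x in `[- m, m]) bump e m)).
  rewrite Rint_cst; last by lra.
  by rewrite mulr_gt0// ?bump_gt0//; [rewrite gtr0_norm /m; lra|lra].
apply: (@le_trans _ _ (\int[mu]_(x in `[- m, m]) bump e x)).
  apply: Rint_le => //.
  - exact: intg_cst _ _ (mu_itv_cc_fin _ _).
  - by apply: cont_intg; exact: bump_continuous.
  - move=> x /=; rewrite in_itv/= => /andP[mx xm].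
    have xm2 : x ^+ 2 <= m ^+ 2 by nra.
    rewrite /bump /pos2 lerXn2r ?nnegrE ?le_max ?lexx//.
    by case: (leP 0 (e ^+ 2 - m ^+ 2)); case: (leP 0 (e ^+ 2 - x ^+ 2)) => *; lra.
apply: Rint_sub_le => //.
- by move=> x /=; rewrite !in_itv/= /m => /andP[? ?]; apply/andP; split; lra.
- by apply: cont_intg; exact: bump_continuous.
- by move=> x _; exact: bump_ge0.
Qed.

Lemma mass_shift e p : 0 < e -> \int[mu]_(x in `[p - e, p + e]) bump e (x - p) = mass e.
Proof.
move=> e0; have c : continuous (fun x : R => bump e (x - p)).
  move=> x; apply: (@continuous_comp _ _ _ (fun x : R => x - p) (bump e)); last exact: bump_continuous.
  by apply: cvgB; [exact: cvg_id|exact: cvg_cst].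
have ee : - e <= e by lra.
have := @Rint_shift R (fun x => bump e (x - p)) (- e) e p ee (cont_intg _ _ c).
rewrite (_ : - e + p = p - e) 1?(_ : e + p = p + e); [|ring..].
by move=> ->; apply: Rint_eq => x _; rewrite addrK.
Qed.

Lemma Rint_support f a b c d : a <= c -> c <= d -> d <= b -> intg `[a, b] f ->
  (forall x, x < c \/ d < x -> f x = 0) ->
  \int[mu]_(x in `[a, b]) f x = \int[mu]_(x in `[c, d]) f x.
Proof.
move=> ac cd db fi f0.
rewrite Rintegral_mkcond [RHS]Rintegral_mkcond; apply: eq_Rintegral => x _.
rewrite !patchE !mem_setE !in_itv/=.
have [ax|xa] := leP a x; have [xb|bx] := leP x b; have [cx|xc] := leP c x; have [xd|dx] := leP x d => //=;
  by try (rewrite f0//; [by left|by right]); try lra; try (by rewrite f0//; left); try (by rewrite f0//; right).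
Qed.

End derivatives.

(** * Weak derivatives *)

Section weak_derivatives.
Context {R : realType}.
Local Notation mu := (@lebesgue_measure R).
Implicit Types (f g w : R -> R) (a b c k e h : R).

Lemma Rint_oo_cc a b f : intg `[a, b] f ->
  \int[mu]_(x in `]a, b[) f x = \int[mu]_(x in `[a, b]) f x.
Proof.
move=> fi; rewrite Rintegral_itv_bndo_bndc; last first.
  by apply: intgS fi => // x /=; rewrite !in_itv/= => /andP[/ltW-> /ltW->].
rewrite Rintegral_itv_obnd_cbnd//.
by apply: intgS fi => // x /=; rewrite !in_itv/= => /andP[/ltW-> ->].
Qed.

Lemma L2loc_patch a b g : sqint `]a, b[ g -> L2loc (g \_ `]a, b[).
Proof.
move=> [mg gi]; have mD := measurable_itv (`]a, b[ : interval R); split.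
  by apply/(measurable_restrictT _ mD); exact: mg.
move=> c d; apply: (@intgS _ _ setT) => //.
have -> : (fun x => (g \_ `]a, b[) x ^+ 2) = (fun x => g x ^+ 2) \_ `]a, b[.
  by apply/funext => x; rewrite !patchE; case: ifP => //; rewrite expr0n.
exact: intg_restrict.
Qed.

Lemma cont_bounded a b f : continuous f -> exists2 B : R, 0 <= B &
  forall x, a <= x <= b -> `|f x| <= B.
Proof.
move=> cf; have [ab|ba] := leP a b; last first.
  by exists 0 => // x /andP[ax xb]; exfalso; move: ba; rewrite ltNge (le_trans ax xb).
have [c _ hc] : exists2 c, c \in `[a, b] & forall t, t \in `[a, b] -> `|f t| <= `|f c|.
  apply: (@EVT_max _ (fun x => `|f x|)) => //; apply: continuous_subspaceT => x.
  by apply: cvg_norm; exact: cf.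
by exists `|f c| => // x xab; apply: hc; rewrite in_itv.
Qed.

(** Absolute continuity of [w] with derivative [g], in integrated form: no differentiability at
    points enters the proof. *)
Definition primitive_of w g := forall x y, x <= y -> w y - w x = \int[mu]_(z in `[x, y]) g z.

Lemma primitive_prim w g : locintg g -> primitive_of w g -> forall x, w x = w 0 + prim g x.
Proof.
move=> gi wg x; rewrite /prim; case: (leP 0 x) => x0; first by rewrite -wg//; ring.
by rewrite -wg ?ltW//; ring.
Qed.

Lemma primitive_cont w g : L2loc g -> primitive_of w g -> continuous w.
Proof.
move=> gl wg; have -> : w = (fun x => w 0 + prim g x).
  by apply/funext => x; exact: primitive_prim (L2loc_locintg gl) wg x.
by move=> x; apply: cvgD; [exact: cvg_cst|exact: prim_continuous].
Qed.

Lemma sqr_small_eq0 (x C : R) : 0 <= C -> (forall e, 0 < e -> x ^+ 2 <= C * e) -> x = 0.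
Proof.
move=> C0 H; apply/eqP; rewrite -sqrf_eq0 eq_le sqr_ge0 andbT; apply/ler_addgt0Pr => e e0.
rewrite add0r; apply: le_trans (H (e / (C + 1)) _) _; first by rewrite divr_gt0//; lra.
by rewrite mulrA ler_pdivrMr; nra.
Qed.

Lemma Rint_sqr_bound a b f (B : R) : a <= b -> intg `[a, b] (fun x => f x ^+ 2) ->
  (forall x, a <= x <= b -> f x ^+ 2 <= B) ->
  \int[mu]_(x in `[a, b]) (f x ^+ 2) <= B * (b - a).
Proof.
move=> ab fi fB; rewrite -Rint_cst//; apply: Rint_le => //.
exact: intg_cst _ _ (mu_itv_cc_fin a b).
Qed.

(** The classical formula holds for [v = w 0 + prim k] with [k] continuous and close to [g] in L^2;
    the two error terms are of the order of the square root of [e] by Cauchy-Schwarz. The condition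
    at 0 is put on the product [w 0 * psi 0]: it covers test functions vanishing at 0 as well as
    displacements vanishing at the fixed end. *)
Lemma Rint_by_parts_primitive a w g (psi dpsi : R -> R) : 0 < a -> L2loc g -> primitive_of w g ->
  (forall x : R, is_derive x 1 psi (dpsi x)) -> continuous dpsi -> psi a = 0 -> w 0 * psi 0 = 0 ->
  \int[mu]_(x in `[0, a]) (w x * dpsi x) = - \int[mu]_(x in `[0, a]) (g x * psi x).
Proof.
move=> a0 gl wg Hpsi cdpsi psia0 wpsi0.
have cpsi : continuous psi by move=> x; exact: is_derive_continuous (Hpsi x).
have cw := primitive_cont gl wg.
have sw : sqint `[0, a] w by apply: L2loc_sqint; exact: L2loc_cont.
have sg : sqint `[0, a] g := L2loc_sqint _ _ gl.
have sp : sqint `[0, a] psi by apply: L2loc_sqint; exact: L2loc_cont.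
have sdp : sqint `[0, a] dpsi by apply: L2loc_sqint; exact: L2loc_cont.
have mD := measurable_itv (`[0, a] : interval R).
set I := \int[mu]_(x in _) _; set J := \int[mu]_(x in _) _.
suff : I + J = 0 by lra.
pose P := \int[mu]_(x in `[0, a]) (psi x ^+ 2).
pose Q := \int[mu]_(x in `[0, a]) (dpsi x ^+ 2).
have P0 : 0 <= P by exact: Rintegral_sqr_ge0.
have Q0 : 0 <= Q by exact: Rintegral_sqr_ge0.
apply: (@sqr_small_eq0 _ (2 * (a ^+ 2 * Q) + 2 * P)) => [|e e0].
  by apply: addr_ge0; apply: mulr_ge0 => //; apply: mulr_ge0 => //; exact: sqr_ge0.
have [k ck gk] := L2_dense sg e0.
have kl := L2loc_cont ck.
pose v x := w 0 + prim k x.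
have Dv (x : R) : is_derive x 1 v (k x).
  rewrite -[k x]add0r; apply: is_deriveD; exact: prim_is_derive.
have cv : continuous v by move=> x; exact: is_derive_continuous (Dv x).
have sv : sqint `[0, a] v by apply: L2loc_sqint; exact: L2loc_cont.
have sk : sqint `[0, a] k := L2loc_sqint _ _ kl.
have E : \int[mu]_(x in `[0, a]) (v x * dpsi x) + \int[mu]_(x in `[0, a]) (k x * psi x) = 0.
  have v0 : v 0 = w 0 by rewrite /v prim0 addr0.
  by rewrite (Rint_by_parts (ltW a0) Dv Hpsi ck cdpsi) v0 wpsi0 psia0; ring.
have h1 : (\int[mu]_(x in `[0, a]) ((w x - v x) * dpsi x)) ^+ 2 <= a ^+ 2 * e * Q.
  apply: le_trans (cauchy_schwarz mD (sqintB mD sw sv) sdp) _.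
  rewrite ler_wpM2r//.
  have -> : a ^+ 2 * e = (a * e) * (a - 0) by ring.
  apply: Rint_sqr_bound; [exact: ltW|exact: sqint_intg_sqr (sqintB mD sw sv)|].
  move=> x /andP[x0 xa].
  have -> : w x - v x = \int[mu]_(z in `[0, x]) (g z - k z).
    rewrite RintB//; [|exact: L2loc_intg..].
    by rewrite -wg// /v -(primB (L2loc_locintg kl) x0) prim0; ring.
  apply: le_trans (Rint_sqr_le_itv x0 (L2loc_sqint _ _ (L2locB gl kl))) _.
  rewrite subr0 ler_pM//; first exact: Rintegral_sqr_ge0.
  apply: le_trans gk; apply: Rint_sub_le => //.
  - by move=> y /=; rewrite !in_itv/= => /andP[-> /le_trans->].
  - exact: (L2locB gl kl).2.
  - by move=> y _; exact: sqr_ge0.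
have h2 : (\int[mu]_(x in `[0, a]) ((g x - k x) * psi x)) ^+ 2 <= e * P.
  apply: le_trans (cauchy_schwarz mD (sqintB mD sg sk) sp) _.
  by rewrite ler_wpM2r.
have -> : I + J = \int[mu]_(x in `[0, a]) ((w x - v x) * dpsi x) +
    \int[mu]_(x in `[0, a]) ((g x - k x) * psi x).
  under eq_Rintegral do rewrite mulrBl.
  under [X in _ = _ + X]eq_Rintegral do rewrite mulrBl.
  rewrite !RintB//; [|exact: sqint_mul..].
  by rewrite -/I -/J; move: E; lra.
by move: h1 h2; set x := \int[mu]_(x in _) _; set y := \int[mu]_(x in _) _ => h1 h2; have := sqr_ge0 (x - y); nra.
Qed.

Lemma weak_of_primitive a w g : 0 < a -> L2loc g -> primitive_of w g -> weak_derivative a w g.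
Proof.
move=> a0 gl wg psi [Dpsi cdpsi [K [cK Ka psi0]]].
have Hpsi x : is_derive x (1 : R) psi (derive1 psi x) by split; [exact: Dpsi|rewrite derive1E].
have cpsi : continuous psi by move=> x; exact: is_derive_continuous (Hpsi x).
have psi00 : psi 0 = 0 by apply: psi0 => /Ka /=; rewrite in_itv/= ltxx.
have psia0 : psi a = 0 by apply: psi0 => /Ka /=; rewrite in_itv/= ltxx andbF.
have mD := measurable_itv (`[0, a] : interval R).
have sl (k : R -> R) : L2loc k -> sqint `[0, a] k by exact: L2loc_sqint.
have sw := sl _ (L2loc_cont (primitive_cont gl wg)).
have sp := sl _ (L2loc_cont cpsi); have sdp := sl _ (L2loc_cont cdpsi).
rewrite (Rint_oo_cc (sqint_mul mD sw sdp)) (Rint_oo_cc (sqint_mul mD (sl _ gl) sp)).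
by apply: Rint_by_parts_primitive => //; rewrite psi00 mulr0.
Qed.

Lemma bump_average w p e d : 0 < e -> intg `[p - e, p + e] w ->
  (forall x, `|x - p| <= e -> `|w x - w p| <= d) ->
  `|\int[mu]_(x in `[p - e, p + e]) (w x * bump e (x - p)) - w p * mass e| <= d * mass e.
Proof.
move=> e0 wi wd; have mD := measurable_itv (`[p - e, p + e] : interval R).
have cb : continuous (fun x : R => bump e (x - p)).
  move=> x; apply: (@continuous_comp _ _ _ (fun x : R => x - p) (bump e)); last exact: bump_continuous.
  by apply: cvgB; [exact: cvg_id|exact: cvg_cst].
have [B B0 hB] := @cont_bounded (p - e) (p + e) _ cb.
have bi := cont_intg (p - e) (p + e) cb.
have wbi : intg `[p - e, p + e] (fun x => w x * bump e (x - p)).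
  apply: (intgM_bounded (M := B)) => //; first by apply: measurable_funTS; exact: continuous_measurable_fun.
have wpi := intgZ (w p) mD bi.
rewrite -(mass_shift p e0) -RintZ// -RintB// -RintZ//.
apply: le_trans (Rint_norm mD (intgB mD wbi wpi)) _.
apply: Rint_le => //; [by apply: intg_norm => //; exact: intgB|exact: intgZ|].
move=> x /=; rewrite in_itv/= => /andP[xp px].
rewrite -mulrBl normrM (ger0_norm (bump_ge0 _ _)) ler_wpM2r ?bump_ge0//.
by apply: wd; rewrite ler_norml; apply/andP; split; lra.
Qed.

Lemma cont_oo_eq w a b : {within `[a, b], continuous w} -> forall x e, a < x < b -> 0 < e ->
  exists2 d : R, 0 < d & forall y, `|y - x| <= d -> `|w y - w x| <= e.
Proof.
move=> /subspace_continuousP cw x e /andP[ax xb] e0.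
have xab : `[a, b]%classic x by rewrite /= in_itv/= !ltW.
have /cvgrPdist_lt/(_ _ e0)/near_withinP[d d0 hd] := cw _ xab.
pose m := Num.min (d / 2) (Num.min ((x - a) / 2) ((b - x) / 2)).
exists m; first by rewrite !lt_min !divr_gt0// subr_gt0.
move=> y; rewrite /m !le_min => /and3P[h1 h2 h3]; rewrite distrC; apply: ltW; apply: hd.
  by rewrite distrC; lra.
by move: h2 h3; rewrite /= in_itv/= !ler_norml => /andP[? ?] /andP[? ?]; apply/andP; split; lra.
Qed.

Definition dhat p q e x : R := bump e (x - p) - bump e (x - q).

(** As both bumps have the same mass, this primitive of their difference vanishes again after
    [q + e]: a compactly supported function whose derivative compares the values near [p] with those
    near [q]. *)
Definition hat p q e x : R := prim (dhat p q e) x - prim (dhat p q e) (p - e).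

Lemma bump_shift_continuous e p : continuous (fun x => bump e (x - p)).
Proof.
move=> x; apply: (@continuous_comp _ _ _ (fun x : R => x - p) (bump e)); last exact: bump_continuous.
by apply: cvgB; [exact: cvg_id|exact: cvg_cst].
Qed.

Lemma dhat_continuous p q e : continuous (dhat p q e).
Proof. by move=> x; apply: cvgB; exact: bump_shift_continuous. Qed.

Lemma hat_derive p q e (x : R) : is_derive x 1 (hat p q e) (dhat p q e x).
Proof.
by rewrite -[dhat p q e x]subr0; apply: is_deriveB; apply: prim_is_derive; exact: dhat_continuous.
Qed.

Lemma dhat_out p q e x : 0 < e -> p <= q -> x <= p - e \/ q + e <= x -> dhat p q e x = 0.
Proof.
by move=> e0 pq h; rewrite /dhat !bump_out ?subrr//; rewrite ler_normr; apply/orP; case: h => h; lra.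
Qed.

Lemma Rint_bump w p e c d : 0 < e -> c <= p - e -> p + e <= d -> intg `[c, d] w ->
  intg `[c, d] (fun x => w x * bump e (x - p)) /\
  \int[mu]_(x in `[c, d]) (w x * bump e (x - p)) = \int[mu]_(x in `[p - e, p + e]) (w x * bump e (x - p)).
Proof.
move=> e0 cp pd wi; have cb := @bump_shift_continuous e p.
have [B B0 hB] := @cont_bounded c d _ cb.
have wbi : intg `[c, d] (fun x => w x * bump e (x - p)).
  by apply: (intgM_bounded (M := B)) => //; apply: measurable_funTS; exact: continuous_measurable_fun.
split=> //; apply: (Rint_support cp _ pd wbi) => [|y hy]; first lra.
by rewrite bump_out ?mulr0// ler_normr; apply/orP; lra.
Qed.

Lemma hat_out p q e x : 0 < e -> p <= q -> x <= p - e \/ q + e <= x -> hat p q e x = 0.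
Proof.
move=> e0 pq; have cb := @dhat_continuous p q e; have bl := L2loc_locintg (L2loc_cont cb).
move=> [xp|qx].
  rewrite /hat -opprB primB//.
  rewrite (Rint_eq (g := fun=> 0)) ?Rint_cst ?mul0r ?oppr0//.
  by move=> y /=; rewrite in_itv/= => /andP[xy yp]; apply: dhat_out => //; left.
rewrite /hat primB//; last by lra.
have i1 := intg_cst 1 (measurable_itv (`[p - e, x] : interval R)) (mu_itv_cc_fin (p - e) x).
have [ip Ep] := @Rint_bump _ p e (p - e) x e0 (lexx _) ltac:(lra) i1.
have [iq Eq] := @Rint_bump _ q e (p - e) x e0 ltac:(lra) qx i1.
rewrite (Rint_eq (g := fun y => 1 * bump e (y - p) - 1 * bump e (y - q))); last first.
  by move=> y _; rewrite !mul1r.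
rewrite RintB// Ep Eq.
have E r : \int[mu]_(x0 in `[r - e, r + e]) (1 * bump e (x0 - r)) = mass e.
  by rewrite -(mass_shift r e0); apply: Rint_eq => y _; rewrite mul1r.
by rewrite !E subrr.
Qed.

(** The du Bois-Reymond argument: divided by [mass e], the pairing is the difference of the local
    means of [w] at [p] and at [q]. Arbitrarily small [e] are enough, and continuity is asked at the
    two points only. It is used for weak derivatives, for momentum in time, and for transport. *)
Lemma dhat_pairing w p q c d : intg `[c, d] w ->
  (forall e, 0 < e -> exists2 r : R, 0 < r & forall y, `|y - p| <= r -> `|w y - w p| <= e) ->
  (forall e, 0 < e -> exists2 r : R, 0 < r & forall y, `|y - q| <= r -> `|w y - w q| <= e) ->
  c < p -> p <= q -> q < d ->
  (forall k, 0 < k -> exists2 e : R, 0 < e < k & \int[mu]_(x in `[c, d]) (w x * dhat p q e x) = 0) ->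
  w p = w q.
Proof.
move=> wi cwp cwq cp pq qd H; apply/eqP; rewrite -subr_eq0.
rewrite -normr_eq0 eq_le normr_ge0 andbT; apply/ler_addgt0Pr => k k0; rewrite add0r.
have k2 : 0 < k / 2 by rewrite divr_gt0.
have [d1 d10 hd1] := cwp _ k2; have [d2 d20 hd2] := cwq _ k2.
pose m := Num.min (Num.min d1 d2) (Num.min (p - c) (d - q)).
have m0 : 0 < m by rewrite !lt_min d10 d20 !subr_gt0 cp.
have [e /andP[e0]] := H _ m0.
rewrite /m !lt_min => /andP[/andP[e1 e2] /andP[e3 e4]].
have [ip Ep] := @Rint_bump w p e c d e0 ltac:(lra) ltac:(lra) wi.
have [iq Eq] := @Rint_bump w q e c d e0 ltac:(lra) ltac:(lra) wi.
rewrite /dhat; under eq_Rintegral do rewrite mulrBr.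
rewrite RintB// {}Ep {}Eq => E.
have wp x : `|x - p| <= e -> `|w x - w p| <= k / 2.
  by move=> h; apply: hd1; apply: le_trans h (ltW e1).
have wq x : `|x - q| <= e -> `|w x - w q| <= k / 2.
  by move=> h; apply: hd2; apply: le_trans h (ltW e2).
have me := mass_gt0 e0.
have jp : intg `[p - e, p + e] w by apply: (intg_itv_mono _ _ wi); lra.
have jq : intg `[q - e, q + e] w by apply: (intg_itv_mono _ _ wi); lra.
have := bump_average e0 jp wp.
have := bump_average e0 jq wq.
move: E; move: (\int[mu]_(x in _) _) => A; move: (\int[mu]_(x in _) _) => B.
clear -me; rewrite !ler_norml => E /andP[? ?] /andP[? ?].
by apply/andP; split; rewrite -(ler_pM2r me); lra.
Qed.

Lemma weak_zero_const a w : 0 < a -> {within `[0, a], continuous w} ->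
  (forall psi, test1 `]0, a[ psi -> \int[mu]_(x in `]0, a[) (w x * derive1 psi x) = 0) ->
  forall p q, 0 < p -> p < q -> q < a -> w p = w q.
Proof.
move=> a0 cw H p q p0 pq qa; have wi := intg_cont cw.
apply: (dhat_pairing wi _ _ p0 (ltW pq) qa) => [k|k|k k0].
- by apply: (cont_oo_eq cw); rewrite p0 (lt_trans pq qa).
- by apply: (cont_oo_eq cw); rewrite (lt_trans p0 pq).
pose e := Num.min (k / 2) (Num.min (p / 2) ((a - q) / 2)).
have e0 : 0 < e by rewrite !lt_min !divr_gt0// subr_gt0.
have [ek [ep eq]] : e <= k / 2 /\ (e <= p / 2 /\ e <= (a - q) / 2).
  by have : e <= e := lexx _; rewrite {2}/e !le_min => /andP[? /andP[? ?]].
exists e; first by rewrite e0; lra.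
have dpsi : derive1 (hat p q e) = dhat p q e.
  by apply/funext => x; exact: is_derive_derive1 (hat_derive p q e x).
have := H (hat p q e); rewrite dpsi Rint_oo_cc; first apply.
- split; first by move=> x; exact: is_derive_derivable (hat_derive p q e x).
    by rewrite dpsi; exact: dhat_continuous.
  exists `[p - e, q + e]%classic; split; first exact: segment_compact.
    by move=> x /=; rewrite !in_itv/= => /andP[? ?]; apply/andP; split; lra.
  move=> x /= /negP; rewrite in_itv/= negb_and -!ltNge => /orP[xp|qx].
    by apply: hat_out => //; [exact: ltW|left; exact: ltW].
  by apply: hat_out => //; [exact: ltW|right; exact: ltW].
- have [B B0 hB] := @cont_bounded 0 a _ (@dhat_continuous p q e).
  by apply: (intgM_bounded (M := B)) => //; apply: measurable_funTS; apply: continuous_measurable_fun; exact: dhat_continuous.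
Qed.

Lemma within_cvg_eps w a b x e : {within `[a, b], continuous w} -> a <= x <= b -> 0 < e ->
  exists2 d : R, 0 < d & forall y, a <= y <= b -> `|x - y| < d -> `|w x - w y| < e.
Proof.
move=> /subspace_continuousP cw xab e0.
have xab' : `[a, b]%classic x by rewrite /= in_itv.
have /cvgrPdist_lt/(_ _ e0)/near_withinP[d d0 hd] := cw _ xab'.
by exists d => // y yab xy; apply: hd => //=; rewrite in_itv.
Qed.

Lemma const_oo_cc w a (c : R) : 0 < a -> {within `[0, a], continuous w} ->
  (forall x, 0 < x < a -> w x = c) -> forall x, 0 <= x <= a -> w x = c.
Proof.
move=> a0 cw wc x xa; apply/eqP; rewrite -subr_eq0 -normr_eq0 eq_le normr_ge0 andbT.
apply/ler_addgt0Pr => e e0; rewrite add0r.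
have [d d0 hd] := within_cvg_eps cw xa e0.
pose m := Num.min (d / 2) (a / 2).
have m0 : 0 < m by rewrite lt_min !divr_gt0.
have [md ma] : m <= d / 2 /\ m <= a / 2.
  by have : m <= m := lexx _; rewrite {2}/m le_min => /andP[].
have [xl|xl] := leP x (a / 2).
  rewrite -(wc (x + m / 2)); last by apply/andP; split; lra.
  apply: ltW; apply: hd; first by apply/andP; split; lra.
  by rewrite opprD addrA subrr add0r normrN gtr0_norm; lra.
rewrite -(wc (x - m / 2)); last by apply/andP; split; lra.
apply: ltW; apply: hd; first by apply/andP; split; lra.
by rewrite opprB addrA addrAC subrr add0r gtr0_norm; lra.
Qed.

(** The difference of [w] and the primitive of its weak derivative has weak derivative zero, hence
    is constant inside the interval, and up to the ends by continuity. *)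
Lemma H1_primitive a w g : 0 < a -> H1 a w g -> forall x, 0 <= x <= a ->
  w x = w 0 + prim (g \_ `]0, a[) x.
Proof.
move=> a0 [cw /L2P[]// mw wi /L2P[]// mg gi wd].
have mI := measurable_itv (`]0, a[ : interval R).
have gl : L2loc (g \_ `]0, a[) by exact: L2loc_patch.
set g0 := g \_ _ in gl *.
pose v := prim g0.
have pv : primitive_of v g0 by move=> x y xy; rewrite /v primB//; exact: L2loc_locintg.
have cv := primitive_cont gl pv.
have cz : {within `[0, a], continuous (fun x => w x - v x)}.
  by move=> x; apply: cvgB; [exact: cw|exact: continuous_subspaceT].
have fin : (mu `]0%R, a[ < +oo)%E by apply: (mu_itv_fin (a := 0) (b := a)) => x /=; rewrite !in_itv/= => /andP[/ltW-> /ltW->].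
have key : forall psi, test1 `]0, a[ psi -> \int[mu]_(x in `]0, a[) ((w x - v x) * derive1 psi x) = 0.
  move=> psi tpsi; have [Dpsi cdpsi _] := tpsi.
  have wv := weak_of_primitive a0 gl pv tpsi.
  have sdp : sqint `]0, a[ (derive1 psi).
    by apply: (@sqintS _ _ `[0, a]) => //; [exact: subset_itv_oo_cc|apply: L2loc_sqint; exact: L2loc_cont].
  have sv : sqint `]0, a[ v.
    by apply: (@sqintS _ _ `[0, a]) => //; [exact: subset_itv_oo_cc|apply: L2loc_sqint; exact: L2loc_cont].
  under eq_Rintegral do rewrite mulrBl.
  rewrite RintB//; [|exact: sqint_mul..].
  rewrite wv wd// (@Rint_eq _ _ (fun x => g0 x * psi x) (fun x => g x * psi x)) ?subrr// => x x0.
  by rewrite /g0 patchE mem_set.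
have c0 := weak_zero_const a0 cz key.
have h x : 0 < x < a -> w x - v x = w (a / 2) - v (a / 2).
  move=> /andP[x0 xa]; have [xl|xl|->//] := ltgtP x (a / 2); first by apply: c0 => //; lra.
  by apply/esym/c0 => //; lra.
have H := const_oo_cc a0 cz h.
move=> x xa; have := H _ xa; have := H 0; rewrite lexx ltW// => /(_ isT) <-.
by rewrite {2}/v prim0 /v; lra.
Qed.

End weak_derivatives.

(** * D'Alembert's formula *)

Section existence.
Context {R : realType}.
Local Notation mu := (@lebesgue_measure R).
Implicit Types (f g F : R -> R) (a b c k e h : R).

Lemma primitive_shift F f c : locintg f -> primitive_of F f ->
  primitive_of (fun x => F (x + c)) (fun x => f (x + c)).
Proof.
by move=> fi Ff x y xy; rewrite Ff ?lerD2r// -Rint_shift.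
Qed.

Lemma primitive_reflect F f : locintg f -> primitive_of F f ->
  primitive_of (fun x => - F (- x)) (fun x => f (- x)).
Proof.
move=> fi Ff x y xy; rewrite -Rint_reflect// -Ff ?lerN2//; ring.
Qed.

Lemma primitiveD F f G g : locintg f -> locintg g -> primitive_of F f -> primitive_of G g ->
  primitive_of (fun x => F x + G x) (fun x => f x + g x).
Proof. by move=> fi gi Ff Gg x y xy; rewrite RintD// -Ff// -Gg//; ring. Qed.

Lemma eq_primitive F F' f f' : F =1 F' -> f =1 f' -> primitive_of F f -> primitive_of F' f'.
Proof. by move=> /funext-> /funext->. Qed.

(** A nearby continuous function is bounded, so its energy on a short interval is at most [B ^+ 2]
    times the length. It controls the strip gained or lost by the moving domain. *)
Lemma L2loc_abs_cont g a b e : L2loc g -> 0 < e -> exists2 d : R, 0 < d &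
  forall c c', a <= c -> c <= c' -> c' <= b -> c' - c < d ->
    \int[mu]_(x in `[c, c']) (g x ^+ 2) <= e.
Proof.
move=> gl e0; have e4 : 0 < e / 4 by rewrite divr_gt0.
have [k ck gk] := L2_dense (L2loc_sqint a b gl) e4.
have kl := L2loc_cont ck.
have [B B0 kB] := @cont_bounded R a b k ck.
exists (e / (4 * (B ^+ 2 + 1))).
  by rewrite divr_gt0// mulr_gt0// ltr_wpDl ?sqr_ge0.
move=> c c' ac cc' c'b cd.
have gkl := L2locB gl kl.
apply: (@le_trans _ _ (\int[mu]_(x in `[c, c']) (2 * (g x - k x) ^+ 2 + 2 * k x ^+ 2))).
  apply: Rint_le => //; first exact: gl.2.
    by apply: intgD => //; apply: intgZ => //; [exact: gkl.2|exact: kl.2].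
  by move=> x _; have := sqr_ge0 (g x - 2 * k x); nra.
rewrite RintD//; [|by apply: intgZ => //; exact: gkl.2|by apply: intgZ => //; exact: kl.2].
rewrite !RintZ//; [|exact: kl.2|exact: gkl.2].
have h1 : \int[mu]_(x in `[c, c']) (g x - k x) ^+ 2 <= e / 4.
  apply: le_trans gk; apply: Rint_sub_le => //.
  - by move=> x /=; rewrite !in_itv/= => /andP[? ?]; apply/andP; split; lra.
  - exact: gkl.2.
  - by move=> x _; exact: sqr_ge0.
have h2 : \int[mu]_(x in `[c, c']) k x ^+ 2 <= B ^+ 2 * (c' - c).
  apply: Rint_sqr_bound => //; first exact: kl.2.
  move=> x /andP[cx xc]; rewrite -real_normK ?num_real// lerXn2r ?nnegrE//.
  by apply: kB; apply/andP; split; lra.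
have h3 : B ^+ 2 * (c' - c) <= e / 4.
  move: cd; rewrite ltr_pdivlMr; last by rewrite mulr_gt0// ltr_wpDl ?sqr_ge0.
  have := sqr_ge0 B; set B2 := B ^+ 2; nra.
by lra.
Qed.

(** Where both windows overlap, the difference is that of two translates of [g]; elsewhere it lives
    on the strip between [l t] and [l s], which is short. *)
Lemma moving_window_cvg g k (l : R -> R) T t : L2loc g -> `|k| <= 1 -> continuous l ->
  (forall t, 0 <= t <= T -> 0 < l t) -> 0 <= t <= T ->
  L2norm setT ((((fun x => g (x + k * s)) \_ `]0, l s[) \- ((fun x => g (x + k * t)) \_ `]0, l t[)))
    @[s --> within `[0, T] (nbhs t)] --> 0%E.
Proof.
move=> gl k1 cl l0 tT.
apply/(@L2norm_cvg0P _ _ _ _ (fun=> setT)) => e e0.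
pose gt x := g (x + k * t); have gtl : L2loc gt := L2loc_shift (k * t) gl.
have e4 : 0 < e / 4 by rewrite divr_gt0.
pose M := l t + 1.
have lt0 : 0 < l t := l0 _ tT.
have [d1 d10 hd1] := L2_translate 0 M gtl e4.
have [d2 d20 hd2] := @L2loc_abs_cont gt 0 M (e / 4) gtl e4.
have d30 : 0 < Num.min d2 1 by rewrite lt_min d20 ltr01.
have /cvgR_epsP/(_ _ d30)[d4 d40 hd4] := cl t.
apply/near_withinP; exists (Num.min d1 d4); first by rewrite lt_min d10.
move=> s; rewrite lt_min => /andP[sd1 sd4] /=; rewrite in_itv/= => sT.
have := hd4 _ sd4; rewrite lt_min => /andP[ls1 ls2].
have ls0 := l0 _ sT.
pose m := Num.min (l t) (l s); pose m' := Num.max (l t) (l s).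
have mm' : [/\ 0 < m, m <= m', m' <= M & m' - m < d2].
  rewrite /m /m' /M; move: ls1 ls2; rewrite !ltr_norml => /andP[? ?] /andP[? ?].
  by case: (leP (l t) (l s)) => ?; split; lra.
have [m0 mm m'M mmd] := mm'.
pose h := k * s - k * t.
have hd : `|h| < d1.
  rewrite /h -mulrBr normrM distrC; apply: le_lt_trans sd1.
  by rewrite ler_piMl.
pose A x := (gt (x + h) - gt x) ^+ 2; pose B x := gt x ^+ 2.
have iA : intg `[0, M] A := (L2locB (L2loc_shift h gtl) gtl).2 0 M.
have iB : intg `[m, m'] B := gtl.2 m m'.
(* On the strip a single value remains: either [gt x], or the translated value, whose square is at
   most twice [A] plus twice [B]. *)
apply: (@le_trans _ _ (\int[mu]_x ((2 * (A \_ `[0%R, M]) x + 2 * (B \_ `[m, m']) x)%:E))%E).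
  apply: ge0_le_lower_integral => x _; first by rewrite lee_fin sqr_ge0.
  have gE : g (x + k * s) = gt (x + h) by rewrite /gt /h; congr g; ring.
  rewrite lee_fin /= !patchE !mem_setE !in_itv/= /A /B gE -/(gt x).
  move: (gt (x + h)) (gt x) => X Y.
  have lsm : l s <= m' by rewrite /m' le_max lexx orbT.
  have ltm : l t <= m' by rewrite /m' le_max lexx.
  have mls : m <= l s by rewrite /m ge_min lexx orbT.
  have mlt : m <= l t by rewrite /m ge_min lexx.
  have f1 : 0 < x < l s -> 0 <= x <= M.
    by move=> /andP[/ltW-> /ltW xs]; rewrite (le_trans xs)// (le_trans lsm).
  have f2 : 0 < x < l t -> 0 <= x <= M.
    by move=> /andP[/ltW-> /ltW xs]; rewrite (le_trans xs)// (le_trans ltm).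
  have f3 : 0 < x < l s -> ~~ (0 < x < l t) -> m <= x <= m'.
    move=> /andP[x0 /ltW xs]; rewrite x0 -leNgt => tx.
    by rewrite (le_trans mlt tx) (le_trans xs lsm).
  have f4 : 0 < x < l t -> ~~ (0 < x < l s) -> m <= x <= m'.
    move=> /andP[x0 /ltW xs]; rewrite x0 -leNgt => tx.
    by rewrite (le_trans mls tx) (le_trans xs ltm).
  have -> : (point : R) = 0 by [].
  have h1 := sqr_ge0 (X - 2 * Y); have h2 := sqr_ge0 X; have h3 := sqr_ge0 Y.
  have h4 := sqr_ge0 (X - Y).
  move: f1 f2 f3 f4 => {lsm ltm mls mlt}.
  case: (0 < x < l s); case: (0 < x < l t) => f1 f2 f3 f4.
  - by rewrite (f1 isT); case: ifP => _; clear -h4 h3; lra.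
  - by rewrite (f1 isT) (f3 isT isT); clear -h1 h2; lra.
  - by rewrite (f2 isT) (f4 isT isT); clear -h3 h4; lra.
  - by rewrite subrr expr0n/=; case: ifP => _; case: ifP => _; clear -h3 h4; lra.
have i1 : intg setT (fun x => 2 * (A \_ `[0, M]) x + 2 * (B \_ `[m, m']) x).
  by apply: intgD => //; apply: intgZ => //; apply: intg_restrict.
rewrite -Rint_EFin// lee_fin RintD//; [|by apply: intgZ => //; apply: intg_restrict..].
rewrite !RintZ//; [|by apply: intg_restrict..].
rewrite -!Rint_restrict.
have := hd1 _ hd; have := hd2 m m' (ltW m0) mm m'M mmd.
by rewrite -/A -/B; lra.
Qed.

End existence.

Section existence2.
Context {R : realType}.
Local Notation mu := (@lebesgue_measure R).
Implicit Types (f g F : R -> R) (a b c k e h : R).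

Lemma integral_sqrD_le (D : set R) (A B : R -> R) a b : measurable D ->
  measurable_fun D A -> measurable_fun D B ->
  (\int[mu]_(x in D) ((A x) ^+ 2)%:E <= a%:E)%E ->
  (\int[mu]_(x in D) ((B x) ^+ 2)%:E <= b%:E)%E ->
  (\int[mu]_(x in D) ((A x + B x) ^+ 2)%:E <= (2 * a + 2 * b)%:E)%E.
Proof.
move=> mD mA mB hA hB.
apply: (@le_trans _ _ (\int[mu]_(x in D) (2%:E * (A x ^+ 2)%:E + 2%:E * (B x ^+ 2)%:E))%E).
  apply: ge0_le_lower_integral => x Dx; first by rewrite lee_fin sqr_ge0.
  rewrite -!EFinM -EFinD lee_fin; have := sqr_ge0 (A x - B x).
  by move: (A x) (B x) => X Y; clear; lra.
have mA2 : measurable_fun D (fun x => (A x ^+ 2)%:E) by apply/measurable_EFinP; exact: measurable_funX.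
have mB2 : measurable_fun D (fun x => (B x ^+ 2)%:E) by apply/measurable_EFinP; exact: measurable_funX.
rewrite ge0_integralD//; last 4 first.
- by move=> x _; rewrite -EFinM lee_fin mulr_ge0// sqr_ge0.
- exact: measurable_funeM.
- by move=> x _; rewrite -EFinM lee_fin mulr_ge0// sqr_ge0.
- exact: measurable_funeM.
rewrite !ge0_integralZl//; last 2 first.
- by move=> x _; rewrite lee_fin sqr_ge0.
- by move=> x _; rewrite lee_fin sqr_ge0.
by rewrite (EFinD (2 * a)) (EFinM 2 a) (EFinM 2 b) leeD// lee_pmul2l.
Qed.

Lemma C0_L2D (l : R -> R) T (w1 w2 : R -> R -> R) :
  C0_L2 l T w1 -> C0_L2 l T w2 -> C0_L2 l T (fun x t => w1 x t + w2 x t).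
Proof.
move=> [L1 c1] [L2' c2]; split=> t tT.
  apply/L2P => //; have /L2P-/(_ (measurable_itv _)) h1 := L1 t tT.
  by have /L2P-/(_ (measurable_itv _)) h2 := L2' t tT; exact: sqintD.
apply/(@L2norm_cvg0P _ _ _ _ (fun=> setT)) => e e0.
have e4 : 0 < e / 4 by rewrite divr_gt0.
have /(@L2norm_cvg0P _ _ _ _ (fun=> setT))/(_ _ e4)/near_withinP[d1 d10 h1] := c1 _ tT.
have /(@L2norm_cvg0P _ _ _ _ (fun=> setT))/(_ _ e4)/near_withinP[d2 d20 h2] := c2 _ tT.
apply/near_withinP; exists (Num.min d1 d2); first by rewrite lt_min d10.
move=> s; rewrite lt_min => /andP[sd1 sd2] sT.
have sT' : 0 <= s <= T by move: sT; rewrite /= in_itv.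
have mw (w : R -> R -> R) r : L2 `]0, l r[ (w^~ r) -> measurable_fun setT ((w^~ r) \_ `]0, l r[).
  by move=> /L2P-/(_ (measurable_itv _))[mw _]; apply/(measurable_restrictT _ (measurable_itv (`]0, l r[ : interval R))).
have := integral_sqrD_le measurableT
  (measurable_funB (mw w1 s (L1 _ sT')) (mw w1 t (L1 _ tT)))
  (measurable_funB (mw w2 s (L2' _ sT')) (mw w2 t (L2' _ tT))) (h1 _ sd1 sT) (h2 _ sd2 sT).
rewrite (_ : 2 * (e / 4) + 2 * (e / 4) = e); last by field.
apply: le_trans; rewrite le_eqVlt; apply/orP; left; apply/eqP.
apply: eq_integral => x _; congr ((_ ^+ 2)%:E); rewrite /= !patchE.
by case: ifP => _; case: ifP => _; rewrite /point/=; ring.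
Qed.

Lemma C0_L2_travelling g (l : R -> R) T k : L2loc g -> `|k| <= 1 -> continuous l ->
  (forall t, 0 <= t <= T -> 0 < l t) -> C0_L2 l T (fun x t => g (x + k * t)).
Proof.
move=> gl k1 cl l0; split=> t tT; last exact: moving_window_cvg.
apply/L2P => //; apply: (@sqintS _ _ `[0, l t]) => //; first exact: subset_itv_oo_cc.
by apply: L2loc_sqint; exact: L2loc_shift.
Qed.

Lemma eq_C0_L2 (l : R -> R) T (w1 w2 : R -> R -> R) : (forall x t, w1 x t = w2 x t) ->
  C0_L2 l T w1 -> C0_L2 l T w2.
Proof. by move=> E; have -> : w1 = w2 by apply/funext => x; apply/funext => t. Qed.

Section solution.
Variables (F f l dl : R -> R) (T : R).
Hypotheses (T0 : 0 < T) (fl : L2loc f) (Ff : primitive_of F f).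
Hypothesis Pd : diffeo (fun t => t + l t) (fun t => 1 + dl t).
Hypothesis Qd : diffeo (fun t => t - l t) (fun t => 1 - dl t).
Hypothesis l0 : forall t, 0 <= t <= T -> 0 < l t.

Definition dal x t : R := F (t + x) - F (t - x).
Definition dalx x t : R := f (t + x) + f (t - x).
Definition dalt x t : R := f (t + x) - f (t - x).

Let cF : continuous F := primitive_cont fl Ff.

Lemma front_continuous : continuous l.
Proof.
have -> : l = (fun t => (t + l t) - t) by apply/funext => t; ring.
by move=> t; apply: cvgB; [exact: diffeo_continuous Pd t|exact: cvg_id].
Qed.

Lemma C0_L2_dal (g1 g2 : R -> R) : L2loc g1 -> L2loc g2 ->
  C0_L2 l T (fun x t => g1 (t + x) + g2 (t - x)).
Proof.
move=> g1l g2l; apply: C0_L2D.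
  apply: (@eq_C0_L2 _ _ (fun x t => g1 (x + 1 * t))); first by move=> x t; congr g1; ring.
  apply: C0_L2_travelling => //; [by rewrite normr1|exact: front_continuous].
apply: (@eq_C0_L2 _ _ (fun x t => g2 (- (x + -1 * t)))); first by move=> x t; congr g2; ring.
apply: (C0_L2_travelling (g := fun y => g2 (- y))) => //; [exact: L2loc_reflect|by rewrite normrN1|exact: front_continuous].
Qed.

Lemma dal_primitive t : primitive_of (dal^~ t) (dalx^~ t).
Proof.
have fi := L2loc_locintg fl.
have Fr := primitive_reflect fi Ff.
have fri := L2loc_locintg (L2loc_reflect fl).
apply: (eq_primitive (F := fun x => F (x + t) + - F (- (x - t)))
   (f := fun x => f (x + t) + f (- (x - t)))).
- by move=> x; rewrite /dal addrC opprB (addrC x); ring.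
- by move=> x; rewrite /dalx opprB (addrC x).
- apply: primitiveD; [exact: L2loc_locintg (L2loc_shift _ fl)| |exact: primitive_shift|].
    exact: L2loc_locintg (L2loc_shift (- t) (L2loc_reflect fl)).
  exact: (@primitive_shift _ _ _ (- t) fri Fr).
Qed.

Lemma dalx_L2loc t : L2loc (dalx^~ t).
Proof.
have -> : dalx^~ t = (fun x => f (x + t) + f (- (x - t))).
  by apply/funext => x; rewrite /dalx opprB (addrC x).
by apply: L2locD; [exact: L2loc_shift|exact: (L2loc_shift (- t) (L2loc_reflect fl))].
Qed.

Lemma dal_C0_V0 : C0_V0 l T dal dalx.
Proof.
split.
- move=> t tT; have lt0 := l0 tT.
  have dl_ := dalx_L2loc t; have cd := primitive_cont dl_ (@dal_primitive t).
  split; last by rewrite /dal addr0 subr0 subrr.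
  split; first exact: continuous_subspaceT.
  + apply/L2P => //; apply: (@sqintS _ _ `[0, l t]) => //; first exact: subset_itv_oo_cc.
    by apply: L2loc_sqint; exact: L2loc_cont.
  + apply/L2P => //; apply: (@sqintS _ _ `[0, l t]) => //; first exact: subset_itv_oo_cc.
    exact: L2loc_sqint.
  + exact: (weak_of_primitive lt0 dl_ (@dal_primitive t)).
- have FL := L2loc_cont cF.
  apply: (@eq_C0_L2 _ _ (fun x t => F (t + x) + (-1 * F (t - x)))); first by move=> x t; rewrite /dal; ring.
  exact: (C0_L2_dal FL (L2locZ (-1) FL)).
- exact: C0_L2_dal.
Qed.

Lemma dalt_C0_L2 : C0_L2 l T dalt.
Proof.
apply: (@eq_C0_L2 _ _ (fun x t => f (t + x) + (-1 * f (t - x)))); first by move=> x t; rewrite /dalt; ring.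
exact: (C0_L2_dal fl (L2locZ (-1) fl)).
Qed.

(** The time quotient of each travelling wave is a quotient of the primitive [F], hence close to [f]
    in mean square by [average_quotient_le]. The integral is first enlarged from the common part of
    the two domains to [0, l t], which does not depend on [s]. *)
Lemma dal_C1_L2 : C1_L2 l T dal dalt.
Proof.
have [_ C0 _] := dal_C0_V0; split => //; first exact: dalt_C0_L2.
move=> t tT; apply/(@L2norm_cvg0P _ _ _ _ (fun s => `]0, Num.min (l t) (l s)[%classic)) => e e0.
have e4 : 0 < e / 4 by rewrite divr_gt0.
pose M := l t.
have [d1 d10 hd1] := L2_translate t (t + M) fl e4.
have [d2 d20 hd2] := L2_translate (t - M) t fl e4.
have M0 : 0 < M by exact: l0.
apply/near_dnbhsP; exists (Num.min d1 d2); first by rewrite lt_min d10.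
move=> s; rewrite lt_min => /andP[sd1 sd2] st sT; rewrite distrC in sd1; rewrite distrC in sd2.
pose h := s - t; have h0 : h != 0 by rewrite subr_eq0.
have mM := measurable_itv (`[0, M] : interval R).
have mp : measurable_fun setT (fun x : R => t + x) by apply: measurable_funD.
have mm : measurable_fun setT (fun x : R => t - x) by apply: measurable_funB.
have FE y : F y = F 0 + prim f y := primitive_prim (L2loc_locintg fl) Ff y.
have A1 := @average_quotient_le R f (fun x => t + x) `[0, M] h (e / 4) mM fl mp (ltW e4) h0.
have A2 := @average_quotient_le R f (fun x => t - x) `[0, M] h (e / 4) mM fl mm (ltW e4) h0.
have i1 c : intg `[t, t + M] (fun y => (f (y + c) - f y) ^+ 2) := (L2locB (L2loc_shift c fl) fl).2 _ _.
have i2 c : intg `[t - M, t] (fun y => (f (y + c) - f y) ^+ 2) := (L2locB (L2loc_shift c fl) fl).2 _ _.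
have i3 c : intg `[0, M] (fun x => (f (t + x + c) - f (t + x)) ^+ 2).
  have := @intg_shift R (fun y => (f (y + c) - f y) ^+ 2) 0 M t (ltW M0).
  rewrite add0r (addrC M) => /(_ (i1 c)); apply: eq_intg => // x _.
  by rewrite (addrC x).
have i4 c : intg `[0, M] (fun x => (f (t - x + c) - f (t - x)) ^+ 2).
  have j : intg `[- M, - 0] (fun x => (f (x + t + c) - f (x + t)) ^+ 2).
    have MM : - M <= - 0 by rewrite lerN2 ltW.
    have := @intg_shift R (fun y => (f (y + c) - f y) ^+ 2) (- M) (- 0) t MM.
    by rewrite oppr0 add0r (addrC (- M)) => /(_ (i2 c)).
  have := intg_reflect j; apply: eq_intg => // x _.
  by rewrite (addrC (- x)).
have B1 : (\int[mu]_(x in `[0%R, M]) (((prim f (t + x + h) - prim f (t + x)) / h - f (t + x)) ^+ 2)%:E <= (e / 4)%:E)%E.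
  apply: A1 => c ch; rewrite -Rint_EFin// lee_fin.
  have := hd1 c (le_lt_trans ch sd1); apply: le_trans; rewrite le_eqVlt; apply/orP; left; apply/eqP.
  have := @Rint_shift R (fun y => (f (y + c) - f y) ^+ 2) 0 M t (ltW M0).
  rewrite add0r (addrC M) => /(_ (i1 c)) ->; apply: Rint_eq => x _.
  by rewrite (addrC x).
have B2 : (\int[mu]_(x in `[0%R, M]) (((prim f (t - x + h) - prim f (t - x)) / h - f (t - x)) ^+ 2)%:E <= (e / 4)%:E)%E.
  apply: A2 => c ch; rewrite -Rint_EFin// lee_fin.
  have := hd2 c (le_lt_trans ch sd2); apply: le_trans; rewrite le_eqVlt; apply/orP; left; apply/eqP.
  have MM : - M <= - 0 by rewrite lerN2 ltW.
  have := @Rint_shift R (fun y => (f (y + c) - f y) ^+ 2) (- M) (- 0) t MM.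
  have j : intg `[- M, - 0] (fun x => (f (x + t + c) - f (x + t)) ^+ 2).
    have := @intg_shift R (fun y => (f (y + c) - f y) ^+ 2) (- M) (- 0) t MM.
    by rewrite oppr0 add0r (addrC (- M)) => /(_ (i2 c)).
  rewrite {1 2}oppr0 add0r (addrC (- M)) => /(_ (i2 c)) ->.
  by rewrite (Rint_reflect j); apply: Rint_eq => x _; rewrite (addrC (- x)).
have mprim := measurable_prim fl.
have mq (s' : R -> R) : measurable_fun setT s' ->
    measurable_fun `[0, M] (fun x => (prim f (s' x + h) - prim f (s' x)) / h - f (s' x)).
  move=> ms; apply: measurable_funTS; apply: measurable_funB; last exact: measurableT_comp fl.1 ms.
  apply: measurable_funM => //; apply: measurable_funB; last exact: measurableT_comp mprim ms.
  by apply: (measurableT_comp mprim); exact: measurable_funD.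
have mq2 : measurable_fun `[0, M] (fun x => - ((prim f (t - x + h) - prim f (t - x)) / h - f (t - x))).
  by apply: measurableT_comp => //; exact: mq.
have B2' : (\int[mu]_(x in `[0%R, M]) ((- ((prim f (t - x + h) - prim f (t - x)) / h - f (t - x))) ^+ 2)%:E <= (e / 4)%:E)%E.
  by under eq_integral do rewrite sqrrN.
have := integral_sqrD_le mM (mq _ mp) mq2 B1 B2'.
rewrite (_ : 2 * (e / 4) + 2 * (e / 4) = e); last by field.
apply: le_trans; apply: (@le_trans _ _ (\int[mu]_(x in `[0%R, M]) (((dal x s - dal x t) / (s - t) - dalt x t) ^+ 2)%:E)%E).
  apply: ge0_subset_integral => //.
  - apply/measurable_EFinP; apply: measurable_funX; apply: measurable_funTS.
    apply: measurable_funB; last first.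
      by apply: measurable_funB; [exact: measurableT_comp fl.1 mp|exact: measurableT_comp fl.1 mm].
    have mF := continuous_measurable_fun cF.
    have mps : measurable_fun setT (fun x : R => s + x) by apply: measurable_funD.
    have mms : measurable_fun setT (fun x : R => s - x) by apply: measurable_funB.
    by apply: measurable_funM => //; do ?apply: measurable_funB => //; exact: measurableT_comp.
  - by move=> x _; rewrite lee_fin sqr_ge0.
  - move=> x /=; rewrite !in_itv/= lt_min => /andP[/ltW-> /andP[/ltW-> _]] //.
rewrite le_eqVlt; apply/orP; left; apply/eqP; apply: eq_integral => x _; congr ((_ ^+ 2)%:E).
rewrite /dal /dalt (FE (s + x)) (FE (t + x)) (FE (s - x)) (FE (t - x)) -/h (_ : t + x + h = s + x) 1?(_ : t - x + h = s - x); [|rewrite /h; ring..].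
by field.
Qed.

End solution.
End existence2.

(** * The weak wave equation for travelling waves *)

Section wave_weak.
Context {R : realType}.
Local Notation mu := (@lebesgue_measure R).
Implicit Types (f g F : R -> R) (a b c k e h : R).

Lemma cont2_bounded (G : R * R -> R) a b c d : continuous G -> exists2 B : R, 0 <= B &
  forall x t, a <= x <= b -> c <= t <= d -> `|G (x, t)| <= B.
Proof.
move=> cG; have cK : compact (`[a, b] `*` `[c, d]) by apply: compact_setX; exact: segment_compact.
have : compact (G @` (`[a, b] `*` `[c, d])).
  by apply: continuous_compact => //; exact: continuous_subspaceT.
move=> /compact_bounded[M [_ HM]].
exists (`|M| + 1); first by rewrite addr_ge0.
move=> x t xab tcd; apply: (HM (`|M| + 1)); first by have := ler_norm M; lra.
by exists (x, t) => //=; rewrite !in_itv.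
Qed.

Lemma mean_value f (df : R -> R) x y : (forall z : R, is_derive z 1 f (df z)) ->
  exists2 c : R, `|c - x| <= `|y - x| & f y - f x = df c * (y - x).
Proof.
move=> Df; have cf : continuous f by move=> z; exact: is_derive_continuous (Df z).
have [xy|yx|->] := ltgtP x y; last by exists y => //; rewrite !subrr mulr0.
- have [c cxy ->] := MVT xy (fun z _ => Df z) (continuous_subspaceT cf).
  exists c => //; move: cxy; rewrite in_itv/= => /andP[xc cy].
  by rewrite !ger0_norm; lra.
- have [c cxy e] := MVT yx (fun z _ => Df z) (continuous_subspaceT cf).
  exists c; last by rewrite -opprB e; ring.
  move: cxy; rewrite in_itv/= => /andP[xc cy].
  by rewrite !ler0_norm; lra.
Qed.

Definition C1_pair (p px pt : R -> R -> R) :=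
  [/\ forall x t : R, is_derive x 1 (p^~ t) (px x t),
      forall x t : R, is_derive t 1 (p x) (pt x t),
      continuous (fun z : R * R => px z.1 z.2) &
      continuous (fun z : R * R => pt z.1 z.2)].

(** The increment is split into one in space at time [t + h] and one in time at the fixed place [x];
    the mean value theorem applies to each, and continuity of the partial derivatives closes the
    estimate. *)
Lemma chain2 p px pt (a b t : R) : C1_pair p px pt ->
  is_derive t 1 (fun t => p (a + b * t) t) (b * px (a + b * t) t + pt (a + b * t) t).
Proof.
move=> [Dx Dt cx ct]; apply/is_derive_epsP => e e0; set x := a + b * t.
have b1 : 0 < `|b| + 1 by rewrite ltr_wpDl.
have e2 : 0 < e / (2 * (`|b| + 1)) by rewrite divr_gt0// mulr_gt0.
have /cvgprod_epsP/(_ _ e2)[d1 d10 h1] := cx (x, t).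
have /cvgprod_epsP/(_ _ e2)[d2 d20 h2] := ct (x, t).
pose d := Num.min d1 d2; have d0 : 0 < d by rewrite lt_min d10.
exists (d / (`|b| + 1)); first by rewrite divr_gt0.
move=> h h0; rewrite ltr_pdivlMr// => hd.
have hb : `|b * h| < d by rewrite normrM; have := normr_ge0 h; nra.
have hh : `|h| < d by have := normr_ge0 h; have := normr_ge0 b; nra.
have [c1 hc1 E1] := @mean_value _ (fun z => px z (t + h)) x (x + b * h) (fun z => Dx z (t + h)).
have [c2 hc2 E2] := @mean_value _ (fun z => pt x z) t (t + h) (fun z => Dt x z).
move: hd hb hh; rewrite /d !lt_min => hd /andP[hb1 hb2] /andP[hh1 hh2].
have k1 : `|px x t - px c1 (t + h)| < e / (2 * (`|b| + 1)).
  apply: h1 => /=; last by rewrite opprD addrA subrr add0r normrN.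
  by rewrite distrC (le_lt_trans hc1)// addrAC subrr add0r.
have k2 : `|pt x t - pt x c2| < e / (2 * (`|b| + 1)).
  apply: h2 => /=; first by rewrite subrr normr0.
  by rewrite distrC (le_lt_trans hc2)// addrAC subrr add0r.
have -> : (p (a + b * (t + h)) (t + h) - p x t) / h - (b * px x t + pt x t) =
    - b * (px x t - px c1 (t + h)) - (pt x t - pt x c2).
  have -> : p (a + b * (t + h)) (t + h) - p x t =
      (p (x + b * h) (t + h) - p x (t + h)) + (p x (t + h) - p x t).
    by rewrite (_ : a + b * (t + h) = x + b * h) /x; ring.
  by rewrite E1 E2; field.
apply: le_lt_trans (ler_normB _ _) _; rewrite normrM normrN.
have : `|b| * `|px x t - px c1 (t + h)| <= `|b| * (e / (2 * (`|b| + 1))).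
  by rewrite ler_wpM2l// ltW.
have E : e / (2 * (`|b| + 1)) * (`|b| + 1) = e / 2 by field; rewrite gt_eqF.
by move: E k2; set w := e / (2 * (`|b| + 1)) => E k2 k3; have := normr_ge0 b; nra.
Qed.

(** On the compact rectangle [-B, B] x [t-1, t+1] the derivative [dp] is bounded, so a multiple of
    [|f|] dominates. *)
Lemma param_integral f (p dp : R -> R -> R) B : locintg f ->
  continuous (fun z : R * R => p z.1 z.2) -> continuous (fun z : R * R => dp z.1 z.2) ->
  (forall y t : R, is_derive t 1 (p y) (dp y t)) ->
  (forall t : R, is_derive t 1 (fun t => \int[mu]_(y in `[- B, B]) (f y * p y t))
     (\int[mu]_(y in `[- B, B]) (f y * dp y t))) /\
  continuous (fun t => \int[mu]_(y in `[- B, B]) (f y * dp y t)).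
Proof.
move=> fi cp cdp Dp; have mD := measurable_itv (`[- B, B] : interval R).
have sec (q : R -> R -> R) t : continuous (fun z : R * R => q z.1 z.2) -> continuous (q^~ t).
  move=> cq y; apply/cvgR_epsP => e e0; have /cvgprod_epsP/(_ _ e0)[d d0 h] := cq (y, t).
  by exists d => // z yz; apply: h => //=; rewrite subrr normr0.
have sec2 (q : R -> R -> R) y : continuous (fun z : R * R => q z.1 z.2) -> continuous (q y).
  move=> cq t; apply/cvgR_epsP => e e0; have /cvgprod_epsP/(_ _ e0)[d d0 h] := cq (y, t).
  by exists d => // z yz; apply: h => //=; rewrite subrr normr0.
have iq (q : R -> R -> R) t : continuous (fun z : R * R => q z.1 z.2) ->
    intg `[- B, B] (fun y => f y * q y t).
  move=> cq; have cqt := sec q t cq; have [M M0 hM] := @cont_bounded R (- B) B _ cqt.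
  by apply: (intgM_bounded (M := M)) => //; apply: measurable_funTS; exact: continuous_measurable_fun.
have key t : exists G : R -> R, [/\ forall y, 0 <= G y, intg `[- B, B] G &
    forall s y, `]t - 1, t + 1[%classic s -> `[- B, B]%classic y -> `|f y * dp y s| <= G y].
  have [M M0 hM] := @cont2_bounded _ (- B) B (t - 1) (t + 1) cdp.
  exists (fun y => M * `|f y|); split.
  - by move=> y; exact: mulr_ge0.
  - by apply: intgZ => //; apply: intg_norm.
  - move=> s y /=; rewrite !in_itv/= => /andP[/ltW s1 /ltW s2] yB.
    by rewrite normrM mulrC ler_wpM2r//; apply: (hM y s) => //; apply/andP.
have tI (t : R) : `]t - 1, t + 1[%classic t by rewrite /= in_itv/=; apply/andP; split; lra.
split=> t; have [G [G0 iG hG]] := key t.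
- pose ff s y := f y * p y s.
  have Dff (s y : R) : is_derive s 1 (ff ^~ y) (f y * dp y s).
    by rewrite (_ : ff^~ y = (f y *: p y)%R)//; exact: is_deriveZ.
  have dff s y : derive1 (ff ^~ y) s = f y * dp y s := is_derive_derive1 (Dff s y).
  have df s y : derivable (ff ^~ y) s 1 := is_derive_derivable (Dff s y).
  have G_ub s y : `]t - 1, t + 1[%classic s -> `[- B, B]%classic y -> `|derive1 (ff ^~ y) s| <= G y.
    by move=> hs hy; rewrite dff; exact: hG.
  have intff s : `]t - 1, t + 1[%classic s -> mu.-integrable `[- B, B] (EFin \o ff s).
    by move=> _; exact: iq.
  have D1 := @derivable_under_integral R _ _ mu ff _ mD t (t - 1) (t + 1) (tI t) intff (fun s y _ _ => df s y) G G0 iG G_ub.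
  have D2 := @differentiation_under_integral R _ _ mu ff _ mD t (t - 1) (t + 1) (tI t) intff (fun s y _ _ => df s y) G G0 iG G_ub.
  split; first exact: D1.
  rewrite -derive1E D2; by apply: eq_Rintegral => y _; exact: dff.
- have := @continuity_under_integral R _ _ mu (fun s y => f y * dp y s) _ mD (t - 1) (t + 1).
  apply => //.
  + by move=> s _; exact: iq.
  + apply/aeW => y _ s _; apply: (@continuousM _ _ (cst (f y)) (dp y)); first exact: cvg_cst.
    exact: sec2.
  + exact: iG.
  + by move=> s hs; apply/aeW => y hy; exact: hG.
  + exact/mem_set/tI.
Qed.

Lemma is_derive_near0 f (l x d : R) : 0 < d -> (forall y, `|x - y| < d -> f y = 0) ->
  is_derive x 1 f l -> l = 0.
Proof.
move=> d0 f0 /is_derive_epsP H; apply/eqP; rewrite -normr_eq0 eq_le normr_ge0 andbT.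
apply/ler_addgt0Pr => e e0; rewrite add0r; have [d' d'0 hd] := H _ e0.
pose h := Num.min d d' / 2.
have h0 : 0 < h by rewrite divr_gt0// lt_min d0.
have [h1 h2] : h < d /\ h < d'.
  have m1 : Num.min d d' <= d by rewrite ge_min lexx.
  have m2 : Num.min d d' <= d' by rewrite ge_min lexx orbT.
  by move: h0; rewrite /h => h0; split; lra.
have := hd h; rewrite gt_eqF// gtr0_norm// => /(_ isT h2).
rewrite !f0; first by rewrite subrr mul0r sub0r normrN => /ltW.
- by rewrite subrr normr0.
- by rewrite opprD addrA subrr add0r normrN gtr0_norm.
Qed.

End wave_weak.

Section wave_weak2.
Context {R : realType}.
Local Notation mu := (@lebesgue_measure R).
Implicit Types (f g F : R -> R) (a b c k e h : R).

Lemma C1_pair_cont p px pt : @C1_pair R p px pt -> continuous (fun z : R * R => p z.1 z.2).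
Proof.
move=> [Dx Dt cx ct] [x t]; apply/cvgprod_epsP => /= e e0.
have [B1 B10 h1] := @cont2_bounded R (fun z => px z.1 z.2) (x - 1) (x + 1) (t - 1) (t + 1) cx.
have [B2 B20 h2] := @cont2_bounded R (fun z => pt z.1 z.2) (x - 1) (x + 1) (t - 1) (t + 1) ct.
pose B := B1 + B2 + 1; have B0 : 0 < B by rewrite /B; lra.
exists (Num.min 1 (e / B)); first by rewrite lt_min ltr01 divr_gt0.
move=> x' t'; rewrite !lt_min !ltr_pdivlMr// => /andP[x1 xe] /andP[t1 te].
have [c1 hc1 E1] := @mean_value _ (fun z => p z t') (fun z => px z t') x x' (fun z => Dx z t').
have [c2 hc2 E2] := @mean_value _ (p x) (pt x) t t' (Dt x).
rewrite distrC in x1; rewrite distrC in t1.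
have k1 : `|px c1 t'| <= B1.
  by apply: h1; move: (le_lt_trans hc1 x1) t1; clear; rewrite !ltr_norml => /andP[? ?] /andP[? ?]; apply/andP; split; lra.
have k2 : `|pt x c2| <= B2.
  by apply: h2; move: (le_lt_trans hc2 t1); clear; rewrite ?ltr_norml => /andP[? ?]; apply/andP; split; lra.
rewrite distrC (_ : p x' t' - p x t = px c1 t' * (x' - x) + pt x c2 * (t' - t)); last first.
  by rewrite -E1 -E2; ring.
apply: le_lt_trans (ler_normD _ _) _; rewrite !normrM.
have := ler_pM (normr_ge0 _) (normr_ge0 (x' - x)) k1 (lexx _).
have := ler_pM (normr_ge0 _) (normr_ge0 (t' - t)) k2 (lexx _).
rewrite distrC in xe; rewrite distrC in te; move: xe te; rewrite /B.
move: `|x' - x| `|t' - t| (normr_ge0 (x' - x)) (normr_ge0 (t' - t)) => X Y X0 Y0.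
by clear -e0 B10 B20 X0 Y0; move=> *; nra.
Qed.

Lemma is_derive_subr f g (x df dg : R) : is_derive x 1 f df -> is_derive x 1 g dg ->
  is_derive x 1 (fun t => f t - g t) (df - dg).
Proof. by move=> Df Dg; exact: is_deriveB. Qed.

Lemma comp_affine_cont (G : R * R -> R) a b : continuous G ->
  continuous (fun z : R * R => G (a * z.1 + b * z.2, z.2)).
Proof.
move=> cG [x t]; apply/cvgprod_epsP => /= e e0.
have /cvgprod_epsP/(_ _ e0)/=[d d0 h] := cG (a * x + b * t, t).
pose C := `|a| + `|b| + 1; have C0 : 0 < C by rewrite /C; have := normr_ge0 a; have := normr_ge0 b; lra.
exists (d / C); first by rewrite divr_gt0.
move=> x' t'; rewrite !ltr_pdivlMr// /C => hx ht; apply: h => /=.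
  rewrite (_ : _ - _ = a * (x - x') + b * (t - t')); last by ring.
  apply: le_lt_trans (ler_normD _ _) _; rewrite !normrM.
  have := normr_ge0 a; have := normr_ge0 b; have := normr_ge0 (x - x'); have := normr_ge0 (t - t').
  move: hx ht; move: `|x - x'| `|t - t'| `|a| `|b| => X Y A B; clear -d0.
  by move=> hx ht X0 Y0 A0 B0; have [XY|YX] := leP X Y; nra.
have := normr_ge0 a; have := normr_ge0 b; have := normr_ge0 (t - t').
by move: ht; move: `|t - t'| `|a| `|b| => Y A B; clear; nra.
Qed.

Section wave.
Variables (F f l dl : R -> R) (T : R).
Hypotheses (T0 : 0 < T) (fl : L2loc f).
Hypothesis cl : continuous l.
Hypothesis l0 : forall t, 0 <= t <= T -> 0 < l t.

(** The complement of the compact [K] is open, so [psi] vanishes near each point outside the domain,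
    and its derivatives vanish there. *)
Lemma test2_out psi : test2 l T psi ->
  [/\ C1_pair psi (dx psi) (dt psi) &
    forall x t, ~ (0 < t < T /\ 0 < x < l t) -> [/\ psi x t = 0, dx psi x t = 0 & dt psi x t = 0]].
Proof.
move=> [Hd cdx cdt [K [cK KD psi0]]].
have C : C1_pair psi (dx psi) (dt psi).
  split=> [x t|x t||]; [|  |exact: cdx|exact: cdt].
    by split; [exact: (Hd x t).1|rewrite /dx derive1E].
  by split; [exact: (Hd x t).2|rewrite /dt derive1E].
split => // x t nD; have nK : ~ K (x, t) by move=> /KD.
have clK : closed K by apply: compact_closed => //; exact: norm_hausdorff.
have : \forall z \near (x, t), ~ K z by apply: open_nbhs_nbhs; split => //; exact: closed_openC.
move=> /near_prodP[d d0 /= hd]; have [Dx Dt _ _] := C; split.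
- exact: psi0.
- apply: (is_derive_near0 d0 _ (Dx x t)) => y xy; apply: psi0; apply: hd => //.
  by rewrite subrr normr0.
- apply: (is_derive_near0 d0 _ (Dt x t)) => y xy; apply: psi0; apply: hd => //.
  by rewrite subrr normr0.
Qed.

(** With [y = t + x] or [y = t - x] as space variable, [f y] no longer depends on time and the
    factor of [f y] becomes a total derivative in [t] of [psi] along a characteristic. The space
    integral is then the derivative of [N], which vanishes at times 0 and [T]. No regularity of [f]
    is involved. *)
Lemma dal_wave : wave_equation l T (dalx f) (dalt f).
Proof.
have ar (c d m t : R) : 0 <= c -> m <= c -> 0 < m -> 0 < t -> t < d ->
    [/\ - (c + d) <= - m + t, - m + t <= t, t <= c + d, - (c + d) <= t & m + t <= c + d].
  by move=> *; split; lra.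
have ar1 (y t m : R) : y < t \/ m + t < y -> 0 < y + -1 * t < m -> False.
  by move=> [?|?] /andP[? ?]; lra.
have ar2 (y t m : R) : y < - m + t \/ t < y -> 0 < - y + 1 * t < m -> False.
  by move=> [?|?] /andP[? ?]; lra.
move=> psi /test2_out[C out]; have [Dx Dt cx ct] := C; have cpsi := C1_pair_cont C.
set px := dx psi in C out Dx cx *; set pt := dt psi in C out Dt ct *.
have [Lm Lm0 hLm] := @cont_bounded R 0 T l cl.
(* Every value [t + x] or [t - x] met in the domain lies in [-B, B], so the integration interval can
   be fixed before differentiating in time. *)
pose B : R := Lm + T; have B0 : 0 <= B by apply: addr_ge0 => //; exact: ltW.
have fi := L2loc_locintg fl.
(* [p1] follows the test function along [t + x = y], and [p2] along [t - x = y]. *)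
pose p1 (y t : R) := psi (y + -1 * t) t; pose dp1 (y t : R) := -1 * px (y + -1 * t) t + pt (y + -1 * t) t.
pose p2 (y t : R) := psi (- y + 1 * t) t; pose dp2 (y t : R) := 1 * px (- y + 1 * t) t + pt (- y + 1 * t) t.
have cc (q : R -> R -> R) a b : continuous (fun z : R * R => q z.1 z.2) ->
    continuous (fun z : R * R => q (a * z.1 + b * z.2) z.2).
  by move=> cq; exact: (@comp_affine_cont (fun z => q z.1 z.2) a b cq).
have D1 (y t : R) : is_derive t 1 (p1 y) (dp1 y t) := chain2 y (-1) t C.
have D2 (y t : R) : is_derive t 1 (p2 y) (dp2 y t) := chain2 (- y) 1 t C.
have E1 (q : R -> R -> R) : (fun z : R * R => q (z.1 + -1 * z.2) z.2) = (fun z => q (1 * z.1 + -1 * z.2) z.2).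
  by apply/funext => z; rewrite mul1r.
have E2 (q : R -> R -> R) : (fun z : R * R => q (- z.1 + 1 * z.2) z.2) = (fun z => q (-1 * z.1 + 1 * z.2) z.2).
  by apply/funext => z; rewrite mulN1r.
have ccD (b : R) (q r : R * R -> R) : continuous q -> continuous r -> continuous (fun z => b * q z + r z).
  by move=> cq cr z; apply: cvgD; [apply: cvgM; [exact: cvg_cst|exact: cq]|exact: cr].
have cp1 : continuous (fun z : R * R => p1 z.1 z.2) by rewrite /p1 E1; exact: cc.
have cp2 : continuous (fun z : R * R => p2 z.1 z.2) by rewrite /p2 E2; exact: cc.
have cdp1 : continuous (fun z : R * R => dp1 z.1 z.2).
  by apply: ccD; rewrite E1; exact: cc.
have cdp2 : continuous (fun z : R * R => dp2 z.1 z.2).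
  by apply: ccD; rewrite E2; exact: cc.
clear E1 E2 ccD.
have [DM1 cM1] := param_integral B fi cp1 cdp1 D1.
have [DM2 cM2] := param_integral B fi cp2 cdp2 D2.
have sec (q : R -> R -> R) t : continuous (fun z : R * R => q z.1 z.2) -> continuous (q^~ t).
  move=> cq y; apply/cvgR_epsP => e e0; have /cvgprod_epsP/(_ _ e0)[d d0 h] := cq (y, t).
  by exists d => // z yz; apply: h => //=; rewrite subrr normr0.
have iq (q : R -> R -> R) a b t : continuous (fun z : R * R => q z.1 z.2) ->
    intg `[a, b] (fun y => f y * q y t).
  move=> cq; have cqt := sec q t cq; have [M M0 hM] := @cont_bounded R a b _ cqt.
  by apply: (intgM_bounded (M := M)) => //; apply: measurable_funTS; exact: continuous_measurable_fun.
pose N t := \int[mu]_(y in `[- B, B]) (f y * p2 y t) - \int[mu]_(y in `[- B, B]) (f y * p1 y t).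
pose dN t := \int[mu]_(y in `[- B, B]) (f y * dp2 y t) - \int[mu]_(y in `[- B, B]) (f y * dp1 y t).
have DN (t : R) : is_derive t 1 N (dN t) by exact: is_derive_subr (DM2 t) (DM1 t).
have cN : continuous dN by move=> t; apply: cvgB; [exact: cM2|exact: cM1].
have inner t : 0 < t < T -> \int[mu]_(x in `]0, l t[) (dalx f x t * px x t - dalt f x t * pt x t) = dN t.
  move=> /andP[t0 tT]; have lt0 : 0 < l t by apply: l0; rewrite !ltW.
  have ltm : l t <= Lm by apply: le_trans (ler_norm _) _; apply: hLm; rewrite !ltW.
  have [b1 b2 b3 b4 b5] := ar _ _ _ _ Lm0 ltm lt0 t0 tT; rewrite -/B in b1 b3 b4 b5.
  pose k1 y := f y * dp1 y t; pose k2 y := f y * dp2 y t.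
  have ik1 a b : intg `[a, b] k1 by exact: (iq dp1 a b t cdp1).
  have ik2 a b : intg `[a, b] k2 by exact: (iq dp2 a b t cdp2).
  have E1 : \int[mu]_(y in `[- B, B]) k1 y = \int[mu]_(x in `[0, l t]) k1 (x + t).
    rewrite -(@Rint_shift R k1 0 (l t) t (ltW lt0) (ik1 _ _)).
    rewrite add0r; apply: (Rint_support b4 _ b5 (ik1 _ _)); first by rewrite lerDr ltW.
    move=> y hy; rewrite /k1 /dp1.
    have [|_ -> ->] := out (y + -1 * t) t; last by rewrite mulr0 addr0 mulr0.
    by move=> [_]; exact: ar1 hy.
  have j2 : intg `[- l t, - 0] (fun y => k2 (y + t)).
    by apply: intg_shift; [rewrite lerN2 ltW|exact: ik2].
  have E2 : \int[mu]_(y in `[- B, B]) k2 y = \int[mu]_(x in `[0, l t]) k2 (- x + t).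
    have lN : - l t <= - 0 by rewrite lerN2 ltW.
    rewrite -(Rint_reflect j2) -(@Rint_shift R k2 (- l t) (- 0) t lN (ik2 _ _)).
    rewrite (_ : - 0 + t = t :> R); last by rewrite oppr0 add0r.
    apply: (Rint_support b1 b2 b3 (ik2 _ _)).
    move=> y hy; rewrite /k2 /dp2.
    have [|_ -> ->] := out (- y + 1 * t) t; last by rewrite mulr0 addr0 mulr0.
    by move=> [_]; exact: ar2 hy.
  have i1 : intg `[0, l t] (fun x => k1 (x + t)) by apply: intg_shift; [exact: ltW|exact: ik1].
  have i2 : intg `[0, l t] (fun x => k2 (- x + t)) by exact: (intg_reflect j2).
  have -> : dN t = \int[mu]_(x in `[0, l t]) (k2 (- x + t) - k1 (x + t)).
    by rewrite (RintB (measurable_itv _) i2 i1) -E1 -E2.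
  rewrite -(Rint_oo_cc (intgB (measurable_itv _) i2 i1)).
  apply: Rint_eq => x _; rewrite /k1 /k2 /dp1 /dp2 /dalx /dalt.
  rewrite (_ : x + t + -1 * t = x) 1?(_ : - (- x + t) + 1 * t = x); [|ring..].
  by rewrite (addrC x t) (addrC (- x) t); ring.
rewrite (Rint_eq (g := dN)); last by move=> t /=; rewrite in_itv/= => tT; exact: inner.
rewrite Rint_oo_cc; last exact: cont_intg.
rewrite (Rint_derive (ltW T0) DN cN).
have z1 t : ~ (0 < t < T) -> forall x, psi x t = 0.
  by move=> nt x; have [|->] := out x t; first by move=> [/nt].
have N0 t : ~ (0 < t < T) -> N t = 0.
  move=> /z1 nt; rewrite /N (Rint_eq (g := fun=> 0)); last by move=> y _; rewrite /p2 nt mulr0.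
  rewrite [X in _ - X](Rint_eq (g := fun=> 0)); last by move=> y _; rewrite /p1 nt mulr0.
  by rewrite subrr.
rewrite !N0 ?subrr// => /andP[]; rewrite ?ltxx//.
Qed.

End wave.
End wave_weak2.

(** * Traces on the moving end *)

Section traces.
Context {R : realType}.
Local Notation mu := (@lebesgue_measure R).
Implicit Types (f g F : R -> R) (a b c k e h : R).

Lemma diffeo_lower_bound (s ds : R -> R) a b : diffeo s ds ->
  exists2 C : R, 0 < C & forall x, a <= x <= b -> 1 <= C * ds x.
Proof.
move=> S; have c1 : continuous (fun x => (ds x)^-1).
  by move=> x; apply: (@continuousV _ _ ds); [rewrite gt_eqF// (diffeo_gt0 S)|apply: (diffeo_cont S)].
have [B B0 hB] := @cont_bounded R a b _ c1.
exists (B + 1); first lra.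
move=> x xab; have dx0 := diffeo_gt0 S x.
have := hB x xab; rewrite gtr0_norm ?invr_gt0// => h.
by rewrite -ler_pdivrMr// div1r; lra.
Qed.

(** On a compact interval the Jacobian [ds] is at least [1 / C], so inserting it costs no more than
    the factor [C]. *)
Lemma comp_sq_le (s ds g : R -> R) a b C : a <= b -> diffeo s ds -> L2loc g -> 0 < C ->
  (forall x, a <= x <= b -> 1 <= C * ds x) ->
  (\int[mu]_(x in `]a, b[) ((g (s x)) ^+ 2)%:E <=
   (C * \int[mu]_(y in `[s a, s b]) (g y ^+ 2))%:E)%E.
Proof.
move=> ab S gl C0 hC; have gs := gl.2 (s a) (s b).
rewrite EFinM Rint_EFin// (ge0_change_of_variables_itv S ab); last 2 first.
- by apply: measurable_funTS; apply: measurable_funX; exact: gl.1.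
- by move=> x _; exact: sqr_ge0.
have mk : measurable_fun `[a, b] (fun x => (g (s x) ^+ 2 * ds x)%:E).
  apply/measurable_EFinP; apply: measurable_funTS; apply: measurable_funM; last exact: diffeo_dmeasurable S.
  by apply: measurable_funX; exact: measurableT_comp gl.1 (diffeo_measurable S).
rewrite -ge0_integralZl//; last 2 first.
- by move=> x _; rewrite lee_fin mulr_ge0 ?sqr_ge0// ltW// (diffeo_gt0 S).
- by rewrite lee_fin ltW.
apply: (@le_trans _ _ (\int[mu]_(x in `[a, b]) ((g (s x)) ^+ 2)%:E)%E).
  apply: ge0_subset_integral => //.
  - apply/measurable_EFinP; apply: measurable_funTS; apply: measurable_funX.
    exact: measurableT_comp gl.1 (diffeo_measurable S).
  - by move=> x _; rewrite lee_fin sqr_ge0.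
  - exact: subset_itv_oo_cc.
apply: ge0_le_lower_integral => x; first by rewrite lee_fin sqr_ge0.
rewrite /= in_itv/= => xab; rewrite -EFinM lee_fin.
by have := hC x xab; have := sqr_ge0 (g (s x)); nra.
Qed.

Lemma comp_L2 (s ds g : R -> R) a b : a <= b -> diffeo s ds -> L2loc g -> L2 `]a, b[ (g \o s).
Proof.
move=> ab S gl; apply/L2P => //; apply/sqintP => //; split.
  by apply: measurable_funTS; exact: measurableT_comp gl.1 (diffeo_measurable S).
have [C C0 hC] := diffeo_lower_bound a b S.
by apply: le_lt_trans (comp_sq_le ab S gl C0 hC) _; exact: ltry.
Qed.

(** The moving layer is written as an indicator in both variables, and the section integrals of a
    jointly measurable function are measurable by Tonelli. *)
Lemma measurable_layer (w : R -> R -> R) (p l : R -> R) e :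
  measurable_fun setT (fun z : R * R => w z.1 z.2) -> measurable_fun setT p ->
  measurable_fun setT l ->
  measurable_fun setT (fun t => \int[mu]_(x in `](l t - e)%R, l t[) ((w x t - p t) ^+ 2)%:E)%E.
Proof.
move=> mw mp ml.
pose b (z : R * R) := (l z.1 - e < z.2) && (z.2 < l z.1).
have mb : measurable_fun setT b.
  apply: measurable_and; apply: measurable_fun_ltr => //.
    by apply: measurable_funB => //; exact: measurableT_comp ml measurable_fst.
  exact: measurableT_comp ml measurable_fst.
pose K (z : measurableTypeR R * measurableTypeR R) : \bar R :=
  ((w z.2 z.1 - p z.1) ^+ 2 * (b z)%:R)%:E.
have mK : measurable_fun setT K.
  apply/measurable_EFinP; apply: measurable_funM.
    apply: measurable_funX; apply: measurable_funB; last exact: measurableT_comp mp measurable_fst.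
    exact: (measurableT_comp mw (measurable_fun_pair measurable_snd measurable_fst)).
  rewrite (_ : (fun z : measurableTypeR R * measurableTypeR R => (b z)%:R : R) = (fun z => if b z then 1 else 0)); last by apply/funext => z; case: (b z).
  exact: measurable_fun_ifT.
have K0 z : (0 <= K z)%E by rewrite lee_fin mulr_ge0 ?sqr_ge0 ?ler0n.
have := @measurable_fun_fubini_tonelli_F _ _ _ _ R mu K mK K0.
apply: eq_measurable_fun => t _; rewrite /fubini_F.
rewrite [RHS]integral_mkcond; apply: eq_integral => x _; rewrite patchE mem_setE in_itv/= /K /b/=.
by case: ifP => _; rewrite ?mulr1 ?mulr0.
Qed.

(** The substitution [x = l t - h * (1 - th)] makes the layer integral [h] times an average over
    translates of [f] by at most [h], which [average_le] controls. Composition with the front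
    [t + sg * l t] costs the constant [C]. *)
Lemma travelling_trace (f l ds : R -> R) T sg e : 0 < T -> L2loc f -> `|sg| = 1 -> 0 < e ->
  diffeo (fun t => t + sg * l t) ds ->
  exists2 d, 0 < d & forall h, 0 < h < d ->
  (\int[mu]_(t in `]0%R, T[) \int[mu]_(x in `](l t - h)%R, l t[)
     ((f (t + sg * x) - f (t + sg * l t)) ^+ 2)%:E <= (h * e)%:E)%E.
Proof.
move=> T0 fl sg1 e0 S; set s := fun t => t + sg * l t in S *.
have [C C0 hC] := diffeo_lower_bound 0 T S.
have eC : 0 < e / C by rewrite divr_gt0.
have [d d0 hd] := L2_translate (s 0) (s T) fl eC.
exists d => // h /andP[h0 hhd].
(* Multiplying [f] by the square root of [h] puts the Jacobian [h] inside the square, where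
   [average_le] expects it. *)
pose r := Num.sqrt h; have r0 : 0 < r by rewrite sqrtr_gt0.
have r2 : r ^+ 2 = h by rewrite sqr_sqrtr// ltW.
have rfl := L2locZ r fl.
pose p (th : R) := 1 - th.
have mp : measurable_fun setT p by apply: measurable_funB.
have p01 th : `[0, 1]%classic th -> 0 <= p th <= 1.
  by rewrite /= in_itv/= /p => ?; apply/andP; split; lra.
have he0 : 0 <= h * e by rewrite mulr_ge0 ?ltW.
have nh : `|- sg * h| = h by rewrite normrM normrN sg1 mul1r gtr0_norm.
have mI := measurable_itv (`]0, T[ : interval R).
apply: le_trans (average_le (p := p) (h := - sg * h) mI rfl.1 (diffeo_measurable S) mp he0 p01 _); last first.
  move=> c; rewrite nh => ch.
  have gl : L2loc (fun y => r * f (y + c) - r * f y) by apply: L2locB => //; exact: (L2loc_shift c rfl).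
  apply: le_trans (comp_sq_le (ltW T0) S gl C0 hC) _; rewrite lee_fin.
  have -> : \int[mu]_(y in `[s 0, s T]) (r * f (y + c) - r * f y) ^+ 2 =
      h * \int[mu]_(y in `[s 0, s T]) (f (y + c) - f y) ^+ 2.
    rewrite -RintZ//; last exact: (L2locB (L2loc_shift c fl) fl).2.
    by apply: Rint_eq => y _; rewrite -mulrBr exprMn r2.
  rewrite mulrCA ler_pM2l//; have := hd c (le_lt_trans ch hhd).
  by rewrite ler_pdivlMr// mulrC.
apply: ge0_le_lower_integral => t tT; first by apply: integral_ge0 => x _; rewrite lee_fin sqr_ge0.
have mf1 : measurable_fun setT (fun x => (f (t + sg * x) - f (t + sg * l t)) ^+ 2).
  apply: measurable_funX; apply: measurable_funB => //.
  by apply: (measurableT_comp fl.1); apply: measurable_funD => //; exact: measurable_funM.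
apply: (@le_trans _ _ (\int[mu]_(x in `[(l t - h)%R, l t]) ((f (t + sg * x) - f (t + sg * l t)) ^+ 2)%:E)%E).
  apply: ge0_subset_integral => //.
  - by apply/measurable_EFinP; exact: measurable_funTS.
  - by move=> x _; rewrite lee_fin sqr_ge0.
  - exact: subset_itv_oo_cc.
have D := diffeo_affine (l t - h) h0.
have := @ge0_change_of_variables_itv R _ _ D (fun x => (f (t + sg * x) - f (t + sg * l t)) ^+ 2) 0 1 ler01.
rewrite mulr0 mulr1 add0r (_ : h + (l t - h) = l t); last by ring.
move=> ->; last 2 first.
- exact: measurable_funTS.
- by move=> x _; exact: sqr_ge0.
rewrite le_eqVlt; apply/orP; left; apply/eqP; apply: eq_integral => th _; congr EFin.
rewrite (_ : s t + - sg * h * p th = t + sg * (h * th + (l t - h))); last by rewrite /s /p; ring.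
by rewrite -mulrBr exprMn r2 mulrC.
Qed.

(** The value [k = 1] gives the trace of [dalx], and [k = -1] that of [dalt]. *)
Lemma travelling_trace2 (f l ds1 ds2 : R -> R) T k : 0 < T -> L2loc f -> measurable_fun setT l ->
  diffeo (fun t => t + 1 * l t) ds1 -> diffeo (fun t => t + -1 * l t) ds2 ->
  moving_trace l T (fun x t => f (t + 1 * x) + k * f (t + -1 * x))
    (fun t => f (t + 1 * l t) + k * f (t + -1 * l t)).
Proof.
move=> T0 fl ml S1 S2; split.
  have /L2P := comp_L2 (ltW T0) S1 fl => /(_ (measurable_itv _)) h1.
  have /L2P := comp_L2 (ltW T0) S2 (L2locZ k fl) => /(_ (measurable_itv _)) h2.
  by apply/L2P => //; exact: sqintD.
apply/cvge0P.
  move=> e; have [e0|e0] := leP 0 e.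
    apply: mule_ge0; first by rewrite lee_fin invr_ge0.
    by apply: integral_ge0 => t _; apply: integral_ge0 => x _; rewrite lee_fin sqr_ge0.
  rewrite integral0_eq ?mule0// => t _; rewrite set_itv_ge ?integral_set0//.
  by rewrite bnd_simp -leNgt; lra.
move=> e e0.
have e4 : 0 < e / 4 by rewrite divr_gt0.
have [d1 d10 h1] := travelling_trace T0 fl (@normr1 R) e4 S1.
have [d2 d20 h2] := travelling_trace T0 (L2locZ k fl) (@normrN1 R) e4 S2.
apply/near_right0P; exists (Num.min d1 d2); first by rewrite lt_min d10.
move=> h /andP[h0]; rewrite lt_min => /andP[hd1 hd2].
have mI := measurable_itv (`]0, T[ : interval R).
have mtr (g : R -> R) (sg : R) : measurable_fun setT g ->
   measurable_fun setT (fun z : R * R => g (z.2 + sg * z.1)) /\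
   measurable_fun setT (fun t : R => g (t + sg * l t)).
  move=> mg; split; apply: (measurableT_comp mg); apply: measurable_funD => //; exact: measurable_funM.
have [m1 m1'] := mtr f 1 fl.1.
have [m2 m2'] := mtr (fun y => k * f y) (-1) (L2locZ k fl).1.
pose I1 t := (\int[mu]_(x in `](l t - h)%R, l t[) ((f (t + 1 * x) - f (t + 1 * l t)) ^+ 2)%:E)%E.
pose I2 t := (\int[mu]_(x in `](l t - h)%R, l t[) ((k * f (t + -1 * x) - k * f (t + -1 * l t)) ^+ 2)%:E)%E.
have mI1 : measurable_fun setT I1 := measurable_layer (w := fun x t => f (t + 1 * x)) h m1 m1' ml.
have mI2 : measurable_fun setT I2 := measurable_layer (w := fun x t => k * f (t + -1 * x)) h m2 m2' ml.
have I10 t : (0 <= I1 t)%E by apply: integral_ge0 => x _; rewrite lee_fin sqr_ge0.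
have I20 t : (0 <= I2 t)%E by apply: integral_ge0 => x _; rewrite lee_fin sqr_ge0.
have B1 : (\int[mu]_(t in `]0%R, T[) I1 t <= (h * (e / 4))%:E)%E by apply: h1; rewrite h0.
have B2 : (\int[mu]_(t in `]0%R, T[) I2 t <= (h * (e / 4))%:E)%E by apply: h2; rewrite h0.
rewrite mulrC EFinM in B1; rewrite mulrC EFinM in B2.
rewrite -(@lee_pmul2l _ h%:E)// muleA -EFinM mulfV ?gt_eqF// mul1e -EFinM.
apply: (@le_trans _ _ (\int[mu]_(t in `]0%R, T[) (2%:E * I1 t + 2%:E * I2 t))%E).
  apply: ge0_le_lower_integral => t _; first by apply: integral_ge0 => x _; rewrite lee_fin sqr_ge0.
  have mJ := measurable_itv (`]l t - h, l t[ : interval R).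
  have ma (g : R -> R) (sg : R) : measurable_fun setT g ->
     measurable_fun `]l t - h, l t[ (fun x => ((g (t + sg * x) - g (t + sg * l t)) ^+ 2)%:E).
    move=> mg; apply/measurable_EFinP; apply: measurable_funTS; apply: measurable_funX; apply: measurable_funB => //.
    by apply: (measurableT_comp mg); apply: measurable_funD => //; exact: measurable_funM.
  have ma1 := ma f 1 fl.1; have ma2 := ma (fun y => k * f y) (-1) (L2locZ k fl).1.
  rewrite /I1 /I2 -!ge0_integralZl//; last 2 first.
  - by move=> x _; rewrite lee_fin sqr_ge0.
  - by move=> x _; rewrite lee_fin sqr_ge0.
  rewrite -ge0_integralD//; last 4 first.
  - by move=> x _; rewrite -EFinM lee_fin mulr_ge0// sqr_ge0.
  - exact: measurable_funeM.
  - by move=> x _; rewrite -EFinM lee_fin mulr_ge0// sqr_ge0.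
  - exact: measurable_funeM.
  apply: ge0_le_lower_integral => x _; first by rewrite lee_fin sqr_ge0.
  rewrite -!EFinM -EFinD lee_fin.
  move: (f (t + 1 * x)) (f (t + 1 * l t)) (k * f (t + -1 * x)) (k * f (t + -1 * l t)) => A A' B B'.
  by have := sqr_ge0 ((A - A') - (B - B')); clear; nra.
have mT1 := measurable_funTS (D := `]0, T[%classic) mI1; have mT2 := measurable_funTS (D := `]0, T[%classic) mI2.
rewrite ge0_integralD//; last 4 first.
- by move=> t _; apply: mule_ge0.
- exact: measurable_funeM.
- by move=> t _; apply: mule_ge0.
- exact: measurable_funeM.
rewrite !ge0_integralZl//.
apply: (@le_trans _ _ (2%:E * ((e / 4) * h)%:E + 2%:E * ((e / 4) * h)%:E)%E).
  have h20 : (0 <= 2%:E :> \bar R)%E by rewrite lee_fin.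
  exact: (leeD (lee_wpmul2l h20 B1) (lee_wpmul2l h20 B2)).
by rewrite -!EFinM -EFinD lee_fin; nra.
Qed.

Lemma eq_moving_trace (l : R -> R) T (w w' : R -> R -> R) (p p' : R -> R) :
  (forall x t, w x t = w' x t) -> (forall t, p t = p' t) ->
  moving_trace l T w p -> moving_trace l T w' p'.
Proof.
move=> Ew /funext Ep; have -> : w = w' by apply/funext => x; apply/funext => t.
by rewrite Ep.
Qed.

(** The boundary hypothesis is the condition at the moving end regrouped by the values of [f]: the
    coefficients [1 + eta * dl] and [eta + dl] add up to [(1 + eta) * (1 + dl)] in front of
    [f (t + l t)] and subtract to [(1 - eta) * (1 - dl)] in front of [f (t - l t)]. *)
Lemma dal_solution (eta : R) (u0 u1 F f l dl : R -> R) T : 0 < T -> L2loc f -> primitive_of F f ->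
  diffeo (fun t => t + l t) (fun t => 1 + dl t) -> diffeo (fun t => t - l t) (fun t => 1 - dl t) ->
  (forall t, 0 <= t <= T -> 0 < l t) ->
  (forall t, 0 < t < T ->
     (1 + eta) * ((1 + dl t) * f (t + l t)) + (1 - eta) * ((1 - dl t) * f (t - l t)) = 0) ->
  (forall x, 0 < x < l 0 -> F x - F (- x) = u0 x) ->
  (forall x, 0 < x < l 0 -> f x - f (- x) = u1 x) ->
  wave_solution_with l dl T eta u0 u1 (dal F) (dalx f) (dalt f).
Proof.
move=> T0 fl Ff Pd Qd l0 hb h0 h1.
have cl := front_continuous Pd; have ml := continuous_measurable_fun cl.
have S1 : diffeo (fun t => t + 1 * l t) (fun t => 1 + dl t).
  by rewrite (_ : (fun t => t + 1 * l t) = (fun t => t + l t))//; apply/funext => t; rewrite mul1r.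
have S2 : diffeo (fun t => t + -1 * l t) (fun t => 1 - dl t).
  by rewrite (_ : (fun t => t + -1 * l t) = (fun t => t - l t))//; apply/funext => t; rewrite mulN1r.
have tr1 := travelling_trace2 1 T0 fl ml S1 S2; have tr2 := travelling_trace2 (-1) T0 fl ml S1 S2.
split.
- exact: (dal_C0_V0 fl Ff Pd l0).
- exact: (dal_C1_L2 fl Ff Pd l0).
- exact: dal_wave.
- exists (fun t => f (t + l t) + f (t - l t)), (fun t => f (t + l t) - f (t - l t)); split.
  + apply: eq_moving_trace tr1 => [x t|t]; first by rewrite /dalx !mul1r mulN1r.
    by rewrite !mul1r mulN1r.
  + apply: eq_moving_trace tr2 => [x t|t]; first by rewrite /dalt !mul1r !mulN1r.
    by rewrite !mul1r !mulN1r.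
  + by apply: aeW => t tT; rewrite -(hb t tT); ring.
- by move=> t _; rewrite /dal addr0 subr0 subrr.
- by move=> x xl; rewrite /dal add0r sub0r; exact: h0.
- by apply: aeW => x xl; rewrite /dalt add0r sub0r; exact: h1.
Qed.

End traces.

(** * Uniqueness *)

Section curves.
Context {R : realType}.
Local Notation mu := (@lebesgue_measure R).
Implicit Types (W k w : R -> R -> R) (M T t s e : R).

Definition L2curve M W := (forall t, L2loc (W^~ t)) /\
  forall t e, 0 < e -> exists2 d : R, 0 < d & forall s, `|t - s| < d ->
    \int[mu]_(x in `[0, M]) ((W x s - W x t) ^+ 2) <= e.

Definition clamp T t : R := Num.max 0 (Num.min T t).

(** Extended by zero in space and frozen in time outside [0,T], a function of the moving domain
    becomes a curve in a fixed L^2 space defined for all times. Two-sided limits and fixed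
    integration intervals are then available. *)
Definition curve (l : R -> R) T w x t := ((w^~ (clamp T t)) \_ `]0, l (clamp T t)[) x.

Lemma clampP T t : 0 <= T -> [/\ 0 <= clamp T t <= T, 0 <= t <= T -> clamp T t = t &
  forall s, `|clamp T t - clamp T s| <= `|t - s|].
Proof.
move=> T0; have h (r : R) : [\/ r <= 0 /\ clamp T r = 0, 0 <= r <= T /\ clamp T r = r | T <= r /\ clamp T r = T].
  rewrite /clamp; case: (leP T r) => Tr; first by apply: Or33; split => //; apply: max_r.
  by case: (leP 0 r) => r0; [apply: Or32; rewrite ltW | apply: Or31; rewrite ltW].
split.
- by case: (h t) => -[? ->]; lra.
- by move=> tT; case: (h t) => -[? ->]; lra.
- move=> s; have h1 := ler_norm (t - s); have h2 := ler_norm (s - t); rewrite distrC in h2.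
  by rewrite ler_norml; case: (h t) => -[? ->]; case: (h s) => -[? ->]; clear h; apply/andP; split; lra.
Qed.

Lemma C0_L2_curve (l : R -> R) T M w : 0 <= T -> C0_L2 l T w -> L2curve M (curve l T w).
Proof.
move=> T0 [wL cw].
have wl t : L2loc ((curve l T w)^~ t).
  have [cT _ _] := clampP t T0; have /L2P := wL _ cT => /(_ (measurable_itv _)).
  exact: L2loc_patch.
split=> // t e e0; have [cT _ lip] := clampP t T0.
have /(@L2norm_cvg0P _ _ _ _ (fun=> setT))/(_ _ e0)/near_withinP[d d0 h] := cw _ cT.
exists d => // s ts; have [cT' _ _] := clampP s T0.
have := h (clamp T s) (le_lt_trans (lip s) ts); rewrite /= in_itv/= => /(_ cT') {}h.
rewrite -lee_fin Rint_EFin//; last exact: (L2locB (wl s) (wl t)).2.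
apply: le_trans h; apply: ge0_subset_integral => //.
- by apply/measurable_EFinP; apply: measurable_funX; apply: measurable_funB; [exact: (wl s).1|exact: (wl t).1].
- by move=> x _; rewrite lee_fin sqr_ge0.
Qed.

Lemma curve_in (l : R -> R) T w x t : 0 <= t <= T -> 0 < x < l t -> curve l T w x t = w x t.
Proof.
move=> tT xl; have T0 : 0 <= T by case/andP: tT => /le_trans; apply.
have [_ /(_ tT) E _] := clampP t T0.
by rewrite /curve E patchE mem_set//= in_itv.
Qed.

Lemma curve_out (l : R -> R) T w x t : 0 <= t <= T -> ~ (0 < x < l t) -> curve l T w x t = 0.
Proof.
move=> tT xl; have T0 : 0 <= T by case/andP: tT => /le_trans; apply.
have [_ /(_ tT) E _] := clampP t T0.
by rewrite /curve E patchE memNset//= in_itv.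
Qed.

Lemma sqr_abs_lt (x y : R) : 0 < y -> x ^+ 2 < y ^+ 2 -> `|x| < y.
Proof.
by move=> y0 xy; rewrite -(ltr_pXn2r (n := 2))// ?nnegrE ?(ltW y0)// real_normK ?num_real.
Qed.

Section one_curve.
Variables (M : R) (W : R -> R -> R).
Hypotheses (M0 : 0 < M) (WC : L2curve M W).

Let I t := \int[mu]_(x in `[0, M]) (W x t ^+ 2).

Lemma curve_norm_continuous : continuous I.
Proof.
move=> t; apply/cvgR_epsP => e e0; have It : 0 <= I t := Rintegral_sqr_ge0 _ _.
(* The first bound handles the squared term. The second, through Cauchy-Schwarz, makes the cross
   term smaller than [e / 4], as [I t * r] is below [(e / 4) ^+ 2]. *)
pose r := Num.min (e / 4) (e ^+ 2 / (32 * (I t + 1))).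
have r0 : 0 < r by rewrite lt_min !divr_gt0 ?exprn_gt0//; lra.
have [r1 r2] : r <= e / 4 /\ r * (32 * (I t + 1)) <= e ^+ 2.
  split; first by rewrite ge_min lexx.
  by rewrite -ler_pdivlMr; [rewrite ge_min lexx orbT|lra].
have [d d0 hd] := WC.2 t r r0; exists d => // s /hd h.
pose v x := W x s - W x t.
have vl : L2loc v := L2locB (WC.1 s) (WC.1 t).
have mD := measurable_itv (`[0, M] : interval R).
have sv := L2loc_sqint 0 M vl; have sw := L2loc_sqint 0 M (WC.1 t).
have E : I s = I t + \int[mu]_(x in `[0, M]) (v x ^+ 2) + 2 * \int[mu]_(x in `[0, M]) (W x t * v x).
  have i1 := sqint_intg_sqr sw; have i2 := sqint_intg_sqr sv; have i3 := sqint_mul mD sw sv.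
  rewrite /I -RintZ// -RintD// -RintD//; [|exact: intgD|exact: intgZ].
  by apply: Rint_eq => x _; rewrite /v; ring.
have cs := cauchy_schwarz mD sw sv.
have V0 : 0 <= \int[mu]_(x in `[0, M]) (v x ^+ 2) := Rintegral_sqr_ge0 _ _.
have : `|\int[mu]_(x in `[0, M]) (W x t * v x)| < e / 4.
  apply: sqr_abs_lt; first by rewrite divr_gt0.
  apply: le_lt_trans cs _; rewrite -/(I t).
  move: h; rewrite -/v; move: (\int[mu]_(x in _) (v x ^+ 2)) V0 => V V0 h.
  apply: (@le_lt_trans _ _ (I t * r)); first by rewrite ler_wpM2l.
  rewrite (_ : (e / 4) ^+ 2 = e ^+ 2 / 16); last by field.
  by rewrite ltr_pdivlMr//; move: r2 r0 It; move: (e ^+ 2) (I t) => A B; clear; nra.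
rewrite -/(I s) E {E}; move: h; rewrite -/v.
move: (\int[mu]_(x in _) (v x ^+ 2)) V0 (\int[mu]_(x in _) (W x t * v x)) => V V0 X h.
have {}h := le_trans h r1; move: (I t) => J; clear -V0 h e0.
by rewrite !ltr_norml => /andP[? ?]; apply/andP; split; lra.
Qed.

Lemma curve_bound a b : exists2 B : R, 0 <= B & forall t, a <= t <= b ->
  \int[mu]_(x in `[0, M]) (W x t ^+ 2) <= B.
Proof.
have [B B0 hB] := @cont_bounded R a b _ curve_norm_continuous.
by exists B => // t /hB; apply: le_trans; exact: ler_norm.
Qed.

Lemma Rint_abs_sqr_le (f : R -> R) a : 0 <= a -> a <= M -> L2loc f ->
  (\int[mu]_(x in `[0, a]) `|f x|) ^+ 2 <= a * \int[mu]_(x in `[0, M]) (f x ^+ 2).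
Proof.
move=> a0 aM fl; have [mf fi] := L2loc_sqint 0 a fl.
have sf : sqint `[0, a] (fun x => `|f x|).
  split; first exact: measurableT_comp.
  by apply: eq_intg fi => // x _; rewrite real_normK ?num_real.
apply: le_trans (Rint_sqr_le_itv a0 sf) _; rewrite subr0 ler_wpM2l//.
rewrite (Rint_eq (g := fun x => f x ^+ 2)); last by move=> x _ /=; rewrite real_normK ?num_real.
apply: Rint_sub_le => //; [exact: subset_itvl|exact: fl.2|by move=> x _; exact: sqr_ge0].
Qed.

Lemma curve_L1 t e : 0 < e -> exists2 d : R, 0 < d & forall s, `|t - s| < d ->
  \int[mu]_(x in `[0, M]) `|W x s - W x t| < e.
Proof.
move=> e0; have r0 : 0 < e ^+ 2 / (2 * M) by rewrite divr_gt0 ?exprn_gt0// mulr_gt0.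
have [d d0 hd] := WC.2 t _ r0; exists d => // s /hd h.
have := Rint_abs_sqr_le (ltW M0) (lexx M) (L2locB (WC.1 s) (WC.1 t)).
move=> /le_trans/(_ (ler_wpM2l (ltW M0) h)) h1.
apply: le_lt_trans (ler_norm _) _; apply: sqr_abs_lt => //; apply: le_lt_trans h1 _.
rewrite (_ : M * (e ^+ 2 / (2 * M)) = e ^+ 2 / 2); last by field; rewrite gt_eqF.
by have : 0 < e ^+ 2 := exprn_gt0 2 e0; lra.
Qed.

(** Bounded, and Lipschitz in time, both uniformly in [x]: enough for the pairing with an L^2 curve
    to be continuous in time, and stable under sums and products. *)
Definition tame k := (forall t, measurable_fun setT (k^~ t)) /\
  exists2 C : R, 0 <= C & forall x t, 0 <= x <= M ->
    `|k x t| <= C /\ forall s, `|k x s - k x t| <= C * `|s - t|.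

Lemma tame_intg k t s : tame k -> intg `[0, M] (fun x => W x t * k x s).
Proof.
move=> [mk [C C0 hk]]; apply: (intgM_bounded (M := C)) => //.
- by apply: measurable_funTS; exact: mk.
- by move=> x /=; rewrite in_itv/= => xM; have [] := hk x s xM.
- exact: L2loc_intg (WC.1 t).
Qed.

Lemma pairing_continuous k : tame k -> continuous (fun t => \int[mu]_(x in `[0, M]) (W x t * k x t)).
Proof.
move=> kT; have [mk [C C0 hk]] := kT; have mD := measurable_itv (`[0, M] : interval R).
move=> t; apply/cvgR_epsP => e e0.
have C1 : 0 < C + 1 by lra.
have e1 : 0 < e / (2 * (C + 1)) by rewrite divr_gt0// mulr_gt0.
have [d1 d10 h1] := curve_L1 t e1.
pose A := \int[mu]_(x in `[0, M]) `|W x t|.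
have iA : intg `[0, M] (fun x => `|W x t|) by apply: intg_norm => //; exact: L2loc_intg (WC.1 t).
have A0 : 0 <= A by apply: Rintegral_ge0.
have CA : 0 < 2 * (C + 1) * (A + 1) by rewrite !mulr_gt0//; lra.
exists (Num.min d1 (e / (2 * (C + 1) * (A + 1)))); first by rewrite lt_min d10 divr_gt0.
move=> s; rewrite lt_min => /andP[/h1 hs]; rewrite ltr_pdivlMr// => st.
have iB : intg `[0, M] (fun x => `|W x s - W x t|).
  by apply: intg_norm => //; exact: L2loc_intg (L2locB (WC.1 s) (WC.1 t)).
rewrite -RintB//; [|exact: tame_intg..].
apply: le_lt_trans (Rint_norm mD (intgB mD (tame_intg _ _ kT) (tame_intg _ _ kT))) _.
apply: (@le_lt_trans _ _ (\int[mu]_(x in `[0, M]) (C * `|W x s - W x t| + C * `|t - s| * `|W x t|))).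
  apply: Rint_le => //.
  - by apply: intg_norm => //; apply: intgB => //; exact: tame_intg.
  - by apply: intgD => //; exact: intgZ.
  - move=> x; rewrite /= in_itv/= => xM; have [k1 _] := hk x s xM; have [_ /(_ s) k2] := hk x t xM.
    rewrite (_ : _ - _ = - ((W x s - W x t) * k x s + (k x s - k x t) * W x t)); last by ring.
    rewrite normrN; apply: le_trans (ler_normD _ _) _; rewrite !normrM.
    by rewrite (distrC t s); apply: lerD; [rewrite mulrC; exact: ler_wpM2r|exact: ler_wpM2r].
rewrite RintD//; [|exact: intgZ..]; rewrite !RintZ// -/A.
have : (C + 1) * \int[mu]_(x in `[0, M]) `|W x s - W x t| < e / 2.
  rewrite -ltr_pdivlMl//; apply: lt_le_trans hs _; rewrite le_eqVlt; apply/orP; left; apply/eqP.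
  by field; rewrite gt_eqF.
have : 0 <= \int[mu]_(x in `[0, M]) `|W x s - W x t| by apply: Rintegral_ge0.
move: (\int[mu]_(x in _) `|W x s - W x t|) st (normr_ge0 (t - s)) => X; move: `|t - s| => Y.
by clear -C0 A0 e0; nra.
Qed.

End one_curve.
End curves.

(** * Cutoff functions and tame kernels *)

Section cutoff.
Context {R : realType}.
Local Notation mu := (@lebesgue_measure R).
Implicit Types (k : R -> R -> R) (h : R -> R) (M t x e : R).

(** A bump of radius 1/2 centred at 3/2 and of total mass 1. Its primitive [step] passes from 0 to 1
    between 1 and 2, so [step (r^-1 * x)] removes the strip [x <= r] and leaves [x >= 2 * r]
    untouched. *)
Definition dstep x : R := (mass 2^-1)^-1 * bump 2^-1 (x - 3 / 2).

Definition step x : R := (mass 2^-1)^-1 * prim (fun y => bump 2^-1 (y - 3 / 2)) x.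

Lemma dstep_continuous : continuous dstep.
Proof. by move=> x; apply: cvgM; [exact: cvg_cst|exact: bump_shift_continuous]. Qed.

Lemma step_derive x : is_derive x (1 : R) step (dstep x).
Proof.
rewrite (_ : step = ((mass 2^-1)^-1 *: prim (fun y => bump 2^-1 (y - 3 / 2)))%R)//.
by apply: is_deriveZ; apply: prim_is_derive; exact: bump_shift_continuous.
Qed.

Lemma dstep_out x : x <= 1 \/ 2 <= x -> dstep x = 0.
Proof.
move=> h; rewrite /dstep bump_out ?mulr0//.
by rewrite ler_normr; apply/orP; case: h => ?; [right|left]; lra.
Qed.

Let step_split x y : x <= y -> step y - step x = \int[mu]_(z in `[x, y]) dstep z.
Proof. by move=> xy; rewrite (Rint_derive xy step_derive dstep_continuous). Qed.

Let dstep_ge0 x : 0 <= dstep x.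
Proof. by rewrite mulr_ge0 ?bump_ge0// invr_ge0 ltW// mass_gt0. Qed.

Lemma step_le x y : x <= y -> step x <= step y.
Proof.
move=> xy; rewrite -subr_ge0 step_split//; apply: Rintegral_ge0 => z _; exact: dstep_ge0.
Qed.

Lemma step_low x : x <= 1 -> step x = 0.
Proof.
have z a b : b <= 1 -> a <= b -> step b - step a = 0.
  move=> b1 ab; rewrite step_split// (Rint_eq (g := fun=> 0)) ?Rint_cst ?mul0r//.
  by move=> y; rewrite /= in_itv/= => /andP[_ yb]; apply: dstep_out; left; exact: le_trans yb b1.
have s0 : step 0 = 0 by rewrite /step prim0 mulr0.
move=> x1; have [x0|x0] := leP 0 x; first by have := z 0 x x1 x0; rewrite s0 subr0.
by have := z x 0 ler01 (ltW x0); rewrite s0 sub0r => /eqP; rewrite oppr_eq0 => /eqP.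
Qed.

Lemma step_high x : 2 <= x -> step x = 1.
Proof.
move=> x2; have h : 0 < 2^-1 :> R by rewrite invr_gt0.
have m0 := mass_gt0 h.
rewrite /step; have := @primB R (fun y => bump 2^-1 (y - 3 / 2)) 1 x.
have -> : prim (fun y : R => bump 2^-1 (y - 3 / 2)) 1 = 0.
  by have := step_low (lexx 1); rewrite /step => /eqP; rewrite mulf_eq0 invr_eq0 gt_eqF//= => /eqP.
rewrite subr0 => -> //; last 2 first.
- by apply: L2loc_locintg; apply: L2loc_cont; exact: bump_shift_continuous.
- by lra.
have i1 := intg_cst 1 (measurable_itv (`[1, x] : interval R)) (mu_itv_cc_fin 1 x).
have [_] := @Rint_bump R (fun=> 1) (3 / 2) 2^-1 1 x h ltac:(lra) ltac:(lra) i1.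
have E (D : set R) : \int[mu]_(x0 in D) (1 * bump 2^-1 (x0 - 3 / 2)) = \int[mu]_(x0 in D) bump 2^-1 (x0 - 3 / 2).
  by apply: Rint_eq => y _; rewrite mul1r.
by rewrite !E mass_shift// => ->; rewrite mulVf// gt_eqF.
Qed.

Lemma step_01 x : 0 <= step x <= 1.
Proof.
apply/andP; split.
  by rewrite -(step_low (ler01 : (0:R) <= 1)); case: (leP 0 x) => [/step_le//|/ltW x0]; rewrite !step_low//; lra.
by have [x2|/ltW/step_le] := leP 2 x; [rewrite step_high|rewrite (step_high (lexx _))].
Qed.

Lemma dstep_bounded : exists2 C : R, 0 <= C & forall x, `|dstep x| <= C.
Proof.
have [C C0 hC] := @cont_bounded R 1 2 _ dstep_continuous; exists C => // x.
have [x1|x1] := leP x 1; first by rewrite dstep_out ?normr0//; left.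
have [x2|x2] := leP 2 x; first by rewrite dstep_out ?normr0//; right.
by apply: hC; rewrite !ltW.
Qed.

Lemma compact_support_bounded h a b : continuous h -> (forall x, x <= a \/ b <= x -> h x = 0) ->
  exists2 C : R, 0 <= C & forall x, `|h x| <= C.
Proof.
move=> ch h0; have [C C0 hC] := @cont_bounded R a b _ ch; exists C => // x.
have [xa|xa] := leP x a; first by rewrite h0 ?normr0//; left.
have [xb|xb] := leP b x; first by rewrite h0 ?normr0//; right.
by apply: hC; rewrite !ltW.
Qed.

Section tame.
Variable M : R.

Lemma tame_char h (dh : R -> R) (sg C : R) : (forall x : R, is_derive x 1 h (dh x)) ->
  0 <= C -> (forall x, `|h x| <= C) -> (forall x, `|dh x| <= C) ->
  tame M (fun x t => h (t + sg * x)).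
Proof.
move=> Dh C0 hC dC; split.
  move=> t; apply: measurableT_comp.
    by apply: continuous_measurable_fun => x; exact: is_derive_continuous (Dh x).
  by apply: measurable_funD => //; exact: measurable_funM.
exists C => // x t xM; split => // s.
have [c _ ->] := @mean_value R h dh (t + sg * x) (s + sg * x) Dh.
by rewrite normrM (_ : s + sg * x - _ = s - t); [exact: ler_wpM2r|ring].
Qed.

Lemma tameD k1 k2 : tame M k1 -> tame M k2 -> tame M (fun x t => k1 x t + k2 x t).
Proof.
move=> [m1 [C1 C10 h1]] [m2 [C2 C20 h2]]; split=> [t|]; first exact: measurable_funD.
exists (C1 + C2); first exact: addr_ge0.
move=> x t xM; have [a1 b1] := h1 x t xM; have [a2 b2] := h2 x t xM; split.
  by apply: le_trans (ler_normD _ _) _; exact: lerD.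
move=> s; rewrite opprD addrACA mulrDl; apply: le_trans (ler_normD _ _) _; exact: lerD.
Qed.

Lemma tameM k1 k2 : tame M k1 -> tame M k2 -> tame M (fun x t => k1 x t * k2 x t).
Proof.
move=> [m1 [C1 C10 h1]] [m2 [C2 C20 h2]]; split=> [t|]; first exact: measurable_funM.
exists (C1 * C2 + C1 * C2); first by rewrite addr_ge0// mulr_ge0.
move=> x t xM; have [a1 b1] := h1 x t xM; have [a2 b2] := h2 x t xM; split.
  rewrite normrM; apply: le_trans (ler_pM _ _ a1 a2) _ => //.
  by rewrite lerDl mulr_ge0.
move=> s; have [a1' _] := h1 x s xM.
rewrite (_ : _ - _ = k1 x s * (k2 x s - k2 x t) + (k1 x s - k1 x t) * k2 x t); last by ring.
apply: le_trans (ler_normD _ _) _; rewrite !normrM mulrDl; apply: lerD.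
  by rewrite -mulrA; apply: ler_pM => //; exact: b2.
by rewrite mulrAC; apply: ler_pM => //; exact: b1.
Qed.

Lemma tame_fst h C : measurable_fun setT h -> 0 <= C -> (forall x, `|h x| <= C) ->
  tame M (fun x _ => h x).
Proof.
move=> mh C0 hC; split=> // ; exists C => // x t _; split => // s.
by rewrite subrr normr0 mulr_ge0.
Qed.

Lemma tame_cst c : tame M (fun _ _ => c).
Proof. exact: (@tame_fst (fun=> c) `|c|). Qed.

(** Cauchy-Schwarz on the short interval [0, e]: a bounded kernel supported there has a pairing
    whose square is linear in [e]. This removes the cutoff near the fixed end. *)
Lemma tame_tail W k t e B C : 0 < M -> L2curve M W -> tame M k -> 0 <= e -> e <= M -> 0 <= C ->
  \int[mu]_(x in `[0, M]) (W x t ^+ 2) <= B ->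
  (forall x, 0 <= x <= e -> `|k x t| <= C) -> (forall x, e <= x -> k x t = 0) ->
  (\int[mu]_(x in `[0, M]) (W x t * k x t)) ^+ 2 <= C ^+ 2 * (e * B).
Proof.
move=> M0 WC kT e0 eM C0 WB kC k0; have ik := tame_intg WC t t kT.
have mE := measurable_itv (`[0, e] : interval R).
have Wi : intg `[0, e] (fun x => `|W x t|) by apply: intg_norm => //; exact: L2loc_intg (WC.1 t).
rewrite (Rint_split e0 eM ik) [X in _ + X](Rint_eq (g := fun=> 0)) ?Rint_cst ?mul0r ?addr0//; last first.
  by move=> x; rewrite /= in_itv/= => /andP[ex _]; rewrite k0 ?mulr0.
have ike := intg_itv_mono (lexx 0) eM ik.
have h1 : `|\int[mu]_(x in `[0, e]) (W x t * k x t)| <= C * \int[mu]_(x in `[0, e]) `|W x t|.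
  apply: le_trans (Rint_norm mE ike) _; rewrite -RintZ//; apply: Rint_le => //.
  - exact: intg_norm.
  - exact: intgZ.
  - by move=> x; rewrite /= in_itv/= => xe; rewrite normrM mulrC ler_wpM2r// kC.
rewrite -real_normK ?num_real//; apply: (@le_trans _ _ ((C * \int[mu]_(x in `[0, e]) `|W x t|) ^+ 2)).
  by rewrite lerXn2r// nnegrE// mulr_ge0//; exact: Rintegral_ge0.
have h2 := Rint_abs_sqr_le e0 eM (WC.1 t).
rewrite exprMn; apply: ler_wpM2l; first exact: sqr_ge0.
apply: (le_trans h2).
exact: ler_wpM2l.
Qed.

End tame.
End cutoff.

(** * The weak equation tested against d'Alembert waves *)

Section transport.
Context {R : realType}.
Local Notation mu := (@lebesgue_measure R).
Implicit Types (h : R -> R) (t x e : R).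

Lemma continuous2_char h sg : continuous h -> continuous (fun z : R * R => h (z.2 + sg * z.1)).
Proof.
move=> ch z; apply: (@continuous_comp _ _ _ (fun z : R * R => z.2 + sg * z.1) h); last exact: ch.
by apply: cvgD; [exact: cvg_snd|apply: cvgM; [exact: cvg_cst|exact: cvg_fst]].
Qed.

Lemma tameB M (k1 k2 : R -> R -> R) : tame M k1 -> tame M k2 -> tame M (fun x t => k1 x t - k2 x t).
Proof.
move=> h1 h2; rewrite (_ : (fun x t => _) = (fun x t => k1 x t + (-1) * k2 x t)).
  by apply: tameD => //; apply: (tameM (k1 := fun _ _ => -1)) => //; exact: tame_cst.
by apply/funext => x; apply/funext => t; rewrite mulN1r.
Qed.

Lemma is_derive_affine (a b y : R) : is_derive y 1 (fun y : R => a + b * y) b.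
Proof.
apply/is_derive_epsP => e e0; exists 1 => // h h0 _.
by rewrite (_ : _ / h - b = 0) ?normr0//; field.
Qed.

Lemma is_derive_compr (f df g : R -> R) (dg y : R) : (forall z : R, is_derive z 1 f (df z)) ->
  is_derive y 1 g dg -> is_derive y 1 (fun y => f (g y)) (df (g y) * dg).
Proof.
by move=> Df Dg; exact: (is_derive1_comp (Df (g y)) Dg).
Qed.

Lemma is_derive_mulr (f g : R -> R) (df dg y : R) : is_derive y 1 f df -> is_derive y 1 g dg ->
  is_derive y 1 (fun y => f y * g y) (df * g y + f y * dg).
Proof.
move=> Df Dg; have -> : df * g y + f y * dg = f y *: dg + g y *: df.
  by rewrite /GRing.scale/= addrC [df * _]mulrC.
exact: is_deriveM.
Qed.

Lemma between_fronts (x t m c d : R) : t - m < c -> d < t + m -> x + t <= d \/ c <= t - x -> x < m.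
Proof. by move=> ? ? [?|?]; lra. Qed.

Lemma Rint_extend (D E : set R) (f g : R -> R) : (forall x, D x -> E x /\ f x = g x) ->
  (forall x, E x -> ~ D x -> g x = 0) -> \int[mu]_(x in D) f x = \int[mu]_(x in E) g x.
Proof.
move=> h1 h2; rewrite [LHS]Rint_restrict [RHS]Rint_restrict; apply: Rint_eq => x _; rewrite !patchE.
have [Dx|nDx] := pselect (D x); first by have [Ex fg] := h1 x Dx; rewrite !mem_set.
rewrite memNset//; case: ifPn => // /set_mem Ex; by rewrite h2.
Qed.

Lemma sqr_sum3_le (a b c A1 A2 A3 e : R) : a ^+ 2 <= A1 * e -> b ^+ 2 <= A2 * e -> c ^+ 2 <= A3 * e ->
  (a - b - c) ^+ 2 <= 3 * (A1 + A2 + A3) * e.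
Proof.
move=> h1 h2 h3; have := sqr_ge0 (a + b); have := sqr_ge0 (a + c); have := sqr_ge0 (b - c).
by move: h1 h2 h3; rewrite !expr2; nra.
Qed.

Section pairing.
Variables (l : R -> R) (T s s' c d M : R) (ux ut : R -> R -> R) (al be ga : R -> R).
Hypotheses (T0 : 0 < T) (s0 : 0 <= s) (s'T : s' <= T) (M0 : 0 < M).
Hypothesis lM : forall t, 0 <= t <= T -> l t <= M.
Hypothesis geo : forall t, s <= t <= s' -> t - l t < c /\ d < t + l t.
Hypotheses (cux : C0_L2 l T ux) (cut : C0_L2 l T ut).
Hypothesis weq : wave_equation l T ux ut.
Hypothesis Dal : forall x : R, is_derive x 1 al (be x).
Hypothesis Dbe : forall x : R, is_derive x 1 be (ga x).
Variable C : R.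
Hypothesis alC : forall x, [/\ `|al x| <= C, `|be x| <= C & `|ga x| <= C].
Hypothesis out : forall x, x <= c \/ d <= x -> al x = 0 /\ be x = 0.

Let X := curve l T ux.
Let Y := curve l T ut.
Let ps x t : R := al (t + 1 * x) - al (t + -1 * x).
Let psx x t : R := be (t + 1 * x) + be (t + -1 * x).
Let pst x t : R := be (t + 1 * x) - be (t + -1 * x).

Let C0 : 0 <= C. Proof. by have [+ _ _] := alC 0; apply: le_trans. Qed.
Let XC : L2curve M X. Proof. exact: C0_L2_curve (ltW T0) cux. Qed.
Let YC : L2curve M Y. Proof. exact: C0_L2_curve (ltW T0) cut. Qed.
Let tal sg : tame M (fun x t => al (t + sg * x)).
Proof. by apply: (tame_char M sg Dal C0) => x; have [] := alC x. Qed.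
Let tbe sg : tame M (fun x t => be (t + sg * x)).
Proof. by apply: (tame_char M sg Dbe C0) => x; have [] := alC x. Qed.
Let tps : tame M ps. Proof. exact: tameB. Qed.
Let tpsx : tame M psx. Proof. exact: tameD. Qed.
Let tpst : tame M pst. Proof. exact: tameB. Qed.
Let cal : continuous al. Proof. by move=> x; exact: is_derive_continuous (Dal x). Qed.
Let cbe : continuous be. Proof. by move=> x; exact: is_derive_continuous (Dbe x). Qed.

Section test_function.
Variables (th dth : R -> R) (s1 s1' : R).
Hypotheses (ss1 : s < s1) (ss1' : s1' < s').
Hypothesis Dth : forall t : R, is_derive t 1 th (dth t).
Hypothesis cdth : continuous dth.
Hypothesis th0 : forall t, ~ (s1 <= t <= s1') -> th t = 0 /\ dth t = 0.

Let cth : continuous th. Proof. by move=> x; exact: is_derive_continuous (Dth x). Qed.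

(** Three factors make the wave [ps] admissible: [th] cuts in time, [step] near the fixed end where
    [ps] vanishes anyway, and [geo] keeps the support of [al] along both families of characteristics
    away from the moving end. *)
Let test e x t := th t * (step (e^-1 * x) * ps x t).

Lemma test_derive e (x t : R) :
  is_derive x 1 ((test e)^~ t)
    (th t * (e^-1 * dstep (e^-1 * x) * ps x t + step (e^-1 * x) * psx x t)) /\
  is_derive t 1 (test e x)
    (dth t * (step (e^-1 * x) * ps x t) + th t * (step (e^-1 * x) * pst x t)).
Proof.
split.
- have D1 := is_derive_compr Dal (is_derive_affine t 1 x).
  have D2 := is_derive_compr Dal (is_derive_affine t (-1) x).
  have D4 := is_derive_compr step_derive (is_derive_affine 0 e^-1 x).
  have D5 := is_derive_mulr (is_derive_cst (th t) x 1) (is_derive_mulr D4 (is_derive_subr D1 D2)).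
  have E : (test e)^~ t = (fun y => th t * (step (0 + e^-1 * y) * (al (t + 1 * y) - al (t + -1 * y)))).
    by apply/funext => y; rewrite /test add0r.
  rewrite E; apply: (is_derive_eq D5); rewrite /ps /psx !add0r /=; ring.
- have D1 := is_derive_compr Dal (is_derive_affine (1 * x) 1 t).
  have D2 := is_derive_compr Dal (is_derive_affine (-1 * x) 1 t).
  have D5 := is_derive_mulr (Dth t) (is_derive_mulr (is_derive_cst (step (e^-1 * x)) t 1) (is_derive_subr D1 D2)).
  have E : test e x = (fun y => th y * (step (e^-1 * x) * (al (1 * x + 1 * y) - al (-1 * x + 1 * y)))).
    apply/funext => y; rewrite /test /ps; congr (_ * (_ * (al _ - al _))); ring.
  rewrite E; apply: (is_derive_eq D5) => /=.
  have E1 : 1 * x + 1 * t = t + 1 * x by ring.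
  have E2 : -1 * x + 1 * t = t + -1 * x by ring.
  rewrite E1 E2 /ps /pst; ring.
Qed.

Lemma test_test2 e : 0 < e -> test2 l T (test e).
Proof.
move=> e0.
have Ex : (fun z : R * R => dx (test e) z.1 z.2) = (fun z =>
    th z.2 * (e^-1 * dstep (e^-1 * z.1) * ps z.1 z.2 + step (e^-1 * z.1) * psx z.1 z.2)).
  by apply/funext => z; exact: is_derive_derive1 (test_derive e z.1 z.2).1.
have Et : (fun z : R * R => dt (test e) z.1 z.2) = (fun z =>
    dth z.2 * (step (e^-1 * z.1) * ps z.1 z.2) + th z.2 * (step (e^-1 * z.1) * pst z.1 z.2)).
  by apply/funext => z; exact: is_derive_derive1 (test_derive e z.1 z.2).2.
have c2 (g : R -> R) : continuous g -> continuous (fun z : R * R => g z.2).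
  by move=> cg z; apply: (@continuous_comp _ _ _ snd g); [exact: cvg_snd|exact: cg].
have c1 (g : R -> R) : continuous g -> continuous (fun z : R * R => g (e^-1 * z.1)).
  move=> cg z; apply: (@continuous_comp _ _ _ (fun z : R * R => e^-1 * z.1) g); last exact: cg.
  by apply: cvgM; [exact: cvg_cst|exact: cvg_fst].
have cstp : continuous (@step R) by move=> x; exact: is_derive_continuous (step_derive x).
have cm (f g : R * R -> R) : continuous f -> continuous g -> continuous (fun z => f z * g z).
  by move=> cf cg z; apply: cvgM; [exact: cf|exact: cg].
have ca (f g : R * R -> R) : continuous f -> continuous g -> continuous (fun z => f z + g z).
  by move=> cf cg z; apply: cvgD; [exact: cf|exact: cg].
have cb (f g : R * R -> R) : continuous f -> continuous g -> continuous (fun z => f z - g z).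
  by move=> cf cg z; apply: cvgB; [exact: cf|exact: cg].
have cps : continuous (fun z : R * R => ps z.1 z.2) by apply: cb; exact: continuous2_char.
have cpsx : continuous (fun z : R * R => psx z.1 z.2) by apply: ca; exact: continuous2_char.
have cpst : continuous (fun z : R * R => pst z.1 z.2) by apply: cb; exact: continuous2_char.
have cds : continuous (fun z : R * R => e^-1 * dstep (e^-1 * z.1)).
  by apply: cm; [move=> z; exact: cvg_cst|apply: c1; exact: dstep_continuous].
split.
- by move=> x t; split; [exact: is_derive_derivable (test_derive e x t).1|exact: is_derive_derivable (test_derive e x t).2].
- by rewrite Ex; exact: (cm _ _ (c2 _ cth) (ca _ _ (cm _ _ cds cps) (cm _ _ (c1 _ cstp) cpsx))).
- by rewrite Et; exact: (ca _ _ (cm _ _ (c2 _ cdth) (cm _ _ (c1 _ cstp) cps)) (cm _ _ (c2 _ cth) (cm _ _ (c1 _ cstp) cpst))).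
(* Only one bound per characteristic is recorded: either of the last two alternatives forces
   [x < l t] by [geo], and compactness comes from the rectangle. *)
pose K : set (R * R) := [set z | [/\ s1 <= z.2, z.2 <= s1', e <= z.1 &
  z.1 + z.2 <= d \/ c <= z.2 - z.1]].
have KB : K `<=` `[e, M] `*` `[s1, s1'].
  move=> [x t] [/= h1 h2 h3 h4]; rewrite !in_itv/= h1 h2 h3/=; split => //.
  have tI : s <= t <= s' by rewrite (le_trans (ltW ss1) h1) (le_trans h2 (ltW ss1')).
  have [tc dt] := geo tI; have lt : l t <= M.
    by apply: lM; case/andP: tI => a1 a2; rewrite (le_trans s0 a1) (le_trans a2 s'T).
  by apply: le_trans lt; exact: ltW (between_fronts tc dt h4).
exists K; split.
- apply: (@subclosed_compact _ _ (`[e, M] `*` `[s1, s1'])) => //; last first.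
    by apply: compact_setX; exact: segment_compact.
  have cl (f g : R * R -> R) : continuous f -> continuous g -> closed [set z | f z <= g z].
    move=> cf cg; rewrite (_ : [set z | _] = (fun z => g z - f z) @^-1` [set x | 0 <= x]).
      by apply: closed_comp => [z _|]; [apply: cvgB; [exact: cg|exact: cf]|exact: closed_ge].
    by apply/seteqP; split => z /=; rewrite subr_ge0.
  have cc (a : R) : continuous (fun _ : R * R => a) by move=> z; exact: cvg_cst.
  have f1 : continuous (fun z : R * R => z.1) by move=> z; exact: cvg_fst.
  have f2 : continuous (fun z : R * R => z.2) by move=> z; exact: cvg_snd.
  rewrite (_ : K = [set z | s1 <= z.2] `&` [set z | z.2 <= s1'] `&` [set z | e <= z.1] `&`
     ([set z | z.1 + z.2 <= d] `|` [set z | c <= z.2 - z.1])); last first.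
    by apply/seteqP; split => z; [move=> [*]|move=> [[[*] *] *]].
  do ?[apply: closedI]; try (by apply: cl).
  by apply: closedU; apply: cl => //; [exact: ca|exact: cb].
- move=> [x t] [/= h1 h2 h3 h4].
  have tI : s <= t <= s' by rewrite (le_trans (ltW ss1) h1) (le_trans h2 (ltW ss1')).
  have [tc dt] := geo tI; split => /=; last by rewrite (lt_le_trans e0 h3) (between_fronts tc dt h4).
  by rewrite (le_lt_trans s0 (lt_le_trans ss1 h1)) (le_lt_trans h2 (lt_le_trans ss1' s'T)).
- move=> x t nK; rewrite /test.
  have [tI|tI] := boolP (s1 <= t <= s1'); last by rewrite (th0 (negP tI)).1 mul0r.
  have [ex'|ex'] := ltP x e.
    by rewrite step_low ?mul0r ?mulr0//; rewrite mulrC ler_pdivrMr// mul1r ltW.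
  rewrite /ps (out (x := t + 1 * x) _).1 ?(out (x := t + -1 * x) _).1 ?subr0 ?mulr0//.
    by left; rewrite leNgt; apply/negP => h; apply: nK; split => //=; [case/andP: tI..|right; lra].
  by right; rewrite leNgt; apply/negP => h; apply: nK; split => //=; [case/andP: tI..|left; lra].
Qed.

Let pair (W k : R -> R -> R) t := \int[mu]_(x in `[0, M]) (W x t * k x t).

Let pairB W k1 k2 t : L2curve M W -> tame M k1 -> tame M k2 ->
  pair W k1 t - pair W k2 t = pair W (fun x t => k1 x t - k2 x t) t.
Proof.
move=> WC h1 h2; rewrite /pair -RintB//; [|exact: tame_intg..].
by apply: Rint_eq => x _; rewrite mulrBr.
Qed.

(** The weak equation for [test r], with the space integrals moved to the fixed interval [0, M]
    outside of whose part []0, l t[] the curves vanish. The integrand in time becomes a combination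
    of continuous pairings. *)
Lemma wave_cutoff r : 0 < r ->
  let kx x t := r^-1 * dstep (r^-1 * x) * ps x t + step (r^-1 * x) * psx x t in
  [/\ tame M kx, tame M (fun x t => step (r^-1 * x) * ps x t),
    tame M (fun x t => step (r^-1 * x) * pst x t) &
  \int[mu]_(t in `[0, T]) (th t * pair X kx t - (dth t * pair Y (fun x t => step (r^-1 * x) * ps x t) t +
     th t * pair Y (fun x t => step (r^-1 * x) * pst x t) t)) = 0].
Proof.
move=> r0 kx.
have mr : measurable_fun setT (fun x : R => r^-1 * x) by apply: measurable_funM.
have cst : continuous (@step R) by move=> x; exact: is_derive_continuous (step_derive x).
have ts : tame M (fun x _ => step (r^-1 * x)).
  apply: (tame_fst M (C := 1)) => // [|x]; first exact: measurableT_comp (continuous_measurable_fun cst) mr.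
  by have /andP[h1 h2] := step_01 (r^-1 * x); rewrite ger0_norm.
have tds : tame M (fun x _ => r^-1 * dstep (r^-1 * x)).
  have [D D0 hD] := @dstep_bounded R.
  apply: (tame_fst M (C := r^-1 * D)) => [||x].
  - apply: measurable_funM => //.
    exact: measurableT_comp (continuous_measurable_fun (@dstep_continuous R)) mr.
  - by rewrite mulr_ge0// invr_ge0 ltW.
  - by rewrite normrM gtr0_norm ?invr_gt0// ler_wpM2l// invr_ge0 ltW.
have tkx : tame M kx by apply: tameD; exact: tameM.
have tk1 : tame M (fun x t => step (r^-1 * x) * ps x t) by exact: tameM.
have tk2 : tame M (fun x t => step (r^-1 * x) * pst x t) by exact: tameM.
split => //.
have := weq (test_test2 r0); rewrite (Rint_eq (g := fun t =>
    th t * pair X kx t - (dth t * pair Y (fun x t => step (r^-1 * x) * ps x t) t +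
    th t * pair Y (fun x t => step (r^-1 * x) * pst x t) t))); last first.
  move=> t; rewrite /= in_itv/= => /andP[/ltW t0 /ltW tT].
  have tI : 0 <= t <= T by rewrite t0.
  have mM := measurable_itv (`[0, M] : interval R).
  have iX := intgZ (th t) mM (tame_intg XC t t tkx).
  have i1 := intgZ (dth t) mM (tame_intg YC t t tk1); have i2 := intgZ (th t) mM (tame_intg YC t t tk2).
  rewrite /pair -(RintZ _ mM (tame_intg XC t t tkx)) -(RintZ _ mM (tame_intg YC t t tk1)).
  rewrite -(RintZ _ mM (tame_intg YC t t tk2)) -(RintD mM i1 i2) -(RintB mM iX (intgD mM i1 i2)).
  apply: Rint_extend => x; rewrite /= !in_itv/= => xl.
    split; first by case/andP: xl => /ltW-> /ltW xl; rewrite (le_trans xl)// lM.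
    rewrite /X /Y (curve_in _ tI xl) (curve_in _ tI xl).
    have -> : dx (test r) x t = _ := is_derive_derive1 (test_derive r x t).1.
    have -> : dt (test r) x t = _ := is_derive_derive1 (test_derive r x t).2.
    by rewrite /kx; ring.
  by move=> nxl; rewrite /X /Y (curve_out _ tI nxl) (curve_out _ tI nxl); ring.
rewrite Rint_oo_cc//; apply: cont_intg => t.
have cX := pairing_continuous M0 XC tkx; have cY1 := pairing_continuous M0 YC tk1.
have cY2 := pairing_continuous M0 YC tk2.
apply: cvgB; first by apply: cvgM; [exact: cth|exact: cX].
by apply: cvgD; apply: cvgM; [exact: cdth|exact: cY1|exact: cth|exact: cY2].
Qed.

(** The cutoff width [r] tends to 0. Its derivative is of size [1 / r], but multiplies [ps], which
    is at most [2 * C * x] and hence of size [r] on the cut strip. All error kernels are thus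
    bounded uniformly in [r] and supported in [x <= 2 * r], where [tame_tail] applies. *)
Lemma wave_pairing :
  \int[mu]_(t in `[0, T]) (th t * (pair X psx t - pair Y pst t) - dth t * pair Y ps t) = 0.
Proof.
have o t : t <= s1 - 1 \/ s1' + 1 <= t -> th t = 0 /\ dth t = 0.
  by move=> h; apply: th0 => /andP[? ?]; case: h => ?; lra.
have [Th Th0 hTh] := compact_support_bounded cth (fun t q => (o t q).1).
have [dTh dTh0 hdTh] := compact_support_bounded cdth (fun t q => (o t q).2).
have [D D0 hD] := @dstep_bounded R.
have [B1 B10 hB1] := curve_bound XC 0 T; have [B2 B20 hB2] := curve_bound YC 0 T.
(* [2 * C] bounds the wave kernels themselves; [4 * D * C] bounds the term with [dstep], from
   [r^-1 * x <= 2] and [|ps| <= 2 * x * C]. *)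
pose Q := 2 * C + 4 * D * C.
have Q2 : 2 * C <= Q by rewrite /Q lerDl !mulr_ge0.
have Q0 : 0 <= Q by apply: le_trans Q2; rewrite mulr_ge0.
pose Kc := 3 * (Th ^+ 2 * Q ^+ 2 * B1 + dTh ^+ 2 * Q ^+ 2 * B2 + Th ^+ 2 * Q ^+ 2 * B2).
have Kc0 : 0 <= Kc by rewrite /Kc mulr_ge0// !addr_ge0// mulr_ge0// mulr_ge0// sqr_ge0.
apply: (@sqr_small_eq0 R _ (T * T * Kc)) => [|e e0]; first by apply: mulr_ge0 => //; apply: mulr_ge0; exact: ltW.
(* The strip [x <= 2 * r] must lie in [0, M], and its width must be at most [e]. *)
pose r := Num.min e M / 2.
have r0 : 0 < r by rewrite divr_gt0// lt_min e0.
have [rM re] : 2 * r <= M /\ 2 * r <= e.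
  by rewrite /r mulrC divfK ?gt_eqF//; split; rewrite ge_min lexx ?orbT.
have rr : 0 <= 2 * r by rewrite mulr_ge0// ltW.
have [tkx tk1 tk2 cut0] := wave_cutoff r0.
set kx := fun x t => r^-1 * _ * _ + _ in tkx cut0.
set k1 := fun x t => _ * ps x t in tk1 cut0; set k2 := fun x t => _ * pst x t in tk2 cut0.
pose E t := th t * pair X (fun x t => psx x t - kx x t) t - dth t * pair Y (fun x t => ps x t - k1 x t) t -
  th t * pair Y (fun x t => pst x t - k2 x t) t.
have cp W k : L2curve M W -> tame M k -> continuous (pair W k) by move=> WC kT; exact: (pairing_continuous M0 WC kT).
have cm (f g : R -> R) : continuous f -> continuous g -> continuous (fun t => f t * g t).
  by move=> cf cg t; apply: cvgM; [exact: cf|exact: cg].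
have cB (f g : R -> R) : continuous f -> continuous g -> continuous (fun t => f t - g t).
  by move=> cf cg t; apply: cvgB; [exact: cf|exact: cg].
have cD (f g : R -> R) : continuous f -> continuous g -> continuous (fun t => f t + g t).
  by move=> cf cg t; apply: cvgD; [exact: cf|exact: cg].
have cE : continuous E.
  exact: (cB _ _ (cB _ _ (cm _ _ cth (cp _ _ XC (tameB tpsx tkx))) (cm _ _ cdth (cp _ _ YC (tameB tps tk1))))
    (cm _ _ cth (cp _ _ YC (tameB tpst tk2)))).
have mT := measurable_itv (`[0, T] : interval R).
have -> : \int[mu]_(t in `[0, T]) (th t * (pair X psx t - pair Y pst t) - dth t * pair Y ps t) =
    \int[mu]_(t in `[0, T]) E t.
  rewrite -[LHS]subr0 -[X in _ - X]cut0 -RintB//; last 2 first.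
  - apply: cont_intg; exact: (cB _ _ (cm _ _ cth (cB _ _ (cp _ _ XC tpsx) (cp _ _ YC tpst))) (cm _ _ cdth (cp _ _ YC tps))).
  - apply: cont_intg; exact: (cB _ _ (cm _ _ cth (cp _ _ XC tkx)) (cD _ _ (cm _ _ cdth (cp _ _ YC tk1)) (cm _ _ cth (cp _ _ YC tk2)))).
  apply: Rint_eq => t _; rewrite /E -(pairB t XC tpsx tkx) -(pairB t YC tps tk1) -(pairB t YC tpst tk2); ring.
apply: le_trans (Rint_sqr_le_itv (ltW T0) (L2loc_sqint 0 T (L2loc_cont cE))) _.
rewrite subr0 (_ : T * T * Kc * e = T * (Kc * e * (T - 0))); last by ring.
rewrite ler_pM2l//.
apply: Rint_sqr_bound; [exact: ltW|exact: (L2loc_cont cE).2|move=> t tT].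
have sh x : 2 * r <= x -> 2 <= r^-1 * x by move=> h; rewrite mulrC ler_pdivlMr.
have s1h x : `|1 - step (r^-1 * x)| <= 1.
  by have /andP[a1 a2] := step_01 (r^-1 * x); rewrite ler_norml; apply/andP; split; lra.
have al2 x : [/\ `|ps x t| <= 2 * C, `|psx x t| <= 2 * C & `|pst x t| <= 2 * C].
  have [a1 b1 _] := alC (t + 1 * x); have [a2 b2 _] := alC (t + -1 * x).
  have tw (y z : R) : `|y| <= C -> `|z| <= C -> `|y - z| <= 2 * C /\ `|y + z| <= 2 * C.
    move=> yC zC; have -> : 2 * C = C + C by ring.
    by split; [apply: le_trans (ler_normB _ _) _|apply: le_trans (ler_normD _ _) _]; exact: lerD.
  by split; [exact: (tw _ _ a1 a2).1|exact: (tw _ _ b1 b2).2|exact: (tw _ _ b1 b2).1].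
have small k x : `|k| <= 2 * C -> `|k - step (r^-1 * x) * k| <= Q.
  move=> kC; rewrite (_ : _ - _ = (1 - step (r^-1 * x)) * k); last by ring.
  by rewrite normrM; apply: le_trans Q2; apply: le_trans kC; apply: ler_piMl.
have p1 : (pair X (fun x t => psx x t - kx x t) t) ^+ 2 <= Q ^+ 2 * (2 * r * B1).
  apply: (tame_tail M0 XC (tameB tpsx tkx) rr rM Q0 (hB1 t tT)) => x hx; last first.
    by rewrite /kx (dstep_out (or_intror (sh x hx))) (step_high (sh x hx)); ring.
  have [_ ax _] := al2 x; case/andP: hx => x0 xr.
  rewrite (_ : _ - _ = (1 - step (r^-1 * x)) * psx x t - r^-1 * dstep (r^-1 * x) * ps x t); last by rewrite /kx; ring.
  apply: le_trans (ler_normB _ _) _; rewrite /Q; apply: lerD.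
    by rewrite normrM; apply: le_trans ax; apply: ler_piMl.
  have [c1 _] := mean_value (t + -1 * x) (t + 1 * x) Dal; rewrite -/(ps x t) => ->.
  have [_ bc _] := alC c1.
  rewrite (_ : t + 1 * x - (t + -1 * x) = 2 * x); last by ring.
  have := hD (r^-1 * x); move: (dstep (r^-1 * x)) => ds hd.
  rewrite !normrM gtr0_norm ?invr_gt0// (ger0_norm x0) (@ger0_norm _ 2)//.
  have : r^-1 * x <= 2 by rewrite mulrC ler_pdivrMr.
  have : 0 <= r^-1 * x by rewrite mulr_ge0// invr_ge0 ltW.
  rewrite (_ : r^-1 * `|ds| * _ = (r^-1 * x) * 2 * (`|ds| * `|be c1|)); last by ring.
  move=> rx0 rx2; have := ler_pM (normr_ge0 _) (normr_ge0 _) hd bc => hh.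
  have -> : 4 * D * C = 2 * 2 * (D * C) by ring.
  by apply: ler_pM; [rewrite mulr_ge0|rewrite mulr_ge0|rewrite ler_pM2r|exact: hh].
have p2 : (pair Y (fun x t => ps x t - k1 x t) t) ^+ 2 <= Q ^+ 2 * (2 * r * B2).
  apply: (tame_tail M0 YC (tameB tps tk1) rr rM Q0 (hB2 t tT)) => x hx; last first.
    by rewrite /k1 step_high ?sh//; ring.
  by have [ax _ _] := al2 x; exact: small.
have p3 : (pair Y (fun x t => pst x t - k2 x t) t) ^+ 2 <= Q ^+ 2 * (2 * r * B2).
  apply: (tame_tail M0 YC (tameB tpst tk2) rr rM Q0 (hB2 t tT)) => x hx; last first.
    by rewrite /k2 step_high ?sh//; ring.
  by have [_ _ ax] := al2 x; exact: small.
have sq (a b A B : R) : `|a| <= A -> b ^+ 2 <= Q ^+ 2 * (2 * r * B) -> 0 <= B ->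
    (a * b) ^+ 2 <= A ^+ 2 * Q ^+ 2 * B * e.
  move=> aA bB B0; rewrite exprMn -[X in X * _]real_normK ?num_real//.
  apply: (@le_trans _ _ (A ^+ 2 * (Q ^+ 2 * (2 * r * B)))).
    apply: ler_pM; [exact: sqr_ge0|exact: sqr_ge0| |exact: bB].
    by rewrite lerXn2r// nnegrE//; exact: le_trans aA.
  have -> : A ^+ 2 * (Q ^+ 2 * (2 * r * B)) = A ^+ 2 * Q ^+ 2 * B * (2 * r) by ring.
  have AQ : 0 <= A ^+ 2 * Q ^+ 2 * B by apply: mulr_ge0 => //; apply: mulr_ge0; exact: sqr_ge0.
  exact: ler_wpM2l.
have q1 := sq _ _ _ _ (hTh t) p1 B10; have q2 := sq _ _ _ _ (hdTh t) p2 B20.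
have q3 := sq _ _ _ _ (hTh t) p3 B20.
rewrite /E /Kc; move: q1 q2 q3; move: (th t * _) (dth t * _) (th t * _) => a b c'.
move: (Th ^+ 2 * Q ^+ 2 * B1) (dTh ^+ 2 * Q ^+ 2 * B2) (Th ^+ 2 * Q ^+ 2 * B2) => A1 A2 A3.
exact: sqr_sum3_le.
Qed.

End test_function.
End pairing.
End transport.

(** * Conservation of momentum *)

Section momentum.
Context {R : realType}.
Local Notation mu := (@lebesgue_measure R).

Lemma small_shift (s s' c d t m h : R) :
  `|h| < Num.min (Num.min (t - s) (s' - t)) (Num.min (t + m - d) (c - (t - m))) ->
  s <= t + h <= s' /\ (d < t + h + m /\ t + h - m < c).
Proof.
rewrite !lt_min !ltr_norml => /andP[/andP[/andP[a1 a2] /andP[a3 a4]] /andP[/andP[a5 a6] /andP[a7 a8]]].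
by split; [apply/andP; split|split]; lra.
Qed.

Lemma beyond_fronts (c d t m x : R) : t - m < c -> d < t + m -> m <= x ->
  d <= t + 1 * x /\ t + -1 * x <= c.
Proof. by move=> *; split; lra. Qed.

Lemma bump_room (e k p q s s' : R) : e <= k / 2 -> e <= (p - s) / 2 -> e <= (s' - q) / 2 -> 0 < k ->
  s < p -> q < s' -> e < k /\ (s < p - e /\ q + e < s').
Proof. by move=> *; split; [|split]; lra. Qed.

Lemma away_from (a b s s' t y : R) : s < a -> b < s' -> ~~ (s < t < s') ->
  `|t - y| < Num.min (a - s) (s' - b) -> ~ (a <= y <= b).
Proof.
move=> sa bs; rewrite negb_and -!leNgt lt_min !ltr_norml => h /andP[/andP[? ?] /andP[? ?]] /andP[? ?].
by case/orP: h => ?; lra.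
Qed.

Lemma is_derive_locally0 (f : R -> R) (t r : R) : 0 < r -> (forall y, `|t - y| < r -> f y = 0) ->
  is_derive t 1 f 0.
Proof.
move=> r0 f0; apply/is_derive_epsP => e e0; exists r => // k _ kr.
rewrite !f0 ?subrr ?normr0 ?mul0r ?subrr ?normr0//.
by rewrite opprD addrA subrr add0r normrN.
Qed.

Variables (l : R -> R) (T s s' c d M : R) (v ux ut : R -> R -> R) (al be ga : R -> R).
Hypotheses (T0 : 0 < T) (s0 : 0 <= s) (ss' : s < s') (s'T : s' <= T) (M0 : 0 < M).
Hypothesis l0 : forall t, 0 <= t <= T -> 0 < l t.
Hypothesis lM : forall t, 0 <= t <= T -> l t <= M.
Hypothesis geo : forall t, s <= t <= s' -> t - l t < c /\ d < t + l t.
Hypotheses (cux : C0_L2 l T ux) (cv : C1_L2 l T v ut).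
Hypothesis weq : wave_equation l T ux ut.
Hypothesis vprim : forall t x, 0 <= t <= T -> 0 <= x <= l t -> v x t = prim ((ux^~ t) \_ `]0, l t[) x.
Hypothesis Dal : forall x : R, is_derive x 1 al (be x).
Hypothesis Dbe : forall x : R, is_derive x 1 be (ga x).
Hypothesis cga : continuous ga.
Variable C : R.
Hypothesis alC : forall x, [/\ `|al x| <= C, `|be x| <= C & `|ga x| <= C].
Hypothesis out : forall x, x <= c \/ d <= x -> [/\ al x = 0, be x = 0 & ga x = 0].

Let cut : C0_L2 l T ut. Proof. by case: cv. Qed.
Let V := curve l T v.
Let X := curve l T ux.
Let Y := curve l T ut.
Let C0 : 0 <= C. Proof. by have [+ _ _] := alC 0; apply: le_trans. Qed.
Let VC : L2curve M V. Proof. by case: cv => h _ _; exact: C0_L2_curve (ltW T0) h. Qed.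
Let XC : L2curve M X. Proof. exact: C0_L2_curve (ltW T0) cux. Qed.
Let YC : L2curve M Y. Proof. exact: C0_L2_curve (ltW T0) cut. Qed.
Let pair (W k : R -> R -> R) t := \int[mu]_(x in `[0, M]) (W x t * k x t).
Let sm (h : R -> R) x t : R := h (t + 1 * x) + h (t + -1 * x).
Let df (h : R -> R) x t : R := h (t + 1 * x) - h (t + -1 * x).

Let tI t : s <= t <= s' -> 0 <= t <= T.
Proof. by move=> /andP[a b]; rewrite (le_trans s0 a) (le_trans b s'T). Qed.

(** The space derivative of [sm h] is [df dh]. The boundary terms vanish because the displacement is
    0 at the fixed end and [h] is 0 on both characteristics through the moving end. *)
Lemma pair_by_parts (h dh : R -> R) t : s <= t <= s' -> (forall x : R, is_derive x 1 h (dh x)) ->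
  continuous dh -> (forall x, x <= c \/ d <= x -> h x = 0 /\ dh x = 0) ->
  pair V (df dh) t = - pair X (sm h) t.
Proof.
move=> ts Dh cdh oh; have tT := tI ts; have lt0 := l0 tT; have ltM := lM tT; have [tc td] := geo ts.
have gl := XC.1 t; have pw : primitive_of (prim (X^~ t)) (X^~ t).
  by move=> x y xy; rewrite primB//; exact: L2loc_locintg.
have Dpsi (x : R) : is_derive x 1 ((sm h)^~ t) (df dh x t).
  have D1 := is_derive_compr Dh (is_derive_affine t 1 x).
  have D2 := is_derive_compr Dh (is_derive_affine t (-1) x).
  by apply: is_derive_eq (is_deriveD D1 D2) _; rewrite /df; ring.
have ca (a : R) : continuous (fun x => dh (t + a * x)).
  move=> x; apply: (@continuous_comp _ _ _ (fun x => t + a * x) dh); last exact: cdh.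
  by apply: cvgD; [exact: cvg_cst|apply: cvgM; [exact: cvg_cst|exact: cvg_id]].
have cd : continuous ((df dh)^~ t) by move=> x; apply: cvgB; exact: ca.
have oR : h (t + 1 * l t) = 0 /\ dh (t + 1 * l t) = 0 by apply: oh; right; lra.
have oL : h (t + -1 * l t) = 0 /\ dh (t + -1 * l t) = 0 by apply: oh; left; lra.
have psil : sm h (l t) t = 0 by rewrite /sm oR.1 oL.1 addr0.
have := Rint_by_parts_primitive lt0 gl pw Dpsi cd psil.
rewrite prim0 mul0r => /(_ erefl).
have EX : X^~ t = (ux^~ t) \_ `]0, l t[.
  by rewrite /X /curve; have [_ /(_ tT) -> _] := clampP t (ltW T0).
have E1 : \int[mu]_(x in `[0, l t]) (prim (X^~ t) x * df dh x t) = pair V (df dh) t.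
  apply: Rint_extend => x; rewrite /= !in_itv/=.
    move=> /andP[x0 xl]; split; first by rewrite x0 (le_trans xl).
    have [xp|xn] := boolP (0 < x < l t).
      by rewrite /V (curve_in _ tT xp) vprim// ?EX// x0.
    have [->|xl'|->] : [\/ x = 0, False | x = l t].
      move: xn; rewrite negb_and -!leNgt => /orP[xl'|lx]; first by apply: Or31; apply/eqP; rewrite eq_le x0 xl'.
      by apply: Or33; apply/eqP; rewrite eq_le xl lx.
    - by rewrite /df !mulr0 subrr !mulr0.
    - by [].
    - by rewrite /df oR.2 oL.2 subrr !mulr0.
  move=> _ nx; rewrite /V (curve_out _ tT) ?mul0r// => /andP[/ltW x0 /ltW xl].
  by apply: nx; rewrite x0.
have E2 : \int[mu]_(x in `[0, l t]) (X x t * sm h x t) = pair X (sm h) t.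
  apply: Rint_extend => x; rewrite /= !in_itv/=.
    by move=> /andP[x0 xl]; rewrite x0 (le_trans xl).
  move=> _ nx; rewrite /X (curve_out _ tT) ?mul0r// => /andP[/ltW x0 /ltW xl].
  by apply: nx; rewrite x0.
by rewrite E1 E2.
Qed.

(** The product rule: the derivative of the displacement gives the term in [Y]; that of the kernel
    gives a pairing with [df ga], which [pair_by_parts] turns into the term in [X]. *)
Lemma pair_derive t : s < t < s' -> is_derive t 1 (pair V (df be)) (pair Y (df be) t - pair X (sm be) t).
Proof.
move=> /andP[st ts']; have ts : s <= t <= s' by rewrite !ltW.
have tT := tI ts; have lt0 := l0 tT; have ltM := lM tT; have [tc td] := geo ts.
have mM := measurable_itv (`[0, M] : interval R).
have cbe : continuous be by move=> x; exact: is_derive_continuous (Dbe x).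
have tbe sg : tame M (fun x t => be (t + sg * x)).
  by apply: (tame_char M sg Dbe C0) => x; have [] := alC x.
have tdf : tame M (df be) by exact: tameB.
have c2 (h : R -> R) : continuous h -> continuous (fun z : R * R => df h z.1 z.2).
  by move=> ch z; apply: cvgB; exact: continuous2_char.
have Dd (y r : R) : is_derive r 1 (df be y) (df ga y r).
  have aff (a : R) : is_derive r 1 (fun r : R => r + a) 1.
    have := is_derive_affine a 1 r.
    by rewrite (_ : (fun y => a + 1 * y) = (fun r => r + a))//; apply/funext => z; rewrite mul1r addrC.
  apply: is_derive_eq (is_derive_subr (is_derive_compr Dbe (aff (1 * y))) (is_derive_compr Dbe (aff (-1 * y)))) _.
  by rewrite /df !mulr1.
have [DG _] := param_integral M (L2loc_locintg (VC.1 t)) (c2 _ cbe) (c2 _ cga) Dd.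
have ext (k : R -> R -> R) r : \int[mu]_(y in `[- M, M]) (V y t * k y r) = \int[mu]_(x in `[0, M]) (V x t * k x r).
  apply/esym; apply: Rint_extend => x; rewrite /= !in_itv/=.
    by move=> /andP[x0 ->]; rewrite andbT; split => //; lra.
  move=> /andP[_ xM] nx; rewrite /V (curve_out _ tT) ?mul0r// => /andP[/ltW x0 _].
  by apply: nx; rewrite x0.
have := DG t; rewrite ext -/(pair V (df ga) t).
rewrite (pair_by_parts ts Dbe cga); last by move=> x /out[].
set G := fun r => _ => DGt.
have cstc (g : R -> R) : L2loc g -> L2curve M (fun x _ => g x).
  move=> gl; split=> [r|r e e0]; first exact: gl.
  by exists 1 => // r' _; rewrite (Rint_eq (g := fun=> 0)) ?Rint_cst ?mul0r// ?ltW// => x _; rewrite subrr expr0n.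
have Yc := cstc _ (YC.1 t).
have cK := pairing_continuous M0 Yc tdf.
apply/is_derive_epsP => e e0; have e3 : 0 < e / 3 by rewrite divr_gt0.
have /is_derive_epsP/(_ _ e3)[d1 d10 h1] := DGt.
have /cvgR_epsP/(_ _ e3)[d2 d20 h2] := cK t.
(* The kernel [df be] is bounded by [2 * C], so a mean-square error [ep] in the quotient contributes
   less than [e / 3]; the added 1 avoids a zero denominator. *)
pose ep := (e / 3) ^+ 2 / (2 * (M * (2 * C + 1) ^+ 2)).
have C21 : 0 < 2 * C + 1 by rewrite ltr_wpDl// mulr_ge0.
have MC0 : 0 < M * (2 * C + 1) ^+ 2 by rewrite mulr_gt0// exprn_gt0.
have ep0 : 0 < ep by rewrite divr_gt0 ?exprn_gt0// mulr_gt0.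
have [_ _ /(_ t tT)] := cv.
move=> /(@L2norm_cvg0P _ _ _ _ (fun s => `]0, Num.min (l t) (l s)[%classic))/(_ _ ep0)/near_dnbhsP[d3 d30 h3].
pose d4 := Num.min (Num.min (t - s) (s' - t)) (Num.min (t + l t - d) (c - (t - l t))).
have d40 : 0 < d4 by rewrite !lt_min !subr_gt0 st ts' td tc.
exists (Num.min (Num.min d1 d2) (Num.min d3 d4)); first by rewrite 2!lt_min d10 d20 lt_min d30 d40.
move=> h hn0; rewrite 2!lt_min => /andP[/andP[hd1 hd2]]; rewrite lt_min => /andP[hd3 hd4].
have hts := small_shift hd4.
have [hs [hd hc]] := hts; have hT := tI hs.
have [tc' td'] := geo hs.
have {h1} h1 := h1 h hn0 hd1.
have {h2} h2 : `|pair (fun x _ => Y x t) (df be) t - pair (fun x _ => Y x t) (df be) (t + h)| < e / 3.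
  by apply: h2; rewrite opprD addrA subrr add0r normrN.
have {h3} h3 := h3 (t + h); rewrite opprD addrA subrr add0r normrN in h3.
have {h3} h3 : (\int[mu]_(x in `]0%R, Num.min (l t) (l (t + h))[) (((v x (t + h) - v x t) / h - ut x t) ^+ 2)%:E <= ep%:E)%E.
  have := h3 hd3; rewrite (_ : t + h - t = h); last by ring.
  apply; last by rewrite /= in_itv.
  by rewrite -subr_eq0 addrAC subrr add0r.
pose q x := h^-1 * (V x (t + h) - V x t) - Y x t.
have ql : L2loc q := L2locB (L2locZ h^-1 (L2locB (VC.1 (t + h)) (VC.1 t))) (YC.1 t).
pose m := Num.min (l t) (l (t + h)); have lth0 := l0 hT.
have m0 : 0 < m by rewrite lt_min lt0.
have mD := measurable_itv (`]0, m[ : interval R).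
have qD : sqint `]0, m[ q by apply: (@sqintS _ _ `[0, m]) => //; [exact: subset_itv_oo_cc|exact: L2loc_sqint].
have fl := L2loc_patch qD; set f := q \_ _ in fl.
(* The time quotient converges only on the common part []0, m[] of two domains. Beyond it the kernel
   at time [t + h] vanishes, since one of the two fronts is then passed. *)
have k0 x (Mx : m <= x) : df be x (t + h) = 0.
  have o1 y : d <= y -> be y = 0 by move=> yd; have [] := out (or_intror yd).
  have o2 y : y <= c -> be y = 0 by move=> yd; have [] := out (or_introl yd).
  have [h1' h2'] : d <= t + h + 1 * x /\ t + h + -1 * x <= c.
    by move: Mx; rewrite /m ge_min => /orP[]; exact: beyond_fronts.
  by rewrite /df o1// o2// subrr.
have f2 : \int[mu]_(x in `[0, M]) (f x ^+ 2) <= ep.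
  rewrite -lee_fin Rint_EFin//; last exact: fl.2.
  apply: le_trans h3; apply: (@le_trans _ _ (\int[mu]_x (f x ^+ 2)%:E)%E).
    apply: ge0_subset_integral => //.
      by apply/measurable_EFinP; apply: measurable_funX; exact: fl.1.
    by move=> x _; rewrite lee_fin sqr_ge0.
  rewrite [leRHS]integral_mkcond le_eqVlt; apply/orP; left; apply/eqP; apply: eq_integral => x _.
  rewrite /f !patchE -/m; case: ifPn => [/set_mem|_]; last by rewrite expr0n.
  rewrite /= in_itv/= lt_min => /andP[x0 /andP[xl xl']]; rewrite /q /V /Y !curve_in ?x0//.
  by rewrite mulrC.
have A0 : `|\int[mu]_(x in `[0, M]) (f x * df be x (t + h))| < e / 3.
  apply: sqr_abs_lt => //.
  apply: (@le_lt_trans _ _ ((2 * C) ^+ 2 * (M * ep))).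
    apply: (tame_tail (k := df be) (t := t + h) M0 (cstc _ fl) tdf (ltW M0) (lexx M) _ f2) => [|x _|x Mx].
    - exact: mulr_ge0.
    - rewrite (_ : 2 * C = C + C); last by ring.
      by apply: le_trans (ler_normB _ _) _; apply: lerD; [have [] := alC (t + h + 1 * x)|have [] := alC (t + h + -1 * x)].
    - by apply: k0; apply: le_trans Mx; rewrite ge_min ltM.
  apply: (@le_lt_trans _ _ ((2 * C + 1) ^+ 2 * (M * ep))).
    apply: ler_wpM2r; first by rewrite mulr_ge0// ltW.
    by rewrite lerXn2r// ?nnegrE ?mulr_ge0// ?lerDl// ltW.
  rewrite (_ : _ * (M * ep) = (e / 3) ^+ 2 / 2); last by rewrite /ep; field; rewrite !gt_eqF.
  by rewrite ltr_pdivrMr// ltr_pMr ?exprn_gt0// ltr1n.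
have key : (pair V (df be) (t + h) - pair V (df be) t) / h - (pair Y (df be) t - pair X (sm be) t) =
   \int[mu]_(x in `[0, M]) (f x * df be x (t + h)) -
   (pair (fun x _ => Y x t) (df be) t - pair (fun x _ => Y x t) (df be) (t + h)) +
   ((G (t + h) - G t) / h - - pair X (sm be) t).
  rewrite (Rint_eq (g := fun x => h^-1 * (V x (t + h) * df be x (t + h) - V x t * df be x (t + h)) -
      Y x t * df be x (t + h))); last first.
    move=> x; rewrite /= in_itv/= => /andP[x0' _]; rewrite /f patchE; case: ifPn => [_|/negP xD]; first by rewrite /q; ring.
    have -> : df be x (t + h) = 0; last by rewrite !mulr0 subrr mulr0 subrr.
    have [x0|x0] := leP x 0; last first.
      by apply: k0; rewrite leNgt; apply/negP => xm; apply: xD; rewrite mem_setE in_itv/= x0.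
    have -> : x = 0 by apply/eqP; rewrite eq_le x0.
    by rewrite /df !mulr0 subrr.
  have i1 := tame_intg VC (t + h) (t + h) tdf; have i2 := tame_intg VC t (t + h) tdf.
  have i3 := tame_intg YC t (t + h) tdf.
  rewrite (RintB mM (intgZ _ mM (intgB mM i1 i2)) i3) (RintZ _ mM (intgB mM i1 i2)) (RintB mM i1 i2).
  rewrite /G !ext -/(pair V (df be) t) /pair; field.
  exact: hn0.
rewrite key; apply: le_lt_trans (ler_normD _ _) _.
apply: (@lt_le_trans _ _ (e / 3 + e / 3 + e / 3)); last by rewrite le_eqVlt; apply/orP; left; apply/eqP; field.
by apply: ltrD => //; apply: le_lt_trans (ler_normB _ _) _; exact: ltrD.
Qed.

(** [pair Y (df al)] and [pair V (df be)] have the same time derivative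
    [pair Y (df be) - pair X (sm be)]: the first only in the weak sense, by [wave_pairing], the
    second by [pair_derive]. Their difference is therefore constant, and [pair V (df be)] equals
    [- pair X (sm al)] by parts. Here [ux] and [ut] are used as derivatives of one displacement. *)
Lemma momentum_const p q : s < p -> p < q -> q < s' ->
  pair Y (df al) p + pair X (sm al) p = pair Y (df al) q + pair X (sm al) q.
Proof.
move=> sp pq qs'.
have out2 x : x <= c \/ d <= x -> al x = 0 /\ be x = 0 by move=> /out[].
have cbe : continuous be by move=> x; exact: is_derive_continuous (Dbe x).
have tal sg : tame M (fun x t => al (t + sg * x)).
  by apply: (tame_char M sg Dal C0) => x; have [] := alC x.
have tbe sg : tame M (fun x t => be (t + sg * x)).
  by apply: (tame_char M sg Dbe C0) => x; have [] := alC x.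
have tda : tame M (df al) by exact: tameB.
have tdb : tame M (df be) by exact: tameB.
have tsb : tame M (sm be) by exact: tameD.
have JE t : s < t < s' -> pair V (df be) t = - pair X (sm al) t.
  by move=> /andP[st ts']; apply: pair_by_parts => //; rewrite !ltW.
rewrite -[pair X (sm al) p]opprK -[pair X (sm al) q]opprK -!JE; last 2 first.
- by rewrite (lt_trans sp pq).
- by rewrite sp (lt_trans pq qs').
have cK : continuous (pair Y (df al)) := pairing_continuous M0 YC tda.
have cJ : continuous (pair V (df be)) := pairing_continuous M0 VC tdb.
have cP : continuous (pair Y (df be)) := pairing_continuous M0 YC tdb.
have cH : continuous (pair X (sm be)) := pairing_continuous M0 XC tsb.
pose w t := pair Y (df al) t - pair V (df be) t.
have cw : continuous w by move=> t; apply: cvgB; [exact: cK|exact: cJ].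
have near_w t e : 0 < e -> exists2 r : R, 0 < r & forall y, `|y - t| <= r -> `|w y - w t| <= e.
  move=> e0; have /cvgR_epsP/(_ _ e0)[r r0 hr] := cw t.
  exists (r / 2) => [|y yt]; first by rewrite divr_gt0.
  by rewrite distrC ltW// hr// distrC (le_lt_trans yt)// ltr_pdivrMr// ltr_pMr ?ltr1n.
have pT : q < T := lt_le_trans qs' s'T.
have p0 : 0 < p := le_lt_trans s0 sp.
apply: (dhat_pairing (cont_intg 0 T cw) (near_w p) (near_w q) p0 (ltW pq) pT) => k k0.
pose e := Num.min (k / 2) (Num.min ((p - s) / 2) ((s' - q) / 2)).
have e0 : 0 < e by rewrite !lt_min !divr_gt0// subr_gt0.
have [ek [ep eq]] : e < k /\ (s < p - e /\ q + e < s').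
  have : e <= e := lexx _; rewrite {2}/e !le_min => /andP[h1 /andP[h2 h3]].
  by move: (e) h1 h2 h3 k0 sp qs' => r; exact: bump_room.
exists e; first by rewrite e0.
pose th := hat p q e; pose dth := dhat p q e.
have Dth (t : R) : is_derive t 1 th (dth t) := hat_derive p q e t.
have cdth : continuous dth := @dhat_continuous R p q e.
have cth : continuous th by move=> t; exact: is_derive_continuous (Dth t).
have th0 t : ~ (p - e <= t <= q + e) -> th t = 0 /\ dth t = 0.
  move=> /negP; rewrite negb_and -!ltNge => h.
  have h' : t <= p - e \/ q + e <= t by case/orP: h => /ltW; [left|right].
  by rewrite /th /dth hat_out ?dhat_out// ltW.
have := wave_pairing T0 s0 s'T M0 lM geo cux cut weq Dal Dbe alC out2 ep eq Dth cdth th0.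
rewrite -/V -/X -/Y.
pose g t := (pair Y (df be) t - pair X (sm be) t) * th t + pair V (df be) t * dth t.
have Dg (t : R) : is_derive t 1 (fun t => pair V (df be) t * th t) (g t).
  have [tI'|tI'] := boolP (s < t < s').
    exact: is_derive_mulr (pair_derive tI') (Dth t).
  have [tn r0 hr] : exists2 r : R, 0 < r & forall y, `|t - y| < r -> th y = 0 /\ dth y = 0.
    exists (Num.min (p - e - s) (s' - (q + e))); first by rewrite lt_min !subr_gt0 ep.
    by move=> y hy; apply: th0; apply: (away_from ep eq tI' hy).
  have -> : g t = 0 by rewrite /g; have [-> ->] := hr t ltac:(by rewrite subrr normr0); rewrite !mulr0 addr0.
  by apply: (is_derive_locally0 r0) => y /hr[-> _]; rewrite mulr0.
have cm (f h : R -> R) : continuous f -> continuous h -> continuous (fun t => f t * h t).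
  by move=> cf ch t; apply: cvgM; [exact: cf|exact: ch].
have cg : continuous g.
  have c1 : continuous (fun t => pair Y (df be) t - pair X (sm be) t).
    by move=> t; apply: cvgB; [exact: cP|exact: cH].
  by move=> t; apply: cvgD; [exact: (cm _ _ c1 cth)|exact: (cm _ _ cJ cdth)].
have := Rint_derive (ltW T0) Dg cg.
have [-> _] : th T = 0 /\ dth T = 0.
  by apply: th0 => /andP[_]; rewrite leNgt (lt_le_trans eq s'T).
have [-> _] : th 0 = 0 /\ dth 0 = 0.
  by apply: th0 => /andP[+ _]; rewrite leNgt (le_lt_trans s0 ep).
rewrite !mulr0 subrr => Eg Ew.
have cB (f h : R -> R) : continuous f -> continuous h -> continuous (fun t => f t - h t).
  by move=> cf ch t; apply: cvgB; [exact: cf|exact: ch].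
have mT := measurable_itv (`[0, T] : interval R).
have i1 := cont_intg 0 T cg.
have i2 := cont_intg 0 T (cB _ _ (cm _ _ cth (cB _ _ cH cP)) (cm _ _ cdth cK)).
rewrite (Rint_eq (g := fun t => - (g t + (th t * (pair X (sm be) t - pair Y (df be) t) - dth t * pair Y (df al) t)))); last first.
  by move=> t _; rewrite /w /g -/dth; ring.
rewrite (RintN mT (intgD mT i1 i2)) (RintD mT i1 i2) Eg add0r.
by apply/eqP; rewrite oppr_eq0; apply/eqP.
Qed.

End momentum.

(** * Transport of the Riemann invariants *)

Section transport_law.
Context {R : realType}.
Local Notation mu := (@lebesgue_measure R).

Lemma continuous_comp_line (h : R -> R) (a b : R) : continuous h ->
  continuous (fun x : R => h (a + b * x)).
Proof.
move=> ch x; apply: (@continuous_comp _ _ _ (fun x => a + b * x) h); last exact: ch.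
by apply: cvgD; [exact: cvg_cst|apply: cvgM; [exact: cvg_cst|exact: cvg_id]].
Qed.

Lemma room_eps (k p q A B : R) : 0 < k -> A < p -> q < B ->
  exists e, [/\ 0 < e, e < k, e <= 1 & A < p - e /\ q + e < B].
Proof.
move=> k0 Ap qB; pose e := Num.min (Num.min (k / 2) 1) (Num.min ((p - A) / 2) ((B - q) / 2)).
have e0 : 0 < e by rewrite !lt_min !divr_gt0 ?ltr01// subr_gt0.
exists e; have : e <= e := lexx _; rewrite {2}/e !le_min => /andP[/andP[h1 h2] /andP[h3 h4]].
by clearbody e; split => //; [lra|split; lra].
Qed.

Lemma continuous_const_cc (w : R -> R) a b : a < b -> continuous w ->
  (forall p q, a < p -> p < q -> q < b -> w p = w q) ->
  forall p q, a <= p <= b -> a <= q <= b -> w p = w q.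
Proof.
move=> ab cw H.
have h x : a < x < b -> w x = w ((a + b) / 2).
  move=> /andP[ax xb]; have [xl|xl|->//] := ltgtP x ((a + b) / 2); first by apply: H => //; lra.
  by apply/esym/H => //; lra.
have g p : a <= p <= b -> w p = w ((a + b) / 2).
  move=> pab; apply/eqP; rewrite -subr_eq0 -normr_eq0 eq_le normr_ge0 andbT.
  apply/ler_addgt0Pr => e e0; rewrite add0r; have /cvgR_epsP/(_ _ e0)[d d0 hd] := cw p.
  have [x [xab px]] : exists x, a < x < b /\ `|p - x| < d.
    have [pl|pl] := leP p ((a + b) / 2).
      pose r := Num.min (d / 2) ((b - a) / 4).
      have r0 : 0 < r by rewrite lt_min !divr_gt0// subr_gt0.
      have [r1 r2] : r <= d / 2 /\ r <= (b - a) / 4 by rewrite /r !ge_min !lexx orbT.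
      exists (p + r); split; first by move: r0 r1 r2; clearbody r; move: pab => /andP[? ?] *; apply/andP; split; lra.
      by rewrite opprD addrA subrr add0r normrN gtr0_norm//; move: r0 r1; clearbody r => *; lra.
    pose r := Num.min (d / 2) ((b - a) / 4).
    have r0 : 0 < r by rewrite lt_min !divr_gt0// subr_gt0.
    have [r1 r2] : r <= d / 2 /\ r <= (b - a) / 4 by rewrite /r !ge_min !lexx orbT.
    exists (p - r); split; first by move: r0 r1 r2; clearbody r; move: pab => /andP[? ?] *; apply/andP; split; lra.
    by rewrite opprB addrC subrK gtr0_norm//; move: r0 r1; clearbody r => *; lra.
  by rewrite -(h x xab) ltW// hd.
by move=> p q /g-> /g->.
Qed.

Lemma dbump_out e (x : R) : 0 < e -> e <= `|x| -> dbump e x = 0.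
Proof.
move=> e0 ex; rewrite /dbump (_ : Num.max 0 _ = 0) ?mulr0 ?mul0r//.
apply/max_idPl; rewrite subr_le0 -(real_normK (num_real x)).
by rewrite lerXn2r// nnegrE ltW.
Qed.

Definition ddhat p q e x : R := dbump e (x - p) - dbump e (x - q).

Lemma dhat_derive p q e (x : R) : is_derive x 1 (dhat p q e) (ddhat p q e x).
Proof.
have D (r : R) : is_derive x 1 (fun x => bump e (x - r)) (dbump e (x - r)).
  have A := is_derive_affine (- r) 1 x.
  have E : (fun x => bump e (x - r)) = (fun x => bump e (- r + 1 * x)).
    by apply/funext => y; rewrite mul1r addrC.
  by rewrite E; apply: is_derive_eq (is_derive_compr (@bump_derive R e) A) _; rewrite mulr1 mul1r addrC.
exact: is_derive_subr.
Qed.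

Lemma ddhat_continuous p q e : continuous (ddhat p q e).
Proof.
have c r : continuous (fun x : R => dbump e (x - r)).
  move=> x; apply: (@continuous_comp _ _ _ (fun x : R => x - r) (dbump e)); last exact: dbump_continuous.
  by apply: cvgB; [exact: cvg_id|exact: cvg_cst].
by move=> x; apply: cvgB; exact: c.
Qed.

Lemma hat_all_out p q e x : 0 < e -> p <= q -> x <= p - e \/ q + e <= x ->
  [/\ hat p q e x = 0, dhat p q e x = 0 & ddhat p q e x = 0].
Proof.
move=> e0 pq h; split; [exact: hat_out|exact: dhat_out|].
by rewrite /ddhat !dbump_out ?subrr//; rewrite ler_normr; apply/orP; case: h => h; lra.
Qed.

Lemma hat_bounded p q e : 0 < e -> p <= q -> exists C : R, forall x,
  [/\ `|hat p q e x| <= C, `|dhat p q e x| <= C & `|ddhat p q e x| <= C].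
Proof.
move=> e0 pq; have o := hat_all_out e0 pq.
have c0 : continuous (hat p q e) by move=> x; exact: is_derive_continuous (hat_derive p q e x).
have [C1 C10 h1] := compact_support_bounded c0 (fun x q => let: And3 a _ _ := o x q in a).
have [C2 C20 h2] := compact_support_bounded (@dhat_continuous R p q e) (fun x q => let: And3 _ a _ := o x q in a).
have [C3 C30 h3] := compact_support_bounded (@ddhat_continuous p q e) (fun x q => let: And3 _ _ a := o x q in a).
exists (C1 + C2 + C3) => x; split; [apply: le_trans (h1 x) _|apply: le_trans (h2 x) _|apply: le_trans (h3 x) _]; lra.
Qed.

Variables (l : R -> R) (T : R) (v ux ut : R -> R -> R).
Hypotheses (T0 : 0 < T).
Hypothesis l0 : forall t, 0 <= t <= T -> 0 < l t.
Hypothesis Pm : forall t t', 0 <= t -> t <= t' -> t' <= T -> t + l t <= t' + l t'.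
Hypothesis Qm : forall t t', 0 <= t -> t <= t' -> t' <= T -> t - l t <= t' - l t'.
Hypotheses (cux : C0_L2 l T ux) (cv : C1_L2 l T v ut).
Hypothesis weq : wave_equation l T ux ut.
Hypothesis vprim : forall t x, 0 <= t <= T -> 0 <= x <= l t -> v x t = prim ((ux^~ t) \_ `]0, l t[) x.

Let X := curve l T ux.
Let Y := curve l T ut.

(* The derivative of the Riemann invariant: [ux + ut] for [y > 0] and its
   reflection [ux - ut] for [y < 0], extended by zero. *)
Definition fld t y : R := X y t + Y y t + (X (- y) t - Y (- y) t).

Let M := T + l T.
Let lM t : 0 <= t <= T -> l t <= M.
Proof. by move=> /andP[t0 tT]; have := Pm t0 tT (lexx T); rewrite /M; lra. Qed.
Let M0 : 0 < M.
Proof. by rewrite /M addr_gt0// l0// lexx ltW. Qed.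
Let XC : L2curve M X. Proof. exact: C0_L2_curve (ltW T0) cux. Qed.
Let YC : L2curve M Y. Proof. by case: cv => _ h _; exact: C0_L2_curve (ltW T0) h. Qed.

Lemma fld_L2loc t : L2loc (fld t).
Proof.
by apply: L2locD; [exact: L2locD (XC.1 t) (YC.1 t)|apply: L2locB; apply: L2loc_reflect; [exact: XC.1|exact: YC.1]].
Qed.

(** Unfolding at the fixed end: collecting the terms with [al (t + x)] gives [ux + ut] on the
    positive half, and those with [al (t - x)] give [ux - ut], reflected to the negative half. The
    condition at [x = 0] is thereby built in. *)
Lemma momentum_fld (al : R -> R) t : 0 <= t <= T -> continuous al ->
  \int[mu]_(x in `[0, M]) (Y x t * (al (t + 1 * x) - al (t + -1 * x))) +
  \int[mu]_(x in `[0, M]) (X x t * (al (t + 1 * x) + al (t + -1 * x))) =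
  \int[mu]_(y in `[- M, M]) (fld t y * al (t + y)).
Proof.
move=> tT ca; have mM := measurable_itv (`[0, M] : interval R).
have MM : - M <= M by have := M0; lra.
have cs (a : R) : continuous (fun x : R => al (t + a * x)) := @continuous_comp_line al t a ca.
have ii (g : R -> R) (a c d : R) : L2loc g -> intg `[c, d] (fun x => g x * al (t + a * x)).
  move=> gl; have [B B0 hB] := @cont_bounded R c d _ (cs a).
  by apply: (intgM_bounded (M := B)) => //; [apply: measurable_funTS; exact: continuous_measurable_fun|exact: L2loc_intg].
have XYp := L2locD (XC.1 t) (YC.1 t); have XYm := L2locB (XC.1 t) (YC.1 t).
have zero (W : R -> R -> R) x : ~ (0 <= x <= M) -> curve l T W x t = 0.
  by move=> nx; apply: curve_out => // /andP[x0 xl]; apply: nx; rewrite ltW//= (le_trans (ltW xl))// lM.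
rewrite (Rint_eq (D := `[- M, M]%classic) (g := fun y => (X y t + Y y t) * al (t + 1 * y) + (X (- y) t - Y (- y) t) * al (t + 1 * y))); last first.
  by move=> y _; rewrite /fld mul1r; ring.
have XYr : L2loc (fun y => X (- y) t - Y (- y) t) := L2loc_reflect XYm.
rewrite RintD//; [|exact: ii|exact: ii].
have -> : \int[mu]_(y in `[- M, M]) ((X y t + Y y t) * al (t + 1 * y)) =
    \int[mu]_(x in `[0, M]) ((X x t + Y x t) * al (t + 1 * x)).
  apply/esym; apply: Rint_extend => x; rewrite /= !in_itv/=.
    by move=> /andP[x0 ->]; rewrite andbT; split => //; have := M0; lra.
  by move=> _ nx; rewrite /X /Y !zero// addr0 mul0r.
have -> : \int[mu]_(y in `[- M, M]) ((X (- y) t - Y (- y) t) * al (t + 1 * y)) =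
    \int[mu]_(x in `[0, M]) ((X x t - Y x t) * al (t + -1 * x)).
  have := @Rint_reflect R (fun x => (X x t - Y x t) * al (t + -1 * x)) (- M) M.
  rewrite opprK => /(_ (ii _ _ _ _ XYm)) E.
  transitivity (\int[mu]_(x in `[- M, M]) ((X (- x) t - Y (- x) t) * al (t + -1 * - x))).
    by apply: Rint_eq => x _; rewrite mulN1r opprK mul1r.
  rewrite -E; apply/esym; apply: Rint_extend => x; rewrite /= !in_itv/=.
    by move=> /andP[x0 ->]; rewrite andbT; split => //; have := M0; lra.
  by move=> _ nx; rewrite /X /Y !zero// subr0 mul0r.
rewrite -(RintD mM (ii _ 1 _ _ XYp) (ii _ (-1) _ _ XYm)).
have iD (W : R -> R -> R) sg : L2curve M W -> intg `[0, M] (fun x => W x t * (al (t + 1 * x) + sg * al (t + -1 * x))).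
  move=> WC; have := intgD mM (ii (W^~ t) 1 0 M (WC.1 t)) (intgZ sg mM (ii (W^~ t) (-1) 0 M (WC.1 t))).
  by apply: eq_intg => // x _; ring.
rewrite (Rint_eq (f := fun x => Y x t * _) (g := fun x => Y x t * (al (t + 1 * x) + -1 * al (t + -1 * x)))); last first.
  by move=> x _; ring.
rewrite (Rint_eq (f := fun x => X x t * _) (g := fun x => X x t * (al (t + 1 * x) + 1 * al (t + -1 * x)))); last first.
  by move=> x _; ring.
rewrite -(RintD mM (iD Y (-1) YC) (iD X 1 XC)).
by apply: Rint_eq => x _; ring.
Qed.

(** The passage to the primitive in the characteristic variable [z = t + y], in which momenta at
    different times are compared against one kernel [be]. *)
Lemma fld_by_parts (al be : R -> R) t : (forall x : R, is_derive x 1 al (be x)) -> continuous be ->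
  al (t - M) = 0 -> al (t + M) = 0 ->
  \int[mu]_(y in `[- M, M]) (fld t y * al (t + y)) =
  - \int[mu]_(z in `[t - M, t + M]) (prim (fld t) (z - t) * be z).
Proof.
move=> Dal cb aL aR; have fl := fld_L2loc t; have fi := L2loc_locintg fl.
have pf : primitive_of (prim (fld t)) (fld t) by move=> x y xy; rewrite primB.
have M20 : 0 < 2 * M by have := M0; lra.
have ps := primitive_shift (- M) fi pf.
have cal : continuous al by move=> x; exact: is_derive_continuous (Dal x).
have Dpsi (x : R) : is_derive x 1 (fun x => al (t - M + 1 * x)) (be (t - M + 1 * x)).
  by apply: is_derive_eq (is_derive_compr Dal (is_derive_affine (t - M) 1 x)) _; rewrite mulr1.
have cpsi : continuous (fun x : R => be (t - M + 1 * x)) := @continuous_comp_line be (t - M) 1 cb.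
have := Rint_by_parts_primitive M20 (L2loc_shift (- M) fl) ps Dpsi cpsi.
rewrite (_ : t - M + 1 * (2 * M) = t + M); last by ring.
rewrite mulr0 addr0 aL mulr0 => /(_ aR erefl) E.
have cF := prim_continuous fl.
have cs (a : R) : continuous (fun x => prim (fld t) (x + a)).
  move=> x; apply: (@continuous_comp _ _ _ (fun x => x + a) (prim (fld t))); last exact: cF.
  by apply: cvgD; [exact: cvg_id|exact: cvg_cst].
have -> : \int[mu]_(z in `[t - M, t + M]) (prim (fld t) (z - t) * be z) =
    \int[mu]_(x in `[0, 2 * M]) (prim (fld t) (x - M) * be (t - M + 1 * x)).
  have := @Rint_shift R (fun z => prim (fld t) (z - t) * be z) 0 (2 * M) (t - M) (ltW M20).
  rewrite add0r (_ : 2 * M + (t - M) = t + M); last by ring.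
  move=> ->; last by apply: cont_intg => z; apply: cvgM; [exact: cs|exact: cb].
  by apply: Rint_eq => x _; rewrite mul1r (addrC x); congr (prim _ _ * be _); ring.
rewrite E opprK.
have := @Rint_shift R (fun y => fld t y * al (t + y)) 0 (2 * M) (- M) (ltW M20).
rewrite add0r (_ : 2 * M + - M = M); last by ring.
move=> ->; last first.
  have ca2 : continuous (fun y => al (t + y)).
    move=> x; apply: (@continuous_comp _ _ _ (fun x => t + x) al); last exact: cal.
    by apply: cvgD; [exact: cvg_cst|exact: cvg_id].
  have [B B0 hB] := @cont_bounded R (- M) M _ ca2.
  by apply: (intgM_bounded (M := B)) => //; apply: measurable_funTS; exact: continuous_measurable_fun.
by apply: Rint_eq => x _; congr (_ * al _); ring.
Qed.

(** Conservation of momentum for all [al] of the form [hat p q e] says that [prim (fld s) (z - s) -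
    prim (fld s') (z - s')] is constant in [z]. The admissible [z] are the characteristics that stay
    in the domain throughout [s, s']: since both fronts increase, the constraints are [z <= s + l s]
    at the start and [z >= s' - l s'] at the end. *)
Lemma transport_law s s' : 0 <= s -> s < s' -> s' <= T -> forall a b,
  s' - l s' <= a <= s + l s -> s' - l s' <= b <= s + l s ->
  prim (fld s) (a - s) - prim (fld s') (a - s') = prim (fld s) (b - s) - prim (fld s') (b - s').
Proof.
move=> s0 ss' s'T.
have sT : 0 <= s <= T by rewrite s0 (le_trans (ltW ss') s'T).
have s'T2 : 0 <= s' <= T by rewrite s'T (le_trans s0 (ltW ss')).
have cF t c : continuous (fun z => prim (fld t) (z + c)).
  have cf := prim_continuous (fld_L2loc t); move=> x; apply: (@continuous_comp _ _ _ (fun x => x + c) (prim (fld t))); last exact: cf.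
  by apply: cvgD; [exact: cvg_id|exact: cvg_cst].
(* When the interval of admissible characteristics degenerates, only one point can satisfy the
   bounds. *)
have [QP|QP] := ltP (s' - l s') (s + l s); last first.
  have h a : s' - l s' <= a <= s + l s -> a = s + l s.
    by move=> /andP[a1 a2]; apply: le_anti; rewrite a2 (le_trans QP a1).
  by move=> a b /h-> /h->.
pose w z := prim (fld s) (z - s) - prim (fld s') (z - s').
have cw : continuous w by move=> z; apply: cvgB; exact: cF.
apply: (continuous_const_cc QP cw) => p q ap pq qb.
have wnear t e : 0 < e -> exists2 r : R, 0 < r & forall y, `|y - t| <= r -> `|w y - w t| <= e.
  move=> e0; have /cvgR_epsP/(_ _ e0)[r r0 hr] := cw t.
  exists (r / 2) => [|y yt]; first by rewrite divr_gt0.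
  by rewrite distrC ltW// hr// distrC (le_lt_trans yt)// ltr_pdivrMr// ltr_pMr ?ltr1n.
have lp : p - 1 < p by lra.
have lq : q < q + 1 by lra.
apply: (dhat_pairing (cont_intg (p - 1) (q + 1) cw) (wnear p) (wnear q) lp (ltW pq) lq) => k k0.
(* With [e <= 1] the support of [be] lies in [p - 1, q + 1], an interval common to all times and all
   [e]. *)
have [e [e0 ek e1 [ea eb]]] : exists e, [/\ 0 < e, e < k, e <= 1 & s' - l s' < p - e /\ q + e < s + l s].
  exact: room_eps.
exists e; first by rewrite e0.
have [C hC] := hat_bounded e0 (ltW pq); have o := hat_all_out e0 (ltW pq).
pose al := hat p q e; pose be := dhat p q e.
have Dal (x : R) : is_derive x 1 al (be x) := hat_derive p q e x.
have cal : continuous al by move=> x; exact: is_derive_continuous (Dal x).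
have geo t : s <= t <= s' -> t - l t < p - e /\ q + e < t + l t.
  move=> /andP[st ts']; have t0 := le_trans s0 st; have tT := le_trans ts' s'T.
  by split; [exact: le_lt_trans (Qm t0 ts' s'T) ea|exact: lt_le_trans eb (Pm s0 st tT)].
have cN : continuous (fun t => \int[mu]_(x in `[0, M]) (Y x t * (al (t + 1 * x) - al (t + -1 * x))) +
  \int[mu]_(x in `[0, M]) (X x t * (al (t + 1 * x) + al (t + -1 * x)))).
  have C0 : 0 <= C by have [+ _ _] := hC 0; apply: le_trans.
  have tal sg : tame M (fun x t => al (t + sg * x)).
    by apply: (tame_char M sg Dal C0) => x; have [] := hC x.
  by move=> t; apply: cvgD; [exact: (pairing_continuous M0 YC (tameB (tal 1) (tal (-1))))|exact: (pairing_continuous M0 XC (tameD (tal 1) (tal (-1))))].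
have := continuous_const_cc ss' cN (momentum_const T0 s0 s'T M0 l0 lM geo cux cv weq vprim Dal
   (dhat_derive p q e) (@ddhat_continuous p q e) hC o).
have E t : s <= t <= s' -> \int[mu]_(x in `[0, M]) (Y x t * (al (t + 1 * x) - al (t + -1 * x))) +
  \int[mu]_(x in `[0, M]) (X x t * (al (t + 1 * x) + al (t + -1 * x))) =
  - \int[mu]_(z in `[p - 1, q + 1]) (prim (fld t) (z - t) * be z).
  move=> ts; have [g1 g2] := geo t ts; case/andP: (ts) => st ts'.
  have tT : 0 <= t <= T by rewrite (le_trans s0 st) (le_trans ts' s'T).
  have ltM := lM tT.
  have b1 : t - M <= p - e := le_trans (lerB (lexx t) ltM) (ltW g1).
  have b2 : q + e <= t + M := le_trans (ltW g2) (lerD (lexx t) ltM).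
  have b3 : p - 1 <= p - e by rewrite lerD2l lerN2.
  have b4 : q + e <= q + 1 by rewrite lerD2l.
  have z1 : al (t - M) = 0 by have [] := o (t - M) (or_introl b1).
  have z2 : al (t + M) = 0 by have [] := o (t + M) (or_intror b2).
  have cbe := @dhat_continuous R p q e.
  rewrite (momentum_fld tT cal) (fld_by_parts Dal cbe z1 z2).
  have ci a b : intg `[a, b] (fun z => prim (fld t) (z - t) * be z).
    by apply: cont_intg => z; apply: cvgM; [exact: cF|exact: cbe].
  have b0 z : z < p - e \/ q + e < z -> prim (fld t) (z - t) * be z = 0.
    by move=> hz; have [|_ h _] := o z; [case: hz => /ltW; [left|right]|rewrite /be h mulr0].
  have pq2 : p - e <= q + e by rewrite (@le_trans _ _ p) ?gerBl ?(le_trans (ltW pq)) ?lerDl// ltW.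
  by rewrite (Rint_support b1 pq2 b2 (ci _ _) b0) (Rint_support b3 pq2 b4 (ci _ _) b0).
have ss : s <= s <= s' by rewrite lexx ltW.
have s's' : s <= s' <= s' by rewrite lexx ltW.
move=> mc; have Ew := oppr_inj (etrans (esym (E s ss)) (etrans (mc s s' ss s's') (E s' s's'))).
have ci t : intg `[p - 1, q + 1] (fun z => prim (fld t) (z - t) * be z).
  by apply: cont_intg => z; apply: cvgM; [exact: cF|exact: dhat_continuous].
rewrite (Rint_eq (g := fun z => prim (fld s) (z - s) * be z - prim (fld s') (z - s') * be z)); last first.
  by move=> z _; rewrite /w mulrBl.
have mI := measurable_itv (`[p - 1, q + 1] : interval R).
by rewrite (RintB mI (ci s) (ci s')) Ew subrr.
Qed.

End transport_law.

(** * Averages over the boundary layer *)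

Section averages.
Context {R : realType}.
Local Notation mu := (@lebesgue_measure R).

Lemma Rint_ae_eq (D : set R) (f g : R -> R) : measurable D -> measurable_fun D f -> measurable_fun D g ->
  {ae mu, forall x, D x -> f x = g x} -> \int[mu]_(x in D) f x = \int[mu]_(x in D) g x.
Proof.
move=> mD mf mg fg; congr fine; apply: ae_eq_integral => //.
- exact/measurable_EFinP.
- exact/measurable_EFinP.
- by apply: negligibleS fg => x; apply: contra_not => h Dx /=; rewrite h.
Qed.

Lemma prim_curve_continuous M (W : R -> R -> R) (k : R -> R) : 0 < M -> L2curve M W -> continuous k ->
  (forall t, 0 <= k t <= M) -> continuous (fun t => prim (W^~ t) (k t)).
Proof.
move=> M0 WC ck kM t; apply/cvgR_epsP => e e0; have e2 : 0 < e / 2 by rewrite divr_gt0.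
have [d1 d10 h1] := curve_L1 M0 WC t e2.
have cp : continuous (fun s => prim (W^~ t) (k s)).
  by move=> s; apply: continuous_comp; [exact: ck|exact: (prim_continuous (WC.1 t))].
have /cvgR_epsP/(_ _ e2)[d2 d20 h2] := cp t.
exists (Num.min d1 d2); first by rewrite lt_min d10.
move=> s; rewrite lt_min => /andP[/h1 a1 /h2 a2].
rewrite (_ : _ - _ = (prim (W^~ t) (k t) - prim (W^~ t) (k s)) - (prim (W^~ s) (k s) - prim (W^~ t) (k s))); last by ring.
apply: le_lt_trans (ler_normB _ _) _; rewrite [ltRHS](splitr e); apply: ltrD => //.
apply: le_lt_trans a1; have /andP[k0 k1] := kM s.
rewrite /prim k0; have mI := measurable_itv (`[0, k s] : interval R).
have li r := L2loc_intg 0 (k s) (WC.1 r).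
rewrite -(RintB mI (li s) (li t)).
apply: le_trans (Rint_norm mI (intgB mI (li s) (li t))) _.
have WB := L2locB (WC.1 s) (WC.1 t).
apply: Rint_sub_le => //; [exact: subset_itvl|by apply: intg_norm => //; exact: L2loc_intg WB].
Qed.

(** The mean of [w] over the layer of width [e], written with primitives: it is continuous in [t]
    for small [e], which supplies the measurability in time. *)
Definition average (l : R -> R) T (w : R -> R -> R) e t : R :=
  e^-1 * (prim ((curve l T w)^~ t) (l (clamp T t)) - prim ((curve l T w)^~ t) (l (clamp T t) - e)).

Lemma clamp_continuous T : 0 <= T -> continuous (@clamp R T).
Proof.
move=> T0 t; apply/cvgR_epsP => e e0; exists e => // s; apply: le_lt_trans.
by have [_ _ h] := clampP t T0; exact: h.
Qed.

Section one_trace.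
Variables (l : R -> R) (T m : R) (w : R -> R -> R).
Hypotheses (T0 : 0 < T) (m0 : 0 < m) (cl : continuous l).
Hypothesis ml : forall t, 0 <= t <= T -> m <= l t.
Hypothesis cw : C0_L2 l T w.

Lemma average_continuous e : 0 < e -> e < m -> continuous (average l T w e).
Proof.
move=> e0 em; have [M [M0 lM]] : exists M, 0 < M /\ forall t, 0 <= t <= T -> l t <= M.
  have [B B0 hB] := @cont_bounded R 0 T l cl; exists (B + 1); split; first lra.
  by move=> t /hB; rewrite ler_norml => /andP[_]; lra.
have WC : L2curve M (curve l T w) := C0_L2_curve M (ltW T0) cw.
have cc : continuous (fun t => l (clamp T t)).
  by move=> t; apply: continuous_comp; [exact: (clamp_continuous (ltW T0))|exact: cl].
have lc t : m <= l (clamp T t) <= M by have [h _ _] := clampP t (ltW T0); rewrite ml//= lM.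
move=> t; apply: cvgM; first exact: cvg_cst.
apply: cvgB.
  apply: (prim_curve_continuous M0 WC cc) => s; have /andP[h1 h2] := lc s.
  by rewrite h2 andbT; lra.
have cc2 : continuous (fun t => l (clamp T t) - e) by move=> s; apply: cvgB; [exact: cc|exact: cvg_cst].
apply: (prim_curve_continuous M0 WC cc2) => s; have /andP[h1 h2] := lc s.
by apply/andP; split; lra.
Qed.

(** The square of the layer mean of [w - p t] is at most the mean of its square, which is what
    [moving_trace] sends to 0. The bound [e < m] keeps the layer inside []0, l t[]. *)
Lemma trace_average p delta : moving_trace l T w p -> 0 < delta ->
  exists2 e0 : R, 0 < e0 & forall e, 0 < e < e0 ->
  (\int[mu]_(t in `]0%R, T[) ((average l T w e t - p t) ^+ 2)%:E <= delta%:E)%E.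
Proof.
move=> [/L2P-/(_ (measurable_itv _))[mp _] tr] d0.
have nn : forall e : R, (0 <= (e^-1)%:E * \int[mu]_(t in `]0%R, T[)
    \int[mu]_(x in `](l t - e)%R, l t[) ((w x t - p t) ^+ 2)%:E)%E.
  move=> e; have [e0|e0] := leP 0 e.
    apply: mule_ge0; first by rewrite lee_fin invr_ge0.
    by apply: integral_ge0 => t _; apply: integral_ge0 => x _; rewrite lee_fin sqr_ge0.
  rewrite integral0_eq ?mule0// => t _; rewrite set_itv_ge ?integral_set0//.
  by rewrite bnd_simp -leNgt; lra.
have [+ _] := @cvge0P R _ (0^'+ : set_system R) _ _ nn; move=> /(_ tr _ d0)/near_right0P[d1 d10 h1].
exists (Num.min d1 m); first by rewrite lt_min d10.
move=> e /andP[e0]; rewrite lt_min => /andP[ed em].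
have := h1 e; rewrite e0 ed => /(_ isT) {}h1.
have mI := measurable_itv (`]0, T[ : interval R).
have ma : measurable_fun `]0, T[ (fun t => (average l T w e t - p t) ^+ 2).
  apply: measurable_funX; apply: measurable_funB => //; apply: measurable_funTS.
  exact: continuous_measurable_fun (average_continuous e0 em).
rewrite -(@lee_pmul2l _ e%:E)//; apply: (@le_trans _ _ (\int[mu]_(t in `]0%R, T[)
    \int[mu]_(x in `](l t - e)%R, l t[) ((w x t - p t) ^+ 2)%:E)%E); last first.
  by move: h1; rewrite -(@lee_pmul2l _ e%:E)// muleA -EFinM mulfV ?gt_eqF// mul1e.
rewrite -ge0_integralZl//; last 3 first.
- exact/measurable_EFinP.
- by move=> t _; rewrite lee_fin sqr_ge0.
- by rewrite lee_fin ltW.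
apply: ge0_le_lower_integral => t; rewrite /= in_itv/= => /andP[t0 tT].
  by rewrite mule_ge0// lee_fin ?sqr_ge0// ltW.
have tI : 0 <= t <= T by rewrite !ltW.
have lt0 := ml tI.
pose W := (curve l T w)^~ t.
have Wl : L2loc W := (C0_L2_curve m (ltW T0) cw).1 t.
have cl' : L2loc (fun _ : R => p t) by apply: L2loc_cont => x; exact: cvg_cst.
have fl : L2loc (fun x => W x - p t) := L2locB Wl cl'.
have le1 : l t - e <= l t by rewrite gerBl ltW.
have mJ := measurable_itv (`[l t - e, l t] : interval R).
have E : \int[mu]_(x in `[l t - e, l t]) (W x - p t) = e * (average l T w e t - p t).
  rewrite RintB//; [|exact: L2loc_intg|exact: (intg_cst _ mJ (mu_itv_cc_fin _ _))].
  rewrite Rint_cst// -primB//; last exact: L2loc_locintg.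
  by rewrite /average; have [_ /(_ tI) -> _] := clampP t (ltW T0); rewrite -/W; field; rewrite gt_eqF.
have := Rint_sqr_le_itv le1 (L2loc_sqint _ _ fl); rewrite E.
have -> : l t - (l t - e) = e by ring.
rewrite exprMn expr2 -mulrA ler_pM2l// => hh.
apply: (@le_trans _ _ (\int[mu]_(x in `[l t - e, l t]) (W x - p t) ^+ 2)%:E).
  by rewrite -EFinM lee_fin.
rewrite -(Rint_oo_cc (fl.2 _ _)) Rint_EFin//; last first.
  by apply: intgS (fl.2 (l t - e) (l t)) => //; exact: subset_itv_oo_cc.
rewrite le_eqVlt; apply/orP; left; apply/eqP; apply: eq_integral => x; rewrite mem_setE in_itv/= => /andP[x1 x2].
by rewrite /W curve_in// x2 andbT; apply: le_lt_trans x1; lra.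
Qed.

End one_trace.

Lemma integral_sqr4_le (D : set R) (f1 f2 f3 f4 : R -> R) k1 k2 k3 k4 delta : measurable D ->
  measurable_fun D f1 -> measurable_fun D f2 -> measurable_fun D f3 -> measurable_fun D f4 ->
  k1 ^+ 2 = 1 -> k2 ^+ 2 = 1 -> k3 ^+ 2 = 1 -> k4 ^+ 2 = 1 ->
  (\int[mu]_(x in D) ((f1 x) ^+ 2)%:E <= delta%:E)%E ->
  (\int[mu]_(x in D) ((f2 x) ^+ 2)%:E <= delta%:E)%E ->
  (\int[mu]_(x in D) ((f3 x) ^+ 2)%:E <= delta%:E)%E ->
  (\int[mu]_(x in D) ((f4 x) ^+ 2)%:E <= delta%:E)%E ->
  (\int[mu]_(x in D) ((k1 * f1 x + k2 * f2 x + (k3 * f3 x + k4 * f4 x)) ^+ 2)%:E <= (16 * delta)%:E)%E.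
Proof.
move=> mD m1 m2 m3 m4 e1 e2 e3 e4 h1 h2 h3 h4.
have sgn (f : R -> R) k : k ^+ 2 = 1 -> (\int[mu]_(x in D) ((f x) ^+ 2)%:E <= delta%:E)%E ->
    (\int[mu]_(x in D) ((k * f x) ^+ 2)%:E <= delta%:E)%E.
  by move=> ek; apply: le_trans; rewrite le_eqVlt; apply/orP; left; apply/eqP; apply: eq_integral => x _; rewrite exprMn ek mul1r.
have mk (f : R -> R) k : measurable_fun D f -> measurable_fun D (fun x => k * f x) by move=> mf; exact: measurable_funM.
have a := integral_sqrD_le mD (mk _ k1 m1) (mk _ k2 m2) (sgn _ _ e1 h1) (sgn _ _ e2 h2).
have b := integral_sqrD_le mD (mk _ k3 m3) (mk _ k4 m4) (sgn _ _ e3 h3) (sgn _ _ e4 h4).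
have := integral_sqrD_le mD (measurable_funD (mk _ k1 m1) (mk _ k2 m2)) (measurable_funD (mk _ k3 m3) (mk _ k4 m4)) a b.
by rewrite (_ : 2 * _ + 2 * _ = 16 * delta)//; ring.
Qed.

(** The curves vanish at nonpositive arguments, so only one of the two halves of [fld] is present on
    either side of 0. *)
Lemma fld_prim (l : R -> R) T (ux ut : R -> R -> R) t y : 0 <= T -> C0_L2 l T ux -> C0_L2 l T ut -> 0 <= t <= T -> 0 <= y ->
  prim (fld l T ux ut t) y = prim ((curve l T ux)^~ t) y + prim ((curve l T ut)^~ t) y /\
  prim (fld l T ux ut t) (- y) = - (prim ((curve l T ux)^~ t) y - prim ((curve l T ut)^~ t) y).
Proof.
move=> T0 cux cut tT y0.
have XL := (C0_L2_curve 1 T0 cux).1 t; have YL := (C0_L2_curve 1 T0 cut).1 t.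
set X := curve l T ux in XL *; set Y := curve l T ut in YL *.
have zero (W : R -> R -> R) z : z <= 0 -> curve l T W z t = 0.
  by move=> z0; apply: curve_out => // /andP[]; rewrite ltNge z0.
have fi : locintg (fld l T ux ut t).
  by apply: L2loc_locintg; apply: L2locD; [exact: L2locD|exact: (L2loc_reflect (L2locB XL YL))].
have m0 : measurable `[0, y]%classic := measurable_itv (`[0, y] : interval R).
have iX := L2loc_intg 0 y XL; have iY := L2loc_intg 0 y YL.
rewrite /prim y0 -(RintD m0 iX iY) -(RintB m0 iX iY); split.
  apply: Rint_eq => z; rewrite /= in_itv/= => /andP[z0 _].
  by rewrite /fld /X /Y !(zero _ (- z)) ?subrr ?addr0// oppr_le0.
have -> : (if 0 <= - y then \int[mu]_(z in `[0, - y]) fld l T ux ut t z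
    else - \int[mu]_(z in `[- y, 0]) fld l T ux ut t z) = - \int[mu]_(z in `[- y, 0]) fld l T ux ut t z.
  case: ifPn => // y1; have -> : y = 0 by apply/eqP; rewrite eq_le y0 andbT -oppr_ge0.
  by rewrite oppr0 Rint_itv1 oppr0.
congr (- _); have := @Rint_reflect R (fld l T ux ut t) 0 y; rewrite oppr0 => ->; last exact: fi.
apply: Rint_eq => z; rewrite /= in_itv/= => /andP[z0 _].
by rewrite /fld opprK /X /Y !(zero _ (- z)) ?add0r// oppr_le0.
Qed.

End averages.

Lemma sub_transport {R : realType} (a1 b1 c1 d1 a2 b2 c2 d2 : R) : a1 - c1 = b1 - d1 ->
  a2 - c2 = b2 - d2 -> (a1 - a2) - (b1 - b2) = (c1 - c2) - (d1 - d2).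
Proof. by move=> *; lra. Qed.

(** The boundary relation solved for [a]: the factor [1 + eta] is at least 1, [1 + k] is at least
    [1 / C], and [1 - k] is below 2. *)
Lemma front_alg {R : realType} (eta k a b C : R) : 0 <= eta -> 0 < 1 + k -> 0 < 1 - k -> 1 <= C * (1 + k) ->
  (1 + eta) * (1 + k) * a + (1 - eta) * (1 - k) * b = 0 -> a ^+ 2 <= (2 * C * (1 - eta)) ^+ 2 * b ^+ 2.
Proof.
move=> e0 k1 k2 hC E; have C0 : 0 < C by rewrite -(pmulr_lgt0 _ k1) (lt_le_trans ltr01).
have h1 : 1 <= C * (1 + k) * (1 + eta) by nra.
have h2 : (C * (1 + k) * (1 + eta) * a) ^+ 2 = (C * (1 - eta) * (1 - k) * b) ^+ 2.
  by rewrite -[RHS]sqrrN; congr (_ ^+ 2); transitivity (C * ((1 + eta) * (1 + k) * a)); [ring|rewrite (_ : (1 + eta) * (1 + k) * a = - ((1 - eta) * (1 - k) * b)); [ring|lra]].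
apply: (@le_trans _ _ ((C * (1 + k) * (1 + eta) * a) ^+ 2)).
  by rewrite exprMn ler_peMl ?sqr_ge0// expr_ge1// (le_trans ler01 h1).
rewrite h2 (_ : C * (1 - eta) * (1 - k) * b = (1 - k) * (C * (1 - eta) * b)); last by ring.
rewrite (_ : (2 * C * (1 - eta)) ^+ 2 * b ^+ 2 = 2 ^+ 2 * (C * (1 - eta) * b) ^+ 2); last by ring.
rewrite exprMn ler_wpM2r ?sqr_ge0// lerXn2r ?nnegrE ?(ltW k2)//; lra.
Qed.

Lemma avg_alg1 {R : realType} (e a b c d a' b' c' d' : R) :
  (a + b - (c + d) - (a' + b' - (c' + d'))) / e =
  e^-1 * (a - a') + e^-1 * (b - b') - (e^-1 * (c - c') + e^-1 * (d - d')).
Proof. by rewrite [LHS]mulrC; ring. Qed.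

Lemma avg_alg2 {R : realType} (e a b c d a' b' c' d' : R) :
  ((c' - d' - (a' - b')) - (c - d - (a - b))) / e =
  e^-1 * (a - a') - e^-1 * (b - b') - (e^-1 * (c - c') - e^-1 * (d - d')).
Proof. by rewrite [LHS]mulrC; ring. Qed.

Lemma no_back {R : realType} (A m L x y : R) : L <= A -> m <= L -> 0 < L -> x - y = A - m ->
  x - y <= 0 - L -> False.
Proof. by move=> *; lra. Qed.

Lemma front_gain {R : realType} (A m x y : R) : x - y = A - m -> m <= y -> A + m <= x + y.
Proof. by move=> *; lra. Qed.

Lemma odd_part_eq {R : realType} (a1 b1 a2 b2 v1 v2 : R) : a1 - b1 = 2 * v1 -> a2 - b2 = 2 * v2 ->
  a1 - a2 = b1 - b2 -> v1 = v2.
Proof. by move=> *; lra. Qed.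

(** * Reflections and uniqueness *)

Section uniqueness.
Context {R : realType}.
Local Notation mu := (@lebesgue_measure R).
Variables (eta : R) (l dl : R -> R) (T : R) (u0 u1 : R -> R).
Hypotheses (eta0 : 0 <= eta) (T0 : 0 < T).
Hypothesis Pd : diffeo (fun t => t + l t) (fun t => 1 + dl t).
Hypothesis Qd : diffeo (fun t => t - l t) (fun t => 1 - dl t).
Hypothesis l0 : forall t, 0 <= t <= T -> 0 < l t.

Let P t : R := t + l t.
Let Q t : R := t - l t.
Let Ple a b : (P a <= P b) = (a <= b). Proof. exact: (diffeo_le Pd). Qed.
Let Qle a b : (Q a <= Q b) = (a <= b). Proof. exact: (diffeo_le Qd). Qed.
Let cl : continuous l := front_continuous Pd.
Let l0' t : 0 <= t <= T -> 0 < l t. Proof. exact: l0. Qed.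

Section one_solution.
Variables v ux ut : R -> R -> R.
Hypothesis sol : wave_solution_with l dl T eta u0 u1 v ux ut.

Let cux : C0_L2 l T ux. Proof. by case: (sol_C0 sol). Qed.
Let cut : C0_L2 l T ut. Proof. by case: (sol_C1 sol). Qed.

Lemma solution_prim t x : 0 <= t <= T -> 0 <= x <= l t -> v x t = prim ((ux^~ t) \_ `]0, l t[) x.
Proof.
move=> tT xl; have [h _ _] := sol_C0 sol; have [H v0] := h t tT.
by rewrite (H1_primitive (l0' tT) H xl) v0 add0r.
Qed.

Lemma solution_transport s s' : 0 <= s -> s < s' -> s' <= T -> forall a b,
  Q s' <= a <= P s -> Q s' <= b <= P s ->
  prim (fld l T ux ut s) (a - s) - prim (fld l T ux ut s') (a - s') =
  prim (fld l T ux ut s) (b - s) - prim (fld l T ux ut s') (b - s').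
Proof.
move=> s0 ss' s'T; apply: (transport_law T0 l0' _ _ cux (sol_C1 sol) (sol_wave sol) solution_prim s0 ss' s'T).
- by move=> t t' _ tt' _; rewrite (Ple t t').
- by move=> t t' _ tt' _; rewrite (Qle t t').
Qed.

Lemma solution_value t x : 0 <= t <= T -> 0 <= x <= l t ->
  prim (fld l T ux ut t) x - prim (fld l T ux ut t) (- x) = 2 * v x t.
Proof.
move=> tT xl; have /andP[x0 _] := xl; have [-> ->] := fld_prim (ltW T0) cux cut tT x0.
rewrite (solution_prim tT xl); have -> : (ux^~ t) \_ `]0, l t[ = (curve l T ux)^~ t.
  by rewrite /curve; have [_ /(_ tT) -> _] := clampP t (ltW T0).
ring.
Qed.

End one_solution.

Variables (v1 ux1 ut1 v2 ux2 ut2 : R -> R -> R).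
Hypothesis sol1 : wave_solution_with l dl T eta u0 u1 v1 ux1 ut1.
Hypothesis sol2 : wave_solution_with l dl T eta u0 u1 v2 ux2 ut2.

Let cux1 : C0_L2 l T ux1. Proof. by case: (sol_C0 sol1). Qed.
Let cut1 : C0_L2 l T ut1. Proof. by case: (sol_C1 sol1). Qed.
Let cux2 : C0_L2 l T ux2. Proof. by case: (sol_C0 sol2). Qed.
Let cut2 : C0_L2 l T ut2. Proof. by case: (sol_C1 sol2). Qed.
(** The two solutions are compared through the primitive [D] of [d]. Only increments of [D] are
    meaningful, as transport holds up to a constant. *)
Let d t y := fld l T ux1 ut1 t y - fld l T ux2 ut2 t y.
Let D t := prim (d t).
Let fL (ux ut : R -> R -> R) t : C0_L2 l T ux -> C0_L2 l T ut -> L2loc (fld l T ux ut t).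
Proof.
move=> cux cut; have XL := (C0_L2_curve 1 (ltW T0) cux).1 t; have YL := (C0_L2_curve 1 (ltW T0) cut).1 t.
by apply: L2locD; [exact: L2locD|exact: (L2loc_reflect (L2locB XL YL))].
Qed.
Let dL t : L2loc (d t). Proof. exact: L2locB (fL t cux1 cut1) (fL t cux2 cut2). Qed.
Let DE t y : D t y = prim (fld l T ux1 ut1 t) y - prim (fld l T ux2 ut2 t) y.
Proof.
have i1 := L2loc_locintg (fL t cux1 cut1); have i2 := L2loc_locintg (fL t cux2 cut2).
rewrite /D /prim; case: ifP => _; first by rewrite RintB.
by rewrite RintB//; ring.
Qed.

Let Dtr s s' : 0 <= s -> s < s' -> s' <= T -> forall a b, Q s' <= a <= P s -> Q s' <= b <= P s ->
  D s (a - s) - D s (b - s) = D s' (a - s') - D s' (b - s').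
Proof.
move=> s0 ss' s'T a b ha hb; rewrite !DE.
exact: sub_transport (solution_transport sol1 s0 ss' s'T ha hb) (solution_transport sol2 s0 ss' s'T ha hb).
Qed.

Let Dpos t y : 0 <= t <= T -> 0 <= y ->
  D t y = (prim ((curve l T ux1)^~ t) y + prim ((curve l T ut1)^~ t) y) -
          (prim ((curve l T ux2)^~ t) y + prim ((curve l T ut2)^~ t) y) /\
  D t (- y) = (prim ((curve l T ux2)^~ t) y - prim ((curve l T ut2)^~ t) y) -
          (prim ((curve l T ux1)^~ t) y - prim ((curve l T ut1)^~ t) y).
Proof.
move=> tT y0; rewrite !DE; have [-> ->] := fld_prim (ltW T0) cux1 cut1 tT y0.
by have [-> ->] := fld_prim (ltW T0) cux2 cut2 tT y0; split; ring.
Qed.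

Let T00 : 0 <= (0 : R) <= T. Proof. by rewrite lexx ltW. Qed.
Let L := l 0.
Let L0 : 0 < L. Proof. exact: l0 T00. Qed.

(** The initial displacements agree pointwise, and are the primitives of [ux] at time 0; the
    velocities agree almost everywhere, hence have the same primitive. *)
Let init_eq y : 0 <= y < L ->
  prim ((curve l T ux1)^~ 0) y = prim ((curve l T ux2)^~ 0) y /\
  prim ((curve l T ut1)^~ 0) y = prim ((curve l T ut2)^~ 0) y.
Proof.
move=> /andP[y0 yL]; have yl : 0 <= y <= l 0 by rewrite y0 ltW.
have XE ux : (curve l T ux)^~ 0 = (ux^~ 0) \_ `]0, l 0[.
  by rewrite /curve; have [_ /(_ T00) -> _] := clampP 0 (ltW T0).
split.
  rewrite !XE -(solution_prim sol1 T00 yl) -(solution_prim sol2 T00 yl).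
  have [->|yn] := eqVneq y 0.
    by rewrite (solution_prim sol1) ?(solution_prim sol2)// ?lexx ?ltW//= !prim0.
  by rewrite (sol_init sol1) ?(sol_init sol2)// yL andbT lt_neqAle eq_sym yn.
rewrite /prim y0.
have mY ut (c : C0_L2 l T ut) : measurable_fun `[0, y] ((curve l T ut)^~ 0).
  by apply: measurable_funTS; exact: ((C0_L2_curve 1 (ltW T0) c).1 0).1.
apply: Rint_ae_eq; [by []|exact: mY|exact: mY|].
have := negligibleU (sol_init_t sol1) (sol_init_t sol2); apply: negligibleS => x /=.
apply: contra_notP => /not_orP[/contrapT h1 /contrapT h2]; rewrite in_itv/= => /andP[x0 xy].
have [xp|xn] := pselect (0 < x < l 0); last by rewrite !curve_out.
by rewrite !curve_in// h1// h2.
Qed.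

Let D0 a b : - L <= a <= L -> - L <= b <= L -> D 0 a = D 0 b.
Proof.
have z y : - L < y -> y < L -> D 0 y = 0.
  move=> y1 y2; have [y0|y0] := leP 0 y.
    by have [-> _] := Dpos T00 y0; have [|-> ->] := @init_eq y; [rewrite y0|rewrite subrr].
  have ny0 : 0 <= - y by rewrite oppr_ge0 ltW.
  have [_ +] := Dpos T00 ny0; rewrite opprK => ->.
  by have [|-> ->] := @init_eq (- y); [rewrite ny0 -ltrN2 opprK|rewrite subrr].
have LL : - L < L by have := L0; lra.
apply: (continuous_const_cc LL (prim_continuous (dL 0))) => p q p1 pq q1.
by rewrite -/(D 0 p) -/(D 0 q) !z// ?(lt_trans p1 pq)// (lt_trans pq q1).
Qed.

(* [zone A]: the difference of the two solutions vanishes on the characteristics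
   [t + y <= A]. *)
Let zone A := forall t, 0 <= t <= T -> forall a b, Q t <= a <= P t -> a <= A ->
  Q t <= b <= P t -> b <= A -> D t (a - t) = D t (b - t).

(** A characteristic with [t + y <= L] that is in the domain at time [t] can be followed back to
    time 0 without meeting the moving end, and there the invariants agree. *)
Let zone0 : zone L.
Proof.
move=> t /andP[t0 tT] a b /andP[a1 a2] aL /andP[b1 b2] bL.
have [tp|tn|E] := ltgtP 0 t.
- have h x : Q t <= x -> x <= L -> Q t <= x <= P 0 by move=> -> /=; rewrite /P add0r.
  have h' x : Q t <= x -> x <= L -> - L <= x - 0 <= L.
    move=> x1 xL; rewrite subr0 xL andbT; apply: le_trans x1.
    by have := t0; rewrite -Qle /Q sub0r.
  have := Dtr (lexx 0) tp tT (h a a1 aL) (h b b1 bL).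
  by rewrite (D0 (h' a a1 aL) (h' b b1 bL)) subrr => /esym/eqP; rewrite subr_eq0 => /eqP.
- by move: tn; rewrite ltNge t0.
- have h' x : Q t <= x -> x <= L -> - L <= x - t <= L.
    by rewrite -E /Q sub0r subr0 => -> ->.
  by rewrite -{1}E -{1}E; move: (D0 (h' a a1 aL) (h' b b1 bL)); rewrite -E.
Qed.

Variable m : R.
Hypotheses (m0 : 0 < m) (ml : forall t, 0 <= t <= T -> m <= l t).

(** [r] and [r'] are the traces of [ux + ut] and [ux - ut] for the difference of the solutions.
    Layer averages of these are increments of [D] near [l t] and near [- l t]. *)
Let boundary_data : exists r r' : R -> R, [/\ measurable_fun `]0, T[ r, measurable_fun `]0, T[ r',
  {ae mu, forall t, 0 < t < T -> (1 + eta) * (1 + dl t) * r t + (1 - eta) * (1 - dl t) * r' t = 0} &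
  forall delta, 0 < delta -> exists2 e0 : R, 0 < e0 & forall e, 0 < e < e0 ->
    (\int[mu]_(t in `]0%R, T[) (((D t (l t) - D t (l t - e)) / e - r t) ^+ 2)%:E <= (16 * delta)%:E)%E /\
    (\int[mu]_(t in `]0%R, T[) (((D t (- (l t - e)) - D t (- l t)) / e - r' t) ^+ 2)%:E <= (16 * delta)%:E)%E].
Proof.
have [p1 [q1 [tp1 tq1 bc1]]] := sol_moving_end sol1.
have [p2 [q2 [tp2 tq2 bc2]]] := sol_moving_end sol2.
have mt (w : R -> R -> R) (p : R -> R) : moving_trace l T w p -> measurable_fun `]0, T[ p.
  by case=> /L2P-/(_ (measurable_itv _))[].
have [mp1 mq1 mp2 mq2] := And4 (mt _ _ tp1) (mt _ _ tq1) (mt _ _ tp2) (mt _ _ tq2).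
exists (fun t => p1 t + q1 t - (p2 t + q2 t)), (fun t => p1 t - q1 t - (p2 t - q2 t)); split.
- by apply: measurable_funB; exact: measurable_funD.
- by apply: measurable_funB; exact: measurable_funB.
- have := negligibleU bc1 bc2; apply: negligibleS => t /=.
  apply: contra_notP => /not_orP[/contrapT h1 /contrapT h2] tT.
  have := h1 tT; have := h2 tT; move: (p1 t) (q1 t) (p2 t) (q2 t) (dl t) => a b c f k.
  (* The factor 2 comes from passing from (ux, ut) to the invariants: [(1 + eta) * (1 + k) + (1 -
     eta) * (1 - k)] is twice [1 + eta * k], and the difference of the two products is twice
     [eta + k]. *)
  by move=> e2 e1; rewrite (_ : _ + _ = 2 * ((1 + eta * k) * a + (eta + k) * b) - 2 * ((1 + eta * k) * c + (eta + k) * f)); [rewrite e1 e2; ring|ring].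
move=> delta dd0.
have [a1 a10 h1] := trace_average T0 m0 cl ml cux1 tp1 dd0.
have [a2 a20 h2] := trace_average T0 m0 cl ml cut1 tq1 dd0.
have [a3 a30 h3] := trace_average T0 m0 cl ml cux2 tp2 dd0.
have [a4 a40 h4] := trace_average T0 m0 cl ml cut2 tq2 dd0.
exists (Num.min (Num.min (Num.min a1 a2) (Num.min a3 a4)) m); first by rewrite !lt_min a10 a20 a30 a40.
move=> e /andP[e0]; rewrite !lt_min => /andP[/andP[/andP[e1 e2] /andP[e3 e4]] em].
have mD := measurable_itv (`]0, T[ : interval R).
have ma (w : R -> R -> R) (p : R -> R) : C0_L2 l T w -> measurable_fun `]0, T[ p -> measurable_fun `]0, T[ (fun t => average l T w e t - p t).
  move=> cw mp; apply: measurable_funB => //; apply: measurable_funTS; apply: continuous_measurable_fun.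
  have ac := @average_continuous R l T m w T0 cl ml cw e e0 em; exact: ac.
have K k1 k2 k3 k4 := @integral_sqr4_le R _ _ _ _ _ k1 k2 k3 k4 delta mD (ma _ _ cux1 mp1) (ma _ _ cut1 mq1) (ma _ _ cux2 mp2) (ma _ _ cut2 mq2).
have s1 : 1 ^+ 2 = 1 :> R by rewrite expr1n.
have sN : (-1) ^+ 2 = 1 :> R by rewrite sqrrN expr1n.
have b1 := h1 e; rewrite e0 e1 in b1; have {}b1 := b1 isT.
have b2 := h2 e; rewrite e0 e2 in b2; have {}b2 := b2 isT.
have b3 := h3 e; rewrite e0 e3 in b3; have {}b3 := b3 isT.
have b4 := h4 e; rewrite e0 e4 in b4; have {}b4 := b4 isT.
have avE t (w : R -> R -> R) : 0 <= t <= T -> average l T w e t = e^-1 * (prim ((curve l T w)^~ t) (l t) - prim ((curve l T w)^~ t) (l t - e)).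
  by move=> tT; rewrite /average; have [_ /(_ tT) -> _] := clampP t (ltW T0).
split.
- have := K 1 1 (-1) (-1) s1 s1 sN sN b1 b2 b3 b4; apply: le_trans; rewrite le_eqVlt; apply/orP; left; apply/eqP.
  apply: eq_integral => t; rewrite mem_setE in_itv/= => /andP[t0 tT]; congr ((_ ^+ 2)%:E).
  have tI : 0 <= t <= T by rewrite !ltW.
  have lp : 0 <= l t by rewrite ltW// l0'.
  have lp2 : 0 <= l t - e by rewrite subr_ge0 (le_trans (ltW em))// ml.
  rewrite !avE//; have [-> _] := Dpos tI lp; have [-> _] := Dpos tI lp2.
  by rewrite !(mulrC _ e^-1); ring.
- have := K 1 (-1) (-1) 1 s1 sN sN s1 b1 b2 b3 b4; apply: le_trans; rewrite le_eqVlt; apply/orP; left; apply/eqP.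
  apply: eq_integral => t; rewrite mem_setE in_itv/= => /andP[t0 tT]; congr ((_ ^+ 2)%:E).
  have tI : 0 <= t <= T by rewrite !ltW.
  have lp : 0 <= l t by rewrite ltW// l0'.
  have lp2 : 0 <= l t - e by rewrite subr_ge0 (le_trans (ltW em))// ml.
  rewrite !avE//; have [_ ->] := Dpos tI lp; have [_ ->] := Dpos tI lp2.
  by rewrite !(mulrC _ e^-1); ring.
Qed.

Let sqr_cut (A B : set R) (f : R -> R) c : measurable A -> measurable B -> A `<=` B ->
  measurable_fun B f -> (\int[mu]_(t in B) (f t ^+ 2)%:E <= c)%E -> (\int[mu]_(t in A) (f t ^+ 2)%:E <= c)%E.
Proof.
move=> mA mB AB mf; apply: le_trans; apply: ge0_subset_integral => //.
  by apply/measurable_EFinP; exact: measurable_funX.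
by move=> t _; rewrite lee_fin sqr_ge0.
Qed.

Let sqr0 (A : set R) (f : R -> R) C : (forall delta, 0 < delta -> (\int[mu]_(t in A) (f t ^+ 2)%:E <= (C * delta)%:E)%E) ->
  0 < C -> (\int[mu]_(t in A) (f t ^+ 2)%:E <= 0)%E.
Proof.
move=> H C0; apply/lee_addgt0Pr => e e0; rewrite add0e.
by have := H (e / C) (divr_gt0 e0 C0); rewrite mulrC divfK ?gt_eqF.
Qed.

(* One reflection at the moving end: on [0, s], where the outgoing invariant
   vanishes near the end, the boundary condition forces the incoming trace to
   vanish. *)
Let front_zero A s r : L <= A -> zone A -> 0 <= r -> P r = A -> r < s -> s <= T -> Q s <= A - m ->
  (\int[mu]_(t in `]r, s[) (d s (P t - s) ^+ 2)%:E <= 0)%E.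
Proof.
move=> LA zA r0 PrA rs sT QsA; have s0 : 0 < s := le_lt_trans r0 rs.
have [ro [ro' [mro mro' rel avg]]] := boundary_data.
have mT := measurable_itv (`]0, T[ : interval R); have mS := measurable_itv (`]r, s[ : interval R).
have ST : `]r, s[ `<=` `]0, T[.
  by move=> t; rewrite /= !in_itv/= => /andP[rt ts]; rewrite (le_lt_trans r0 rt) (lt_le_trans ts sT).
have c1 : continuous (fun t => l t) by exact: cl.
have mDl (e : R) : 0 < e -> e < m -> measurable_fun `]0, T[ (fun t => (D t (l t) - D t (l t - e)) / e) /\
    measurable_fun `]0, T[ (fun t => (D t (- (l t - e)) - D t (- l t)) / e).
  move=> e0 em.
  have E t : t \in `]0, T[%classic -> (D t (l t) - D t (l t - e)) / e =
     average l T ux1 e t + average l T ut1 e t - (average l T ux2 e t + average l T ut2 e t) /\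
     (D t (- (l t - e)) - D t (- l t)) / e =
     average l T ux1 e t - average l T ut1 e t - (average l T ux2 e t - average l T ut2 e t).
    rewrite mem_setE in_itv/= => /andP[t0 tT]; have tI : 0 <= t <= T by rewrite !ltW.
    have lp : 0 <= l t by rewrite ltW// l0'.
    have lp2 : 0 <= l t - e by rewrite subr_ge0 (le_trans (ltW em))// ml.
    rewrite /average; have [_ /(_ tI) -> _] := clampP t (ltW T0).
    have [-> ->] := Dpos tI lp; have [-> ->] := Dpos tI lp2.
    by split; [exact: avg_alg1|exact: avg_alg2].
  have ma (w : R -> R -> R) : C0_L2 l T w -> measurable_fun `]0, T[ (average l T w e).
    move=> cw; apply: measurable_funTS; apply: continuous_measurable_fun.
    have ac := @average_continuous R l T m w T0 cl ml cw e e0 em; exact: ac.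
  split.
    apply: (eq_measurable_fun (fun t => average l T ux1 e t + average l T ut1 e t - (average l T ux2 e t + average l T ut2 e t))).
      by move=> t /E[-> _].
    by apply: measurable_funB; apply: measurable_funD; exact: ma.
  apply: (eq_measurable_fun (fun t => average l T ux1 e t - average l T ut1 e t - (average l T ux2 e t - average l T ut2 e t))).
    by move=> t /E[_ ->].
  by apply: measurable_funB; apply: measurable_funB; exact: ma.
(* The layer near [- l t] consists of the characteristics between [Q t] and [Q t + e]. They lie in
   the zone, because [Q t <= Q s <= A - m] and [e < m], so every layer average of the outgoing
   invariant is 0. *)
have R'0 : (\int[mu]_(t in `]r, s[) (ro' t ^+ 2)%:E <= 0)%E.
  apply: (@sqr0 _ _ 16) => // delta d0; have [e0 e00 he] := avg _ d0.
  pose e := Num.min e0 m / 2.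
  have ep : 0 < e by rewrite divr_gt0// lt_min e00.
  have [ee em] : e < e0 /\ e < m.
    have h : e < Num.min e0 m by rewrite /e ltr_pdivrMr// ltr_pMr ?ltr1n// lt_min e00.
    by move: h; rewrite lt_min => /andP[].
  have [_ hg] := he e ltac:(by rewrite ep).
  have := sqr_cut mS mT ST (measurable_funB (mDl e ep em).2 mro') hg.
  apply: le_trans; rewrite le_eqVlt; apply/orP; left; apply/eqP; apply: eq_integral => t.
  rewrite mem_setE in_itv/= => /andP[rt ts]; have t0 := le_lt_trans r0 rt.
  have tI : 0 <= t <= T by rewrite ltW//= ltW// (lt_le_trans ts sT).
  have Qts : Q t <= Q s by rewrite Qle ltW.
  have lm := ml tI.
  have Qe : Q t <= Q t + e <= P t.
    by rewrite lerDl (ltW ep) /Q /P -addrA lerD2l; move: lm em ep => *; lra.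
  have QP : Q t <= Q t <= P t by rewrite lexx; case/andP: Qe => h1 h2; exact: le_trans h1 h2.
  have QA : Q t <= A by rewrite (le_trans Qts)// (le_trans QsA)// gerBl ltW.
  have QeA : Q t + e <= A.
    by rewrite (le_trans (lerD Qts (ltW em)))//; move: QsA; rewrite lerBrDr.
  have := zA t tI _ _ Qe QeA QP QA.
  rewrite (_ : Q t + e - t = - (l t - e)); last by rewrite /Q; ring.
  rewrite (_ : Q t - t = - l t); last by rewrite /Q; ring.
  by move=> ->; rewrite subrr mul0r sub0r sqrrN.
(* The boundary relation bounds the incoming trace by a constant times the outgoing one, almost
   everywhere. *)
have R0 : (\int[mu]_(t in `]r, s[) (ro t ^+ 2)%:E <= 0)%E.
  have [C C0 hC] := diffeo_lower_bound 0 T Pd.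
  pose K := (2 * C * (1 - eta)) ^+ 2.
  have mr : measurable_fun `]r, s[ (fun t => (ro t ^+ 2)%:E).
    by apply/measurable_EFinP; apply: measurable_funX; apply: measurable_funS mro.
  have mr' : measurable_fun `]r, s[ (fun t => (ro' t ^+ 2)%:E).
    by apply/measurable_EFinP; apply: measurable_funX; apply: measurable_funS mro'.
  have K0 : 0 <= K := sqr_ge0 _.
  apply: (@le_trans _ _ (\int[mu]_(t in `]r, s[) (K%:E * (ro' t ^+ 2)%:E))%E).
    apply: ae_ge0_le_integral => //.
    - by move=> t _; rewrite lee_fin sqr_ge0.
    - by move=> t _; rewrite -EFinM lee_fin mulr_ge0// sqr_ge0.
    - exact: measurable_funeM.
    - apply: negligibleS rel => t /=; apply: contra_not => h; rewrite in_itv/= => /andP[rt ts].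
      have t0 := le_lt_trans r0 rt; have tT := lt_le_trans ts sT.
      rewrite -EFinM lee_fin; apply: (front_alg eta0 (diffeo_gt0 Pd t) (diffeo_gt0 Qd t) (hC t _) (h _)).
        by rewrite !ltW.
      by rewrite t0.
  rewrite ge0_integralZl// ?lee_fin//; last by move=> t _; rewrite lee_fin sqr_ge0.
  by apply: mule_ge0_le0.
(* The incoming layer average at time [t] is carried by transport to time [s], where it is a
   difference quotient of [D s] at [P t - s] and converges in mean square to [d s]. The limit of
   these averages is 0 by [R0]. *)
have [C C0 hC] := diffeo_lower_bound r s Pd.
apply: (@sqr0 _ _ 66) => // delta d0; have [e0 e00 he] := avg _ d0.
have dsl : L2loc (fun y => d s (y - s)) := L2loc_shift (- s) (dL s).
have [e1 e10 he1] := L2_translate (P r) (P s) dsl (divr_gt0 d0 C0).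
pose e := Num.min (Num.min e0 e1) m / 2.
have ep : 0 < e by rewrite divr_gt0// !lt_min e00 e10.
have [[ee ee1] em] : (e < e0 /\ e < e1) /\ e < m.
  have h : e < Num.min (Num.min e0 e1) m by rewrite /e ltr_pdivrMr// ltr_pMr ?ltr1n// !lt_min e00 e10.
  by move: h; rewrite !lt_min => /andP[/andP[]].
have [hg _] := he e ltac:(by rewrite ep).
pose H t := (D t (l t) - D t (l t - e)) / e.
have mH : measurable_fun `]r, s[ H by apply: measurable_funS (mDl e ep em).1.
have mro2 : measurable_fun `]r, s[ ro by apply: measurable_funS mro.
have h1 := sqr_cut mS mT ST (measurable_funB (mDl e ep em).1 mro) hg.
have h2 := integral_sqrD_le mS (measurable_funB mH mro2) mro2 h1 R0.
have mP : measurable_fun setT (fun t => P t - s) by apply: measurable_funB => //; exact: diffeo_measurable Pd.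
have mh : measurable_fun `]r, s[ (fun t => d s (P t - s)).
  by apply: measurable_funTS; exact: measurableT_comp (dL s).1 mP.
have en0 : - e != 0 by rewrite oppr_eq0 gt_eqF.
have h3 : (\int[mu]_(t in `]r, s[) ((((D s (P t - s + - e) - D s (P t - s)) / - e) - d s (P t - s)) ^+ 2)%:E <= delta%:E)%E.
  apply: (average_quotient_le mS (dL s) mP (ltW d0) en0) => c; rewrite normrN (gtr0_norm ep) => ce.
  have gl : L2loc (fun y => d s (y + c - s) - d s (y - s)) := L2locB (L2loc_shift c dsl) dsl.
  have := comp_sq_le (ltW rs) Pd gl C0 hC; rewrite -/(P r) -/(P s) => hh.
  apply: le_trans (le_trans _ hh) _.
    by rewrite le_eqVlt; apply/orP; left; apply/eqP; apply: eq_integral => t _; rewrite /P; congr ((((d s _) - _) ^+ 2)%:E); ring.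
  by rewrite lee_fin mulrC -ler_pdivlMr//; apply: he1; exact: le_lt_trans ce ee1.
have HE t : t \in `]r, s[%classic -> H t = (D s (P t - s + - e) - D s (P t - s)) / - e.
  rewrite mem_setE in_itv/= => /andP[rt ts]; have t0 := le_lt_trans r0 rt.
  have tI : 0 <= t <= T by rewrite ltW//= ltW// (lt_le_trans ts sT).
  have Pe : A <= P t by rewrite -PrA Ple ltW.
  have Qe : Q s <= P t - e.
    by apply: (le_trans QsA); rewrite lerB// ltW.
  have a1 : Q s <= P t - e <= P t by rewrite Qe gerBl ltW.
  have a2 : Q s <= P t <= P t by rewrite lexx andbT (le_trans Qe)// gerBl ltW.
  have := Dtr (ltW t0) ts sT a2 a1.
  rewrite (_ : P t - t = l t); last by rewrite /P; ring.
  rewrite (_ : P t - e - t = l t - e); last by rewrite /P; ring.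
  rewrite (_ : P t - e - s = P t - s + - e); last by ring.
  by move=> E; rewrite /H E invrN mulrN -mulNr opprB.
have h3' : (\int[mu]_(t in `]r, s[) ((d s (P t - s) - H t) ^+ 2)%:E <= delta%:E)%E.
  apply: le_trans h3; rewrite le_eqVlt; apply/orP; left; apply/eqP; apply: eq_integral => t /HE <-.
  by rewrite -sqrrN opprB.
have h2' : (\int[mu]_(t in `]r, s[) (H t ^+ 2)%:E <= (2 * (16 * delta) + 2 * 0)%:E)%E.
  apply: le_trans h2; rewrite le_eqVlt; apply/orP; left; apply/eqP; apply: eq_integral => t _.
  by rewrite subrK.
(* The constant 66 is [2 * 1 + 2 * (2 * 16)], from two uses of the square of a sum and the 16 of
   [boundary_data]. *)
have := integral_sqrD_le mS (measurable_funB mh mH) mH h3' h2'.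
rewrite (_ : 2 * delta + _ = 66 * delta); last by ring.
by apply: le_trans; rewrite le_eqVlt; apply/orP; left; apply/eqP; apply: eq_integral => t _; rewrite subrK.
Qed.

(** Substituting [y = P t], whose Jacobian is below 2, turns [front_zero] into a vanishing energy of
    [d s] on the characteristics between [A] and [P s], so the primitive is constant there. *)
Let front_const A s r : L <= A -> zone A -> 0 <= r -> P r = A -> r < s -> s <= T -> Q s <= A - m ->
  forall a b, A <= a <= P s -> A <= b <= P s -> D s (a - s) = D s (b - s).
Proof.
move=> LA zA r0 PrA rs sT QsA a b aA bA.
have fz := front_zero LA zA r0 PrA rs sT QsA.
have h2 := (L2loc_shift (- s) (dL s)).2 (P r) (P s).
have mS := measurable_itv (`]r, s[ : interval R).
have gi := intg_change_itv Pd (ltW rs) h2.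
have E : \int[mu]_(y in `[P r, P s]) (d s (y - s) ^+ 2) <= 0.
  rewrite (change_of_variables Pd (ltW rs) h2) -(Rint_oo_cc gi) -lee_fin Rint_EFin//; last first.
    by apply: intgS gi => //; exact: subset_itv_oo_cc.
  apply: (@le_trans _ _ (\int[mu]_(t in `]r, s[) (2%:E * (d s (P t - s) ^+ 2)%:E))%E).
    apply: ge0_le_lower_integral => t _.
      by rewrite lee_fin mulr_ge0 ?sqr_ge0// ltW// (diffeo_gt0 Pd).
    rewrite -EFinM lee_fin mulrC ler_wpM2r ?sqr_ge0//.
    by have := diffeo_gt0 Qd t; lra.
  rewrite ge0_integralZl//; first exact: mule_ge0_le0.
  - apply/measurable_EFinP; apply: measurable_funX; apply: measurable_funTS.
    by apply: (measurableT_comp (dL s).1); apply: measurable_funB => //; exact: diffeo_measurable Pd.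
  - by move=> t _; rewrite lee_fin sqr_ge0.
have rsP : P r <= P s by rewrite Ple ltW.
have E2 : \int[mu]_(z in `[P r - s, P s - s]) (d s z ^+ 2) <= 0.
  have ab : P r - s <= P s - s by rewrite lerD2r.
  have := @Rint_shift R (fun y => d s (y - s) ^+ 2) (P r - s) (P s - s) s ab; rewrite !subrK.
  move=> /(_ h2) eq; rewrite eq in E.
  by rewrite (Rint_eq (g := fun x => d s (x + s - s) ^+ 2)) // => x _; rewrite addrK.
have := @prim_hoelder R (d s) (P r - s) (P s - s) (a - s) (b - s) (dL s).
rewrite !lerD2r PrA => /(_ aA bA) h.
apply/eqP; rewrite -subr_eq0 -sqrf_eq0 eq_le sqr_ge0 andbT; apply: le_trans h _.
by rewrite PrA in E2; apply: mulr_ge0_le0.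
Qed.

(** At the time [s] chosen below, all of [D s] is constant: up to [A] by the zone, above [A] by one
    reflection. Transport then spreads this to the other times. *)
Let zone_step A : L <= A -> zone A -> zone (A + m).
Proof.
move=> LA zA.
have QP t : 0 <= t <= T -> Q t <= P t by move=> /l0' lt; rewrite /Q /P; lra.
(* The latest time at which every reflection still takes place on characteristics of the zone:
   [Q s = A - m], or [T] if that comes first. *)
have [s [s0 sT QsA sC]] : exists s, [/\ 0 < s, s <= T, Q s <= A - m & s = T \/ Q s = A - m].
  have [QT|QT] := leP (Q T) (A - m); first by exists T; split => //; left.
  have [s Es] := diffeo_surj Qd (A - m); exists s; split; [| |by rewrite -Es|by right].
  - rewrite ltNge; apply/negP => sn; have : Q s <= Q 0 by rewrite Qle.
    exact: no_back LA (ml T00) L0 Es.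
  - by rewrite -Qle {1}/Q Es ltW.
have sI : 0 <= s <= T by rewrite ltW.
have zs a b : Q s <= a <= P s -> Q s <= b <= P s -> D s (a - s) = D s (b - s).
  have [PA|PA] := leP (P s) A.
    by move=> ha hb; apply: (zA s sI) => //; [case/andP: ha => _ /le_trans->|case/andP: hb => _ /le_trans->].
  have [r Er] := diffeo_surj Pd A.
  have r0 : 0 <= r by rewrite -Ple {2}/P Er /P add0r.
  have rs : r < s by rewrite -(diffeo_lt Pd) Er.
  have fc := front_const LA zA r0 Er rs sT QsA.
  have QA : Q s <= A by rewrite (le_trans QsA)// gerBl ltW.
  have toA x : Q s <= x <= P s -> D s (x - s) = D s (A - s).
    move=> /andP[x1 x2]; have [xA|Ax] := leP x A.
      by apply: (zA s sI) => //; rewrite ?x1 ?x2 ?QA ?ltW.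
    by apply: fc; rewrite ?x2 ?lexx ?ltW.
  by move=> /toA-> /toA->.
move=> t tI a b /andP[a1 a2] aA /andP[b1 b2] bA; have /andP[t0 tT] := tI.
have [ts|st|Est] := ltgtP t s; last first.
- by rewrite Est; apply: zs; rewrite -Est ?a1 ?b1.
- case: sC => [sE|QE]; first by move: st; rewrite sE ltNge tT.
  (* [P s] exceeds [Q s = A - m] by [2 * l s], hence by at least [2 * m]; this is the gain of a
     reflection. *)
  have PA : A + m <= P s := front_gain QE (ml sI).
  have ha : Q t <= a <= P s by rewrite a1 (le_trans aA).
  have hb : Q t <= b <= P s by rewrite b1 (le_trans bA).
  have Qst : Q s <= Q t by rewrite Qle ltW.
  have := Dtr (ltW s0) st tT ha hb; rewrite (zs a b) ?subrr.
  + by move=> /esym/eqP; rewrite subr_eq0 => /eqP.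
  + by rewrite (le_trans Qst a1) (le_trans aA).
  + by rewrite (le_trans Qst b1) (le_trans bA).
- have QA : Q s <= A by rewrite (le_trans QsA)// gerBl ltW.
  have Pts : P t <= P s by rewrite Ple ltW.
  have Qts : Q t <= Q s by rewrite Qle ltW.
  have [QPs|PQ] := leP (Q s) (P t); last first.
    by apply: (zA t tI); rewrite ?a1 ?b1//; [rewrite (le_trans a2)// (le_trans (ltW PQ))|rewrite (le_trans b2)// (le_trans (ltW PQ))].
  (* Characteristics below [Q s] leave the domain before time [s] and cannot be transported; they
     belong to the zone, so they may be replaced by [Q s]. *)
  have up x : Q t <= x -> x <= P t -> exists2 y, Q s <= y <= P t & D t (x - t) = D t (y - t).
    move=> x1 x2; have [xQ|Qx] := leP (Q s) x; first by exists x; rewrite ?xQ.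
    exists (Q s); first by rewrite lexx.
    by apply: (zA t tI); rewrite ?x1 ?Qts// (le_trans (ltW Qx)).
  have [a' ha' ->] := up a a1 a2; have [b' hb' ->] := up b b1 b2.
  have := Dtr t0 ts sT ha' hb'; rewrite (zs a' b') ?subrr.
  + by move=> /eqP; rewrite subr_eq0 => /eqP.
  + by case/andP: ha' => -> /le_trans->.
  + by case/andP: hb' => -> /le_trans->.
Qed.

(** After finitely many gains of [m] the zone covers [P t]. The displacement is half the increment
    of the primitive of [fld] between [- x] and [x], so it agrees. *)
Lemma solution_unique x t : 0 <= t <= T -> 0 <= x <= l t -> v1 x t = v2 x t.
Proof.
move=> tT xl; have zn n : zone (L + m *+ n).
  elim: n => [|n IH]; first by rewrite mulr0n addr0; exact: zone0.
  by rewrite mulrSr addrA; apply: zone_step => //; rewrite lerDl mulrn_wge0// ltW.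
have [n hn] : exists n, P t <= L + m *+ n.
  exists (Num.truncn (`|P t| / m)).+1.
  have := truncnS_gt (`|P t| / m); rewrite ltr_pdivrMr// => h.
  have := ler_norm (P t); have := L0; rewrite -mulr_natl; lra.
have [x0 xlt] := andP xl.
have nl : - l t <= x by apply: (le_trans _ x0); rewrite oppr_le0 (le_trans x0 xlt).
have nx : - x <= l t by apply: (le_trans _ (le_trans x0 xlt)); rewrite oppr_le0.
have ha : Q t <= t + x <= P t by rewrite /Q /P !lerD2l nl.
have hb : Q t <= t - x <= P t by rewrite /Q /P !lerD2l lerN2 xlt.
have h y : Q t <= y <= P t -> y <= L + m *+ n by case/andP => _ /le_trans; apply.
have := zn n t tT _ _ ha (h _ ha) hb (h _ hb).
rewrite (_ : t + x - t = x); last by ring.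
rewrite (_ : t - x - t = - x); last by ring.
by rewrite !DE; exact: odd_part_eq (solution_value sol1 tT xl) (solution_value sol2 tT xl).
Qed.

End uniqueness.

(** * Trigonometric series *)

Section fourier.
Context {R : realType}.
Local Notation mu := (@lebesgue_measure R).
Variables (s0 : R) (sg : bool).
Implicit Types (n k : int) (A B : seq int) (x y : int -> R).

(** One formula for both cases: on a cell of length 2 the exponentials are antiperiodic when [sg] is
    true and periodic when it is false. *)
Definition frq n : R := (2 * n + sg%:Z)%:~R / 2 * pi.

Local Notation cell := (`[s0, s0 + 2]%classic : set R).
Let mc : measurable cell. Proof. exact: measurable_itv. Qed.
Let s02 : s0 <= s0 + 2. Proof. by rewrite lerDl. Qed.

Let C n (s : R) : R := cos (frq n * s).
Let S n (s : R) : R := sin (frq n * s).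

Lemma continuous_cos_line (a : R) : continuous (fun s : R => cos (a * s)).
Proof.
move=> s; apply: (@continuous_comp _ _ _ (fun s => a * s) cos); last exact: continuous_cos.
by apply: cvgM; [exact: cvg_cst|exact: cvg_id].
Qed.

Lemma continuous_sin_line (a : R) : continuous (fun s : R => sin (a * s)).
Proof.
move=> s; apply: (@continuous_comp _ _ _ (fun s => a * s) sin); last exact: continuous_sin.
by apply: cvgM; [exact: cvg_cst|exact: cvg_id].
Qed.

Lemma cosD2pi_int k (r : R) : cos (r + k%:~R * (pi *+ 2)) = cos r /\ sin (r + k%:~R * (pi *+ 2)) = sin r.
Proof.
have h (m : nat) (x : R) : cos (x + m%:R * (pi *+ 2)) = cos x /\ sin (x + m%:R * (pi *+ 2)) = sin x.
  by rewrite mulr_natl; split; [exact: (periodicn (@cosD2pi R))|exact: (periodicn (@sinD2pi R))].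
case: k => m; first exact: h.
have [<- <-] := h m.+1 (r + (Negz m)%:~R * (pi *+ 2)).
by rewrite NegzE mulrNz -pmulrn mulNr subrK.
Qed.

Lemma cos_sin_int k (s : R) : cos (k%:~R * pi * (s + 2)) = cos (k%:~R * pi * s) /\
  sin (k%:~R * pi * (s + 2)) = sin (k%:~R * pi * s).
Proof.
have -> : k%:~R * pi * (s + 2) = k%:~R * pi * s + k%:~R * (pi *+ 2) by rewrite mulr2n; ring.
exact: cosD2pi_int.
Qed.

(** Orthogonality for both systems at once, since the difference of two frequencies [frq] is always
    an integer multiple of [pi]. *)
Lemma cell_cos_sin k : k != 0 ->
  \int[mu]_(s in cell) cos (k%:~R * pi * s) = 0 /\ \int[mu]_(s in cell) sin (k%:~R * pi * s) = 0.
Proof.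
move=> k0; have a0 : k%:~R * pi != 0 :> R by rewrite mulf_neq0 ?intr_eq0// gt_eqF// pi_gt0.
set a := k%:~R * pi in a0 *.
have D1 (s : R) : is_derive s 1 (fun s => a^-1 * sin (a * s)) (cos (a * s)).
  have := is_derive_mulr (is_derive_cst a^-1 s 1) (is_derive_compr (@is_derive_sin R) (is_derive_affine 0 a s)).
  rewrite (_ : (fun y : R => cst a^-1 y * sin (0 + a * y)) = (fun s => a^-1 * sin (a * s))); last by apply/funext => z; rewrite add0r.
  by move=> h; apply: is_derive_eq h _; rewrite add0r mul0r add0r mulrCA mulVf// mulr1.
have D2 (s : R) : is_derive s 1 (fun s => - a^-1 * cos (a * s)) (sin (a * s)).
  have := is_derive_mulr (is_derive_cst (- a^-1) s 1) (is_derive_compr (@is_derive_cos R) (is_derive_affine 0 a s)).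
  rewrite (_ : (fun y : R => cst (- a^-1) y * cos (0 + a * y)) = (fun s => - a^-1 * cos (a * s))); last by apply/funext => z; rewrite add0r.
  by move=> h; apply: is_derive_eq h _; rewrite /= add0r mul0r add0r !mulNr mulrN opprK mulrCA mulVf// mulr1.
rewrite (Rint_derive s02 D1 (@continuous_cos_line a)) (Rint_derive s02 D2 (@continuous_sin_line a)).
by have [-> ->] := cos_sin_int k s0; rewrite !subrr.
Qed.

Let frqB n k : frq n - frq k = (n - k)%:~R * pi.
Proof. rewrite /frq -mulrBl -mulrBl -intrB (_ : 2 * n + sg%:Z - (2 * k + sg%:Z) = 2 * (n - k)); last by ring.
by rewrite intrM; field. Qed.

(* Real and imaginary parts of the sum of (x n - i y n) e^(i frq n s). *)
Definition trigU A x y (s : R) : R := \sum_(n <- A) (x n * C n s + y n * S n s).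
Definition trigW A x y (s : R) : R := \sum_(n <- A) (x n * S n s - y n * C n s).

Lemma trig_continuous A x y : continuous (trigU A x y) /\ continuous (trigW A x y).
Proof.
have cm (a : R) (f : R -> R) : continuous f -> continuous (fun s => a * f s).
  by move=> cf s; apply: cvgM; [exact: cvg_cst|exact: cf].
have cC n : continuous (C n) := @continuous_cos_line (frq n).
have cS n : continuous (S n) := @continuous_sin_line (frq n).
rewrite /trigU /trigW; elim: A => [|n A [IH1 IH2]].
  have c0 (f : int -> R -> R) : continuous (fun s : R => \sum_(n <- [::]) f n s).
    by rewrite (_ : (fun s => _) = (fun=> 0)); [move=> s; exact: cvg_cst|apply/funext => s; rewrite big_nil].
  by split; [exact: (c0 (fun n s => x n * C n s + y n * S n s))|exact: (c0 (fun n s => x n * S n s - y n * C n s))].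
split.
  rewrite (_ : (fun s => _) = (fun s => x n * C n s + y n * S n s + \sum_(n <- A) (x n * C n s + y n * S n s))); last first.
    by apply/funext => s; rewrite big_cons.
  by move=> s; apply: cvgD; [apply: cvgD; apply: cm|exact: IH1].
rewrite (_ : (fun s => _) = (fun s => x n * S n s - y n * C n s + \sum_(n <- A) (x n * S n s - y n * C n s))); last first.
  by apply/funext => s; rewrite big_cons.
by move=> s; apply: cvgD; [apply: cvgB; apply: cm|exact: IH2].
Qed.

Variable H : R -> R.
Hypothesis HL : L2loc H.

Definition fa n : R := 2^-1 * \int[mu]_(s in cell) (H s * C n s).
Definition fb n : R := 2^-1 * \int[mu]_(s in cell) (H s * S n s).

(* Half the squared L^2 distance from H to the sum of (x n - i y n) e^(i frq n s). *)
Definition residual A x y : R :=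
  2^-1 * \int[mu]_(s in cell) ((H s - trigU A x y s) ^+ 2 + trigW A x y s ^+ 2).

Let N2 : R := 2^-1 * \int[mu]_(s in cell) (H s ^+ 2).

(** Expansion of the square, one index at a time; orthogonality to the earlier indices leaves only
    the Fourier coefficients of [H]. The form is quadratic in each pair (x n, y n), with minimum at
    [fa], [fb]. *)
Lemma residualE A x y : uniq A ->
  residual A x y = N2 + \sum_(n <- A) (x n ^+ 2 + y n ^+ 2 - 2 * x n * fa n - 2 * y n * fb n).
Proof.
have cC n : continuous (C n) := @continuous_cos_line (frq n).
have cS n : continuous (S n) := @continuous_sin_line (frq n).
have LC (f : R -> R) : continuous f -> L2loc f := @L2loc_cont R f.
have sq f : L2loc f -> sqint cell f by exact: L2loc_sqint.
have ii f g : L2loc f -> L2loc g -> intg cell (fun s => f s * g s) by move=> /sq h1 /sq h2; exact: sqint_mul.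
have i2 f : L2loc f -> intg cell (fun s => f s ^+ 2) by move=> fl; exact: fl.2.
elim: A => [_|n A IH /= /andP[nA uA]].
  rewrite big_nil addr0 /residual; congr (_ * _); apply: Rint_eq => s _.
  by rewrite /trigU /trigW !big_nil subr0 expr0n addr0.
have [cU cW] := trig_continuous A x y.
have UL : L2loc (fun s => H s - trigU A x y s) := L2locB HL (LC _ cU).
have WL := LC _ cW; have CL := LC _ (cC n); have SL := LC _ (cS n).
set U := fun s => H s - trigU A x y s in UL; set W := trigW A x y in WL cW.
pose e1 s := U s * C n s - W s * S n s; pose e2 s := U s * S n s + W s * C n s.
have j1 : intg cell e1 by apply: intgB => //; exact: ii.
have j2 : intg cell e2 by apply: intgD => //; exact: ii.
have j0 : intg cell (fun s => U s ^+ 2 + W s ^+ 2) by apply: intgD => //; exact: i2.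
have jc : intg cell (fun _ => x n ^+ 2 + y n ^+ 2) by apply: intg_cst => //; exact: mu_itv_cc_fin.
have E : residual (n :: A) x y = residual A x y - x n * \int[mu]_(s in cell) e1 s -
    y n * \int[mu]_(s in cell) e2 s + (x n ^+ 2 + y n ^+ 2).
  have -> : residual (n :: A) x y = 2^-1 * \int[mu]_(s in cell) ((U s ^+ 2 + W s ^+ 2) - 2 * x n * e1 s - 2 * y n * e2 s + (x n ^+ 2 + y n ^+ 2)).
    rewrite /residual; congr (_ * _); apply: Rint_eq => s _.
    rewrite /trigU /trigW !big_cons -/(trigU A x y s) -/(trigW A x y s) -/(W s).
    rewrite (_ : H s - _ = U s - (x n * C n s + y n * S n s)); last by rewrite /U; ring.
    have := cos2Dsin2 (frq n * s); rewrite -/(C n s) -/(S n s) /e1 /e2.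
    move: (U s) (W s) (C n s) (S n s) => u w c t h.
    rewrite (_ : x n ^+ 2 + y n ^+ 2 = (x n ^+ 2 + y n ^+ 2) * (c ^+ 2 + t ^+ 2)); last by rewrite h mulr1.
    by ring.
  rewrite RintD//; last by do 2?apply: intgB => //; exact: intgZ.
  rewrite RintB//; [|by apply: intgB => //; exact: intgZ|exact: intgZ].
  rewrite RintB//; last exact: intgZ.
  rewrite !RintZ// Rint_cst//; first by rewrite /residual -/U -/W; field.
have orth k : k \in A ->
    \int[mu]_(s in cell) ((x k * C k s + y k * S k s) * C n s + (x k * S k s - y k * C k s) * S n s) = 0 /\
    \int[mu]_(s in cell) ((x k * C k s + y k * S k s) * S n s - (x k * S k s - y k * C k s) * C n s) = 0.
  move=> kA; have kn : k - n != 0.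
    by rewrite subr_eq0; apply: contraNneq nA => <-.
  have [z1 z2] := cell_cos_sin kn.
  have ic := cont_intg s0 (s0 + 2) (@continuous_cos_line ((k - n)%:~R * pi)).
  have js := cont_intg s0 (s0 + 2) (@continuous_sin_line ((k - n)%:~R * pi)).
  have cs s : cos ((k - n)%:~R * pi * s) = C k s * C n s + S k s * S n s.
    by rewrite -frqB mulrBl cosB.
  have ss s : sin ((k - n)%:~R * pi * s) = S k s * C n s - C k s * S n s.
    by rewrite -frqB mulrBl sinB.
  split.
    rewrite (Rint_eq (g := fun s => x k * cos ((k - n)%:~R * pi * s) + y k * sin ((k - n)%:~R * pi * s))); last first.
      by move=> s _; rewrite cs ss; ring.
    by rewrite RintD ?RintZ ?z1 ?z2 ?mulr0 ?addr0//; exact: intgZ.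
  rewrite (Rint_eq (g := fun s => y k * cos ((k - n)%:~R * pi * s) - x k * sin ((k - n)%:~R * pi * s))); last first.
    by move=> s _; rewrite cs ss; ring.
  by rewrite RintB ?RintZ ?z1 ?z2 ?mulr0 ?subr0//; exact: intgZ.
have key B : {subset B <= A} ->
    \int[mu]_(s in cell) (trigU B x y s * C n s + trigW B x y s * S n s) = 0 /\
    \int[mu]_(s in cell) (trigU B x y s * S n s - trigW B x y s * C n s) = 0.
  have cm (f g : R -> R) : continuous f -> continuous g -> continuous (fun t => f t * g t).
    by move=> cf cg t; apply: cvgM; [exact: cf|exact: cg].
  elim: B => [_|k B IHB sB].
    by split; rewrite (Rint_eq (g := fun=> 0)) ?Rint_cst ?mul0r// => s _; rewrite /trigU /trigW !big_nil !mul0r ?addr0 ?subr0.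
  have [h1 h2] := IHB (fun z zB => sB z (mem_behead (s := k :: B) zB)).
  have [w1 w2] := orth k (sB k (mem_head _ _)).
  have [cUB cWB] := trig_continuous B x y; have [cUk cWk] := trig_continuous [:: k] x y.
  have Uk s : trigU [:: k] x y s = x k * C k s + y k * S k s by rewrite /trigU big_cons big_nil addr0.
  have Wk s : trigW [:: k] x y s = x k * S k s - y k * C k s by rewrite /trigW big_cons big_nil addr0.
  have Us s : trigU (k :: B) x y s = trigU [:: k] x y s + trigU B x y s by rewrite Uk /trigU big_cons.
  have Ws s : trigW (k :: B) x y s = trigW [:: k] x y s + trigW B x y s by rewrite Wk /trigW big_cons.
  have ic (f g : R -> R) : continuous f -> continuous g -> intg cell (fun s => f s * g s).
    by move=> cf cg; apply: cont_intg; exact: cm.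
  split.
    rewrite (Rint_eq (g := fun s => (trigU [:: k] x y s * C n s + trigW [:: k] x y s * S n s) +
      (trigU B x y s * C n s + trigW B x y s * S n s))); last by move=> s _; rewrite Us Ws; ring.
    rewrite RintD ?h1 ?addr0//; [|by apply: intgD => //; exact: ic|by apply: intgD => //; exact: ic].
    by rewrite -[RHS]w1; apply: Rint_eq => s _; rewrite Uk Wk.
  rewrite (Rint_eq (g := fun s => (trigU [:: k] x y s * S n s - trigW [:: k] x y s * C n s) +
    (trigU B x y s * S n s - trigW B x y s * C n s))); last by move=> s _; rewrite Us Ws; ring.
  rewrite RintD ?h2 ?addr0//; [|by apply: intgB => //; exact: ic|by apply: intgB => //; exact: ic].
  by rewrite -[RHS]w2; apply: Rint_eq => s _; rewrite Uk Wk.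
have [k1 k2] := key A (fun _ => id).
have UtL := LC _ cU.
have E1 : \int[mu]_(s in cell) e1 s = 2 * fa n.
  rewrite (Rint_eq (g := fun s => H s * C n s - (trigU A x y s * C n s + W s * S n s))); last first.
    by move=> s _; rewrite /e1 /U; ring.
  rewrite RintB//; [|exact: ii|by apply: intgD => //; exact: ii].
  by rewrite k1 subr0 /fa; field.
have E2 : \int[mu]_(s in cell) e2 s = 2 * fb n.
  rewrite (Rint_eq (g := fun s => H s * S n s - (trigU A x y s * S n s - W s * C n s))); last first.
    by move=> s _; rewrite /e2 /U; ring.
  rewrite RintB//; [|exact: ii|by apply: intgB => //; exact: ii].
  by rewrite k2 subr0 /fb; field.
by rewrite E E1 E2 IH// big_cons; ring.
Qed.

Lemma residual_ge0 A x y : 0 <= residual A x y.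
Proof. by rewrite mulr_ge0//; apply: Rintegral_ge0 => s _; rewrite addr_ge0// sqr_ge0. Qed.

Lemma residual_coef A : uniq A -> residual A fa fb = N2 - \sum_(n <- A) (fa n ^+ 2 + fb n ^+ 2).
Proof.
move=> uA; rewrite residualE// -sumrN; congr (_ + _); apply: eq_bigr => n _; ring.
Qed.

Lemma bessel A : uniq A -> \sum_(n <- A) (fa n ^+ 2 + fb n ^+ 2) <= N2.
Proof. by move=> /residual_coef E; rewrite -subr_ge0 -E residual_ge0. Qed.

(** Fourier coefficients minimise the residual on [B], and adding further indices only lowers it. *)
Lemma residual_best A B x y : uniq A -> uniq B -> {subset B <= A} ->
  residual A fa fb <= residual B x y.
Proof.
move=> uA uB BA; rewrite residual_coef// residualE// lerD2l.
apply: (@le_trans _ _ (- \sum_(n <- B) (fa n ^+ 2 + fb n ^+ 2))).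
  rewrite lerN2 [leRHS](bigID (mem B)) /= ler_wpDr ?sumr_ge0// => [n _|]; first by rewrite addr_ge0// sqr_ge0.
  rewrite -[leRHS]big_filter [leLHS](perm_big [seq i <- A | i \in B]) ?lexx//=.
  apply: uniq_perm => //; first exact: filter_uniq.
  by move=> n; rewrite mem_filter; apply/idP/andP => [nB|[]//]; split => //; exact: BA.
rewrite -sumrN; apply: ler_sum => n _.
have := sqr_ge0 (x n - fa n); have := sqr_ge0 (y n - fb n); nra.
Qed.

End fourier.

(** * Concentration of powers of the cosine *)

Section cosine_kernel.
Context {R : realType}.
Local Notation mu := (@lebesgue_measure R).

(** The hypothesis on [F] is shared by [cos] and [sin]. Having the same coefficients for both, they
    give at once the expansion of the power and the vanishing of the conjugate sum, as [sin] is 0 at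
    0. *)
Lemma cos_power (m : nat) : exists2 al : nat -> R, (forall j, (m < j)%N -> al j = 0) &
  forall F : R -> R, (forall x r, F (x + r) + F (x - r) = 2 * cos r * F x) ->
    forall r, \sum_(0 <= j < m.+1) al j * F ((m%:R - 2 * j%:R) * r) = cos r ^+ m * F 0.
Proof.
elim: m => [|m [al al0 IH]].
  exists (fun j => (j == 0%N)%:R) => [[|j]//|F _ r].
  by rewrite big_nat1 mulr0 subr0 mul0r expr0.
(* Pascal's rule: the coefficients are the binomial ones divided by 2^m, and the product with
   [cos r] averages the shifts by [r] and [- r]. *)
exists (fun j => 2^-1 * (al j + (if j is j'.+1 then al j' else 0))).
  by move=> [|j]// mj; rewrite !al0 ?addr0 ?mulr0//; exact: ltnW.
move=> F FE r.
have E1 : \sum_(0 <= j < m.+2) al j * F ((m.+1%:R - 2 * j%:R) * r) =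
    \sum_(0 <= j < m.+1) al j * F ((m%:R - 2 * j%:R) * r + r).
  rewrite big_nat_recr//= al0// mul0r addr0; apply: eq_bigr => j _; congr (_ * F _).
  by rewrite -natr1; ring.
have E2 : \sum_(0 <= j < m.+2) (if j is j'.+1 then al j' else 0) * F ((m.+1%:R - 2 * j%:R) * r) =
    \sum_(0 <= j < m.+1) al j * F ((m%:R - 2 * j%:R) * r - r).
  rewrite big_nat_recl//= mul0r add0r; apply: eq_bigr => j _; congr (_ * F _).
  by rewrite -!natr1; ring.
transitivity (2^-1 * (\sum_(0 <= j < m.+2) al j * F ((m.+1%:R - 2 * j%:R) * r) +
   \sum_(0 <= j < m.+2) (if j is j'.+1 then al j' else 0) * F ((m.+1%:R - 2 * j%:R) * r))).
  by rewrite -big_split mulr_sumr; apply: eq_bigr => j _ /=; rewrite -mulrA mulrDl.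
rewrite E1 E2 -big_split /=.
transitivity (2^-1 * (2 * cos r * (\sum_(0 <= j < m.+1) al j * F ((m%:R - 2 * j%:R) * r)))).
  congr (_ * _); rewrite mulr_sumr; apply: eq_bigr => j _.
  by rewrite -mulrDr FE; ring.
by rewrite IH// exprS; field.
Qed.

Lemma Rint_tails (h : R -> R) a p q b A : a <= p -> p <= q -> q <= b -> continuous h ->
  (forall x, a <= x <= p \/ q <= x <= b -> `|h x| <= A) ->
  `|\int[mu]_(x in `[a, b]) h x - \int[mu]_(x in `[p, q]) h x| <= A * (p - a + (b - q)).
Proof.
move=> ap pq qb ch hA; have hi c d := cont_intg c d ch.
have bd c d : c <= d -> (forall x, c <= x <= d -> `|h x| <= A) -> `|\int[mu]_(x in `[c, d]) h x| <= A * (d - c).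
  move=> cd hc; have mcd : measurable (`[c, d]%classic : set R) := measurable_itv _.
  apply: le_trans (Rint_norm mcd (hi _ _)) _; rewrite -Rint_cst//; apply: Rint_le => //.
  - exact: intg_norm.
  - by apply: intg_cst => //; exact: mu_itv_cc_fin.
have aq := le_trans ap pq.
rewrite (Rint_split aq qb (hi _ _)) (Rint_split ap pq (hi _ _)).
rewrite (_ : _ - _ = \int[mu]_(x in `[a, p]) h x + \int[mu]_(x in `[q, b]) h x); last by ring.
rewrite mulrDr; apply: le_trans (ler_normD _ _) _; apply: lerD; apply: bd => // x xI; apply: hA.
  by left.
by right.
Qed.

Lemma small_power (z e : R) : 0 <= z < 1 -> 0 < e -> exists N : nat, z ^+ N <= e.
Proof.
move=> /andP[z0 z1] e0; have zn : `|z| < 1 by rewrite ger0_norm.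
have /cvgrPdist_lt/(_ _ e0)[N _ h] := cvg_expr zn.
exists N; have := h N (leqnn N); rewrite sub0r normrN => /ltW; apply: le_trans; exact: ler_norm.
Qed.

Lemma cos_pi_lt (x y : R) : 0 <= x -> x < y -> y <= 2 -> cos (pi / 2 * y) < cos (pi / 2 * x).
Proof.
move=> x0 xy y2; have p0 := pi_gt0 R; have p2 : 0 < pi / 2 :> R by rewrite divr_gt0.
have hp : pi / 2 * 2 = pi :> R by field.
have I (z : R) : 0 <= z -> z <= 2 -> pi / 2 * z \in `[0, pi].
  move=> z0 z2; rewrite in_itv/= (mulr_ge0 (ltW p2) z0)/=.
  by apply: le_trans (_ : pi / 2 * 2 <= _); [rewrite (ler_wpM2l (ltW p2))|rewrite hp].
by rewrite (ltr_cos (I _ x0 (le_trans (ltW xy) y2)) (I _ (le_trans x0 (ltW xy)) y2)) ltr_pM2l.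
Qed.

Lemma cos_pi_le (x y : R) : 0 <= x -> x <= y -> y <= 2 -> cos (pi / 2 * y) <= cos (pi / 2 * x).
Proof.
by move=> x0; rewrite le_eqVlt => /predU1P[->//|xy y2]; exact: ltW (cos_pi_lt x0 xy y2).
Qed.

Lemma cos_pi_norm (r : R) : cos (pi / 2 * r) = cos (pi / 2 * `|r|).
Proof. by rewrite -(cos_norm (_ * r)) normrM (ger0_norm (divr_ge0 (ltW (pi_gt0 R)) (ltW (ltr0Sn _ 1)))). Qed.

Lemma cos_pi_ge0 (r : R) : `|r| <= 1 -> 0 <= cos (pi / 2 * r).
Proof.
move=> r1; rewrite cos_pi_norm -[leLHS](@cos_pihalf R) -[X in cos X <= _](mulr1 (pi / 2)).
by apply: cos_pi_le => //; rewrite ler1n.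
Qed.

(** [cos (pi / 2 * x)] decreases on [0,2] and changes sign under [x |-> 2 - x]. *)
Lemma cos_pi_small (d r : R) : 0 <= d -> d <= `|r| <= 2 - d -> `|cos (pi / 2 * r)| <= cos (pi / 2 * d).
Proof.
move=> d0 /andP[dr rd]; rewrite cos_pi_norm; move: (normr_ge0 r) dr rd; move: `|r| => x x0 dx xd.
rewrite ler_norml; apply/andP; split; last by apply: cos_pi_le => //; lra.
rewrite lerNl -cosDpi (_ : pi / 2 * x + pi = - (pi / 2 * (2 - x)) + pi *+ 2); last by rewrite mulr2n; field.
by rewrite cosD2pi cosN; apply: cos_pi_le => //; lra.
Qed.

Lemma kernel_mass (k : R -> R) d p : continuous k -> 0 < d -> (forall r, `|r| <= d / 2 -> p <= k r) ->
  (forall r, `|r| <= d -> 0 <= k r) -> d * p <= \int[mu]_(y in `[- d, d]) k y.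
Proof.
move=> ck d0 kp k0; have dd : - (d / 2) <= d / 2 by lra.
have -> : d * p = \int[mu]_(y in `[- (d / 2), d / 2]) p by rewrite Rint_cst//; field.
apply: (@le_trans _ _ (\int[mu]_(y in `[- (d / 2), d / 2]) k y)).
  apply: Rint_le; [exact: measurable_itv| |exact: cont_intg|].
    by apply: intg_cst; [exact: measurable_itv|exact: mu_itv_cc_fin].
  by move=> y; rewrite /= in_itv/= => yI; apply: kp; rewrite ler_norml.
apply: Rint_sub_le; [exact: measurable_itv|exact: measurable_itv| |exact: cont_intg|].
  by move=> y; rewrite /= !in_itv/=; lra.
by move=> y; rewrite /= in_itv/= => yI; apply: k0; rewrite ler_norml.
Qed.

Lemma kernel_window (k f : R -> R) s d w : continuous k -> continuous f -> (forall r, k (- r) = k r) -> 0 < d ->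
  (forall r, `|r| <= d -> 0 <= k r) -> (forall y, `|y - s| <= d -> `|f y - f s| <= w) ->
  `|\int[mu]_(y in `[s - d, s + d]) (f y * k (s - y)) - f s * \int[mu]_(y in `[- d, d]) k y| <=
    w * \int[mu]_(y in `[- d, d]) k y.
Proof.
move=> ck cf kN d0 k0 fw.
have cks : continuous (fun y => k (s - y)).
  move=> y; apply: (@continuous_comp _ _ _ (fun y => s - y) k); last exact: ck.
  by apply: cvgB; [exact: cvg_cst|exact: cvg_id].
have dd : - d <= d by lra.
have <- : \int[mu]_(y in `[s - d, s + d]) k (s - y) = \int[mu]_(y in `[- d, d]) k y.
  rewrite (addrC s d) (_ : s - d = - d + s); last by ring.
  rewrite (Rint_shift dd (cont_intg _ _ cks)); apply: Rint_eq => y _.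
  by rewrite -[RHS]kN; congr k; ring.
have md : measurable (`[s - d, s + d]%classic : set R) := measurable_itv _.
have ik := cont_intg (s - d) (s + d) cks.
have ih : intg `[s - d, s + d] (fun y => f y * k (s - y)).
  by apply: cont_intg => y; apply: cvgM; [exact: cf|exact: cks].
rewrite -!RintZ// -RintB//; last exact: intgZ.
apply: le_trans (Rint_norm md _) _; first by apply: intgB => //; exact: intgZ.
apply: Rint_le => //; [by apply: intg_norm => //; apply: intgB => //; exact: intgZ|exact: intgZ|].
move=> y; rewrite /= in_itv/= => yI; rewrite -mulrBl normrM.
have ys : `|y - s| <= d by rewrite ler_norml; lra.
have ky : 0 <= k (s - y) by apply: k0; rewrite distrC.
by rewrite (ger0_norm ky) ler_wpM2r// fw.
Qed.

(* As f vanishes near the ends of the cell, only the distances |r| <= 2 - d occur: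
   on them the kernel concentrates at 0 and f needs no periodic extension. *)
Lemma kernel_average (k f : R -> R) s0 rho d K Q w s : continuous k -> continuous f -> (forall r, k (- r) = k r) ->
  0 < d -> d <= rho -> rho <= 1 -> (forall r, `|r| <= d -> 0 <= k r) ->
  (forall r, d <= `|r| <= 2 - d -> `|k r| <= Q) -> 0 <= Q -> 0 <= K ->
  (forall x, x <= s0 + rho \/ s0 + 2 - rho <= x -> f x = 0) -> (forall x, `|f x| <= K) ->
  (forall y, `|y - s| <= d -> `|f y - f s| <= w) -> s0 <= s <= s0 + 2 ->
  `|\int[mu]_(y in `[s0, s0 + 2]) (f y * k (s - y)) - f s * \int[mu]_(y in `[- d, d]) k y| <=
    K * Q * 4 + w * \int[mu]_(y in `[- d, d]) k y.
Proof.
move=> ck cf kN d0 dr r1 k0 kQ Q0 K0 f0 fK fw /andP[s1 s2].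
have KQ : 0 <= K * Q by rewrite mulr_ge0.
have r0 : 0 < rho := lt_le_trans d0 dr.
have ch : continuous (fun y => f y * k (s - y)).
  move=> y; apply: cvgM; first exact: cf.
  apply: (@continuous_comp _ _ _ (fun y => s - y) k); last exact: ck.
  by apply: cvgB; [exact: cvg_cst|exact: cvg_id].
have g1 : s0 - 1 <= s0 by rewrite gerBl.
have g2 : s0 + 2 <= s0 + 3 by rewrite lerD2l ler_nat.
have <- : \int[mu]_(y in `[s0 - 1, s0 + 3]) (f y * k (s - y)) = \int[mu]_(y in `[s0, s0 + 2]) (f y * k (s - y)).
  apply: (Rint_support g1 (le_trans s1 s2) g2 (cont_intg _ _ ch)) => x xI.
  rewrite f0 ?mul0r//; case: xI => /ltW xI; [left|right].
    by apply: le_trans xI _; rewrite lerDl ltW.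
  by apply: le_trans xI; rewrite gerBl ltW.
have w1 : s0 - 1 <= s - d by rewrite lerB// (le_trans dr).
have w2 : s - d <= s + d by rewrite lerD2l ge0_cp// ltW.
have w3 : s + d <= s0 + 3 by rewrite (_ : s0 + 3 = s0 + 2 + 1); [rewrite lerD// (le_trans dr)|ring].
have tails x : s0 - 1 <= x <= s - d \/ s + d <= x <= s0 + 3 -> `|f x * k (s - x)| <= K * Q.
  move=> xI; have dx : d <= `|s - x|.
    by rewrite ler_normr; case: xI => /andP[a b]; apply/orP; [left|right]; move: a b; clear; lra.
  have [fx|] := boolP ((s0 + rho <= x) && (x <= s0 + 2 - rho)).
    rewrite normrM ler_pM//; apply: kQ; rewrite dx /= ler_norml.
    by case/andP: fx => a b; move: a b dr s1 s2; clear; lra.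
  by rewrite negb_and -!ltNge => /orP nx; rewrite f0 ?mul0r ?normr0//; case: nx => /ltW; [left|right].
rewrite (_ : _ - _ = (\int[mu]_(y in `[s0 - 1, s0 + 3]) (f y * k (s - y)) - \int[mu]_(y in `[s - d, s + d]) (f y * k (s - y))) +
  (\int[mu]_(y in `[s - d, s + d]) (f y * k (s - y)) - f s * \int[mu]_(y in `[- d, d]) k y)); last by ring.
apply: le_trans (ler_normD _ _) _; apply: lerD; last exact: kernel_window.
apply: le_trans (Rint_tails w1 w2 w3 ch tails) _; rewrite ler_wpM2l//.
by move: d0; clear; lra.
Qed.

(** An approximate identity: the power on [d <= |r| <= 2 - d] is negligible compared with its mass
    on [|r| <= d], and [c] normalises by that mass. *)
Lemma cos_kernel_concentration (sg : bool) (s0 rho e : R) (f : R -> R) : 0 < rho -> rho <= 1 -> continuous f ->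
  (forall x, x <= s0 + rho \/ s0 + 2 - rho <= x -> f x = 0) -> 0 < e ->
  exists (M : nat) (c : R), forall s, s0 <= s <= s0 + 2 ->
    `|c * \int[mu]_(y in `[s0, s0 + 2]) (f y * cos (pi / 2 * (s - y)) ^+ (2 * M + sg)) - f s| <= e.
Proof.
move=> r0 r1 cf f0 e0.
have e2 : 0 < e / 2 by rewrite divr_gt0.
have [d1 d10 hd1] : exists2 d1, 0 < d1 & forall x y, s0 - 1 <= x <= s0 + 3 -> s0 - 1 <= y <= s0 + 3 ->
    `|x - y| < d1 -> `|f x - f y| < e / 2 by apply: heine => //; exact: continuous_subspaceT.
have [K K0 fK'] := cont_bounded (s0 + rho) (s0 + 2 - rho) cf.
have fK x : `|f x| <= K.
  have [xI|] := boolP ((s0 + rho <= x) && (x <= s0 + 2 - rho)); first exact: fK'.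
  by rewrite negb_and -!ltNge => /orP nx; rewrite f0 ?normr0//; case: nx => /ltW; [left|right].
have [d [d0 dr dd1]] : exists d : R, [/\ 0 < d, d <= rho & d < d1].
  exists (Num.min rho (d1 / 2)); split; first by rewrite lt_min r0 divr_gt0.
    by rewrite ge_min lexx.
  by rewrite gt_min; apply/orP; right; rewrite ltr_pdivrMr// ltr_pMr// ltr1n.
have d1' : d <= 1 := le_trans dr r1.
have dh : d / 2 < d by rewrite ltr_pdivrMr// ltr_pMr// ltr1n.
have dh0 : 0 < d / 2 by rewrite divr_gt0.
have d2 : d <= 2 by apply: le_trans d1' _; rewrite ler1n.
(* [q ^+ m] bounds the kernel away from 0, and [q2 ^+ m] bounds it from below on half the window;
   their ratio tends to 0 with [m]. *)
set q := cos (pi / 2 * d); set q2 := cos (pi / 2 * (d / 2)).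
have q0 : 0 <= q by apply: cos_pi_ge0; rewrite gtr0_norm.
have q2q : q < q2 := cos_pi_lt (ltW dh0) dh d2.
have q20 : 0 < q2 := le_lt_trans q0 q2q.
have z01 : 0 <= q / q2 < 1 by rewrite (divr_ge0 q0 (ltW q20)) ltr_pdivrMr// mul1r.
(* Chosen so that the tails, at most [K * q ^+ m * 4], are below [e / 2] times the mass, which is at
   least [d * q2 ^+ m]; the other [e / 2] is the oscillation of [f]. *)
have eps0 : 0 < e / 2 * d / (4 * (K + 1)) by rewrite divr_gt0// ?mulr_gt0// ltr_wpDl.
have [M zM] := small_power z01 eps0.
set m := (2 * M + sg)%N.
have zm : (q / q2) ^+ m <= e / 2 * d / (4 * (K + 1)).
  apply: le_trans zM; case/andP: z01 => z0 z1.
  by apply: ler_wiXn2l => //; [exact: ltW|rewrite /m mul2n -addnn -addnA leq_addr].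
pose k r : R := cos (pi / 2 * r) ^+ m.
have ck : continuous k.
  move=> x; rewrite /k; apply: (@continuous_comp _ _ _ (fun r => cos (pi / 2 * r)) (fun z => z ^+ m)).
    exact: (@continuous_cos_line R).
  exact: exprn_continuous.
have kN r : k (- r) = k r by rewrite /k mulrN cosN.
have k0 r : `|r| <= d -> 0 <= k r.
  by move=> rd; rewrite /k exprn_ge0// cos_pi_ge0//; exact: le_trans rd d1'.
have kle r : `|r| <= d / 2 -> q2 ^+ m <= k r.
  move=> rd; have rd' := le_trans rd (ltW dh).
  rewrite /k lerXn2r ?nnegrE ?(ltW q20)//; first by apply: cos_pi_ge0; exact: le_trans rd' d1'.
  by rewrite cos_pi_norm; apply: cos_pi_le => //; exact: le_trans (le_trans (ltW dh) d2).
have ksmall r : d <= `|r| <= 2 - d -> `|k r| <= q ^+ m.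
  by move=> rd; rewrite /k normrX lerXn2r ?nnegrE//; apply: cos_pi_small => //; exact: ltW.
set I := \int[mu]_(y in `[- d, d]) k y.
have Ige : d * q2 ^+ m <= I := kernel_mass ck d0 kle k0.
have I0 : 0 < I by apply: lt_le_trans Ige; rewrite mulr_gt0// exprn_gt0.
exists M, I^-1 => s sI; rewrite -/m.
have fw y : `|y - s| <= d -> `|f y - f s| <= e / 2.
  move=> ys; apply: ltW; apply: hd1; last exact: le_lt_trans dd1.
    by move: sI (le_trans ys d1') => /andP[a b]; rewrite ler_norml => /andP[a' b']; move: a b a' b'; clear; lra.
  by case/andP: sI => a b; apply/andP; split; move: a b; clear; lra.
have := kernel_average ck cf kN d0 dr r1 k0 ksmall (exprn_ge0 m q0) K0 f0 fK fw sI.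
rewrite -/I => A.
have T3 : K * q ^+ m * 4 <= e / 2 * I.
  apply: le_trans (_ : e / 2 * (d * q2 ^+ m) <= _); last by rewrite ler_wpM2l// ltW.
  move: zm; rewrite expr_div_n ler_pdivrMr ?exprn_gt0//.
  have Q0 : 0 <= q ^+ m by rewrite exprn_ge0.
  move: (q ^+ m) (q2 ^+ m) Q0 => Q Q2 Q0.
  rewrite (mulrAC _ _ Q2) ler_pdivlMr ?mulr_gt0 ?ltr_wpDl//.
  by move: (e / 2) Q0 K0; clear => E Q0 K0 zz; nra.
rewrite -(@ler_pM2r _ I)// -[X in _ * X <= _](gtr0_norm I0) -normrM mulrBl mulrAC mulVf ?gt_eqF// mul1r.
apply: le_trans A _; apply: le_trans (_ : _ <= e / 2 * I + e / 2 * I) _; first by rewrite lerD2r.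
by rewrite -mulrDl -splitr.
Qed.

End cosine_kernel.

(** * Completeness of the trigonometric system *)

Section completeness.
Context {R : realType}.
Local Notation mu := (@lebesgue_measure R).
Variables (s0 : R) (sg : bool).
Local Notation cell := (`[s0, s0 + 2]%classic : set R).
Local Notation frq := (@frq R sg).
Local Notation fa := (@fa R s0 sg).
Local Notation fb := (@fb R s0 sg).
Local Notation trigU := (@trigU R sg).
Local Notation trigW := (@trigW R sg).
Implicit Types (n : int) (B : seq int) (x y : int -> R).

Lemma pairing_trigU (f : R -> R) B x y : L2loc f ->
  \int[mu]_(s in cell) (f s * trigU B x y s) = 2 * \sum_(n <- B) (x n * fa f n + y n * fb f n).
Proof.
move=> fL; have mc : measurable cell := measurable_itv _.
have cC n : continuous (fun s : R => cos (frq n * s)) := @continuous_cos_line R (frq n).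
have cS n : continuous (fun s : R => sin (frq n * s)) := @continuous_sin_line R (frq n).
have ii (g : R -> R) : continuous g -> intg cell (fun s => f s * g s).
  by move=> cg; apply: sqint_mul => //; apply: L2loc_sqint => //; exact: L2loc_cont.
elim: B => [|n B IH].
  by rewrite big_nil mulr0 (Rint_eq (g := fun=> 0)) ?Rint_cst ?mul0r ?lerDl// => s _; rewrite /trigU big_nil mulr0.
rewrite big_cons mulrDr -IH.
have [cU _] := trig_continuous sg B x y.
rewrite (Rint_eq (g := fun s => (x n * (f s * cos (frq n * s)) + y n * (f s * sin (frq n * s))) + f s * trigU B x y s)); last first.
  by move=> s _; rewrite /trigU big_cons; ring.
have i1 := ii _ (cC n); have i2 := ii _ (cS n).
rewrite RintD//; [|by apply: intgD => //; exact: intgZ|exact: ii].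
rewrite RintD//; [|exact: intgZ|exact: intgZ].
by rewrite !RintZ// /fa /fb; congr (_ + _); field.
Qed.

Lemma cos_kernel_trig (M : nat) (f : R -> R) : continuous f -> exists B x y, [/\ uniq B,
  forall s, trigW B x y s = 0 &
  forall s, trigU B x y s = \int[mu]_(r in cell) (f r * cos (pi / 2 * (s - r)) ^+ (2 * M + sg))].
Proof.
move=> cf; have fL := L2loc_cont cf; set m := (2 * M + sg)%N.
have [al _ alE]   := @cos_power R m.
pose B := [seq M%:Z - j%:Z | j <- index_iota 0 m.+1].
(* At [n = M - j] the absolute value recovers [j]. *)
pose be n : R := al `|M%:Z - n|%N.
have frE j r : (m%:R - 2 * j%:R) * (pi / 2 * r) = frq (M%:Z - j%:Z) * r.
  rewrite /frq /m natrD natrM !intrD intrM intrB -!pmulrn.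
  by move: (M%:R : R) (j%:R : R) (sg%:R : R) => a b c; field.
have beE j : be (M%:Z - j%:Z) = al j by rewrite /be subKr.
have FC r : \sum_(n <- B) be n * cos (frq n * r) = cos (pi / 2 * r) ^+ m.
  have <- : \sum_(0 <= j < m.+1) al j * cos ((m%:R - 2 * j%:R) * (pi / 2 * r)) = cos (pi / 2 * r) ^+ m.
    by rewrite (alE cos) ?cos0 ?mulr1// => a b; rewrite cosD cosB; ring.
  by rewrite big_map; apply: eq_bigr => j _; rewrite beE frE.
have FS r : \sum_(n <- B) be n * sin (frq n * r) = 0.
  transitivity (\sum_(0 <= j < m.+1) al j * sin ((m%:R - 2 * j%:R) * (pi / 2 * r))); last first.
    by rewrite (alE sin) ?sin0 ?mulr0// => a b; rewrite sinD sinB; ring.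
  by rewrite big_map; apply: eq_bigr => j _; rewrite beE frE.
exists B, (fun n => 2 * (be n * fa f n)), (fun n => 2 * (be n * fb f n)); split.
- by rewrite map_inj_uniq ?iota_uniq// => i j /(addrI _)/oppr_inj[].
- move=> s; have := pairing_trigU B (fun n => be n * sin (frq n * s)) (fun n => - (be n * cos (frq n * s))) fL.
  rewrite (Rint_eq (g := fun=> 0)); last first.
    move=> r _; rewrite (_ : trigU _ _ _ _ = 0) ?mulr0// -[RHS](FS (s - r)).
    by apply: eq_bigr => n _; rewrite mulrBr sinB; ring.
  rewrite Rint_cst ?lerDl// mul0r => h; rewrite [RHS]h mulr_sumr; apply: eq_bigr => n _; ring.
- move=> s; have := pairing_trigU B (fun n => be n * cos (frq n * s)) (fun n => be n * sin (frq n * s)) fL.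
  rewrite (Rint_eq (g := fun r => f r * cos (pi / 2 * (s - r)) ^+ m)); last first.
    move=> r _; congr (_ * _); rewrite -FC.
    by apply: eq_bigr => n _; rewrite mulrBr cosB; ring.
  by move=> ->; rewrite mulr_sumr; apply: eq_bigr => n _; ring.
Qed.

Lemma trigZ c B x y s : trigU B (fun n => c * x n) (fun n => c * y n) s = c * trigU B x y s /\
  trigW B (fun n => c * x n) (fun n => c * y n) s = c * trigW B x y s.
Proof. by split; rewrite /trigU /trigW mulr_sumr; apply: eq_bigr => n _; ring. Qed.

Lemma trig_uniform (rho e : R) (f : R -> R) : 0 < rho -> rho <= 1 -> continuous f ->
  (forall r, r <= s0 + rho \/ s0 + 2 - rho <= r -> f r = 0) -> 0 < e ->
  exists B x y, [/\ uniq B, forall s, trigW B x y s = 0 &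
    forall s, cell s -> `|trigU B x y s - f s| <= e].
Proof.
move=> r0 r1 cf f0 e0; have [M [c h]] := cos_kernel_concentration sg r0 r1 cf f0 e0.
have [B [x [y [uB W0 UE]]]] := cos_kernel_trig M cf.
exists B, (fun n => c * x n), (fun n => c * y n); split => //.
  by move=> s; rewrite (trigZ c B x y s).2 W0 mulr0.
by move=> s; rewrite /= in_itv/= => sI; rewrite (trigZ c B x y s).1 UE; exact: h.
Qed.

(** The kernel argument needs functions that vanish near the ends of the cell. Multiplication by two
    copies of [step] changes [g] only on two end intervals of total length [4 * rho], by at most its
    bound [K]. *)
Lemma cutoff (e : R) (g : R -> R) : continuous g -> 0 < e -> exists rho f, [/\ 0 < rho, rho <= 1, continuous f,
  forall r, r <= s0 + rho \/ s0 + 2 - rho <= r -> f r = 0 &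
  \int[mu]_(s in cell) ((g s - f s) ^+ 2) <= e].
Proof.
move=> cg e0; have [K K0 gK] := cont_bounded s0 (s0 + 2) cg.
have K1 : 0 < K ^+ 2 + 1 by rewrite ltr_wpDl// sqr_ge0.
pose rho := Num.min (2^-1) (e / (4 * (K ^+ 2 + 1))).
have rho0 : 0 < rho by rewrite lt_min invr_gt0 ltr0n divr_gt0// mulr_gt0.
have rho2 : rho <= 2^-1 by rewrite ge_min lexx.
have rhoe : 4 * rho * (K ^+ 2 + 1) <= e.
  have : rho <= e / (4 * (K ^+ 2 + 1)) by rewrite ge_min lexx orbT.
  by rewrite ler_pdivlMr ?mulr_gt0// => h; apply: le_trans h; rewrite le_eqVlt; apply/orP; left; apply/eqP; ring.
pose chi s : R := step (rho^-1 * (s - s0)) * step (rho^-1 * (s0 + 2 - s)).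
have cstep : continuous (@step R) by move=> z; exact: is_derive_continuous (step_derive z).
have cchi : continuous chi.
  move=> z; apply: cvgM.
    apply: (@continuous_comp _ _ _ (fun s => rho^-1 * (s - s0)) (@step R)); last exact: cstep.
    by apply: cvgM; [exact: cvg_cst|apply: cvgB; [exact: cvg_id|exact: cvg_cst]].
  apply: (@continuous_comp _ _ _ (fun s => rho^-1 * (s0 + 2 - s)) (@step R)); last exact: cstep.
  by apply: cvgM; [exact: cvg_cst|apply: cvgB; [exact: cvg_cst|exact: cvg_id]].
have chi01 s : 0 <= 1 - chi s <= 1.
  have /andP[a0 a1] := step_01 (rho^-1 * (s - s0)); have /andP[b0 b1] := step_01 (rho^-1 * (s0 + 2 - s)).
  rewrite subr_ge0 mulr_ile1//= lerBlDr lerDl mulr_ge0//.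
pose f s := g s * chi s.
have cf : continuous f by move=> z; apply: cvgM; [exact: cg|exact: cchi].
exists rho, f; split => //; first by apply: le_trans rho2 _; rewrite invf_le1 ?ler1n.
  move=> r [rI|rI]; rewrite /f /chi.
    by rewrite (@step_low _ (rho^-1 * (r - s0))) ?mul0r ?mulr0// mulrC ler_pdivrMr// mul1r lerBlDl.
  by rewrite (@step_low _ (rho^-1 * (s0 + 2 - r))) ?mul0r ?mulr0// mulrC ler_pdivrMr// mul1r lerBlDl -lerBlDr.
have hE s : (g s - f s) ^+ 2 = (g s * (1 - chi s)) ^+ 2 by rewrite /f; ring.
rewrite (Rint_eq (g := fun s => (g s * (1 - chi s)) ^+ 2)); last by move=> s _; exact: hE.
set h := fun s => (g s * (1 - chi s)) ^+ 2.
have ch : continuous h.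
  have ck : continuous (fun s => g s * (1 - chi s)).
    by move=> z; apply: cvgM; [exact: cg|apply: cvgB; [exact: cvg_cst|exact: cchi]].
  by rewrite (_ : h = fun s => (g s * (1 - chi s)) * (g s * (1 - chi s))) => [z|]; [apply: cvgM; exact: ck|apply/funext => s; rewrite /h expr2].
have pq : s0 + 2 * rho <= s0 + 2 - 2 * rho by move: rho2; rewrite -[2^-1]mul1r ler_pdivlMr//; lra.
have ap : s0 <= s0 + 2 * rho by rewrite lerDl mulr_ge0// ltW.
have qb : s0 + 2 - 2 * rho <= s0 + 2 by rewrite gerBl mulr_ge0// ltW.
have hK (x : R) : s0 <= x <= s0 + 2 * rho \/ s0 + 2 - 2 * rho <= x <= s0 + 2 -> `|h x| <= K ^+ 2.
  move=> xI; have gx : `|g x| <= K by apply: gK; lra.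
  have /andP[c0 c1] := chi01 x.
  rewrite /h ger0_norm ?sqr_ge0// exprMn -[leRHS]mulr1 ler_pM ?sqr_ge0//.
    by rewrite -real_normK ?num_real// lerXn2r ?nnegrE.
  by rewrite expr_le1.
have := Rint_tails ap pq qb ch hK.
rewrite [X in _ - X](_ : _ = 0) ?subr0; last first.
  rewrite (Rint_eq (g := fun=> 0)) ?Rint_cst ?mul0r// => x; rewrite /= in_itv/= => /andP[xa xb].
  rewrite /h /chi !step_high ?mulr1 ?subrr ?mulr0 ?expr0n// mulrC ler_pdivlMr//; first by rewrite lerBrDl addrC -lerBrDl; lra.
  by rewrite lerBrDl; lra.
move=> /(le_trans (ler_norm _)) H; apply: (le_trans H); apply: le_trans rhoe.
by rewrite (_ : _ * _ = 4 * rho * K ^+ 2); [rewrite ler_wpM2l ?lerDl// mulr_ge0// ltW|ring].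
Qed.

(** Three successive approximations in mean square: by a continuous function, by one vanishing near
    the ends, and by a trigonometric sum with zero imaginary part. *)
Lemma residual_small (H : R -> R) e : L2loc H -> 0 < e ->
  exists B x y, uniq B /\ residual s0 sg H B x y <= e.
Proof.
move=> HL e0; have e3 : 0 < e / 5 by rewrite divr_gt0.
have [g cg Hg] := L2_dense (L2loc_sqint s0 (s0 + 2) HL) e3.
have [rho [f [r0 r1 cf f0 gf]]] := cutoff cg e3.
(* A uniform error at most 1 and [e / 10] has square at most [e / 10], hence energy at most [e / 5]
   on a cell of length 2. *)
have d0 : 0 < Num.min 1 (e / 10) by rewrite lt_min ltr01 divr_gt0.
have [B [x [y [uB W0 Uf]]]] := trig_uniform r0 r1 cf f0 d0.
exists B, x, y; split => //.
have mc : measurable cell := measurable_itv _.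
have [cU _] := trig_continuous sg B x y.
have i2 (k : R -> R) : L2loc k -> intg cell (fun s => k s ^+ 2) by move=> kl; exact: kl.2.
have gL := L2loc_cont cg; have fL := L2loc_cont cf; have UL := L2loc_cont cU.
have j1 := i2 _ (L2locB HL gL); have j2 := i2 _ (L2locB gL fL); have j3 := i2 _ (L2locB fL UL).
have j := i2 _ (L2locB HL UL).
have fU : \int[mu]_(s in cell) ((f s - trigU B x y s) ^+ 2) <= e / 5.
  rewrite (_ : e / 5 = e / 10 * (s0 + 2 - s0)); last by field.
  apply: Rint_sqr_bound => //; first by rewrite lerDl.
  move=> s sI; have := Uf s; rewrite /= in_itv/= => /(_ sI); rewrite distrC le_min => /andP[b1 b2].
  rewrite -real_normK ?num_real// expr2; apply: le_trans b2.
  by rewrite ler_piMl.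
rewrite /residual.
(* The weights 2, 4, 4 come from splitting the square of a sum twice; with three errors [e / 5] and
   the factor 1/2 they add up to [e]. *)
apply: (@le_trans _ _ (2^-1 * \int[mu]_(s in cell) (2 * ((H s - g s) ^+ 2) + (4 * ((g s - f s) ^+ 2) + 4 * ((f s - trigU B x y s) ^+ 2))))).
  rewrite ler_pM2l ?invr_gt0//; apply: Rint_le => //.
  - by apply: (eq_intg (f := fun s => (H s - trigU B x y s) ^+ 2)) => // s _; rewrite W0 expr0n addr0.
  - by apply: intgD => //; [exact: intgZ|apply: intgD => //; exact: intgZ].
  - move=> s _; rewrite W0 expr0n addr0; move: (H s) (g s) (f s) (trigU B x y s) => a b c d.
    have := sqr_ge0 (a - b - (b - d)); have := sqr_ge0 (b - c - (c - d)); nra.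
have k1 : intg cell (fun s => 4 * (g s - f s) ^+ 2) by exact: intgZ.
have k2 : intg cell (fun s => 4 * (f s - trigU B x y s) ^+ 2) by exact: intgZ.
rewrite RintD//; [|exact: intgZ|exact: intgD].
rewrite RintD// !RintZ//; lra.
Qed.

End completeness.

Lemma L2locM_cont {R : realType} (k f : R -> R) : continuous k -> L2loc f -> L2loc (fun z => k z * f z).
Proof.
move=> ck fL; split; first by apply: measurable_funM; [exact: continuous_measurable_fun|exact: fL.1].
move=> b c; have [M M0 hM] := cont_bounded b c ck.
apply: (intg_le (g := fun z => M ^+ 2 * f z ^+ 2)); [exact: measurable_itv| | |].
- apply: measurable_funTS; apply: measurable_funX; apply: measurable_funM; [exact: continuous_measurable_fun|exact: fL.1].
- move=> z; rewrite /= in_itv/= => zI; rewrite ger0_norm ?sqr_ge0// exprMn ler_wpM2r ?sqr_ge0//.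
  by rewrite -real_normK ?num_real// lerXn2r ?nnegrE// hM.
- by apply: intgZ; [exact: measurable_itv|exact: fL.2].
Qed.

(** * Parseval's identity and convergence of the series *)

Section series.
Context {R : realType}.
Local Notation mu := (@lebesgue_measure R).
Variables (s0 : R) (sg : bool) (a : R) (H : R -> R).
Local Notation cell := (`[s0, s0 + 2]%classic : set R).
Local Notation frq := (@frq R sg).
Hypothesis HL : L2loc H.
Implicit Types (n : int) (A B : seq int).

Lemma parseval_approx e : 0 < e -> exists2 B, uniq B & forall A, uniq A -> {subset B <= A} ->
  residual s0 sg H A (fa s0 sg H) (fb s0 sg H) <= e.
Proof.
move=> e0; have [B [x [y [uB rB]]]] := residual_small s0 sg HL e0.
by exists B => // A uA BA; apply: le_trans rB; exact: residual_best.
Qed.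

(** Bessel's inequality bounds every finite sum from above; a finite set with residual at most [e]
    gives the reverse up to [e]. *)
Lemma parseval_esum : (\esum_(n in [set: int]) (fa s0 sg H n ^+ 2 + fb s0 sg H n ^+ 2)%:E =
  (2^-1 * \int[mu]_(s in cell) (H s ^+ 2))%:E)%E.
Proof.
set r := fun n : int => fa s0 sg H n ^+ 2 + fb s0 sg H n ^+ 2.
have fs (X : set int) : finite_set X -> (\sum_(n \in X) (r n)%:E)%E = (\sum_(n <- fset_set X) r n)%:E.
  by move=> fX; rewrite fsbig_finite// sumEFin.
apply/eqP; rewrite eq_le; apply/andP; split.
  apply: ub_ereal_sup => _ [X [fX _] <-]; rewrite fs// lee_fin.
  by apply: bessel => //; exact: fset_uniq.
apply/lee_addgt0Pr => e e0.
have [B uB hB] := parseval_approx e0.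
have := hB _ uB (fun _ => id); rewrite residual_coef// => hB'.
apply: (@le_trans _ _ ((\sum_(n <- B) r n)%:E + e%:E)%E).
  by rewrite -EFinD lee_fin -lerBlDl.
apply: leeD => //; rewrite -[X in (X <= _)%E](_ : (\sum_(n \in [set` B]) (r n)%:E)%E = _).
  by apply: ereal_sup_ubound; exists [set` B] => //; split => //; exact: finite_seq.
rewrite fs ?finite_seq//; congr (_%:E); apply: perm_big; apply: uniq_perm => // n.
rewrite in_fset_set; last exact: finite_seq.
by apply/idP/idP; [move=> /set_mem|move=> nB; apply: mem_set].
Qed.

Variables (p q : int -> R).
Hypothesis pq_a : forall n, - a * p n - frq n * q n = fa s0 sg H n.
Hypothesis pq_b : forall n, a * q n - frq n * p n = fb s0 sg H n.

(** With [c_n = p n + i q n], [modeP] and [modeQ] are the real and imaginary parts of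
    [c_n e^(omega_n s)], and [pq_a], [pq_b] say that [omega_n c_n = fa n - i fb n]. *)
Definition modeP n (s : R) : R := expR (- a * s) * (p n * cos (frq n * s) - q n * sin (frq n * s)).
Definition modeQ n (s : R) : R := expR (- a * s) * (p n * sin (frq n * s) + q n * cos (frq n * s)).

Let kappa : R := if sg then - expR (- a * 2) else expR (- a * 2).

(** [e^(2 omega_n)] does not depend on [n]: the integer part of the frequency contributes a multiple
    of 2 pi, and the half-integer shift of the antiperiodic case a sign. *)
Lemma mode_shift n s : modeP n (s + 2) = kappa * modeP n s /\ modeQ n (s + 2) = kappa * modeQ n s.
Proof.
have fr : frq n * (s + 2) = (frq n * s + (if sg then pi else 0)) + n%:~R * (pi *+ 2).
  by rewrite /frq intrD intrM mulr2n; case: sg => /=; field.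
have [c s'] := cosD2pi_int n (frq n * s + (if sg then pi else 0)).
rewrite /modeP /modeQ fr c s' (mulrDr (- a) s 2) expRD /kappa.
by case: (sg); rewrite ?cosDpi ?sinDpi ?addr0; split; ring.
Qed.

(** Differentiation multiplies by [omega_n], so the coefficients become those of [H]; the
    term-by-term derivative of the series is the Fourier series of [H] times [expR (- a * s)]. *)
Lemma mode_derive n (s : R) :
  is_derive s 1 (modeP n) (expR (- a * s) * (fa s0 sg H n * cos (frq n * s) + fb s0 sg H n * sin (frq n * s))) /\
  is_derive s 1 (modeQ n) (expR (- a * s) * (fa s0 sg H n * sin (frq n * s) - fb s0 sg H n * cos (frq n * s))).
Proof.
have aff (b z : R) : is_derive z 1 (fun y : R => b * y) b.
  have := is_derive_affine 0 b z; rewrite (_ : (fun y => _) = (fun y : R => b * y))//.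
  by apply/funext => y; rewrite add0r.
have dE := is_derive_compr (@is_derive_expR R) (aff (- a) s).
have dC := is_derive_compr (@is_derive_cos R) (aff (frq n) s).
have dS := is_derive_compr (@is_derive_sin R) (aff (frq n) s).
have dZ (c : R) (f : R -> R) df : is_derive s 1 f df -> is_derive s 1 (fun y => c * f y) (c * df).
  move=> D; have := is_derive_mulr (is_derive_cst c s 1) D.
  by move=> h; apply: is_derive_eq h _; rewrite mul0r add0r.
split.
  have := is_derive_mulr dE (is_derive_subr (dZ (p n) _ _ dC) (dZ (q n) _ _ dS)).
  by move=> h; apply: is_derive_eq h _; rewrite -pq_a -pq_b; ring.
have := is_derive_mulr dE (is_derive_subr (dZ (p n) _ _ dS) (dZ (- q n) _ _ dC)).
rewrite (_ : (fun y => _) = modeQ n); last by apply/funext => y; rewrite /modeQ; congr (_ * _); rewrite mulNr opprK.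
by move=> h; apply: is_derive_eq h _; rewrite -pq_a -pq_b; ring.
Qed.

Lemma sum_mode_derive A (s : R) :
  is_derive s 1 (fun s => \sum_(n <- A) modeP n s) (expR (- a * s) * trigU sg A (fa s0 sg H) (fb s0 sg H) s) /\
  is_derive s 1 (fun s => \sum_(n <- A) modeQ n s) (expR (- a * s) * trigW sg A (fa s0 sg H) (fb s0 sg H) s).
Proof.
have nl (F : int -> R -> R) : is_derive s 1 (fun s => \sum_(n <- [::]) F n s) 0.
  rewrite (_ : (fun s => _) = cst 0); [exact: is_derive_cst|by apply/funext => z; rewrite big_nil].
have cs (F : int -> R -> R) n A' df df' : is_derive s 1 (F n) df -> is_derive s 1 (fun s => \sum_(n <- A') F n s) df' ->
    is_derive s 1 (fun s => \sum_(n <- n :: A') F n s) (df + df').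
  move=> d1 d2; rewrite (_ : (fun s => _) = (fun s => F n s + \sum_(n <- A') F n s)); last first.
    by apply/funext => z; rewrite big_cons.
  exact: is_deriveD.
rewrite /trigU /trigW; elim: A => [|n A [IH1 IH2]].
  by rewrite !big_nil !mulr0; split; exact: nl.
rewrite !big_cons [X in is_derive _ _ _ X /\ _]mulrDr [X in _ /\ is_derive _ _ _ X]mulrDr; have [d1 d2] := mode_derive n s.
by split; apply: cs.
Qed.

Variable G : R -> R.
Hypothesis kappa1 : kappa != 1.
Hypothesis Gprim : forall x y, s0 <= x -> x <= y -> y <= s0 + 2 ->
  G y - G x = \int[mu]_(z in `[x, y]) (expR (- a * z) * H z).
Hypothesis Gshift : forall s, s0 <= s -> G (s + 2) = kappa * G s.

(* The twisted periodicity replaces a vanishing mean in Poincare's inequality. *)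
Lemma twisted_sup (v dv : R -> R) : (forall x y, s0 <= x -> x <= y -> y <= s0 + 2 ->
    v y - v x = \int[mu]_(z in `[x, y]) dv z) -> L2loc dv -> v (s0 + 2) = kappa * v s0 ->
  forall s, cell s -> v s ^+ 2 <= 4 * (1 + (kappa - 1) ^- 2) * \int[mu]_(z in cell) (dv z ^+ 2).
Proof.
move=> vp dvL vs s; rewrite /= in_itv/= => /andP[s1 s2].
set N := \int[mu]_(z in cell) (dv z ^+ 2).
have sq x y : s0 <= x -> x <= y -> y <= s0 + 2 -> (v y - v x) ^+ 2 <= 2 * N.
  move=> x0 xy y2; rewrite vp//; apply: le_trans (Rint_sqr_le_itv xy (L2loc_sqint x y dvL)) _.
  apply: ler_pM; rewrite ?subr_ge0 ?Rintegral_sqr_ge0//; first lra.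
  apply: Rint_sub_le; [exact: measurable_itv|exact: measurable_itv| |exact: dvL.2|by move=> z _; exact: sqr_ge0].
  by move=> z; rewrite /= !in_itv/= => /andP[z1 z2]; rewrite (le_trans x0 z1) (le_trans z2 y2).
have h1 := sq s0 s (lexx _) s1 s2.
have h2 := sq s0 (s0 + 2) (lexx _) (le_trans s1 s2) (lexx _).
have k10 : kappa - 1 != 0 by rewrite subr_eq0.
(* The increment over one period is [(kappa - 1) * v s0], so it bounds the value at the end
   point. *)
have h3 : v s0 ^+ 2 <= (kappa - 1) ^- 2 * (2 * N).
  rewrite -exprVn -(@ler_pM2l _ ((kappa - 1) ^+ 2)) ?exprn_even_gt0//.
  rewrite (mulrA _ _ (2 * N)) -[_ ^+ 2 * _ ^+ 2]exprMn -[_ ^+ 2 * _^-1 ^+ 2]exprMn divff// expr1n mul1r.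
  by apply: le_trans h2; rewrite vs mulrBl mul1r.
have := sqr_ge0 (v s - v s0 - v s0); nra.
Qed.

(** [twisted_sup] is applied to [G] minus the partial sum, and to the imaginary partial sum. Their
    derivatives are [expR (- a * s)] times the two functions whose energies form the residual, so
    uniform convergence follows from convergence in mean square. *)
Lemma series_cell e : 0 < e -> exists2 B, uniq B & forall A, uniq A -> {subset B <= A} -> forall s, cell s ->
  `|G s - \sum_(n <- A) modeP n s| <= e /\ `|\sum_(n <- A) modeQ n s| <= e.
Proof.
move=> e0.
have cex : continuous (fun s : R => expR (- a * s)).
  move=> s; apply: (@continuous_comp _ _ _ (fun s => - a * s) expR); last exact: continuous_expR.
  by apply: cvgM; [exact: cvg_cst|exact: cvg_id].
have [E E0 hE] := cont_bounded s0 (s0 + 2) cex.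
set K := 4 * (1 + (kappa - 1) ^- 2).
have K0 : 0 < K by rewrite mulr_gt0// ltr_wpDr// -exprVn sqr_ge0.
(* [K] comes from [twisted_sup], [E] bounds the exponential weight on the cell, and 2 undoes the
   factor 1/2 in [residual]. *)
set D := K * (E ^+ 2 + 1) * 2.
have E1 : 0 < E ^+ 2 + 1 by rewrite ltr_wpDl// sqr_ge0.
have D0 : 0 < D by apply: mulr_gt0 => //; exact: mulr_gt0.
have [B uB hB] := parseval_approx (divr_gt0 (exprn_gt0 2 e0) D0).
exists B => // A uA BA s sI.
have := hB A uA BA; set x := fa s0 sg H; set y := fb s0 sg H => rA.
have [cU cW] := trig_continuous sg A x y.
have UL := L2locB HL (L2loc_cont cU); have WL := L2loc_cont cW.
have mc : measurable cell := measurable_itv _.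
have mul_exp (f : R -> R) : L2loc f -> L2loc (fun z => expR (- a * z) * f z) := L2locM_cont cex.
have fin (v f : R -> R) : (forall x y, s0 <= x -> x <= y -> y <= s0 + 2 ->
    v y - v x = \int[mu]_(z in `[x, y]) (expR (- a * z) * f z)) -> L2loc f -> v (s0 + 2) = kappa * v s0 ->
    2^-1 * \int[mu]_(z in cell) (f z ^+ 2) <= e ^+ 2 / D -> `|v s| <= e.
  move=> vp fL vs fe; have := twisted_sup vp (mul_exp _ fL) vs sI.
  rewrite -/K => h.
  have h2 : \int[mu]_(z in cell) ((expR (- a * z) * f z) ^+ 2) <= (E ^+ 2 + 1) * \int[mu]_(z in cell) (f z ^+ 2).
    have f2 := fL.2 s0 (s0 + 2).
    rewrite -RintZ//; apply: Rint_le => //; [exact: (mul_exp _ fL).2|exact: intgZ|].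
    move=> z; rewrite /= in_itv/= => zI; rewrite exprMn ler_wpM2r ?sqr_ge0//.
    by apply: le_trans (_ : E ^+ 2 <= _); rewrite ?lerDl// -real_normK ?num_real// lerXn2r ?nnegrE// hE.
  have h3 : v s ^+ 2 <= e ^+ 2.
    apply: le_trans h _; apply: le_trans (ler_wpM2l (ltW K0) h2) _.
    by move: fe; rewrite ler_pdivlMr// /D; apply: le_trans; rewrite le_eqVlt; apply/orP; left; apply/eqP; field.
  by move: h3; rewrite -(real_normK (num_real (v s))) ler_pXn2r ?nnegrE// ltW.
have resE : residual s0 sg H A x y = 2^-1 * \int[mu]_(z in cell) ((H z - trigU sg A x y z) ^+ 2) +
    2^-1 * \int[mu]_(z in cell) (trigW sg A x y z ^+ 2).
  by rewrite /residual RintD ?mulrDr//; [exact: UL.2|exact: WL.2].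
have h0 (f : R -> R) : 0 <= 2^-1 * \int[mu]_(z in cell) (f z ^+ 2).
  by rewrite mulr_ge0// Rintegral_sqr_ge0.
have sumprim (F : R -> R) (dF : R -> R) x' y' : (forall z : R, is_derive z 1 F (expR (- a * z) * dF z)) -> continuous dF -> x' <= y' ->
    F y' - F x' = \int[mu]_(z in `[x', y']) (expR (- a * z) * dF z).
  move=> dFd cdF xy; rewrite -(Rint_derive xy dFd)// => z.
  by apply: cvgM; [exact: cex|exact: cdF].
have HeL := mul_exp _ HL; have UeL := mul_exp _ (L2loc_cont cU).
split.
  apply: (fin (fun s => G s - \sum_(n <- A) modeP n s) (fun z => H z - trigU sg A x y z)) => //.
  - move=> x' y' h1 h2 h3.
    rewrite (_ : _ - _ = (G y' - G x') - (\sum_(n <- A) modeP n y' - \sum_(n <- A) modeP n x')); last by ring.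
    have Sm : \sum_(n <- A) modeP n y' - \sum_(n <- A) modeP n x' =
        \int[mu]_(z in `[x', y']) (expR (- a * z) * trigU sg A x y z).
      by apply: (sumprim (fun s => \sum_(n <- A) modeP n s)) => // z; exact: (sum_mode_derive A z).1.
    rewrite Gprim// Sm.
    rewrite -RintB//; [|exact: L2loc_intg|exact: L2loc_intg].
    by apply: Rint_eq => z _; rewrite mulrBr.
  - rewrite Gshift// mulrBr mulr_sumr; congr (_ - _); apply: eq_bigr => n _; exact: (mode_shift n s0).1.
  - by apply: le_trans rA; rewrite resE lerDl h0.
apply: (fin (fun s => \sum_(n <- A) modeQ n s) (trigW sg A x y)) => //.
- by move=> x' y' h1 h2 h3; apply: (sumprim (fun s => \sum_(n <- A) modeQ n s)) => // z; exact: (sum_mode_derive A z).2.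
- by rewrite mulr_sumr; apply: eq_bigr => n _; exact: (mode_shift n s0).2.
- by apply: le_trans rA; rewrite resE lerDr h0.
Qed.

(** A shift by 2 multiplies [G] and every mode by [kappa], so induction on the number of periods
    reaches every [s], the tolerance being divided by [|kappa| + 1] at each step. *)
Lemma series_all e s : s0 <= s -> 0 < e -> exists2 B, uniq B & forall A, uniq A -> {subset B <= A} ->
  `|G s - \sum_(n <- A) modeP n s| <= e /\ `|\sum_(n <- A) modeQ n s| <= e.
Proof.
move=> s0s.
have [k] : exists k : nat, s < s0 + 2 * k.+1%:R.
  exists (Num.truncn ((s - s0) / 2)); have := truncnS_gt ((s - s0) / 2).
  by rewrite ltr_pdivrMr// ltrBlDl mulrC.
elim: k s s0s e => [|k IH] s s0s e sk e0.
  have [B uB hB] := series_cell e0; exists B => // A uA BA; apply: hB => //.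
  by rewrite /= in_itv/= s0s; move: sk; rewrite mulr1 => /ltW.
have [s2|s2] := leP (s0 + 2) s; last first.
  have [B uB hB] := series_cell e0; exists B => // A uA BA; apply: hB => //.
  by rewrite /= in_itv/= s0s ltW.
have K0 : 0 < `|kappa| + 1 by rewrite ltr_wpDl.
have h1 : s0 <= s - 2 by rewrite lerBrDr.
have h2 : s - 2 < s0 + 2 * k.+1%:R by move: sk; rewrite -(natr1 k.+1); lra.
have [B uB hB] := IH (s - 2) h1 (e / (`|kappa| + 1)) h2 (divr_gt0 e0 K0).
exists B => // A uA BA; have [hP hQ] := hB A uA BA.
have sh : s = s - 2 + 2 by rewrite subrK.
have eP : \sum_(n <- A) modeP n s = kappa * \sum_(n <- A) modeP n (s - 2).
  by rewrite mulr_sumr; apply: eq_bigr => n _; rewrite {1}sh (mode_shift n _).1.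
have eQ : \sum_(n <- A) modeQ n s = kappa * \sum_(n <- A) modeQ n (s - 2).
  by rewrite mulr_sumr; apply: eq_bigr => n _; rewrite {1}sh (mode_shift n _).2.
have fin (r r' : R) : r = kappa * r' -> `|r'| <= e / (`|kappa| + 1) -> `|r| <= e.
  move=> ->; rewrite ler_pdivlMr// normrM => h; apply: le_trans h; by rewrite mulrC ler_wpM2l// lerDl ler01.
by split; [apply: fin hP; rewrite mulrBr -Gshift// -sh; congr (_ - _); exact: eP|exact: fin hQ].
Qed.

End series.

(** * Moving boundary and initial data *)

Section extension.
Context {R : realType}.
Local Notation mu := (@lebesgue_measure R).
Implicit Types (a b e : R).

(** A uniform lower bound on the derivative makes [s] unbounded in both directions; surjectivity
    follows by intermediate values. *)
Lemma diffeo_of_derive (s ds : R -> R) e : (forall x : R, is_derive x 1 s (ds x)) -> continuous ds ->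
  0 < e -> (forall x, e <= ds x) -> diffeo s ds.
Proof.
move=> D cds e0 de.
have ds0 x : 0 < ds x := lt_le_trans e0 (de x).
have gr x y : x <= y -> e * (y - x) <= s y - s x.
  move=> xy; have [c _ ->] := mean_value x y D.
  by rewrite ler_wpM2r ?subr_ge0.
split => // y.
have cs : continuous s by move=> z; exact: is_derive_continuous (D z).
pose r := (`|y - s 0| + 1) / e.
have r0 : 0 <= r by rewrite divr_ge0 ?ltW// addr_ge0.
have re : e * r = `|y - s 0| + 1 by rewrite /r mulrC divfK// gt_eqF.
have h1 := gr 0 r r0; have h2 := gr (- r) 0 (_ : - r <= 0).
rewrite subr0 re in h1; rewrite sub0r opprK re in h2.
have rr : - r <= r by rewrite (le_trans _ r0)// oppr_le0.
have yb : Num.min (s (- r)) (s r) <= y <= Num.max (s (- r)) (s r).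
  have := ler_norm (y - s 0); have := ler_norm (- (y - s 0)); rewrite normrN => n1 n2.
  have h2' := h2 (_ : - r <= 0); rewrite oppr_le0 in h2'.
  have {}h2 := h2' r0; rewrite ge_min le_max; apply/andP; split; apply/orP; [left|right]; lra.
have [c _ <-] := IVT rr (continuous_subspaceT cs) yb.
by exists c.
Qed.

Lemma positive_lower_bound a b (h : R -> R) : a <= b -> {within `[a, b], continuous h} ->
  (forall x, a <= x <= b -> 0 < h x) -> exists2 e, 0 < e & forall x, a <= x <= b -> e <= h x.
Proof.
move=> ab ch h0; have [c cI hc] := EVT_min ab ch.
have c' : a <= c <= b by move: cI; rewrite in_itv.
by exists (h c); [exact: h0|move=> x xI; apply: hc; rewrite in_itv].
Qed.

Lemma const_of_derive0 a b (h : R -> R) : {within `[a, b], continuous h} ->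
  (forall x : R, a < x < b -> is_derive x 1 h 0) -> forall x, a <= x <= b -> h x = h a.
Proof.
move=> ch dh x /andP[ax xb].
have [| |c _] := @MVT_segment R h (fun=> 0) a x ax.
- by move=> z; rewrite in_itv/= => /andP[az zx]; apply: dh; rewrite az (lt_le_trans zx xb).
- apply: continuous_subspaceW ch => z; rewrite /= !in_itv/= => /andP[-> zx]; exact: le_trans zx xb.
- by rewrite mul0r => /eqP; rewrite subr_eq0 => /eqP.
Qed.

Lemma derivative_on_interior a (f df : R -> R) x : derivative_on `[a, +oo[ f df -> a < x -> is_derive x 1 f (df x).
Proof.
move=> D ax; apply/is_derive_epsP => e e0.
have xa : `[a, +oo[%classic x by rewrite /= in_itv/= andbT ltW.
have /cvgrPdist_lt/(_ _ e0)/near_dnbhsP[d d0 hd] := D x xa.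
exists (Num.min d (x - a)); first by rewrite lt_min d0 subr_gt0.
move=> h h0; rewrite lt_min => /andP[hd' ha].
have := hd (x + h); rewrite opprD addrA subrr sub0r normrN => /(_ hd').
rewrite distrC (addrC x h) addrK; apply; first by rewrite -subr_eq0 addrK.
rewrite /= in_itv/= andbT; move: ha; rewrite ltr_norml => /andP[ha _]; lra.
Qed.

Lemma derivative_on_continuous a (f df : R -> R) : derivative_on `[a, +oo[ f df -> {within `[a, +oo[, continuous f}.
Proof.
move=> D; apply/subspace_continuousP => x xa.
have /cvgrPdist_lt/(_ _ ltr01)/near_dnbhsP[d d0 hd] := D x xa.
apply/cvgrPdist_lt => e e0; apply/near_withinP.
have K0 : 0 < `|df x| + 1 by rewrite ltr_wpDl.
exists (Num.min d (e / (`|df x| + 1))); first by rewrite lt_min d0 divr_gt0.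
move=> y; rewrite lt_min => /andP[yd]; rewrite ltr_pdivlMr// => ye ya.
have [->|yx] := eqVneq y x; first by rewrite subrr normr0.
have yx0 : y - x != 0 by rewrite subr_eq0.
have := hd y yd yx ya; set q := (f y - f x) / (y - x) => hq.
have fE : f y - f x = q * (y - x) by rewrite /q divfK.
rewrite distrC fE normrM (distrC y x); apply: le_lt_trans ye; rewrite mulrC ler_wpM2l//.
rewrite (_ : q = df x + - (df x - q)); last by ring.
by apply: le_trans (ler_normD _ _) _; rewrite normrN lerD2l ltW.
Qed.

Definition pin a b x : R := a + clamp (b - a) (x - a).

Lemma pinP a b x : a <= b -> [/\ a <= pin a b x <= b, a <= x <= b -> pin a b x = x &
  forall y, `|pin a b x - pin a b y| <= `|x - y|].
Proof.
move=> ab; have ba : 0 <= b - a by rewrite subr_ge0.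
have [/andP[h1 h2] h3 h4] := clampP (x - a) ba; rewrite /pin; split.
- by rewrite lerDl h1 -lerBrDl.
- move=> /andP[ax xb]; rewrite h3 ?subr_ge0 ?ax ?lerD2r//; ring.
- move=> y; have := h4 (y - a); rewrite (_ : x - a - (y - a) = x - y); last by ring.
  by rewrite (_ : a + _ - (a + _) = clamp (b - a) (x - a) - clamp (b - a) (y - a)); last by ring.
Qed.

Lemma pin_continuous a b (h : R -> R) : a <= b -> {within `[a, b], continuous h} -> continuous (h \o pin a b).
Proof.
move=> ab ch x; apply/cvgR_epsP => e e0; have [px _ plip] := pinP x ab.
have [d d0 hd] := within_cvg_eps ch px e0.
exists d => // y xy; apply: hd; first by have [] := pinP y ab.
exact: le_lt_trans (plip y) xy.
Qed.

(** The derivative is frozen at its end values and integrated. Every value of [dF] is then a value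
    of [df] on the interval, so lower bounds carry over to the line; the last clause records
    this. *)
Lemma C1_extension a b (f df : R -> R) : a <= b -> {within `[a, b], continuous f} -> {within `[a, b], continuous df} ->
  (forall x, a < x < b -> is_derive x 1 f (df x)) -> exists F dF : R -> R,
  [/\ forall x : R, is_derive x 1 F (dF x), continuous dF, forall x, a <= x <= b -> F x = f x /\ dF x = df x &
      forall x, exists2 y, a <= y <= b & dF x = df y].
Proof.
move=> ab cf cdf D; have cdF := pin_continuous ab cdf; set dF := df \o pin a b in cdF.
pose F x := prim dF x + (f a - prim dF a).
have DF (x : R) : is_derive x 1 F (dF x).
  have := is_deriveD (prim_is_derive x cdF) (is_derive_cst (f a - prim dF a) x 1).
  by move=> h; apply: is_derive_eq h _; rewrite addr0.
exists F, dF; split => //; last by move=> x; exists (pin a b x) => //; have [] := pinP x ab.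
move=> x xI; have [_ pe _] := pinP x ab; split; last by rewrite /dF /= pe.
have cF : continuous F by move=> z; exact: is_derive_continuous (DF z).
have : F x - f x = F a - f a.
  apply: (@const_of_derive0 a b (fun x => F x - f x)) => //.
    by move=> z; apply: cvgB; [exact: (continuous_subspaceT cF)|exact: cf].
  move=> z zI; have := is_derive_subr (DF z) (D z zI); move=> h; apply: is_derive_eq h _.
  have [_ pz _] := pinP z ab; case/andP: zI => az zb.
  by rewrite /dF /= pz ?subrr// !ltW.
by rewrite (_ : F a - f a = 0) /F; [move/eqP; rewrite subr_eq0 => /eqP|ring].
Qed.

Lemma diffeo_inverse (s ds : R -> R) : diffeo s ds -> exists2 r : R -> R,
  diffeo r (fun y => (ds (r y))^-1) & cancel s r.
Proof.
move=> S; pose r y := projT1 (cid (diffeo_surj S y)).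
have rK y : s (r y) = y by rewrite /r; case: (cid _).
have sK x : r (s x) = x by apply: (diffeo_inj S); rewrite rK.
have D (y : R) : is_derive y 1 r (ds (r y))^-1.
  rewrite -[X in is_derive X](rK y); apply: is_derive_inverse.
  - exact: (@filterE _ (nbhs (r y)) _ _ sK).
  - exact: (@filterE _ (nbhs (r y)) _ _ (diffeo_continuous S)).
  - exact: diffeo_derive S _.
  - by rewrite gt_eqF// (diffeo_gt0 S).
have cr : continuous r by move=> y; exact: is_derive_continuous (D y).
exists r => //; split => //.
- move=> y; apply: cvgV; first by rewrite gt_eqF// (diffeo_gt0 S).
  by apply: (@continuous_comp _ _ _ r ds); [exact: cr|exact: diffeo_cont S _].
- by move=> y; rewrite invr_gt0 (diffeo_gt0 S).
- by move=> x; exists (s x).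
Qed.

End extension.

(** * Dependence on the boundary only up to time T *)

Section locality.
Context {R : realType}.
Local Notation mu := (@lebesgue_measure R).
Variables (l dl l' dl' : R -> R) (T : R).
Hypothesis T0 : 0 < T.
Hypothesis ll' : forall t, 0 <= t <= T -> l' t = l t.

Let oo t : 0 < t < T -> 0 <= t <= T. Proof. by case/andP => t0 tT; rewrite !ltW. Qed.

Lemma local_C0_L2 (w w' : R -> R -> R) : (forall x t, 0 <= t <= T -> w' x t = w x t) ->
  C0_L2 l T w -> C0_L2 l' T w'.
Proof.
move=> ww [L C].
have wE t : 0 <= t <= T -> w'^~ t = w^~ t by move=> tT; apply/funext => x; exact: ww.
split=> t tT; first by rewrite ll'// wE//; exact: L.
apply/(@L2norm_cvg0P _ _ _ _ (fun=> setT)) => e e0.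
have /(@L2norm_cvg0P _ _ _ _ (fun=> setT))/(_ _ e0)/near_withinP[d d0 hd] := C t tT.
apply/near_withinP; exists d => // s sd sT; have := hd s sd sT.
have sT' : 0 <= s <= T by move: sT; rewrite /= in_itv.
by rewrite ll'// wE// ll'// wE.
Qed.

Lemma local_wave (ux ut : R -> R -> R) : wave_equation l T ux ut -> wave_equation l' T ux ut.
Proof.
move=> W psi [d1 d2 d3 [K [cK KD K0]]].
have h : test2 l T psi.
  split => //; exists K; split => // z /KD[/= zT zl]; split => //=; rewrite -ll'//; exact: oo.
rewrite -[RHS](W psi h); apply: Rint_eq => t; rewrite /= in_itv/= => tT; rewrite ll'//; exact: oo.
Qed.

Lemma local_trace (w : R -> R -> R) p : moving_trace l T w p -> moving_trace l' T w p.
Proof.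
move=> [L C]; split; first exact: L.
pose I (k : R -> R) (e t : R) : \bar R := (\int[mu]_(x in `](k t - e)%R, k t[) ((w x t - p t) ^+ 2)%:E)%E.
have J e : (\int[mu]_(t in `]0%R, T[) I l' e t = \int[mu]_(t in `]0%R, T[) I l e t)%E.
  by apply: eq_integral => t /set_mem; rewrite /= in_itv/= => tT; rewrite /I ll'//; exact: oo.
have E : (fun e : R => (e^-1)%:E * \int[mu]_(t in `]0%R, T[) I l' e t)%E =
    (fun e : R => (e^-1)%:E * \int[mu]_(t in `]0%R, T[) I l e t)%E.
  by apply/funext => e; rewrite J.
exact: (eq_ind_r (fun f : R -> \bar R => f e @[e --> 0^'+] --> 0%E) C E).
Qed.

(** The definition of a solution sees [l] on [0,T] and [dl] inside it. This is used in both
    directions: existence returns from the extended boundary to the given one, uniqueness goes the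
    other way. *)
Lemma local_solution (eta : R) (u0 u1 : R -> R) (u u' ux ut : R -> R -> R) :
  (forall t, 0 < t < T -> dl' t = dl t) -> (forall x t, 0 <= t <= T -> u' x t = u x t) ->
  wave_solution_with l dl T eta u0 u1 u ux ut -> wave_solution_with l' dl' T eta u0 u1 u' ux ut.
Proof.
move=> dd uu [[V0u C0u C0x] [_ C0t D] W [p [q [tp tq pq]]] F I J].
have uE t : 0 <= t <= T -> u'^~ t = u^~ t by move=> tT; apply/funext => x; exact: uu.
have T00 : 0 <= (0 : R) <= T by rewrite lexx ltW.
have C0u' := local_C0_L2 uu C0u; have C0x' := @local_C0_L2 ux ux (fun _ _ _ => erefl) C0x.
have C0t' := @local_C0_L2 ut ut (fun _ _ _ => erefl) C0t.
split => //.
- by split => // t tT; rewrite ll'// uE//; exact: V0u.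
- split => // t tT; apply/(@L2norm_cvg0P _ _ _ _ (fun s => `]0, Num.min (l' t) (l' s)[%classic)) => e e0.
  have /(@L2norm_cvg0P _ _ _ _ (fun s => `]0, Num.min (l t) (l s)[%classic))/(_ _ e0)/near_dnbhsP[d d0 hd] := D t tT.
  apply/near_dnbhsP; exists d => // s sd st sT; have := hd s sd st sT.
  have sT' : 0 <= s <= T by move: sT; rewrite /= in_itv.
  rewrite !ll'//; apply: le_trans; rewrite le_eqVlt; apply/orP; left; apply/eqP.
  by apply: eq_integral => x _; rewrite !uu.
- exact: local_wave.
- exists p, q; split; [exact: local_trace|exact: local_trace|].
  by apply: negligibleS pq => t; apply: contra_not => h tT; rewrite dd//; exact: h.
- by move=> t /andP[t0 tT]; rewrite uu ?(ltW t0)//; apply: F; rewrite t0.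
- by move=> x; rewrite ll'// uu//; exact: I.
- by rewrite ll'.
Qed.

End locality.

(** * Twisted periodic extension *)

Section twisted.
Context {R : realType}.
Local Notation mu := (@lebesgue_measure R).
Variables (s0 kappa : R) (h : R -> R).
Hypothesis hL : L2loc h.
Hypothesis h_out : forall s, s <= s0 \/ s0 + 2 <= s -> h s = 0.
Hypothesis kappa1 : kappa != 1.

(** The derivative [h], supported in one cell, is repeated with factor [kappa] over [N] cells.
    Stopping at [N] keeps the sum finite and locally square integrable; to the left of its last cell
    it no longer depends on [N]. *)
Definition twist (N : nat) (s : R) : R := \sum_(k < N) kappa ^+ k * h (s - 2 * k%:R).
(** The unique initial value for which the primitive is itself twisted: [C] plus the integral of [h]
    must equal [kappa * C]. *)
Let C : R := (\int[mu]_(s in `[s0, s0 + 2]) h s) / (kappa - 1).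
Definition twist_prim N (s : R) : R := C + (prim (twist N) s - prim (twist N) s0).

Lemma twist_L2loc N : L2loc (twist N).
Proof.
elim: N => [|N IH].
  by rewrite (_ : twist 0 = fun=> 0); [apply: L2loc_cont => z; exact: cvg_cst|apply/funext => z; rewrite /twist big_ord0].
rewrite (_ : twist N.+1 = fun s => twist N s + kappa ^+ N * h (s + - (2 * N%:R))); last first.
  by apply/funext => z; rewrite /twist big_ord_recr.
exact: L2locD IH (L2locZ _ (L2loc_shift _ hL)).
Qed.

Lemma twist_prim_of N : primitive_of (twist_prim N) (twist N).
Proof.
by move=> x y xy; rewrite -primB//; [rewrite /twist_prim; ring|exact: L2loc_locintg (twist_L2loc N)].
Qed.

Lemma twist_stable N M s : s <= s0 + 2 * N%:R -> (N <= M)%N -> twist M s = twist N s.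
Proof.
move=> sN /subnKC <-; elim: (M - N)%N => [|j IH]; first by rewrite addn0.
rewrite addnS /twist big_ord_recr/= -/(twist _ _) IH h_out ?mulr0 ?addr0//.
left; rewrite lerBlDr natrD mulrDr addrA; apply: le_trans sN _; rewrite lerDl mulr_ge0//.
Qed.

Lemma twist_shift N s : s0 <= s -> twist N.+1 (s + 2) = kappa * twist N s.
Proof.
move=> s0s; rewrite /twist big_ord_recl/= mulr0 subr0 h_out ?mulr0 ?add0r; last by right; rewrite lerD2r.
rewrite mulr_sumr; apply: eq_bigr => k _; rewrite exprS mulrA; congr (_ * h _).
by rewrite /fintype.bump/= add1n -natr1; ring.
Qed.

Lemma twist_twisted N s : s0 <= s -> s + 2 <= s0 + 2 * N%:R -> twist N (s + 2) = kappa * twist N s.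
Proof. by move=> s0s sN; rewrite -twist_shift// (twist_stable sN). Qed.

Lemma twist_cell s : s0 <= s <= s0 + 2 -> forall N, twist N.+1 s = h s.
Proof.
move=> /andP[_ s2] N; rewrite (@twist_stable 1); [|by rewrite mulr1|by []].
by rewrite /twist big_ord1 mulr0 subr0 expr0 mul1r.
Qed.

Lemma twist_prim_stable N M s : s0 <= s -> s <= s0 + 2 * N%:R -> (N <= M)%N -> twist_prim M s = twist_prim N s.
Proof.
move=> s0s sN NM; rewrite /twist_prim !primB//; [|exact: L2loc_locintg (twist_L2loc _)..].
congr (_ + _); apply: Rint_eq => z; rewrite /= in_itv/= => /andP[_ zs].
by apply: twist_stable => //; exact: le_trans zs sN.
Qed.

Lemma twist_prim_shift N s : s0 <= s -> twist_prim N.+1 (s + 2) = kappa * twist_prim N s.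
Proof.
move=> s0s; have k1 : kappa - 1 != 0 by rewrite subr_eq0.
have p0 M : twist_prim M s0 = C by rewrite /twist_prim subrr addr0.
have E1 : twist_prim N.+1 (s0 + 2) = kappa * C.
  have := @twist_prim_of N.+1 s0 (s0 + 2); rewrite lerDl => /(_ (ltW (ltr0Sn _ _))).
  rewrite (Rint_eq (g := h)); last by move=> z; rewrite /= in_itv/= => /twist_cell.
  by rewrite p0 => /eqP; rewrite subr_eq => /eqP ->; rewrite -{1}(divfK k1 (Rintegral _ _ _)) -/C; ring.
have s02 : s0 + 2 <= s + 2 by rewrite lerD2r.
have := twist_prim_of N.+1 s02; rewrite Rint_shift//; last by apply: L2loc_intg; exact: twist_L2loc.
rewrite (Rint_eq (g := fun z => kappa * twist N z)); last by move=> z; rewrite /= in_itv/= => /andP[z0 _]; exact: twist_shift.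
rewrite RintZ//; last by apply: L2loc_intg; exact: twist_L2loc.
rewrite -(twist_prim_of N s0s) p0 E1 => /eqP; rewrite subr_eq => /eqP ->; ring.
Qed.

Definition twist_lim s : R := twist_prim (Num.truncn ((s - s0) / 2)).+1 s.

Lemma twist_limE N s : s0 <= s <= s0 + 2 * N%:R -> twist_lim s = twist_prim N s.
Proof.
move=> /andP[s0s sN]; rewrite /twist_lim; set M := (Num.truncn _).+1.
have sM : s <= s0 + 2 * M%:R.
  by have := truncnS_gt ((s - s0) / 2); rewrite -/M ltr_pdivrMr// ltrBlDl mulrC => /ltW.
have [NM|/ltnW MN] := leqP N M; first exact: twist_prim_stable.
by apply/esym/twist_prim_stable.
Qed.

Lemma twist_lim_shift s : s0 <= s -> twist_lim (s + 2) = kappa * twist_lim s.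
Proof.
move=> s0s; set M := (Num.truncn ((s - s0) / 2)).+1.
have sM : s <= s0 + 2 * M%:R.
  by have := truncnS_gt ((s - s0) / 2); rewrite -/M ltr_pdivrMr// ltrBlDl mulrC => /ltW.
rewrite (@twist_limE M.+1); first exact: twist_prim_shift.
have e : s0 + 2 * M.+1%:R = s0 + 2 * M%:R + 2 by rewrite -[M.+1%:R]natr1; ring.
by apply/andP; split; [rewrite (le_trans s0s)// lerDl|rewrite e lerD2r].
Qed.

Lemma twist_lim_prim x y : s0 <= x -> x <= y -> y <= s0 + 2 ->
  twist_lim y - twist_lim x = \int[mu]_(z in `[x, y]) h z.
Proof.
move=> x0 xy y2; rewrite !(@twist_limE 1) ?mulr1 ?x0 ?y2 ?(le_trans x0 xy) ?(le_trans xy y2)//.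
rewrite (twist_prim_of 1 xy); apply: Rint_eq => z; rewrite /= in_itv/= => /andP[zx zy].
by apply: twist_cell; rewrite (le_trans x0 zx) (le_trans zy y2).
Qed.

End twisted.

Section composition.
Context {R : realType}.
Local Notation mu := (@lebesgue_measure R).
Variables (s ds : R -> R).
Hypothesis S : diffeo s ds.

Lemma primitive_comp (G g : R -> R) : L2loc g -> primitive_of G g ->
  primitive_of (fun x => G (s x)) (fun x => g (s x) * ds x).
Proof.
move=> gL Gg x y xy; rewrite (Gg (s x) (s y)); last by rewrite (diffeo_le S).
by apply: change_of_variables => //; exact: L2loc_intg.
Qed.

(** One of the two factors [ds] in the square is bounded on compact intervals; the other is the
    Jacobian. *)
Lemma L2loc_comp (g : R -> R) : L2loc g -> L2loc (fun x => g (s x) * ds x).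
Proof.
move=> gL; have mg : measurable_fun setT (g \o s) := measurableT_comp gL.1 (diffeo_measurable S).
split=> [|a b]; first by apply: measurable_funM => //; exact: diffeo_dmeasurable S.
have [ab|ba] := leP a b; last first.
  rewrite (_ : `[a, b]%classic = set0); first exact: integrable_set0.
  by apply/seteqP; split => // x; rewrite /= in_itv/= => /andP[ax xb]; move: ba; rewrite ltNge (le_trans ax xb).
have [M M0 hM] := cont_bounded a b (diffeo_cont S).
apply: (intg_le (g := fun x => M * (g (s x) ^+ 2 * ds x))); [exact: measurable_itv| | |].
- apply: measurable_funTS; apply: measurable_funX; apply: measurable_funM => //; exact: diffeo_dmeasurable S.
- move=> x; rewrite /= in_itv/= => xI; have d0 := diffeo_gt0 S x; have := hM x xI.
  rewrite (gtr0_norm d0) ger0_norm ?sqr_ge0// => dM.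
  by rewrite exprMn (mulrCA M) ler_wpM2l ?sqr_ge0// expr2 ler_wpM2r// ltW.
- apply: intgZ; first exact: measurable_itv.
  exact: (intg_change_itv S (g := fun y => g y ^+ 2) ab (gL.2 _ _)).
Qed.

End composition.

(** * Extension of the characteristics *)

Section characteristics.
Context {R : realType}.
Variables (l dl phi dphi : R -> R) (L T : R).
Hypotheses (l_cont : {within `[0, +oo[, continuous l}) (l_gt0 : forall t, 0 <= t -> 0 < l t).
Hypotheses (l_deriv : derivative_on `[0, +oo[ l dl) (dl_lt1 : forall t, 0 <= t -> `|dl t| < 1).
Hypotheses (L_def : L = l 0) (phi_C1 : C1_on `[- L, +oo[ phi dphi).
Hypothesis dphi_gt0 : forall x, - L <= x -> 0 < dphi x.
Hypothesis phi_l : forall t, 0 <= t -> phi (t + l t) - phi (t - l t) = 2.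
Hypothesis T0 : 0 < T.

Lemma front_lipschitz s t : 0 <= s -> s <= t -> `|l t - l s| <= t - s.
Proof.
move=> s0 st; have [| |c cI ->] := @MVT_segment R l dl s t st.
- move=> z; rewrite in_itv/= => /andP[sz _]; apply: (derivative_on_interior l_deriv).
  exact: le_lt_trans s0 sz.
- apply: continuous_subspaceW l_cont => z; rewrite /= !in_itv/= => /andP[sz _].
  by rewrite andbT (le_trans s0).
- have c0 : 0 <= c by move: cI; rewrite in_itv/= => /andP[sc _]; exact: le_trans sc.
  rewrite normrM (ger0_norm (_ : 0 <= t - s)) ?subr_ge0// -[leRHS]mul1r ler_wpM2r ?subr_ge0//.
  exact: ltW (dl_lt1 c0).
Qed.

Lemma front_range t : 0 <= t -> - L <= t - l t /\ forall T', t <= T' -> t + l t <= T' + l T'.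
Proof.
move=> t0; split.
  have := front_lipschitz (lexx 0) t0; rewrite subr0 -L_def ler_norml; lra.
by move=> T' tT; have := front_lipschitz t0 tT; rewrite ler_norml; lra.
Qed.

(** Continuity of [dl] is not given but forced: differentiating [phi (t + l t) - phi (t - l t) = 2]
    expresses [dl] through [dphi] at the two fronts. The formula also keeps [1 + dl] and [1 - dl]
    above positive constants on [0,T], so that extending [l] with frozen derivative yields
    diffeomorphisms. *)
Lemma characteristic_extension : exists (f df k dk : R -> R),
  [/\ diffeo f df /\ (forall x, - L <= x <= T + l T -> f x = phi x /\ df x = dphi x),
      diffeo (fun t => t + k t) (fun t => 1 + dk t), diffeo (fun t => t - k t) (fun t => 1 - dk t),
      forall t, 0 <= t <= T -> k t = l t &
      forall t, 0 < t < T -> dk t = dl t /\ (1 + dl t) * df (t + l t) = (1 - dl t) * df (t - l t)].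
Proof.
have L0 : 0 < L by rewrite L_def l_gt0.
have lT := l_gt0 (ltW T0); set b := T + l T.
have Lb : - L <= b by apply: (@le_trans _ _ 0); [rewrite oppr_le0 ltW|rewrite /b addr_ge0// ltW].
have [phiD cdphi] := phi_C1.
have sub : `[- L, b]%classic `<=` `[- L, +oo[%classic by move=> z; rewrite /= !in_itv/= => /andP[->].
have cphi := continuous_subspaceW sub (derivative_on_continuous phiD).
have cdphi' := continuous_subspaceW sub cdphi.
have Dphi (x : R) : - L < x < b -> is_derive x 1 phi (dphi x).
  by case/andP => Lx _; exact: derivative_on_interior phiD Lx.
have [f [df [Df cdf fE dfr]]] := C1_extension Lb cphi cdphi' Dphi.
have [e e0 he] := positive_lower_bound Lb cdphi' (fun x xI => dphi_gt0 (proj1 (andP xI))).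
have fd : diffeo f df.
  by apply: (diffeo_of_derive Df cdf e0) => x; have [y yI ->] := dfr x; exact: he.
have df0 x := diffeo_gt0 fd x.
have PQ (t : R) : 0 <= t <= T -> (- L <= t + l t <= b) && (- L <= t - l t <= b).
  case/andP => t0 tT; have [h1 h2] := front_range t0; have := h2 T tT; have lt0 := l_gt0 t0.
  rewrite /b; lra.
(* The relation [(1 + dl) * df (t + l t) = (1 - dl) * df (t - l t)] solved for [dl] gives
   [N t / D t]. *)
pose N t := df (t - l t) - df (t + l t); pose D t := df (t + l t) + df (t - l t).
have D0 (t : R) : 0 < D t by rewrite addr_gt0.
pose k t := N t / D t.
have k1 (t : R) : 1 + k t = 2 * df (t - l t) / D t.
  by rewrite /k /N; move: (D0 t) => /lt0r_neq0; rewrite /D => d; field.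
have k2 (t : R) : 1 - k t = 2 * df (t + l t) / D t.
  by rewrite /k /N; move: (D0 t) => /lt0r_neq0; rewrite /D => d; field.
have subT : (`[0, T]%classic : set R) `<=` (`[0, +oo[%classic : set R) by move=> z; rewrite /= !in_itv/= => /andP[->].
have clT : {within `[0, T], continuous l} := continuous_subspaceW subT l_cont.
have cid : {within `[0, T], continuous (fun t : R => t)} by apply: continuous_subspaceT => z; exact: cvg_id.
have cP : {within `[0, T], continuous (fun t => df (t + l t))}.
  by move=> t; apply: continuous_comp; [apply: cvgD; [exact: cid|exact: clT]|exact: cdf].
have cQ : {within `[0, T], continuous (fun t => df (t - l t))}.
  by move=> t; apply: continuous_comp; [apply: cvgB; [exact: cid|exact: clT]|exact: cdf].
have ck : {within `[0, T], continuous k}.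
  move=> t; apply: cvgM; first by apply: cvgB; [exact: cQ|exact: cP].
  by apply: cvgV; [exact: lt0r_neq0|apply: cvgD; [exact: cP|exact: cQ]].
have c1 : {within `[0, T], continuous (fun _ : R => 1 : R)} by apply: continuous_subspaceT => z; exact: cvg_cst.
have [e1 e10 he1] := @positive_lower_bound R 0 T (fun t => 1 + k t) (ltW T0)
  (fun t => cvgD (c1 t) (ck t)) (fun t _ => eq_ind_r (fun z => 0 < z) (divr_gt0 (mulr_gt0 (ltr0Sn _ 1) (df0 _)) (D0 t)) (k1 t)).
have [e2 e20 he2] := @positive_lower_bound R 0 T (fun t => 1 - k t) (ltW T0)
  (fun t => cvgB (c1 t) (ck t)) (fun t _ => eq_ind_r (fun z => 0 < z) (divr_gt0 (mulr_gt0 (ltr0Sn _ 1) (df0 _)) (D0 t)) (k2 t)).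
have Dl (t : R) : 0 < t -> is_derive t 1 l (dl t) by move=> t0; exact: derivative_on_interior l_deriv t0.
have compat (t : R) : 0 < t < T -> (1 + dl t) * df (t + l t) = (1 - dl t) * df (t - l t).
  move=> /andP[t0 tT]; have Did := is_derive_id t (1 : R).
  have DP := is_derive_compr Df (is_deriveD Did (Dl t t0)).
  have DQ := is_derive_compr Df (is_derive_subr Did (Dl t t0)).
  have DPQ := is_derive_subr DP DQ.
  have Dz : is_derive t (1 : R) (fun s => f (s + l s) - f (s - l s) - 2) 0.
    apply: (@is_derive_locally0 R _ t (Num.min t (T - t))); first by rewrite lt_min t0 subr_gt0.
    move=> s; rewrite lt_min => /andP[h1 h2].
    have sT : 0 <= s <= T by move: h1 h2; rewrite !ltr_norml; lra.
    by have /andP[p q] := PQ s sT; rewrite (fE _ p).1 (fE _ q).1 phi_l ?subrr//; case/andP: sT.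
  have Dz' := is_derive_subr DPQ (is_derive_cst (2 : R) t 1).
  have := is_derive_derive1 Dz; have /= -> := is_derive_derive1 Dz'.
  by move/eqP; rewrite subr0 subr_eq0 => /eqP; rewrite mulrC => ->; rewrite mulrC.
have dlk (t : R) : 0 < t < T -> dl t = k t.
  move=> tT; have := compat t tT; have := D0 t; rewrite /k /N /D => d h.
  apply/eqP; rewrite eq_sym -subr_eq0 -(mulrI_eq0 _ (lregP (lt0r_neq0 d))) mulrBr mulrC divfK ?lt0r_neq0//.
  by apply/eqP; move: h; move: (df _) (df _) => u v h; lra.
have Dlk (t : R) : 0 < t < T -> is_derive t 1 l (k t) by move=> tT; rewrite -dlk//; apply: Dl; case/andP: tT.
have [m [dm [Dm cdm mE dmr]]] := C1_extension (ltW T0) clT ck Dlk.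
have cm1 : continuous (fun t => 1 + dm t) by move=> t; apply: cvgD; [exact: cvg_cst|exact: cdm].
have cm2 : continuous (fun t => 1 - dm t) by move=> t; apply: cvgB; [exact: cvg_cst|exact: cdm].
have D1 (x : R) : is_derive x 1 (fun t => t + m t) (1 + dm x) by exact: is_deriveD (is_derive_id x (1 : R)) (Dm x).
have D2 (x : R) : is_derive x 1 (fun t => t - m t) (1 - dm x) by exact: is_derive_subr (is_derive_id x (1 : R)) (Dm x).
exists f, df, m, dm; split.
- by [].
- apply: (diffeo_of_derive D1 cm1 e10) => x.
  by have [y yI ->] := dmr x; exact: he1.
- apply: (diffeo_of_derive D2 cm2 e20) => x.
  by have [y yI ->] := dmr x; exact: he2.
- by move=> t tT; exact: (mE t tT).1.
- move=> t tT; split; last exact: compat.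
  by rewrite dlk// (mE t _).2//; case/andP: tT => *; rewrite !ltW.
Qed.

Lemma phi_le x y : - L <= x -> x <= y -> phi x <= phi y.
Proof.
move=> xL xy; have [phiD _] := phi_C1; have [| |c cI] := @MVT_segment R phi dphi x y xy.
- by move=> z; rewrite in_itv/= => /andP[xz _]; apply: (derivative_on_interior phiD); exact: le_lt_trans xz.
- apply: continuous_subspaceW (derivative_on_continuous phiD) => z; rewrite /= !in_itv/= => /andP[xz _].
  by rewrite andbT (le_trans xL).
- have cL : - L <= c by move: cI; rewrite in_itv/= => /andP[xc _]; exact: le_trans xc.
  by move=> E; rewrite -subr_ge0 E mulr_ge0 ?subr_ge0// ltW// dphi_gt0.
Qed.

Lemma front_min : exists2 m, 0 < m & forall t, 0 <= t <= T -> m <= l t.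
Proof.
apply: positive_lower_bound; first exact: ltW.
  by apply: continuous_subspaceW l_cont => z; rewrite /= !in_itv/= => /andP[->].
by move=> t /andP[t0 _]; exact: l_gt0.
Qed.

End characteristics.

Lemma patch_oo {R : realType} (g : R -> R) a b x :
  (g \_ `]a, b[) x = if a < x < b then g x else 0.
Proof. by rewrite patchE mem_setE in_itv/=. Qed.

(** * The profile at time 0 and its density in the variable phi *)

Section initial_data.
Context {R : realType}.
Local Notation mu := (@lebesgue_measure R).
Variables (L : R) (u0 u0x u1 : R -> R).
Hypotheses (L0 : 0 < L) (u0_V0 : V0 L u0 u0x) (u1_L2 : L2 `]0, L[ u1).

(* The derivative of the profile F of the d'Alembert formula
   u(x,t) = F(t + x) - F(t - x) at time 0. *)
Definition profile : R -> R := (fun x => (even_ext u0x x + odd_ext u1 x) / 2) \_ `]- L, L[.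

Let p := u0x \_ `]0, L[.
Let r := u1 \_ `]0, L[.

Let pL : L2loc p.
Proof. by apply: L2loc_patch; apply/L2P; [exact: measurable_itv|case: u0_V0 => -[]]. Qed.

Let rL : L2loc r.
Proof. by apply: L2loc_patch; apply/L2P; [exact: measurable_itv|]. Qed.

Lemma profile_L2loc : L2loc profile.
Proof.
(* At the origin the even extension takes the value [u0x 0], whereas both patches vanish; the
   indicator of that point restores an equality of functions. *)
have iL : L2loc (fun x : R => u0x 0 / 2 * \1_[set 0] x).
  apply: L2locZ; have mi : measurable_fun setT (\1_[set (0 : R)] : R -> R) by exact: measurable_indic.
  split=> // a b; apply: (intg_bounded (M := 1)); [exact: measurable_itv|exact: mu_itv_cc_fin| |].
    by apply: measurable_funTS; exact: measurable_funX.
  by move=> x _; rewrite indicE; case: (_ \in _); rewrite ?expr1n ?expr0n/= ?normr1 ?normr0.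
rewrite (_ : profile = fun x => 2^-1 * ((p x + r x) + (p (- x) - r (- x))) + u0x 0 / 2 * \1_[set 0] x).
  apply: L2locD iL; apply: L2locZ; apply: L2locD; first exact: L2locD.
  by apply: L2locB; exact: L2loc_reflect.
apply/funext => x; rewrite /profile /p /r !patch_oo indicE /even_ext /odd_ext.
rewrite -!(ltrN2 (- x)) !opprK oppr0.
have [x0|x0|->] := ltgtP x 0.
- rewrite (ltr0_norm x0) (ltr0_sg x0) memNset; last by move=> /= e; move: x0; rewrite e ltxx.
  have -> : x < L by apply: lt_trans x0 L0.
  by rewrite (ltrNl L) /= ?andbT; case: ifP => _; rewrite mulr0; field.
- rewrite (gtr0_norm x0) (gtr0_sg x0) memNset; last by move=> /= e; move: x0; rewrite e ltxx.
  have -> : - L < x by apply: lt_trans x0; rewrite oppr_lt0.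
  by rewrite /=; case: ifP => _; rewrite mulr0; field.
- by rewrite mem_set// normr0 sgr0 oppr_lt0 L0 /=; field.
Qed.

Lemma profile_value x : 0 < x < L -> profile x + profile (- x) = u0x x /\ profile x - profile (- x) = u1 x.
Proof.
move=> /andP[x0 xL]; have mx : - L < x by apply: lt_trans x0; rewrite oppr_lt0.
have mL : - x < L by rewrite ltrNl.
rewrite /profile !patch_oo mx xL ltrN2 xL mL /=.
by rewrite /even_ext /odd_ext normrN sgrN (gtr0_norm x0) (gtr0_sg x0); split; field.
Qed.

(** The increment of [F] over [-x, x] folds to the integral over [0, x] of [f y + f (- y)], which is
    the derivative of [u0]. *)
Lemma profile_initial (F f : R -> R) : L2loc f -> primitive_of F f ->
  (forall x, - L < x < L -> f x = profile x) -> forall x, 0 < x < L ->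
  F x - F (- x) = u0 x /\ f x - f (- x) = u1 x.
Proof.
move=> fL Ff fE x /andP[x0 xL]; have mx : - L < x by apply: lt_trans x0; rewrite oppr_lt0.
have fEx y : 0 < y < L -> f y = profile y /\ f (- y) = profile (- y).
  move=> /andP[y0 yL]; have my : - L < y by apply: lt_trans y0; rewrite oppr_lt0.
  by split; apply: fE; rewrite ?my// ltrN2 yL ltrNl.
split; last first.
  have [-> ->] := fEx x (introT andP (conj x0 xL)).
  by have [_ ->] := profile_value (introT andP (conj x0 xL)).
have x0' := ltW x0; have mx0 : - x <= 0 by rewrite oppr_le0.
have [H1u u00] := u0_V0.
have -> := H1_primitive L0 H1u (introT andP (conj x0' (ltW xL))).
rewrite u00 add0r -/p (Ff (- x) x (le_trans mx0 x0')).
rewrite (Rint_split mx0 x0' (L2loc_intg _ _ fL)).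
have fi := L2loc_intg 0 x fL; have fri := L2loc_intg 0 x (L2loc_reflect fL).
have -> : \int[mu]_(z in `[- x, 0]) f z = \int[mu]_(z in `[0, x]) f (- z).
  by rewrite -{1}(oppr0 R) Rint_reflect// oppr0; exact: L2loc_intg.
have mI := measurable_itv (`[0, x] : interval R).
rewrite addrC -RintD//.
have -> : prim p x = \int[mu]_(z in `[0, x]) p z.
  by rewrite -(primB (L2loc_locintg pL) x0') prim0 subr0.
rewrite -!Rint_oo_cc//; [|exact: L2loc_intg|exact: intgD].
apply: Rint_eq => y; rewrite /= in_itv/= => /andP[y0 yx]; have yL := lt_trans yx xL.
have yI : 0 < y < L by rewrite y0.
have [-> ->] := fEx y yI; have [-> _] := profile_value yI.
by rewrite /p patch_oo yI.
Qed.

Variables (phi dphi psi : R -> R).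
Hypotheses (S : diffeo phi dphi) (psiK : cancel phi psi).
Hypothesis Sr : diffeo psi (fun s => (dphi (psi s))^-1).
Hypothesis phi2 : phi L = phi (- L) + 2.
Local Notation s0 := (phi (- L)).

(** The derivative of [G] on one period, where [F = G o phi]: [profile] divided by [dphi], read in
    the variable [s = phi x]. *)
Definition density s : R := profile (psi s) * (dphi (psi s))^-1.

Lemma density_L2loc : L2loc density.
Proof. exact: L2loc_comp Sr _ profile_L2loc. Qed.

Lemma density_out s : s <= s0 \/ s0 + 2 <= s -> density s = 0.
Proof.
have q y z : (psi y <= psi z) = (y <= z) := diffeo_le Sr y z.
rewrite /density /profile patch_oo; case: ifP => [/andP[h1 h2]|_]; last by rewrite mul0r.
case; first by rewrite -q psiK leNgt h1.
by rewrite -phi2 -q psiK leNgt h2.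
Qed.

Lemma density_comp x : density (phi x) * dphi x = profile x.
Proof. by rewrite /density psiK mulfVK// gt_eqF// (diffeo_gt0 S). Qed.

Variable a : R.
Definition weighted s : R := expR (a * s) * density s.

Lemma weighted_L2loc : L2loc weighted.
Proof.
apply: L2locM_cont density_L2loc => s; apply: (@continuous_comp _ _ _ (fun s => a * s) expR); last exact: continuous_expR.
by apply: cvgM; [exact: cvg_cst|exact: cvg_id].
Qed.

Let LL : - L <= L. Proof. by rewrite (@le_trans _ _ 0)// ?oppr_le0 ltW. Qed.

(** The substitution [s = phi x]: its Jacobian cancels the division by [dphi] in [density], so the
    Fourier integrals of [weighted] become those defining the coefficients. *)
Lemma weighted_pairing (k : R -> R) : continuous k ->
  intg `]- L, L[ (fun x => profile x * (expR (a * phi x) * k (phi x))) /\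
  \int[mu]_(s in `[s0, s0 + 2]) (weighted s * k s) =
  \int[mu]_(x in `]- L, L[) (profile x * (expR (a * phi x) * k (phi x))).
Proof.
move=> ck; have kL := L2locM_cont ck weighted_L2loc.
have E x : k (phi x) * weighted (phi x) * dphi x = profile x * (expR (a * phi x) * k (phi x)).
  by rewrite -density_comp /weighted; ring.
have i1 : intg `[- L, L] (fun x => profile x * (expR (a * phi x) * k (phi x))).
  apply: eq_intg (intg_change_itv S (g := fun s => k s * weighted s) LL (L2loc_intg _ _ kL)) => //.
split; first by apply: intgS i1 => //; exact: subset_itv_oo_cc.
rewrite (Rint_eq (g := fun s => k s * weighted s)); last by move=> s _; rewrite mulrC.
rewrite -phi2 (change_of_variables S LL); last exact: L2loc_intg.
by rewrite Rint_oo_cc//; apply: Rint_eq => x _; exact: E.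
Qed.

Lemma weighted_energy : intg `[- L, L] (fun x => profile x ^+ 2 * expR (2 * a * phi x) / dphi x) /\
  \int[mu]_(s in `[s0, s0 + 2]) (weighted s ^+ 2) =
  \int[mu]_(x in `[- L, L]) (profile x ^+ 2 * expR (2 * a * phi x) / dphi x).
Proof.
have E x : weighted (phi x) ^+ 2 * dphi x = profile x ^+ 2 * expR (2 * a * phi x) / dphi x.
  have d0 : dphi x != 0 by rewrite gt_eqF// (diffeo_gt0 S).
  rewrite -density_comp /weighted (_ : 2 * a * phi x = a * phi x + a * phi x); last by ring.
  by rewrite expRD; field.
have w2 := weighted_L2loc.2 (phi (- L)) (phi L).
split.
  by apply: eq_intg (intg_change_itv S (g := fun s => weighted s ^+ 2) LL w2); [exact: measurable_itv|move=> x _; exact: E].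
by rewrite -phi2 (change_of_variables S LL w2); apply: Rint_eq => x _; exact: E.
Qed.

End initial_data.

Local Open Scope complex_scope.

(** * The exponents omega_n and the coefficients c_n *)

Section spectrum.
Context {R : realType}.
Local Notation mu := (@lebesgue_measure R).
Variable eta : R.
Hypotheses (eta_ge0 : 0 <= eta) (eta_neq1 : eta <> 1).
Local Notation sg := (eta < 1).
Local Notation a := (2^-1 * ln `|gamma eta|).

Definition reflection : R := if sg then - expR (- a * 2) else expR (- a * 2).

(** In both cases the value is -1/gamma: for [eta < 1] gamma is positive and the sign is written
    out, for [eta > 1] gamma is negative and the absolute value supplies it. *)
Lemma reflectionE : reflection = (eta - 1) / (1 + eta).
Proof.
have p0 : 0 < 1 + eta by rewrite ltr_pwDl.
have p1 := lt0r_neq0 p0.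
have m0 : 1 - eta != 0 by rewrite subr_eq0 eq_sym; apply/eqP.
have g0 : gamma eta != 0 by rewrite mulf_neq0// invr_eq0.
have E : expR (- a * 2) = `|gamma eta|^-1.
  rewrite (_ : - a * 2 = - ln `|gamma eta|); last by field.
  by rewrite expRN lnK// posrE normr_gt0.
have e1 : eta != 1 by apply/eqP.
rewrite /reflection E /gamma; case: ltP => [h|h].
  rewrite gtr0_norm ?divr_gt0 ?subr_gt0//; field.
  by rewrite p1.
have {}h : 1 < eta by rewrite lt_neqAle eq_sym e1.
rewrite ltr0_norm ?pmulr_rlt0 ?invr_lt0 ?subr_lt0//; field.
by rewrite p1.
Qed.

Lemma reflection_neq1 : reflection != 1.
Proof.
have p0 : 0 < 1 + eta by rewrite ltr_pwDl.
by rewrite reflectionE -subr_eq0 (_ : _ - 1 = - 2 / (1 + eta)) ?mulf_neq0 ?invr_eq0 ?oppr_eq0 ?lt0r_neq0//; field; exact: lt0r_neq0.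
Qed.

Lemma reflection_boundary : (1 + eta) * reflection + (1 - eta) = 0.
Proof.
have p0 : 0 < 1 + eta by rewrite ltr_pwDl.
by rewrite reflectionE; field; exact: lt0r_neq0.
Qed.

Lemma omegaE n : omega eta n = (- a) +i* frq sg n.
Proof. by rewrite /omega /frq; case: ifP => _; rewrite ?addr0 ?intrM//=; congr (_ +i* _); field. Qed.

Lemma frq_neq0 n : frq true n != 0 :> R.
Proof.
rewrite /frq !mulf_neq0 ?invr_eq0 ?(gt_eqF (pi_gt0 R))// intr_eq0.
apply/eqP => /= h; have [n0|] := leP 0 n; first by move: h; lra.
by rewrite -lezD1 => n1; move: h; lra.
Qed.

(** For [eta < 1] the imaginary part is an odd multiple of pi/2. Otherwise a zero real part would
    give [reflection = 1], which is excluded. *)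
Lemma omega_neq0 n : omega eta n != 0.
Proof.
rewrite omegaE eq_complex /= negb_and.
have [h|h] := boolP sg; first by rewrite frq_neq0 orbT.
apply/orP; left; apply: contraNneq reflection_neq1 => a0.
by rewrite /reflection (negbTE h) a0 mul0r expR0.
Qed.

Lemma cexp_line (x y s : R) : cexp ((x +i* y) * s%:C) = (expR (x * s) * cos (y * s)) +i* (expR (x * s) * sin (y * s)).
Proof. by rewrite /cexp /= !mulr0 subr0 add0r. Qed.

End spectrum.

Section coefficients.
Context {R : realType}.
Local Notation mu := (@lebesgue_measure R).
Variables (eta L : R) (u0 u0x u1 phi dphi psi phi0 : R -> R).
Hypotheses (eta_ge0 : 0 <= eta) (eta_neq1 : eta <> 1).
Hypotheses (L0 : 0 < L) (u0_V0 : V0 L u0 u0x) (u1_L2 : L2 `]0, L[ u1).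
Hypotheses (S : diffeo phi dphi) (psiK : cancel phi psi).
Hypothesis Sr : diffeo psi (fun s => (dphi (psi s))^-1).
Hypothesis phi2 : phi L = phi (- L) + 2.
Hypothesis phiE : forall x, - L < x < L -> phi0 x = phi x.
Local Notation sg := (eta < 1).
Local Notation a := (2^-1 * ln `|gamma eta|).
Local Notation H := (weighted L u0x u1 dphi psi a).
Local Notation s0 := (phi (- L)).

(** The 1/4 in the coefficient is the product of the 1/2 in [profile] and the 1/2 in [fa] and [fb];
    multiplication by [omega eta n] removes the remaining denominator. *)
Lemma omega_coef n : omega eta n * coef eta phi0 L u0x u1 n = (fa s0 sg H n) +i* (- fb s0 sg H n).
Proof.
have w0 := omega_neq0 eta_ge0 eta_neq1 n.
have four : (4 : R[i]) != 0 by rewrite pnatr_eq0.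
have pr (k : R -> R) : continuous k ->
    \int[mu]_(x in `]- L, L[) ((even_ext u0x x + odd_ext u1 x) * (expR (a * phi0 x) * k (phi0 x))) =
    2 * \int[mu]_(s in `[s0, s0 + 2]) (H s * k s).
  move=> ck; have [ik ->] := weighted_pairing L0 u0_V0 u1_L2 S psiK Sr phi2 a ck.
  rewrite -RintZ//; apply: Rint_eq => x; rewrite /= in_itv/= => xL.
  by rewrite (phiE xL) /profile patch_oo xL; field.
have oE : - omega eta n = a +i* (- frq sg n).
  by rewrite omegaE; apply/eqP; rewrite eq_complex /= opprK !eqxx.
have cC := @continuous_cos_line R (frq sg n); have cS := @continuous_sin_line R (frq sg n).
have cNS : continuous (fun s : R => - sin (frq sg n * s)) by move=> s; apply: cvgN; exact: cS.
have IE : cintegral `]- L, L[ (fun x => (even_ext u0x x + odd_ext u1 x)%:C * cexp (- omega eta n * (phi0 x)%:C)) =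
    (4 * fa s0 sg H n) +i* (- (4 * fb s0 sg H n)).
  rewrite /cintegral; congr (_ +i* _).
    rewrite (Rint_eq (g := fun x => (even_ext u0x x + odd_ext u1 x) * (expR (a * phi0 x) * cos (frq sg n * phi0 x)))); last first.
      by move=> x _; rewrite oE cexp_line mulNr cosN /= mul0r subr0.
    by rewrite (pr _ cC) /fa; field.
  rewrite (Rint_eq (g := fun x => (even_ext u0x x + odd_ext u1 x) * (expR (a * phi0 x) * - sin (frq sg n * phi0 x)))); last first.
    by move=> x _; rewrite oE cexp_line mulNr sinN /= mul0r addr0.
  rewrite (pr _ cNS) (Rint_eq (g := fun s => (-1) * (H s * sin (frq sg n * s)))); last by move=> s _; rewrite mulrN mulN1r.
  rewrite RintZ ?/fb//; first by field.
  have HL : L2loc H := weighted_L2loc L0 u0_V0 u1_L2 Sr a.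
  by apply: sqint_mul => //; apply: L2loc_sqint => //; exact: L2loc_cont.
rewrite /coef IE (_ : omega eta n * _ = 4^-1 * ((4 * fa s0 sg H n) +i* - (4 * fb s0 sg H n))); last by field.
apply: (mulfI four); rewrite mulVKf// (_ : (4 : R[i]) = (4 : R)%:C); last by rewrite rmorph_nat.
by apply/eqP; rewrite eq_complex /= !mul0r subr0 addr0 mulrN !eqxx.
Qed.

Lemma coef_parts n : exists p q, [/\ coef eta phi0 L u0x u1 n = p +i* q,
  - a * p - frq sg n * q = fa s0 sg H n & a * q - frq sg n * p = fb s0 sg H n].
Proof.
have := omega_coef n; case: (coef _ _ _ _ _ _) => p q E; exists p, q; split => //.
  by move/(congr1 (@complex.Re R)): E; rewrite omegaE.
move/(congr1 (@complex.Im R)): E; rewrite omegaE /= => E.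
by rewrite -[RHS]opprK -E; ring.
Qed.

End coefficients.

Section complex_series.
Context {R : realType}.

Lemma normc_sqr (x y : R) : ComplexField.Normc.normc (x +i* y) ^+ 2 = x ^+ 2 + y ^+ 2.
Proof. by rewrite /ComplexField.Normc.normc sqr_sqrtr// addr_ge0// sqr_ge0. Qed.

Lemma sum_complex (A : seq int) (X Y : int -> R) :
  \sum_(n <- A) (X n +i* Y n) = (\sum_(n <- A) X n) +i* (\sum_(n <- A) Y n).
Proof. by elim: A => [|n A IH]; rewrite ?big_nil ?big_cons// IH. Qed.

Lemma sums_to_parts (z : int -> R[i]) (X Y : int -> R) (x : R) : (forall n, z n = X n +i* Y n) ->
  (forall e : R, 0 < e -> exists B : seq int, forall A : seq int, uniq A -> {subset B <= A} ->
    `|x - \sum_(n <- A) X n| <= e /\ `|\sum_(n <- A) Y n| <= e) ->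
  sums_to z x%:C.
Proof.
have FF : Filter (@totally int) by exact: @totally_filter.
(* A positive element of [R[i]] has zero imaginary part, so the tolerance is real; [e / 4] in each
   part leaves room under the square root. *)
move=> zE h; apply/(@cvgrPdist_lt R[i] R[i]^o _ (@totally int) FF (partial_sum z) x%:C) => -[e e']; rewrite ltcE /= => /andP[/eqP e'0 e0].
have [B hB] := h (e / 4) (divr_gt0 e0 (ltr0Sn _ 3)).
exists [fset n | n in B]%fset => // A /= /fsubsetP BA.
have [|h1 h2] := hB (enum_fset A) (fset_uniq A).
  by move=> n nB; apply: BA; rewrite in_fset.
rewrite /partial_sum -(big_seq_fsetE _ A xpredT z) /= (eq_bigr _ (fun n _ => zE n)) sum_complex.
rewrite normc_def ltcE /= e'0 eqxx /= add0r.
rewrite -[X in _ < X](gtr0_norm e0) -sqrtr_sqr ltr_sqrt ?exprn_gt0//.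
have sq (r : R) : `|r| <= e / 4 -> r ^+ 2 <= (e / 4) ^+ 2.
  by move=> re; rewrite -real_normK ?num_real// lerXn2r ?nnegrE// divr_ge0// ltW.
have s1 := sq _ h1; have := sq _ h2; rewrite -[X in X <= _ -> _]sqrrN => s2.
apply: le_lt_trans (lerD s1 s2) _; rewrite exprMn -mulrDr gtr_pMr ?exprn_gt0//.
by lra.
Qed.

End complex_series.

(** * Existence, uniqueness, series and energy identity *)

Theorem theorem1 (R : realType) (eta : R) (l dl phi dphi : R -> R)
    (u0 u0x u1 : R -> R) (L T : R)
    (eta_ge0 : 0 <= eta) (eta_neq1 : eta <> 1)
    (l_cont : {within `[0, +oo[, continuous l})
    (l_gt0 : forall t, 0 <= t -> 0 < l t)
    (l_deriv : derivative_on `[0, +oo[ l dl)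
    (dl_lt1 : forall t, 0 <= t -> `|dl t| < 1)
    (L_def : L = l 0)
    (phi_C1 : C1_on `[- L, +oo[ phi dphi)
    (dphi_gt0 : forall x, - L <= x -> 0 < dphi x)
    (phi_l : forall t, 0 <= t -> phi (t + l t) - phi (t - l t) = 2)
    (u0_V0 : V0 L u0 u0x)
    (u1_L2 : L2 `]0, L[ u1)
    (T_gt0 : 0 < T) :
  (exists u : R -> R -> R,
    [/\ wave_solution l dl T eta u0 u1 u,
        forall v, wave_solution l dl T eta u0 u1 v ->
          forall x t, 0 <= t <= T -> 0 <= x <= l t -> v x t = u x t &
        forall x t, 0 <= t -> 0 < x < l t ->
          sums_to (fun n => coef eta phi L u0x u1 n *
                     (cexp (omega eta n * (phi (t + x))%:C) -
                      cexp (omega eta n * (phi (t - x))%:C)))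
                  (u x t)%:C])
  /\ (\esum_(n in [set: int])
        (ComplexField.Normc.normc (omega eta n * coef eta phi L u0x u1 n) ^+ 2)%:E =
      (8^-1)%:E *
        \int[lebesgue_measure]_(x in `](- L)%R, L[)
          ((even_ext u0x x + odd_ext u1 x) ^+ 2 *
           expR (ln `|gamma eta| * phi x) / dphi x)%:E)%E
  /\ (\int[lebesgue_measure]_(x in `](- L)%R, L[)
          ((even_ext u0x x + odd_ext u1 x) ^+ 2 *
           expR (ln `|gamma eta| * phi x) / dphi x)%:E < +oo)%E.
Proof.
have L0 : 0 < L by rewrite L_def l_gt0.
have LL : - L <= L by rewrite (@le_trans _ _ 0)// ?oppr_le0 ltW.
have [f [df [k [dk [[fd fE] Pd Qd kE dkE]]]]] :=
  characteristic_extension l_cont l_gt0 l_deriv dl_lt1 L_def phi_C1 dphi_gt0 phi_l T_gt0.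
have range t x : 0 <= t <= T -> 0 <= x <= l t ->
    (- L <= t + x <= T + l T) && (- L <= t - x <= T + l T).
  move=> /andP[t0 tT] /andP[x0 xl].
  have [h1 h2] := front_range l_cont l_deriv dl_lt1 L_def t0; have h3 := h2 T tT.
  by apply/andP; split; apply/andP; split; lra.
have [psi Sr psiK] := diffeo_inverse fd.
have bL : L <= T + l T.
  have := range 0 L; rewrite -L_def add0r lexx (ltW T_gt0) (ltW L0) lexx => /(_ erefl erefl).
  by case/andP => /andP[].
have phiE x : - L <= x <= T + l T -> phi x = f x by move=> /fE[].
have LI : - L <= L <= T + l T by rewrite LL.
have mLI : - L <= - L <= T + l T by rewrite lexx (le_trans LL).
have f2 : f L = f (- L) + 2.
  have := phi_l 0 (lexx 0); rewrite -L_def add0r sub0r !phiE// => <-; ring.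
set s0 := f (- L); set kappa := reflection eta.
have kappa1 : kappa != 1 := reflection_neq1 eta_ge0 eta_neq1.
pose h := density L u0x u1 df psi.
have hL : L2loc h := density_L2loc L0 u0_V0 u1_L2 Sr.
have h_out s : s <= s0 \/ s0 + 2 <= s -> h s = 0 by exact: (density_out u0x u1 psiK Sr f2).
(* Enough periods to cover [f (T + l T)], the largest value of the phase met up to time [T]. *)
pose N := (Num.truncn ((f (T + l T) - s0) / 2)).+1.
have fN : f (T + l T) <= s0 + 2 * N%:R.
  by have := truncnS_gt ((f (T + l T) - s0) / 2); rewrite -/N ltr_pdivrMr// ltrBlDl mulrC => /ltW.
pose F x := twist_prim s0 kappa h N (f x).
pose ff x := twist kappa h N (f x) * df x.
have tL := twist_L2loc kappa hL N.
have ffL : L2loc ff := L2loc_comp fd tL.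
have Fp : primitive_of F ff := primitive_comp fd tL (twist_prim_of s0 kappa hL N).
have ff_profile x : - L < x < L -> ff x = profile L u0x u1 x.
  move=> /andP[x1 x2]; rewrite /ff /N (twist_cell kappa h_out) ?(density_comp _ _ _ fd psiK)//.
  by rewrite /s0 -f2 !(diffeo_le fd) !ltW.
have kl0 : k 0 = L by rewrite kE ?lexx ?(ltW T_gt0)// -L_def.
have k0 t : 0 <= t <= T -> 0 < k t by move=> tT; rewrite kE// l_gt0//; case/andP: tT.
have init x : 0 < x < k 0 -> F x - F (- x) = u0 x /\ ff x - ff (- x) = u1 x.
  by rewrite kl0; exact: (profile_initial L0 u0_V0 ffL Fp ff_profile).
have bdry t : 0 < t < T -> (1 + eta) * ((1 + dk t) * ff (t + k t)) + (1 - eta) * ((1 - dk t) * ff (t - k t)) = 0.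
  move=> tT; have [dkt comp] := dkE t tT.
  have tT' : 0 <= t <= T by case/andP: tT => *; rewrite !ltW.
  have lt0 : 0 <= l t by rewrite ltW// l_gt0//; case/andP: tT'.
  have /andP[r1 r2] := range t (l t) tT' (introT andP (conj lt0 (lexx _))).
  have fPQ : f (t + l t) = f (t - l t) + 2.
    have := phi_l t (proj1 (andP tT')); rewrite !phiE// => <-; ring.
  rewrite kE// dkt /ff fPQ (twist_twisted kappa h_out); last 2 first.
  - by rewrite /s0 (diffeo_le fd); case/andP: r2.
  - by rewrite -fPQ; apply: le_trans fN; rewrite (diffeo_le fd); case/andP: r1.
  rewrite !(mulrCA (1 + dl t)) !(mulrCA (1 - dl t)) comp.
  (* By [comp] both fronts carry the same weight, and one period separates their phases, so the
     boundary condition reduces to the equation that defines the reflection factor. *)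
  rewrite (_ : _ + _ = ((1 + eta) * kappa + (1 - eta)) * (twist kappa h N (f (t - l t)) * ((1 - dl t) * df (t - l t)))); last by ring.
  by rewrite reflection_boundary// mul0r.
have sol_k : wave_solution_with k dk T eta u0 u1 (dal F) (dalx ff) (dalt ff).
  by apply: (dal_solution T_gt0 ffL Fp Pd Qd k0 bdry) => x xk; [exact: (init x xk).1|exact: (init x xk).2].
pose G := twist_lim s0 kappa h.
(* Two expressions: up to time [T] the d'Alembert function built on the extended phase [f], and
   otherwise the twisted limit on the given [phi]. The series is claimed for all [t >= 0], while [f]
   agrees with [phi] only up to [T + l T]. *)
pose u x t := if 0 <= t <= T then dal F x t else G (phi (t + x)) - G (phi (t - x)).
have uG x t : 0 <= t -> 0 <= x <= l t -> u x t = G (phi (t + x)) - G (phi (t - x)).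
  move=> t0 xl; rewrite /u t0 /=; case: leP => // tT.
  have tT' : 0 <= t <= T by rewrite t0.
  have /andP[r1 r2] := range t x tT' xl.
  have GF y : - L <= y <= T + l T -> G (phi y) = F y.
    move=> yI; rewrite phiE//; apply: (twist_limE kappa hL h_out); rewrite /s0 (diffeo_le fd).
    by case/andP: yI => -> yb; apply: le_trans fN; rewrite (diffeo_le fd).
  by rewrite !GF.
have u_dal x t : 0 <= t <= T -> u x t = dal F x t by move=> tT; rewrite /u tT.
have sol_l : wave_solution_with l dl T eta u0 u1 u (dalx ff) (dalt ff).
  apply: local_solution sol_k => //; first by move=> t tT; rewrite kE.
  by move=> t tT; rewrite (dkE t tT).1.
have aE : forall x, - L < x < L -> phi x = f x.
  by move=> x /andP[x1 x2]; apply: phiE; rewrite (ltW x1) (le_trans (ltW x2)).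
set a := 2^-1 * ln `|gamma eta|.
pose H := weighted L u0x u1 df psi a.
have HL : L2loc H := weighted_L2loc L0 u0_V0 u1_L2 Sr a.
have parts n := coef_parts eta_ge0 eta_neq1 L0 u0_V0 u1_L2 fd psiK Sr f2 aE n.
have omc n := omega_coef eta_ge0 eta_neq1 L0 u0_V0 u1_L2 fd psiK Sr f2 aE n.
have [iH EH] := weighted_energy L0 u0_V0 u1_L2 fd psiK Sr f2 a.
have energy : (\int[lebesgue_measure]_(x in `](- L)%R, L[)
    ((even_ext u0x x + odd_ext u1 x) ^+ 2 * expR (ln `|gamma eta| * phi x) / dphi x)%:E =
    (4 * \int[lebesgue_measure]_(s in `[s0, s0 + 2]) (H s ^+ 2))%:E)%E.
  have mI : measurable (`]- L, L[%classic : set R) by exact: measurable_itv.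
  have iO := intgS mI (measurable_itv _) (@subset_itv_oo_cc _ _ _ _) iH.
  rewrite EH -(Rint_oo_cc iH) -RintZ// Rint_EFin//; last exact: intgZ.
  apply: eq_integral => x /set_mem; rewrite /= in_itv/= => xL; congr (_%:E).
  have [x1 x2] : - L <= x /\ x <= T + l T by case/andP: xL => x1 x2; split; [exact: ltW|exact: le_trans (ltW x2) bL].
  have [<- <-] := fE x (introT andP (conj x1 x2)).
  rewrite /profile patch_oo xL (_ : 2 * a * f x = ln `|gamma eta| * f x); last by rewrite /a; field.
  by field; exact: lt0r_neq0 (diffeo_gt0 fd x).
split; last first.
  split; last by rewrite energy ltry.
  (* The 4 in [energy] undoes the square of the 1/2 in [profile]; with the 1/8 of the claim it
     leaves the 1/2 of [parseval_esum]. *)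
  rewrite energy -EFinM -[RHS](_ : (2^-1 * \int[lebesgue_measure]_(s in `[s0, s0 + 2]) (H s ^+ 2))%:E = _); last first.
    by congr (_%:E); field.
  rewrite -(parseval_esum s0 (eta < 1) HL); apply: eq_esum => n _.
  by rewrite omc normc_sqr sqrrN.
exists u; split; first by exists (dalx ff), (dalt ff).
  move=> v [vx [vt solv]] x t tT xl.
  have solv' : wave_solution_with k dk T eta u0 u1 v vx vt.
    by apply: local_solution solv => // s sT; exact: (dkE s sT).1.
  have [m m0 hm] := front_min l_cont l_gt0 T_gt0.
  rewrite u_dal//; apply: (solution_unique eta_ge0 T_gt0 Pd Qd k0 solv' sol_k m0 _ tT).
    by move=> s sT; rewrite kE//; exact: hm.
  by rewrite kE.
move=> x t t0 /andP[x0 xl].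
pose p n := complex.Re (coef eta phi L u0x u1 n); pose q n := complex.Im (coef eta phi L u0x u1 n).
have pq_a n : - a * p n - frq (eta < 1) n * q n = fa s0 (eta < 1) H n.
  by have [p' [q' [E1 E2 _]]] := parts n; rewrite /p /q E1.
have pq_b n : a * q n - frq (eta < 1) n * p n = fb s0 (eta < 1) H n.
  by have [p' [q' [E1 _ E2]]] := parts n; rewrite /p /q E1.
(* The weight [expR (a * r)] in [H] cancels [expR (- a * r)], leaving the density. *)
have Gprim y z : s0 <= y -> y <= z -> z <= s0 + 2 ->
    G z - G y = \int[lebesgue_measure]_(r in `[y, z]) (expR (- a * r) * H r).
  move=> y0 yz z2; rewrite (twist_lim_prim kappa hL h_out)//; apply: Rint_eq => r _.
  by rewrite /H /weighted mulrA -expRD mulNr addNr expR0 mul1r.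
have Gshift s : s0 <= s -> G (s + 2) = kappa * G s by exact: (twist_lim_shift hL h_out kappa1).
have approx := series_all HL pq_a pq_b kappa1 Gprim Gshift.
have phi_ge y : - L <= y -> s0 <= phi y.
  by move=> yL; rewrite /s0 -phiE//; exact: (phi_le phi_C1 dphi_gt0 (lexx _) yL).
have [lo _] := front_range l_cont l_deriv dl_lt1 L_def t0.
have xI : 0 <= x <= l t by rewrite !ltW.
have p1 : s0 <= phi (t + x) by apply: phi_ge; apply: (@le_trans _ _ 0); [rewrite oppr_le0 ltW|rewrite addr_ge0// ltW].
have p2 : s0 <= phi (t - x) by apply: phi_ge; apply: le_trans lo _; rewrite lerD2l lerN2 ltW.
apply: (@sums_to_parts R _ (fun n => modeP (eta < 1) a p q n (phi (t + x)) - modeP (eta < 1) a p q n (phi (t - x)))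
  (fun n => modeQ (eta < 1) a p q n (phi (t + x)) - modeQ (eta < 1) a p q n (phi (t - x)))).
  move=> n; rewrite omegaE !cexp_line (_ : coef _ _ _ _ _ n = p n +i* q n); last by rewrite /p /q; case: coef.
  apply/eqP; rewrite eq_complex /= /modeP /modeQ; apply/andP; split; apply/eqP; ring.
move=> e e0; have e2 : 0 < e / 2 by rewrite divr_gt0.
have [B1 _ h1] := approx _ _ p1 e2; have [B2 _ h2] := approx _ _ p2 e2.
exists (B1 ++ B2) => A uA BA.
have [a1 b1] := h1 A uA (fun n nB => BA n (eq_ind_r is_true (introT orP (or_introl nB)) (mem_cat n B1 B2))).
have [a2 b2] := h2 A uA (fun n nB => BA n (eq_ind_r is_true (introT orP (or_intror nB)) (mem_cat n B1 B2))).
rewrite uG// !sumrB [e]splitr; split.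
  rewrite (_ : _ - _ = (G (phi (t + x)) - \sum_(n <- A) modeP (eta < 1) a p q n (phi (t + x))) -
    (G (phi (t - x)) - \sum_(n <- A) modeP (eta < 1) a p q n (phi (t - x)))); last by ring.
  by apply: le_trans (ler_normB _ _) _; exact: lerD.
by apply: le_trans (ler_normB _ _) _; exact: lerD.
Qed.
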